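(* There is a nonempty open subset $U$, in the complex topology, of the moduli space $M_{1,1}$ such that for every $[X]\in U$ the sections $\sigma_X$ and $\eta_X$ of $K_S(2\Delta)$ on $S=X\times X$ (defined in the context) are different: $\sigma_X\ne\eta_X$.
   Context: $M_{1,1}$ is the moduli space of elliptic curves over $\mathbb C$ (isomorphism classes of $X_\tau=\mathbb C/(\mathbb Z+\tau\mathbb Z)$, $\operatorname{Im}\tau>0$). For a compact connected Riemann surface $X$ of genus $g$ (here $g=1$) let $S=X\times X$, $p_1,p_2:S\to X$ the projections, $\Delta\subset S$ the reduced diagonal, $K_S=\Omega_S^2$. Definition of $\sigma_X$: For a theta characteristic $F$ ($F\otimes F\cong K_X$) let $\Theta_F=\{L\in J^0(X):H^0(X,L\otimes F)\neq0\}$, where $J^0(X)$ is the Jacobian of degree $0$ line bundles; the class of $\mathcal O_{J^0(X)}(2\Theta_F)$ is independent of $F$; this line bundle is $\mathbf L$. Put $\mathbb V=H^0(J^0(X),\mathbf L)$. The cup product on $H^1(X,\mathbb Z)$ gives a (translation invariant) Kähler form $\omega_0$ on $J^0(X)$ with $c_1(\mathbf L)=2[\omega_0]$. Fix a Hermitian structure $h$ on $\mathbf L$ whose Chern curvature (normalized so as to represent $c_1(\mathbf L)$) equals $2\omega_0$, and equip $\mathbb V$ with $\langle s,t\rangle=\int_{J^0(X)}\langle s,t\rangle_h\,\omega_0^g$ (canonical up to a constant). Let $V_0\subset\mathbb V$ be the sections vanishing at $0=[\mathcal O_X]$ and $\mathbb S=V_0^\perp$, a line. With $\phi:S\to J^0(X)$,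 $\phi(x,y)=\mathcal O_X(x-y)$, there is an isomorphism $\phi^*\mathbf L\cong(p_1^*K_X)\otimes(p_2^*K_X)\otimes\mathcal O_S(2\Delta)$, unique up to a constant, and the latter is identified with $K_S(2\Delta)$ via $p_1^*\psi_1\otimes p_2^*\psi_2\mapsto p_1^*\psi_1\wedge p_2^*\psi_2$. A section of $K_S(2\Delta)$ written locally as $\frac{v(z_1,z_2)}{(z_1-z_2)^2}dz_1\wedge dz_2$ ($z_i=z\circ p_i$) restricts to $\Delta$ as the function $v(z,z)$ (its biresidue). $\sigma_X$ is the unique element of the image of $\mathbb S$ in $H^0(S,K_S(2\Delta))$ whose restriction to $\Delta$ is the constant function $1$. Definition of $\eta_X$: Let $(U,z)$ be a holomorphic chart on $X$ and let $p\in U$ be the point with $z(p)=0$. Since holomorphic 1-forms are closed, there is an inclusion $j_z:H^0(X,K_X(2p))\hookrightarrow H^1(X\setminus\{p\},\mathbb C)\cong H^1(X,\mathbb C)$, and $j_z^{-1}(H^{0,1}(X))$ is one dimensional. Let $\eta_z$ be its unique generator of the form $\eta_z=\left(\frac1{z^2}+h(z)\right)dz$ on $U$ with $h$ holomorphic. Then $\eta_X\in H^0(S,K_S(2\Delta))$ is the unique section such that $\eta_X|_{X\times\{p\}}=\eta_z$ for all such charts, where the restriction means contraction with $\frac{\partial}{\partial z}$ in the second factor: if $\eta_X=u(z_1,z_2)\,dz_1\wedge dz_2$ then $\eta_X|_{X\times\{p\}}=u(z_1,0)\,dz_1$. *)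

(* Defs.v *)
From Stdlib Require Import Reals ZArith List ClassicalEpsilon.
From Coquelicot Require Import Coquelicot.
Import ListNotations.
Open Scope R_scope.

(* Conventions.  The curve is X = C / (Z + tau Z).  Points of X are represented
   by points of C, subsets of X by lattice-invariant subsets of C, functions on
   X (on X * X) by functions on C (on C * C) that are lattice-periodic (in each
   variable).  The form dz trivialises K_X and dz_1 /\ dz_2 trivialises K_S, so
   f stands for the 1-form f dz and u for the 2-form u dz_1 /\ dz_2.

   A section f of O(D) is a meromorphic function with div f + D >= 0.  Near a
   it is written f(z) = (z - a)^(- D a) * g(z) with g holomorphic at a.  As
   1 / 0 = 0, asking for this equation at z = a too gives f the value 0
   wherever D a > 0, so that a section has exactly one representative. *)

Record UHP := mkUHP { tau_of :> C; Im_tau_pos : 0 < Im tau_of }.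

Definition lattice (tau : C) (l : C) : Prop :=
  exists m n : Z, l = (RtoC (IZR m) + RtoC (IZR n) * tau)%C.

Definition periodic (tau : C) (f : C -> C) : Prop :=
  forall z l, lattice tau l -> f (z + l)%C = f z.

Definition holo_at (f : C -> C) (a : C) : Prop :=
  locally a (fun z => ex_derive (K := C_AbsRing) (V := C_NormedModule) f z).

Definition holo2_at (f : C * C -> C) (p : C * C) : Prop :=
  locally p (fun q : C * C =>
    ex_filterdiff (K := C_AbsRing)
      (U := prod_NormedModule C_AbsRing C_NormedModule C_NormedModule)
      (V := C_NormedModule) f (locally q)).

Definition Czpow (z : C) (n : Z) : C :=
  match n with
  | Z0 => RtoC 1
  | Zpos p => (z ^ Pos.to_nat p)%C
  | Zneg p => (/ (z ^ Pos.to_nat p))%C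
  end.

(* A map X_t -> X_t' is given by f : C -> C, well defined modulo the lattices;
   f itself need not be continuous, only its local lifts are holomorphic. *)
Definition holo_map (t t' : C) (f : C -> C) : Prop :=
  (forall z l, lattice t l -> lattice t' (f (z + l) - f z)%C) /\
  (forall a, exists g, holo_at g a /\
     locally a (fun z => lattice t' (f z - g z)%C)).

Definition elliptic_iso (t t' : UHP) : Prop :=
  exists f f' : C -> C,
    holo_map t t' f /\ holo_map t' t f' /\
    (forall z, lattice t (f' (f z) - z)%C) /\
    (forall z, lattice t' (f (f' z) - z)%C) /\
    lattice t' (f (RtoC 0)).

Definition M11 : Type :=
  { c : UHP -> Prop | exists t, c = elliptic_iso t }.

Definition M11_class (t : UHP) : M11 :=
  exist _ (elliptic_iso t) (ex_intro _ t eq_refl).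

(* Quotient topology from the upper half plane. *)
Definition M11_open (U : M11 -> Prop) : Prop :=
  forall t : UHP, U (M11_class t) ->
    locally (tau_of t) (fun z => forall hz : 0 < Im z, U (M11_class (mkUHP z hz))).

Definition divisor : Type := list (C * Z).

Definition deg (D : divisor) : Z :=
  fold_right (fun q n => (snd q + n)%Z) 0%Z D.

Definition mult (tau : C) (D : divisor) (a : C) : Z :=
  fold_right (fun q n =>
    if excluded_middle_informative (lattice tau (fst q - a)%C)
    then (snd q + n)%Z else n) 0%Z D.

Definition is_div (tau : C) (f : C -> C) (D : C -> Z) : Prop :=
  periodic tau f /\
  forall a, exists g, holo_at g a /\ g a <> RtoC 0 /\
    locally a (fun z => f z = (Czpow (z - a) (D a) * g z)%C).

(* H^0(O(D)); D is lattice-periodic. *)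
Definition H0 (tau : C) (D : C -> Z) (f : C -> C) : Prop :=
  periodic tau f /\
  forall a, exists g, holo_at g a /\
    locally a (fun z => f z = (Czpow (z - a) (- D a) * g z)%C).

(* Vanishing at a as a section of O(D), i.e. of the coefficient in the local
   frame (z - a)^(- D a). *)
Definition section_vanishes (D : C -> Z) (f : C -> C) (a : C) : Prop :=
  exists g, holo_at g a /\ g a = RtoC 0 /\
    locally a (fun z => f z = (Czpow (z - a) (- D a) * g z)%C).

Definition lin_equiv (tau : C) (D E : divisor) : Prop :=
  exists f, is_div tau f (fun a => (mult tau D a - mult tau E a)%Z).

(* J^0(X): isomorphism classes of the O_X(D) with deg D = 0, a class being the
   set of divisors that define it. *)
Definition J0 (tau : C) : Type :=
  { L : divisor -> Prop | exists D, deg D = 0%Z /\ L = lin_equiv tau D }.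

Definition phi (tau : C) (x y : C) : J0 tau :=
  exist _ (lin_equiv tau [(x, 1%Z); (y, (-1)%Z)])
    (ex_intro _ [(x, 1%Z); (y, (-1)%Z)] (conj eq_refl eq_refl)).

(* Abel-Jacobi map C -> J^0(X), w |-> O_X(w - 0): the universal covering of
   J^0(X), with kernel the lattice.  It defines the complex structure of J^0(X),
   and w is the global coordinate used on J^0(X).  By Abel's theorem
   phi (x, y) has coordinate x - y. *)
Definition AJ (tau : C) (w : C) : J0 tau := phi tau w (RtoC 0).

(* F = O_X(E) with 2 E = div (f dz), i.e. F (x) F = K_X. *)
Definition theta_char (tau : C) (E : divisor) : Prop :=
  exists f, is_div tau f (fun a => (2 * mult tau E a)%Z).

Definition Theta (tau : C) (E : divisor) (L : J0 tau) : Prop :=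
  exists D, proj1_sig L D /\
    exists f, H0 tau (mult tau (D ++ E)) f /\ exists z, f z <> RtoC 0.

(* Multiplicity of the divisor 2 Theta_F at a point of J^0(X). *)
Definition twoTheta (tau : C) (E : divisor) (L : J0 tau) : Z :=
  if excluded_middle_informative (Theta tau E L) then 2%Z else 0%Z.

Definition VV (tau : C) (E : divisor) (s : J0 tau -> C) : Prop :=
  H0 tau (fun w => twoTheta tau E (AJ tau w)) (fun w => s (AJ tau w)).

Definition VV0 (tau : C) (E : divisor) (s : J0 tau -> C) : Prop :=
  VV tau E s /\
  section_vanishes (fun w => twoTheta tau E (AJ tau w))
    (fun w => s (AJ tau w)) (RtoC 0).

(* The cup product, seen as an alternating form on the lattice
   H_1(J^0(X), Z) = Z + tau Z and extended to C: it is 1 on (1, tau).  Thus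
   omega_0 = (i / (2 Im tau)) dw /\ dwbar = dx /\ dy / Im tau. *)
Definition omega0 (tau : C) (u v : C) : R := Im (Cconj u * v)%C / Im tau.

Definition d_x (k : C -> R) (z : C) : R := Derive (fun x => k (x, Im z)) (Re z).
Definition d_y (k : C -> R) (z : C) : R := Derive (fun y => k (Re z, y)) (Im z).

Fixpoint Cn_at (n : nat) (k : C -> R) (a : C) : Prop :=
  match n with
  | O => locally a (fun z => continuous (T := C_UniformSpace) (U := R_UniformSpace) k z)
  | S m =>
      locally a (fun z => continuous (T := C_UniformSpace) (U := R_UniformSpace) k z /\
        ex_derive (fun x => k (x, Im z)) (Re z) /\
        ex_derive (fun y => k (Re z, y)) (Im z)) /\
      Cn_at m (d_x k) a /\ Cn_at m (d_y k) a
  end.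

Definition smooth_at (k : C -> R) (a : C) : Prop := forall n, Cn_at n k a.

Definition laplacian (k : C -> R) (z : C) : R :=
  d_x (d_x k) z + d_y (d_y k) z.

(* A Hermitian structure on O(2 Theta_F), given by rho = |1|_h^2 where 1 is the
   canonical meromorphic frame.  In the local holomorphic frame
   e = (w - a)^(- 2 Theta_F(a)) one has |e|_h^2 = exp (- k) with k smooth.  The
   normalised Chern curvature is
   (i / 2 pi) ddbar k = (laplacian k / (4 pi)) dx /\ dy,
   and dx /\ dy takes the value 1 on (1, i). *)
Definition hermitian (tau : C) (E : divisor) (rho : J0 tau -> R) : Prop :=
  forall a, exists k : C -> R, smooth_at k a /\
    locally a (fun w =>
      rho (AJ tau w) =
        Cmod (Czpow (w - a) (twoTheta tau E (AJ tau a))) ^ 2 * exp (- k w)) /\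
    locally a (fun w =>
      laplacian k w / (4 * PI) = 2 * omega0 tau (RtoC 1) Ci).

(* Integral over J^0(X), computed on the fundamental domain {x + y tau}. *)
Definition inner (tau : C) (rho : J0 tau -> R) (s t : J0 tau -> C) : C :=
  RInt (V := C_R_CompleteNormedModule) (fun y : R =>
    RInt (V := C_R_CompleteNormedModule) (fun x : R =>
      let L := AJ tau (RtoC x + RtoC y * tau)%C in
      (s L * Cconj (t L) * RtoC (rho L * omega0 tau (RtoC 1) tau))%C) 0 1) 0 1.

Definition SS (tau : C) (E : divisor) (rho : J0 tau -> R) (s : J0 tau -> C)
  : Prop :=
  VV tau E s /\ forall t, VV0 tau E t -> inner tau rho s t = RtoC 0.

Definition H0_KS2Delta (tau : C) (u : C * C -> C) : Prop :=
  (forall z1 z2 l1 l2, lattice tau l1 -> lattice tau l2 ->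
     u ((z1 + l1)%C, (z2 + l2)%C) = u (z1, z2)) /\
  (forall a1 a2, ~ lattice tau (a1 - a2)%C -> holo2_at u (a1, a2)) /\
  (forall a, exists v, holo2_at v (a, a) /\
     locally (a, a) (fun z : C * C => u z = (v z / (fst z - snd z) ^ 2)%C)).

Definition biresidue (u : C * C -> C) (a c : C) : Prop :=
  exists v, holo2_at v (a, a) /\
    locally (a, a) (fun z : C * C => u z = (v z / (fst z - snd z) ^ 2)%C) /\
    v (a, a) = c.

Definition twoDelta (tau : C) (a1 a2 : C) : Z :=
  if excluded_middle_informative (lattice tau (a1 - a2)%C) then 2%Z else 0%Z.

(* An isomorphism phi^* O(2 Theta_F) -> K_S(2 Delta) is multiplication by a
   meromorphic 2-form m dz_1 /\ dz_2 with divisor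
   phi^* (2 Theta_F) - 2 Delta. *)
Definition pullback_iso (tau : C) (E : divisor) (m : C * C -> C) : Prop :=
  (forall z1 z2 l1 l2, lattice tau l1 -> lattice tau l2 ->
     m ((z1 + l1)%C, (z2 + l2)%C) = m (z1, z2)) /\
  forall a1 a2, exists g, holo2_at g (a1, a2) /\ g (a1, a2) <> RtoC 0 /\
    locally (a1, a2) (fun z : C * C =>
      m z = (Czpow ((fst z - snd z) - (a1 - a2))
               (twoTheta tau E (phi tau a1 a2) - twoDelta tau a1 a2) * g z)%C).

(* On phi^* Theta_F the function s o phi only carries the conventional value 0,
   hence the restriction to the (dense) complement, which determines u. *)
Definition is_sigma (tau : C) (u : C * C -> C) : Prop :=
  H0_KS2Delta tau u /\
  (forall a, biresidue u a (RtoC 1)) /\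
  exists (E : divisor) (rho : J0 tau -> R) (m : C * C -> C) (s : J0 tau -> C),
    theta_char tau E /\ hermitian tau E rho /\ pullback_iso tau E m /\
    SS tau E rho s /\
    forall z1 z2, ~ Theta tau E (phi tau z1 z2) ->
      u (z1, z2) = (s (phi tau z1 z2) * m (z1, z2))%C.

Definition sigma_X (tau : C) : C * C -> C :=
  epsilon (inhabits (fun _ => RtoC 0)) (is_sigma tau).

(* A holomorphic chart (W, zeta) of X, with holomorphic local inverses. *)
Definition is_chart (tau : C) (W : C -> Prop) (zeta : C -> C) : Prop :=
  open (T := C_UniformSpace) W /\
  (forall z l, W z -> lattice tau l -> W (z + l)%C /\ zeta (z + l)%C = zeta z) /\
  (forall z z', W z -> W z' -> zeta z = zeta z' -> lattice tau (z - z')%C) /\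
  (forall a, W a -> holo_at zeta a /\
     exists psi, holo_at psi (zeta a) /\
       locally a (fun z => psi (zeta z) = z) /\
       locally (zeta a) (fun x => zeta (psi x) = x)).

(* The class of f dz in H^1(X \ {p}, C) is that of an antiholomorphic form
   conj (alpha dz), with alpha dz in H^0(X, K_X): the difference is dG for a
   function G on X \ {p}. *)
Definition class_in_H01 (tau : C) (p : C) (f : C -> C) : Prop :=
  exists alpha G : C -> C,
    H0 tau (fun _ => 0%Z) alpha /\ periodic tau G /\
    forall z : C, ~ lattice tau (z - p)%C ->
      filterdiff (K := R_AbsRing) (U := C_R_NormedModule)
        (V := C_R_NormedModule) G (locally z)
        (fun dz : C => (f z * dz - Cconj (alpha z) * Cconj dz)%C).

Definition is_eta_z (tau : C) (W : C -> Prop) (zeta : C -> C) (p : C)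
    (f : C -> C) : Prop :=
  H0 tau (mult tau [(p, 2%Z)]) f /\
  class_in_H01 tau p f /\
  exists h, (forall w, W w -> holo_at h (zeta w)) /\
    forall w, W w -> ~ lattice tau (w - p)%C ->
      f w = ((/ (zeta w ^ 2) + h (zeta w)) * C_derive zeta w)%C.

(* The vector field d/dzeta is (1 / zeta') d/dz. *)
Definition is_eta (tau : C) (u : C * C -> C) : Prop :=
  H0_KS2Delta tau u /\
  forall W zeta p, is_chart tau W zeta -> W p -> zeta p = RtoC 0 ->
    is_eta_z tau W zeta p (fun w => (u (w, p) / C_derive zeta p)%C).

Definition eta_X (tau : C) : C * C -> C :=
  epsilon (inhabits (fun _ => RtoC 0)) (is_eta tau).

(* Main.v *)
Require Import Defs.
From Stdlib Require Import Reals ZArith List Lra Lia ClassicalEpsilon FunctionalExtensionality PropExtensionality.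
From Coquelicot Require Import Coquelicot.
Import ListNotations Defs.
Open Scope R_scope.
Open Scope C_scope.

(** Let X = C / (Z + tau Z) and T = Im tau.  Both sections are functions of
    w = z_1 - z_2 with polar part 1 / w^2 at the lattice, so they differ by a
    constant that depends on X; the theorem says that this constant is not
    zero when T is large.

    Let theta be the product of (1 - q^n e) (1 - q^(n+1) / e) over n >= 0, with
    e = exp (2 pi i w) and q = exp (2 pi i tau): it vanishes simply on the
    lattice.  Then eta is P = - (theta' / theta)' - pi / T.  Indeed P is
    elliptic, and - (theta' / theta + 2 pi i Im w / T) is a single-valued
    function whose differential is P dw up to an antiholomorphic form
    ([eta_prim_rdf]); conversely these properties determine eta
    ([eta_unique]).

    The sections of L are the functions with at most a double pole at the
    origin of the Jacobian, and those that vanish there are the constants,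
    because an elliptic function with one simple pole is constant
    ([simple_pole_const]).  The Hermitian structure is, up to a factor, the
    density R = |theta|^4 exp (4 pi Im w - 4 pi (Im w)^2 / T), since two metrics
    with the same curvature and the same zeros are proportional
    ([potential_const]).  Hence sigma = P + c, where c makes P + c orthogonal to
    the constants for R dx dy, and sigma = eta would force the integral of P R
    over a period cell to vanish ([sigma_eta_orthogonal]).  For sigma and eta,
    which are picked by a choice operator, to have their defining properties at
    all, sections with these properties are exhibited ([is_sigma_exists],
    [is_eta_exists]).

    The integral of P R does not vanish high in the cusp ([cusp_nonzero]).
    With b = q / e, splitting off the first two factors of theta shows that
    minus P equals 4 pi^2 (e / (1 - e)^2 + b / (1 - b)^2) + pi / T, up to an
    exponentially small term.
    For Im w = y T, the density R is of size exp (4 pi T y (1 - y)), which is at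
    least a constant times exp (3 pi T / 4) on the middle half of the cell,
    whereas the two pole terms multiplied by R are bounded by a constant times
    exp (pi T / 4).  Hence the contribution of pi / T prevails.

    Finally, isomorphisms of elliptic curves are homotheties of lattices
    ([elliptic_iso_homothety]), so the classes that have a representative with
    T above a fixed bound form an open set ([cusp_neighbourhood_open]).  For
    another representative, the relation on the integral is transported to this
    one by the homothety and by the invariance of cell integrals under a change
    of basis ([cell_int_GL2]).

    The complex analysis is developed from differentiability alone: Goursat's
    theorem on rectangles, Cauchy's formula in the form of a quotient of two
    boundary integrals, and from it removable singularities, the
    differentiability of the derivative, Cauchy's estimate, Liouville's and
    Weierstrass' theorems. *)

(** * Complex derivatives *)

(** [ring] on C reads [RtoC (IZR m)] as a numeral even for a variable [m], so
    such terms are generalised first. *)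
Ltac zring := repeat match goal with |- context [RtoC (IZR ?m)] => is_var m; generalize (RtoC (IZR m)); intro end; ring.

Lemma Cmod_minus_le (x y : C) : Cmod (x - y) <= Cmod x + Cmod y.
Proof. unfold Cminus. rewrite <- (Cmod_opp y). apply Cmod_triangle. Qed.

Lemma Cmod_sub_sym (x y : C) : Cmod (x - y) = Cmod (y - x).
Proof. rewrite <- Cmod_opp. f_equal. ring. Qed.

Lemma Cmod_ge_sub (x y : C) : Cmod x - Cmod y <= Cmod (x - y).
Proof. generalize (Cmod_triangle (x - y) y). replace (x - y + y) with x by ring. lra. Qed.

Lemma Cmod_sub_lt_nonzero (x y : C) : Cmod (x - y) < Cmod y -> x <> 0.
Proof. intros H ->. rewrite Cmod_sub_sym in H. replace (y - 0) with y in H by ring. lra. Qed.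

Lemma im_le_Cmod (c : C) : Rabs (Im c) <= Cmod c.
Proof. eapply Rle_trans; [apply (Rmax_r (Rabs (fst c)))|apply Rmax_Cmod]. Qed.

Lemma Cmod_le_re_im (c : C) : Cmod c <= Rabs (Re c) + Rabs (Im c).
Proof.
  replace c with (RtoC (Re c) + RtoC (Im c) * Ci) at 1.
  - eapply Rle_trans; [apply Cmod_triangle|]. rewrite Cmod_mult, !Cmod_R, Cmod_Ci. lra.
  - destruct c as [a b]. unfold RtoC, Ci, Cplus, Cmult, Re, Im; simpl. f_equal; ring.
Qed.

Lemma locally_CE (a : C) (P : C -> Prop) :
  locally (T := C_UniformSpace) a P <->
  exists d : R, 0 < d /\ forall z, Cmod (z - a) < d -> P z.
Proof.
  split.
  - intros [d Hd]. exists d. split; [apply cond_pos|]. intros z Hz. apply Hd.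
    apply C_NormedModule_mixin_compat1. exact Hz.
  - intros (d & Hd & H). assert (Hd2 : 0 < d / 2) by lra.
    exists (mkposreal _ Hd2). intros z Hz.
    apply H. destruct Hz as [H1 H2].
    change (Rabs (fst z - fst a) < d / 2) in H1. change (Rabs (snd z - snd a) < d / 2) in H2.
    eapply Rle_lt_trans; [apply Cmod_le_re_im|].
    destruct z, a; unfold Re, Im in *; simpl in *. unfold Rminus in *. lra.
Qed.

(** Complex differentiability with an explicit modulus. Estimates are shorter
    with it than with the filter-based notion, to which [cdvE] compares it. *)
Definition cdv (f : C -> C) (z l : C) : Prop :=
  forall eps : R, 0 < eps -> exists d : R, 0 < d /\
    forall h, Cmod h < d -> Cmod (f (z + h) - f z - l * h) <= eps * Cmod h.

Lemma cdvE (f : C -> C) (z l : C) :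
  is_derive (K := C_AbsRing) (V := C_NormedModule) f z l <-> cdv f z l.
Proof.
  split.
  - intros [_ H] eps Heps. specialize (H z (fun P H => H) (mkposreal _ Heps)).
    destruct H as [d Hd]. exists d. split; [apply cond_pos|]. intros h Hh.
    assert (E : forall a b : C, (a + b + - a)%C = b) by (intros; ring).
    specialize (Hd ((z + h)%C : C)).
    change (Cmod (z + h + - z) < d -> Cmod (f (z + h) + - f z + - ((z + h + - z) * l)) <= eps * Cmod (z + h + - z)) in Hd.
    rewrite E in Hd. specialize (Hd Hh).
    replace (f (z + h) - f z - l * h) with (f (z + h) + - f z + - (h * l)) by ring. exact Hd.
  - intros H. split; [apply is_linear_scal_l|].
    intros x Hx. assert (Hxz : z = x).
    { apply (is_filter_lim_locally_unique (K := C_AbsRing) (V := AbsRing_NormedModule C_AbsRing)) in Hx. exact Hx. }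
    subst x. intros [eps Heps]. destruct (H eps Heps) as (d & Hd & Hh).
    exists (mkposreal d Hd). refine (fun (y : C) Hy => _).
    change (Cmod (y - z) < d) in Hy. specialize (Hh (y - z) Hy).
    replace (z + (y - z)) with y in Hh by ring.
    change (Cmod (f y + - f z + - ((y + - z) * l)) <= eps * Cmod (y + - z)).
    replace (f y + - f z + - ((y + - z) * l)) with (f y - f z - l * (y - z)) by ring. exact Hh.
Qed.

Lemma cdv_cont (f : C -> C) z l : cdv f z l ->
  forall eps : R, 0 < eps -> exists d : R, 0 < d /\ forall w, Cmod (w - z) < d -> Cmod (f w - f z) < eps.
Proof.
  intros H eps He. destruct (H 1%R Rlt_0_1) as (d & Hd & Hh).
  assert (Hl : 0 < 2 + Cmod l) by (generalize (Cmod_ge_0 l); lra).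
  exists (Rmin d (eps / (2 + Cmod l))). split.
  { apply Rmin_glb_lt; auto. apply Rdiv_lt_0_compat; lra. }
  intros w Hw. specialize (Hh (w - z)).
  replace (z + (w - z)) with w in Hh by ring.
  assert (H1 : Cmod (w - z) < d) by (eapply Rlt_le_trans; [exact Hw|apply Rmin_l]).
  assert (H2 : Cmod (w - z) < eps / (2 + Cmod l)) by (eapply Rlt_le_trans; [exact Hw|apply Rmin_r]).
  specialize (Hh H1).
  assert (H3 : Cmod (f w - f z) <= (1 + Cmod l) * Cmod (w - z)).
  { replace (f w - f z) with ((f w - f z - l * (w - z)) + l * (w - z)) by ring.
    eapply Rle_trans; [apply Cmod_triangle|]. rewrite Cmod_mult. lra. }
  apply Rmult_lt_compat_r with (r := (2 + Cmod l)%R) in H2; auto.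
  unfold Rdiv in H2. rewrite Rmult_assoc, Rinv_l, Rmult_1_r in H2 by lra.
  generalize (Cmod_ge_0 (w - z)) (Cmod_ge_0 l). nra.
Qed.

Lemma cdv_const (c z : C) : cdv (fun _ => c) z 0.
Proof. intros eps He. exists 1%R. split; [lra|]. intros h _.
  replace (c - c - 0 * h) with (RtoC 0) by ring. rewrite Cmod_0.
  apply Rmult_le_pos; [lra|apply Cmod_ge_0]. Qed.

Lemma cdv_id (z : C) : cdv (fun w => w) z 1.
Proof. intros eps He. exists 1%R. split; [lra|]. intros h _.
  replace (z + h - z - 1 * h) with (RtoC 0) by ring. rewrite Cmod_0.
  apply Rmult_le_pos; [lra|apply Cmod_ge_0]. Qed.

Lemma cdv_eq (f : C -> C) z l l' : cdv f z l -> l = l' -> cdv f z l'.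
Proof. now intros H <-. Qed.

Lemma cdv_plus (f g : C -> C) z l m : cdv f z l -> cdv g z m -> cdv (fun w => f w + g w) z (l + m).
Proof.
  intros Hf Hg eps He.
  destruct (Hf (eps/2)%R) as (d1 & Hd1 & H1); [lra|].
  destruct (Hg (eps/2)%R) as (d2 & Hd2 & H2); [lra|].
  exists (Rmin d1 d2). split; [now apply Rmin_glb_lt|]. intros h Hh.
  specialize (H1 h (Rlt_le_trans _ _ _ Hh (Rmin_l _ _))).
  specialize (H2 h (Rlt_le_trans _ _ _ Hh (Rmin_r _ _))).
  replace (f (z + h) + g (z + h) - (f z + g z) - (l + m) * h) with
    ((f (z + h) - f z - l * h) + (g (z + h) - g z - m * h)) by ring.
  eapply Rle_trans; [apply Cmod_triangle|]. lra.
Qed.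

Lemma cdv_comp (f g : C -> C) z l m : cdv f (g z) l -> cdv g z m -> cdv (fun w => f (g w)) z (l * m).
Proof.
  intros Hf Hg eps He.
  set (M := (2 + Cmod l + Cmod m)%R).
  assert (HM : 0 < M) by (unfold M; generalize (Cmod_ge_0 l) (Cmod_ge_0 m); lra).
  set (e := Rmin 1 (eps / (2 * M))).
  assert (He1 : 0 < e). { apply Rmin_glb_lt; [lra|]. apply Rdiv_lt_0_compat; lra. }
  assert (He2 : 2 * (M * e) <= eps).
  { assert (e <= eps / (2 * M)) by apply Rmin_r.
    apply Rmult_le_compat_l with (r := (2 * M)%R) in H; [|lra].
    replace (2 * M * (eps / (2 * M)))%R with eps in H by (field; lra). lra. }
  assert (He3 : e <= 1) by apply Rmin_l.
  destruct (Hf e He1) as (d1 & Hd1 & H1).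
  destruct (Hg e He1) as (d2 & Hd2 & H2).
  destruct (cdv_cont g z m Hg d1 Hd1) as (d3 & Hd3 & H3).
  exists (Rmin d2 d3). split; [now apply Rmin_glb_lt|]. intros h Hh.
  specialize (H2 h (Rlt_le_trans _ _ _ Hh (Rmin_l _ _))).
  specialize (H3 (z + h)). replace (z + h - z) with h in H3 by ring.
  specialize (H3 (Rlt_le_trans _ _ _ Hh (Rmin_r _ _))).
  specialize (H1 _ H3). replace (g z + (g (z + h) - g z)) with (g (z + h)) in H1 by ring.
  set (k := g (z + h) - g z) in *.
  replace (f (g (z + h)) - f (g z) - l * m * h) with
    ((f (g (z + h)) - f (g z) - l * k) + l * (k - m * h)) by ring.
  eapply Rle_trans; [apply Cmod_triangle|]. rewrite Cmod_mult.
  assert (Hk : Cmod k <= (e + Cmod m) * Cmod h).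
  { replace k with ((k - m * h) + m * h) by ring.
    eapply Rle_trans; [apply Cmod_triangle|]. rewrite Cmod_mult. lra. }
  generalize (Cmod_ge_0 h) (Cmod_ge_0 l) (Cmod_ge_0 m); intros.
  assert (Cmod l * Cmod (k - m * h) <= Cmod l * (e * Cmod h)) by (apply Rmult_le_compat_l; auto).
  assert (e * Cmod k <= e * ((e + Cmod m) * Cmod h)) by (apply Rmult_le_compat_l; lra).
  assert (e * ((e + Cmod m) * Cmod h) + Cmod l * (e * Cmod h) <= M * e * Cmod h).
  { replace (e * ((e + Cmod m) * Cmod h) + Cmod l * (e * Cmod h))%R with ((e + Cmod m + Cmod l) * (e * Cmod h))%R by ring.
    rewrite Rmult_assoc. apply Rmult_le_compat_r; [apply Rmult_le_pos; lra|unfold M; lra]. }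
  assert (M * e * Cmod h <= eps * Cmod h) by (apply Rmult_le_compat_r; nra).
  lra.
Qed.

Lemma cdv_sqr (z : C) : cdv (fun w => w * w) z (2 * z).
Proof.
  intros eps He. exists eps. split; auto. intros h Hh.
  replace ((z + h) * (z + h) - z * z - 2 * z * h) with (h * h) by ring.
  rewrite Cmod_mult. apply Rmult_le_compat_r; [apply Cmod_ge_0|lra].
Qed.

Lemma cdv_scal (c : C) (f : C -> C) z l : cdv f z l -> cdv (fun w => c * f w) z (c * l).
Proof.
  intros Hf. apply (cdv_comp (fun v => c * v) f z c l); auto.
  intros eps He. exists 1%R. split; [lra|]. intros h _.
  replace (c * (f z + h) - c * f z - c * h) with (RtoC 0) by ring. rewrite Cmod_0.
  apply Rmult_le_pos; [lra|apply Cmod_ge_0].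
Qed.

Lemma cdv_ext (f g : C -> C) z l : (forall w, f w = g w) -> cdv f z l -> cdv g z l.
Proof. intros H Hf eps He. destruct (Hf eps He) as (d & Hd & K). exists d; split; auto.
  intros h Hh. rewrite <- !H. auto. Qed.

Lemma cdv_opp (f : C -> C) z l : cdv f z l -> cdv (fun w => - f w) z (- l).
Proof. intros H. apply cdv_ext with (fun w => (-(1)) * f w). { intros; ring. }
  eapply cdv_eq; [apply (cdv_scal _ _ _ _ H)|ring]. Qed.

Lemma cdv_minus (f g : C -> C) z l m : cdv f z l -> cdv g z m -> cdv (fun w => f w - g w) z (l - m).
Proof. intros Hf Hg. exact (cdv_plus _ _ _ _ _ Hf (cdv_opp _ _ _ Hg)). Qed.

(** By polarisation, a product is a combination of squares, so [cdv_sqr] and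
    the chain rule suffice. *)
Lemma cdv_mult (f g : C -> C) z l m : cdv f z l -> cdv g z m ->
  cdv (fun w => f w * g w) z (l * g z + f z * m).
Proof.
  intros Hf Hg.
  assert (S : forall k n, cdv k z n -> cdv (fun w => k w * k w) z (2 * k z * n)).
  { intros k n Hk. apply (cdv_comp (fun w => w * w) k z (2 * k z) n); auto. apply cdv_sqr. }
  apply cdv_ext with (fun w => / 4 * ((f w + g w) * (f w + g w) - (f w - g w) * (f w - g w))).
  { intros w. assert (H4 : RtoC 4 <> 0) by (intros H; apply RtoC_inj in H; lra). field. }
  eapply cdv_eq.
  - apply cdv_scal, cdv_minus.
    + apply (S (fun w => f w + g w)). apply cdv_plus; eassumption.
    + apply (S (fun w => f w - g w)). apply cdv_minus; eassumption.
  - assert (H4 : RtoC 4 <> 0) by (intros H; apply RtoC_inj in H; lra). simpl. field.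
Qed.

Lemma Cinv_0 : / (RtoC 0) = 0.
Proof. unfold Cinv, RtoC; simpl. f_equal; unfold Rdiv; ring. Qed.

Lemma cdv_Cinv (z : C) : z <> 0 -> cdv Cinv z (- / (z * z)).
Proof.
  intros Hz eps He. assert (Hm : 0 < Cmod z) by now apply Cmod_gt_0.
  assert (Hm3 : 0 < Cmod z * (Cmod z * Cmod z)) by (repeat apply Rmult_lt_0_compat; auto).
  exists (Rmin (Cmod z / 2) (eps * (Cmod z * (Cmod z * Cmod z)) / 2)). split.
  { apply Rmin_glb_lt; [lra|]. apply Rmult_lt_0_compat; [|lra]. apply Rmult_lt_0_compat; auto. }
  intros h Hh.
  assert (H1 : Cmod h < Cmod z / 2) by (eapply Rlt_le_trans; [exact Hh|apply Rmin_l]).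
  assert (H2 : Cmod h < eps * (Cmod z * (Cmod z * Cmod z)) / 2) by (eapply Rlt_le_trans; [exact Hh|apply Rmin_r]).
  assert (H3 : Cmod z / 2 <= Cmod (z + h)).
  { generalize (Cmod_ge_sub z (- h)). rewrite Cmod_opp. replace (z - - h) with (z + h) by ring. lra. }
  assert (Hzh : z + h <> 0) by (apply Cmod_gt_0; lra).
  replace (/ (z + h) - / z - - / (z * z) * h) with (h * h * / (z * z * (z + h))) by (field; auto).
  rewrite !Cmod_mult, Cmod_inv, !Cmod_mult by (repeat apply Cmult_neq_0; auto).
  rewrite Rmult_assoc, Rmult_comm. apply Rmult_le_compat_r; [apply Cmod_ge_0|].
  apply Rmult_le_reg_r with (Cmod z * Cmod z * Cmod (z + h))%R.
  { repeat apply Rmult_lt_0_compat; lra. }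
  rewrite Rmult_assoc, Rinv_l, Rmult_1_r by (apply Rgt_not_eq; repeat apply Rmult_lt_0_compat; lra).
  assert (eps * (Cmod z * Cmod z * (Cmod z / 2)) <= eps * (Cmod z * Cmod z * Cmod (z + h))).
  { apply Rmult_le_compat_l; [lra|]. apply Rmult_le_compat_l; [nra|lra]. }
  lra.
Qed.

Lemma cdv_inv (f : C -> C) z l : f z <> 0 -> cdv f z l -> cdv (fun w => / f w) z (- l / (f z * f z)).
Proof.
  intros Hz Hf. eapply cdv_eq; [apply (cdv_comp Cinv f z _ _ (cdv_Cinv _ Hz) Hf)|].
  field. exact Hz.
Qed.

Lemma cdv_div (f g : C -> C) z l m : g z <> 0 -> cdv f z l -> cdv g z m ->
  cdv (fun w => f w / g w) z ((l * g z - f z * m) / (g z * g z)).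
Proof.
  intros Hz Hf Hg. eapply cdv_eq; [apply (cdv_mult _ _ _ _ _ Hf (cdv_inv _ _ _ Hz Hg))|].
  field. exact Hz.
Qed.

Lemma cdv_loc (f g : C -> C) z l : locally (T := C_UniformSpace) z (fun w => f w = g w) -> cdv f z l -> cdv g z l.
Proof.
  intros HE Hf eps He. apply locally_CE in HE. destruct HE as (d0 & Hd0 & HE).
  destruct (Hf eps He) as (d & Hd & K). exists (Rmin d0 d); split; [now apply Rmin_glb_lt|].
  intros h Hh. rewrite <- !HE.
  - apply K. eapply Rlt_le_trans; [exact Hh|apply Rmin_r].
  - replace (z - z) with (RtoC 0) by ring. now rewrite Cmod_0.
  - replace (z + h - z) with h by ring. eapply Rlt_le_trans; [exact Hh|apply Rmin_l].
Qed.

Lemma cdv_unique (f : C -> C) z l m : cdv f z l -> cdv f z m -> l = m.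
Proof.
  intros Hl Hm. destruct (Classical_Prop.classic (l = m)) as [|N]; auto. exfalso.
  assert (P : 0 < Cmod (l - m)) by (apply Cmod_gt_0; intros H; apply N; now apply Ceq_minus).
  destruct (Hl (Cmod (l - m) / 3)%R) as (d1 & Hd1 & H1); [lra|].
  destruct (Hm (Cmod (l - m) / 3)%R) as (d2 & Hd2 & H2); [lra|].
  set (h := RtoC (Rmin d1 d2 / 2)).
  assert (Hmin : 0 < Rmin d1 d2) by now apply Rmin_glb_lt.
  assert (Eh : Cmod h = (Rmin d1 d2 / 2)%R) by (unfold h; rewrite Cmod_R; apply Rabs_pos_eq; lra).
  generalize (Rmin_l d1 d2) (Rmin_r d1 d2); intros.
  specialize (H1 h ltac:(lra)). specialize (H2 h ltac:(lra)).
  assert (Cmod ((l - m) * h) <= 2 * (Cmod (l - m) / 3) * Cmod h).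
  { replace ((l - m) * h) with ((f (z + h) - f z - m * h) - (f (z + h) - f z - l * h)) by ring.
    eapply Rle_trans; [apply Cmod_minus_le|]. lra. }
  rewrite Cmod_mult in H3. assert (0 < Cmod h) by lra. nra.
Qed.

Lemma cdv_C_derive (f : C -> C) z l : cdv f z l -> C_derive f z = l.
Proof. intros H. apply is_C_derive_unique. now apply cdvE. Qed.

(** * Neighbourhoods and continuity *)

Notation nearC := (locally (T := C_UniformSpace)).

Lemma nearC_pt (a : C) (P : C -> Prop) : nearC a P -> P a.
Proof. intros H. apply locally_CE in H. destruct H as (d & Hd & H). apply H.
  replace (a - a) with (RtoC 0) by ring. now rewrite Cmod_0. Qed.

Lemma nearC_open (a : C) (P : C -> Prop) : nearC a P -> nearC a (fun z => nearC z P).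
Proof. apply (locally_locally (T := C_UniformSpace)). Qed.

Lemma nearC_and (a : C) (P Q : C -> Prop) : nearC a P -> nearC a Q -> nearC a (fun z => P z /\ Q z).
Proof. apply filter_and. Qed.

Lemma nearC_imp (a : C) (P Q : C -> Prop) : (forall z, P z -> Q z) -> nearC a P -> nearC a Q.
Proof. apply filter_imp. Qed.

Lemma nearC_all (a : C) (P : C -> Prop) : (forall z, P z) -> nearC a P.
Proof. intros H. now apply filter_forall. Qed.

Lemma nearC_disc (a : C) (r : R) : 0 < r -> nearC a (fun z => Cmod (z - a) < r).
Proof. intros H. apply locally_CE. exists r; split; auto. Qed.

Definition cont (f : C -> C) (a : C) : Prop :=
  forall eps : R, 0 < eps -> nearC a (fun w => Cmod (f w - f a) < eps).

Lemma cont_near (f : C -> C) a (P : C -> Prop) : cont f a -> nearC (f a) P -> nearC a (fun w => P (f w)).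
Proof. intros Hf HP. apply locally_CE in HP. destruct HP as (d & Hd & HP).
  apply (nearC_imp _ _ _ (fun w H => HP _ H) (Hf d Hd)). Qed.

Lemma cont_continuous (f : C -> C) a : cont f a <-> continuous (T := C_UniformSpace) (U := C_UniformSpace) f a.
Proof.
  split.
  - intros H P HP. exact (cont_near f a P H HP).
  - intros H eps He. apply (H (fun y => Cmod (y - f a) < eps)). now apply nearC_disc.
Qed.

Lemma cdv_continuous f z l : cdv f z l -> cont f z.
Proof. intros H eps He. destruct (cdv_cont _ _ _ H eps He) as (d & Hd & K).
  apply locally_CE. now exists d. Qed.

Lemma cont_const c a : cont (fun _ => c) a.
Proof. eapply cdv_continuous, cdv_const. Qed.
Lemma cont_id a : cont (fun w => w) a.
Proof. eapply cdv_continuous, cdv_id. Qed.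
Lemma cont_comp (f g : C -> C) a : cont f (g a) -> cont g a -> cont (fun w => f (g w)) a.
Proof. rewrite !cont_continuous. intros. now apply (continuous_comp (U := C_UniformSpace) (V := C_UniformSpace) (W := C_UniformSpace) g f). Qed.
Lemma cont_plus (f g : C -> C) (a : C) : cont f a -> cont g a -> cont (fun w => f w + g w) a.
Proof.
  intros Hf Hg eps He. generalize (nearC_and _ _ _ (Hf (eps/2)%R ltac:(lra)) (Hg (eps/2)%R ltac:(lra))).
  apply nearC_imp. intros w [H1 H2].
  replace (f w + g w - (f a + g a)) with ((f w - f a) + (g w - g a)) by ring.
  eapply Rle_lt_trans; [apply Cmod_triangle|lra].
Qed.
Lemma cont_opp (f : C -> C) (a : C) : cont f a -> cont (fun w => - f w) a.
Proof. intros. apply (cont_comp (fun v => - v)); auto. eapply cdv_continuous, cdv_opp, cdv_id. Qed.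
Lemma cont_minus (f g : C -> C) (a : C) : cont f a -> cont g a -> cont (fun w => f w - g w) a.
Proof. intros. apply cont_plus; auto. now apply cont_opp. Qed.
Lemma cont_ext (f g : C -> C) a : (forall w, f w = g w) -> cont f a -> cont g a.
Proof. intros E H eps He. generalize (H eps He). apply nearC_imp. intros w. now rewrite !E. Qed.
Lemma cont_loc (f g : C -> C) a : nearC a (fun w => f w = g w) -> cont f a -> cont g a.
Proof. intros E H eps He. generalize (nearC_and _ _ _ E (H eps He)). apply nearC_imp.
  intros w [H1 H2]. now rewrite <- H1, <- (nearC_pt _ _ E). Qed.
Lemma cont_mult (f g : C -> C) (a : C) : cont f a -> cont g a -> cont (fun w => f w * g w) a.
Proof.
  intros Hf Hg.
  assert (S : forall k, cont k a -> cont (fun w => k w * k w) a).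
  { intros k Hk. apply (cont_comp (fun w => w * w) k); auto. eapply cdv_continuous, cdv_sqr. }
  apply cont_ext with (fun w => / 4 * ((f w + g w) * (f w + g w) - (f w - g w) * (f w - g w))).
  { intros w. field. }
  apply (cont_comp (fun v => / 4 * v)).
  - eapply cdv_continuous, cdv_scal, cdv_id.
  - apply cont_minus.
    + apply (S (fun w => f w + g w)). now apply cont_plus.
    + apply (S (fun w => f w - g w)). now apply cont_minus.
Qed.
Lemma cont_inv (f : C -> C) (a : C) : f a <> 0 -> cont f a -> cont (fun w => / f w) a.
Proof. intros. apply (cont_comp Cinv f); [|assumption]. exact (cdv_continuous _ _ _ (cdv_Cinv _ H)). Qed.
Lemma cont_div (f g : C -> C) (a : C) : g a <> 0 -> cont f a -> cont g a -> cont (fun w => f w / g w) a.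
Proof. intros. apply cont_mult; auto. now apply cont_inv. Qed.

Lemma cont_nonzero (f : C -> C) (a : C) : cont f a -> f a <> 0 -> nearC a (fun w => f w <> 0).
Proof. intros H N. generalize (H (Cmod (f a)) ltac:(now apply Cmod_gt_0)).
  apply nearC_imp. intros w. apply Cmod_sub_lt_nonzero. Qed.

(** Functions with poles, and sections of O(D), are compared away from the base
    point, where their conventional value carries no information. *)
Definition nearP (a : C) (P : C -> Prop) : Prop := nearC a (fun z => z <> a -> P z).

Lemma nearP_of a P : nearC a P -> nearP a P.
Proof. apply nearC_imp; auto. Qed.
Lemma nearP_and (a : C) (P Q : C -> Prop) : nearP a P -> nearP a Q -> nearP a (fun z => P z /\ Q z).
Proof. intros H K. generalize (nearC_and _ _ _ H K). apply nearC_imp. intuition. Qed.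
Lemma nearP_imp (a : C) (P Q : C -> Prop) : (forall z, P z -> Q z) -> nearP a P -> nearP a Q.
Proof. intros H. apply nearC_imp. auto. Qed.
Lemma nearP_ex a P : nearP a P -> forall r : R, 0 < r -> exists z, Cmod (z - a) < r /\ z <> a /\ P z.
Proof.
  intros H r Hr. apply locally_CE in H. destruct H as (d & Hd & H).
  assert (Hm : 0 < Rmin d r) by now apply Rmin_glb_lt.
  generalize (Rmin_l d r) (Rmin_r d r); intros.
  assert (E : Cmod (a + RtoC (Rmin d r / 2) - a) = (Rmin d r / 2)%R).
  { replace (a + RtoC (Rmin d r / 2) - a) with (RtoC (Rmin d r / 2)) by ring.
    rewrite Cmod_R. apply Rabs_pos_eq. lra. }
  assert (N : a + RtoC (Rmin d r / 2) <> a).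
  { intros K. rewrite K in E. replace (a - a) with (RtoC 0) in E by ring. rewrite Cmod_0 in E. lra. }
  exists (a + RtoC (Rmin d r / 2)). rewrite E. repeat split; auto; try lra. apply H; auto. rewrite E; lra.
Qed.
Lemma nearP_open (a : C) (P : C -> Prop) : nearP a P -> nearP a (fun z => nearC z P).
Proof.
  intros H. apply locally_CE in H. destruct H as (d & Hd & H). apply locally_CE. exists d. split; auto.
  intros z Hz N. apply locally_CE.
  exists (Rmin (d - Cmod (z - a)) (Cmod (z - a))). split.
  { apply Rmin_glb_lt; [lra|]. apply Cmod_gt_0. intros K. apply N. now apply Ceq_minus. }
  intros w Hw. generalize (Rmin_l (d - Cmod (z - a)) (Cmod (z - a))) (Rmin_r (d - Cmod (z - a)) (Cmod (z - a))); intros.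
  apply H.
  - replace (w - a) with ((w - z) + (z - a)) by ring. eapply Rle_lt_trans; [apply Cmod_triangle|lra].
  - intros ->. rewrite Cmod_sub_sym in Hw. lra.
Qed.

(** A value at an isolated point is recovered by continuity; this removes the
    exceptional points left by [nearP]. *)
Lemma cont_agree (f g : C -> C) (a : C) : cont f a -> cont g a -> nearP a (fun z => f z = g z) -> f a = g a.
Proof.
  intros Hf Hg HE. apply Classical_Prop.NNPP. intros N.
  assert (P : 0 < Cmod (f a - g a)) by (apply Cmod_gt_0; intros H; apply N; now apply Ceq_minus).
  destruct (nearP_ex _ _ (nearP_and _ _ _ HE (nearP_of _ _ (nearC_and _ _ _ (Hf (Cmod (f a - g a) / 2)%R ltac:(lra)) (Hg (Cmod (f a - g a) / 2)%R ltac:(lra))))) 1%R Rlt_0_1) as (z & _ & _ & E & H1 & H2).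
  assert (Cmod (f a - g a) < Cmod (f a - g a)); [|lra].
  replace (f a - g a) with ((g z - g a) - (f z - f a)) at 1 by (rewrite E; ring).
  eapply Rle_lt_trans; [apply Cmod_minus_le|]. lra.
Qed.

(** * Holomorphic germs *)

Lemma holoE f a : holo_at f a <-> nearC a (fun z => exists l, cdv f z l).
Proof. split; apply nearC_imp; intros z [l Hl]; exists l; now apply cdvE. Qed.

Lemma holo_open (f : C -> C) (a : C) : holo_at f a -> nearC a (holo_at f).
Proof. apply nearC_open. Qed.

Lemma holo_cdv (f : C -> C) (a : C) : holo_at f a -> cdv f a (C_derive f a).
Proof. intros H. apply holoE, nearC_pt in H. destruct H as [l Hl]. now rewrite (cdv_C_derive _ _ _ Hl). Qed.

Lemma holo_near_cdv (f : C -> C) (a : C) : holo_at f a -> nearC a (fun z => cdv f z (C_derive f z)).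
Proof. intros H. apply holo_open in H. revert H. apply nearC_imp. intros z; apply holo_cdv. Qed.

Lemma holo_cont (f : C -> C) (a : C) : holo_at f a -> cont f a.
Proof. intros H. eapply cdv_continuous, holo_cdv; eauto. Qed.

Lemma holo_near_cont (f : C -> C) (a : C) : holo_at f a -> nearC a (cont f).
Proof. intros H. apply holo_open in H. revert H. apply nearC_imp, holo_cont. Qed.

Lemma holo_loc (f g : C -> C) (a : C) : nearC a (fun w => f w = g w) -> holo_at f a -> holo_at g a.
Proof. rewrite !holoE. intros E H. apply nearC_open in E.
  generalize (nearC_and _ _ _ E H). apply nearC_imp. intros z [H1 [l Hl]]. exists l.
  now apply cdv_loc with f. Qed.

Lemma holo_ext (f g : C -> C) (a : C) : (forall w, f w = g w) -> holo_at f a -> holo_at g a.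
Proof. intros E. apply holo_loc. now apply nearC_all. Qed.

Lemma holo_const c a : holo_at (fun _ => c) a.
Proof. apply holoE, nearC_all. intros z. eexists; apply cdv_const. Qed.
Lemma holo_id a : holo_at (fun w => w) a.
Proof. apply holoE, nearC_all. intros z. eexists; apply cdv_id. Qed.
Lemma holo_plus (f g : C -> C) (a : C) : holo_at f a -> holo_at g a -> holo_at (fun w => f w + g w) a.
Proof. rewrite !holoE. intros H K. generalize (nearC_and _ _ _ H K). apply nearC_imp.
  intros z [[l Hl] [m Hm]]. eexists. now apply cdv_plus; eassumption. Qed.
Lemma holo_minus (f g : C -> C) (a : C) : holo_at f a -> holo_at g a -> holo_at (fun w => f w - g w) a.
Proof. rewrite !holoE. intros H K. generalize (nearC_and _ _ _ H K). apply nearC_imp.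
  intros z [[l Hl] [m Hm]]. eexists. now apply cdv_minus; eassumption. Qed.
Lemma holo_opp (f : C -> C) (a : C) : holo_at f a -> holo_at (fun w => - f w) a.
Proof. rewrite !holoE. apply nearC_imp. intros z [l Hl]. eexists. apply cdv_opp; eassumption. Qed.
Lemma holo_mult (f g : C -> C) (a : C) : holo_at f a -> holo_at g a -> holo_at (fun w => f w * g w) a.
Proof. rewrite !holoE. intros H K. generalize (nearC_and _ _ _ H K). apply nearC_imp.
  intros z [[l Hl] [m Hm]]. eexists. now apply cdv_mult; eassumption. Qed.
Lemma holo_inv (f : C -> C) (a : C) : f a <> 0 -> holo_at f a -> holo_at (fun w => / f w) a.
Proof. intros N H. generalize (nearC_and _ _ _ (cont_nonzero _ _ (holo_cont _ _ H) N) (holo_near_cdv _ _ H)).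
  rewrite holoE. apply nearC_imp. intros z [H1 H2]. eexists. apply cdv_inv; eassumption. Qed.
Lemma holo_div (f g : C -> C) (a : C) : g a <> 0 -> holo_at f a -> holo_at g a -> holo_at (fun w => f w / g w) a.
Proof. intros. apply holo_mult; auto. now apply holo_inv. Qed.
Lemma holo_comp (f g : C -> C) (a : C) : holo_at f (g a) -> holo_at g a -> holo_at (fun w => f (g w)) a.
Proof. intros Hf Hg. generalize (nearC_and _ _ _ (cont_near _ _ _ (holo_cont _ _ Hg) (holo_near_cdv _ _ Hf)) (holo_near_cdv _ _ Hg)).
  rewrite holoE. apply nearC_imp. intros z [H1 H2]. eexists. apply cdv_comp; eassumption. Qed.
Lemma holo_pow f n a : holo_at f a -> holo_at (fun w => f w ^ n) a.
Proof. intros H. induction n; simpl; [apply holo_const|now apply holo_mult]. Qed.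

(** * Integrals of complex functions of a real variable *)

Notation CI := (RInt (V := C_R_CompleteNormedModule)).
Notation isCI := (is_RInt (V := C_R_NormedModule)).

Lemma norm_CR (z : C) : norm (K := R_AbsRing) (V := C_R_NormedModule) z = Cmod z.
Proof.
  unfold norm; simpl. unfold prod_norm, Cmod. f_equal. simpl. unfold norm; simpl. unfold abs; simpl.
  rewrite !Rmult_1_r. rewrite <- !Rabs_mult. rewrite !Rabs_pos_eq; auto; apply Rle_0_sqr.
Qed.

Definition rcont (f : R -> C) (t : R) : Prop :=
  forall eps : R, 0 < eps -> exists d : R, 0 < d /\ forall s, Rabs (s - t) < d -> Cmod (f s - f t) < eps.

Lemma rcont_continuous f t : rcont f t <-> continuous (T := R_UniformSpace) (U := C_UniformSpace) f t.
Proof.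
  split.
  - intros H P HP. apply locally_CE in HP. destruct HP as (e & He & HP).
    destruct (H e He) as (d & Hd & K). exists (mkposreal d Hd). intros y Hy. apply HP, K, Hy.
  - intros H eps He. destruct (H (fun y => Cmod (y - f t) < eps)) as [d Hd].
    { now apply nearC_disc. }
    exists d. split; [apply cond_pos|]. intros s Hs. now apply Hd.
Qed.

Lemma rcont_comp (f : C -> C) (g : R -> C) t : cont f (g t) -> rcont g t -> rcont (fun s => f (g s)) t.
Proof.
  intros Hf Hg eps He. specialize (Hf eps He). apply locally_CE in Hf. destruct Hf as (d & Hd & K).
  destruct (Hg d Hd) as (e & He' & L). exists e; split; auto.
Qed.

Lemma rcont_const c t : rcont (fun _ => c) t.
Proof. intros eps He. exists 1%R. split; [lra|]. intros s _. replace (c - c) with (RtoC 0) by ring. now rewrite Cmod_0. Qed.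

Lemma rcont_h y t : rcont (fun x => (x, y)) t.
Proof. intros eps He. exists eps; split; auto. intros s Hs.
  replace ((s, y) - (t, y)) with (RtoC (s - t)). now rewrite Cmod_R.
  unfold RtoC, Cminus, Cplus, Copp; simpl. f_equal; ring. Qed.
Lemma rcont_v x t : rcont (fun y => (x, y)) t.
Proof. intros eps He. exists eps; split; auto. intros s Hs.
  replace ((x, s) - (x, t)) with (RtoC (s - t) * Ci). now rewrite Cmod_mult, Cmod_R, Cmod_Ci, Rmult_1_r.
  unfold RtoC, Ci, Cminus, Cmult, Cplus, Copp; simpl. f_equal; ring. Qed.

Lemma rcont_mult f g t : rcont f t -> rcont g t -> rcont (fun s => f s * g s) t.
Proof.
  intros Hf Hg eps He.
  generalize (Cmod_ge_0 (f t)) (Cmod_ge_0 (g t)); intros.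
  set (e := Rmin 1 (eps / (2 + Cmod (f t) + Cmod (g t)))).
  assert (He' : 0 < e) by (apply Rmin_glb_lt; [lra|apply Rdiv_lt_0_compat; lra]).
  assert (He1 : e <= 1) by apply Rmin_l.
  assert (He2 : e * (2 + Cmod (f t) + Cmod (g t)) <= eps).
  { assert (e <= eps / (2 + Cmod (f t) + Cmod (g t))) by apply Rmin_r.
    apply Rmult_le_compat_r with (r := (2 + Cmod (f t) + Cmod (g t))%R) in H1; [|lra].
    unfold Rdiv in H1. rewrite Rmult_assoc, Rinv_l in H1; lra. }
  destruct (Hf e He') as (d1 & Hd1 & K1). destruct (Hg e He') as (d2 & Hd2 & K2).
  exists (Rmin d1 d2). split; [now apply Rmin_glb_lt|]. intros s Hs.
  specialize (K1 s (Rlt_le_trans _ _ _ Hs (Rmin_l _ _))). specialize (K2 s (Rlt_le_trans _ _ _ Hs (Rmin_r _ _))).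
  replace (f s * g s - f t * g t) with ((f s - f t) * (g s - g t) + ((f s - f t) * g t + f t * (g s - g t))) by ring.
  eapply Rle_lt_trans; [apply Cmod_triangle|]. rewrite Cmod_mult.
  assert (Cmod ((f s - f t) * g t + f t * (g s - g t)) <= e * (Cmod (g t) + Cmod (f t))).
  { eapply Rle_trans; [apply Cmod_triangle|]. rewrite !Cmod_mult. nra. }
  generalize (Cmod_ge_0 (f s - f t)) (Cmod_ge_0 (g s - g t)); intros. nra.
Qed.

Lemma rcont_plus f g t : rcont f t -> rcont g t -> rcont (fun s => f s + g s) t.
Proof.
  intros Hf Hg eps He. destruct (Hf (eps/2)%R ltac:(lra)) as (d1 & Hd1 & K1). destruct (Hg (eps/2)%R ltac:(lra)) as (d2 & Hd2 & K2).
  exists (Rmin d1 d2). split; [now apply Rmin_glb_lt|]. intros s Hs.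
  specialize (K1 s (Rlt_le_trans _ _ _ Hs (Rmin_l _ _))). specialize (K2 s (Rlt_le_trans _ _ _ Hs (Rmin_r _ _))).
  replace (f s + g s - (f t + g t)) with ((f s - f t) + (g s - g t)) by ring.
  eapply Rle_lt_trans; [apply Cmod_triangle|lra].
Qed.

Definition rcont_on (f : R -> C) (a b : R) : Prop := forall t, a <= t <= b -> rcont f t.

Lemma exCI f a b : a <= b -> rcont_on f a b -> ex_RInt (V := C_R_NormedModule) f a b.
Proof. intros Hab H. apply (ex_RInt_continuous (V := C_R_CompleteNormedModule)).
  intros z Hz. rewrite Rmin_left, Rmax_right in Hz by auto. apply rcont_continuous. now apply H. Qed.

Lemma isCI_CI f a b l : isCI f a b l -> CI f a b = l.
Proof. intros. now apply (is_RInt_unique (V := C_R_CompleteNormedModule)). Qed.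

Lemma CI_isCI f a b : ex_RInt (V := C_R_NormedModule) f a b -> isCI f a b (CI f a b).
Proof. intros. now apply (RInt_correct (V := C_R_CompleteNormedModule)). Qed.

Lemma isCI_plus f g a b l m : isCI f a b l -> isCI g a b m -> isCI (fun t => f t + g t) a b (l + m).
Proof. apply (is_RInt_plus (V := C_R_NormedModule)). Qed.
Lemma isCI_minus f g a b l m : isCI f a b l -> isCI g a b m -> isCI (fun t => f t - g t) a b (l - m).
Proof. apply (is_RInt_minus (V := C_R_NormedModule)). Qed.

Lemma isCI_pair f a b (l : C) : isCI f a b l <-> is_RInt (fun t => Re (f t)) a b (Re l) /\ is_RInt (fun t => Im (f t)) a b (Im l).
Proof.
  split.
  - intros H. split.
    + exact (is_RInt_fct_extend_fst (U := R_NormedModule) (V := R_NormedModule) f a b l H).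
    + exact (is_RInt_fct_extend_snd (U := R_NormedModule) (V := R_NormedModule) f a b l H).
  - intros [H1 H2]. replace l with (Re l, Im l) by now destruct l.
    exact (is_RInt_fct_extend_pair (U := R_NormedModule) (V := R_NormedModule) f a b _ _ H1 H2).
Qed.

Lemma isCI_scal c f a b l : isCI f a b l -> isCI (fun t => c * f t) a b (c * l).
Proof.
  rewrite !isCI_pair. intros [H1 H2]. destruct c as [c1 c2]. split.
  - apply (is_RInt_ext (fun t => minus (scal c1 (Re (f t))) (scal c2 (Im (f t))))).
    { intros t _. destruct (f t). unfold minus, plus, opp, scal, Re, Im; simpl; unfold Hierarchy.mult; simpl; unfold fst, snd, Cmult; ring. }
    replace (Re ((c1, c2) * l)) with (minus (scal c1 (Re l)) (scal c2 (Im l))).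
    + apply (is_RInt_minus (V := R_NormedModule)); now apply (is_RInt_scal (V := R_NormedModule)).
    + destruct l. unfold minus, plus, opp, scal, Re, Im; simpl; unfold Hierarchy.mult; simpl; unfold fst, snd, Cmult; ring.
  - apply (is_RInt_ext (fun t => plus (scal c1 (Im (f t))) (scal c2 (Re (f t))))).
    { intros t _. destruct (f t). unfold minus, plus, opp, scal, Re, Im; simpl; unfold Hierarchy.mult; simpl; unfold fst, snd, Cmult; ring. }
    replace (Im ((c1, c2) * l)) with (plus (scal c1 (Im l)) (scal c2 (Re l))).
    + apply (is_RInt_plus (V := R_NormedModule)); now apply (is_RInt_scal (V := R_NormedModule)).
    + destruct l. unfold minus, plus, opp, scal, Re, Im; simpl; unfold Hierarchy.mult; simpl; unfold fst, snd, Cmult; ring.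
Qed.

Lemma isCI_bound f a b l (M : R) : a <= b -> (forall t, a <= t <= b -> Cmod (f t) <= M) -> isCI f a b l -> Cmod l <= (b - a) * M.
Proof. intros Hab H Hl. rewrite <- norm_CR. apply (norm_RInt_le_const (V := C_R_NormedModule) f a b l M); auto.
  intros x Hx. rewrite norm_CR. now apply H. Qed.

Lemma isCI_Chasles f a b c l m : isCI f a b l -> isCI f b c m -> isCI f a c (l + m).
Proof. apply (is_RInt_Chasles (V := C_R_NormedModule)). Qed.

Lemma isCI_const (c : C) a b : isCI (fun _ => c) a b (RtoC (b - a) * c).
Proof. replace (RtoC (b - a) * c) with (scal (V := C_R_NormedModule) (b - a)%R c).
  - apply (is_RInt_const (V := C_R_NormedModule)).
  - apply scal_R_Cmult. Qed.

Lemma isCI_ext f g a b l : a <= b -> (forall t, a < t < b -> f t = g t) -> isCI f a b l -> isCI g a b l.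
Proof. intros Hab H. apply (is_RInt_ext (V := C_R_NormedModule)). rewrite Rmin_left, Rmax_right by auto. auto. Qed.

Lemma isCI_unique f a b l m : isCI f a b l -> isCI f a b m -> l = m.
Proof. intros H K. apply isCI_CI in H, K. congruence. Qed.

Lemma isCI_FTC (F : R -> C) (f : R -> C) a b : a <= b ->
  (forall t, a <= t <= b -> forall eps : R, 0 < eps -> exists d : R, 0 < d /\ forall h, Rabs h < d ->
      Cmod (F (t + h)%R - F t - RtoC h * f t) <= eps * Rabs h) ->
  rcont_on f a b -> isCI f a b (F b - F a).
Proof.
  intros Hab HF Hf.
  apply (is_RInt_derive (V := C_R_CompleteNormedModule) F f a b).
  - rewrite Rmin_left, Rmax_right by auto. intros t Ht. split; [apply is_linear_scal_l|].
    intros x Hx. assert (E : t = x) by (apply (is_filter_lim_locally_unique (K := R_AbsRing) (V := R_NormedModule)) in Hx; exact Hx).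
    subst x. intros [eps He]. destruct (HF t Ht eps He) as (d & Hd & K).
    exists (mkposreal d Hd). refine (fun (y : R) Hy => _).
    change (Rabs (y - t) < d) in Hy. specialize (K (y - t)%R Hy). replace (t + (y - t))%R with y in K by ring.
    change (norm (K := R_AbsRing) (V := C_R_NormedModule) (F y + - F t + - (scal (K := R_AbsRing) (V := C_R_NormedModule) (y + - t)%R (f t))) <= eps * Rabs (y + - t)).
    rewrite norm_CR. rewrite scal_R_Cmult. exact K.
  - rewrite Rmin_left, Rmax_right by auto. intros t Ht. apply rcont_continuous. now apply Hf.
Qed.

(** * Goursat's theorem on rectangles *)

(** The integral of f dz along the boundary of the rectangle with corners a +
    ic and b + id, counterclockwise. *)
Definition rect (f : C -> C) (a b c d : R) : C :=
  CI (fun x => f (x, c)) a b - CI (fun x => f (x, d)) a b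
  + Ci * (CI (fun y => f (b, y)) c d - CI (fun y => f (a, y)) c d).

Definition in_box (a b c d : R) (z : C) : Prop := a <= Re z <= b /\ c <= Im z <= d.

Definition contB (f : C -> C) a b c d : Prop := forall z, in_box a b c d z -> cont f z.

Lemma contB_sub f a b c d a' b' c' d' : contB f a b c d -> a <= a' -> b' <= b -> c <= c' -> d' <= d -> contB f a' b' c' d'.
Proof. intros H; intros. intros z [K1 K2]. apply H. split; lra. Qed.

Lemma isCI_h f a b c d y : a <= b -> contB f a b c d -> c <= y <= d -> isCI (fun x => f (x, y)) a b (CI (fun x => f (x, y)) a b).
Proof. intros Hab H Hy. apply CI_isCI, exCI; auto. intros t Ht. apply rcont_comp; [|apply rcont_h].
  apply H. split; simpl; auto. Qed.
Lemma isCI_v f a b c d x : c <= d -> contB f a b c d -> a <= x <= b -> isCI (fun y => f (x, y)) c d (CI (fun y => f (x, y)) c d).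
Proof. intros Hab H Hy. apply CI_isCI, exCI; auto. intros t Ht. apply rcont_comp; [|apply rcont_v].
  apply H. split; simpl; auto. Qed.

Lemma rect_split_h f a m b c d : a <= m <= b -> c <= d -> contB f a b c d ->
  rect f a b c d = rect f a m c d + rect f m b c d.
Proof.
  intros Hm Hcd H. unfold rect.
  assert (E : forall y, c <= y <= d -> CI (fun x => f (x, y)) a b = CI (fun x => f (x, y)) a m + CI (fun x => f (x, y)) m b).
  { intros y Hy. apply isCI_CI. apply isCI_Chasles with m.
    - apply isCI_h with c d; auto; [lra|]. apply contB_sub with a b c d; auto; lra.
    - apply isCI_h with c d; auto; [lra|]. apply contB_sub with a b c d; auto; lra. }
  rewrite !E by lra. ring.
Qed.

Lemma rect_split_v f a b c m d : a <= b -> c <= m <= d -> contB f a b c d ->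
  rect f a b c d = rect f a b c m + rect f a b m d.
Proof.
  intros Hab Hm H. unfold rect.
  assert (E : forall x, a <= x <= b -> CI (fun y => f (x, y)) c d = CI (fun y => f (x, y)) c m + CI (fun y => f (x, y)) m d).
  { intros x Hx. apply isCI_CI. apply isCI_Chasles with m.
    - apply isCI_v with a b; auto; [lra|]. apply contB_sub with a b c d; auto; lra.
    - apply isCI_v with a b; auto; [lra|]. apply contB_sub with a b c d; auto; lra. }
  rewrite !E by lra. ring.
Qed.

Lemma rect_bound f a b c d (M : R) : a <= b -> c <= d -> contB f a b c d ->
  (forall z, in_box a b c d z -> Cmod (f z) <= M) -> Cmod (rect f a b c d) <= 2 * ((b - a) + (d - c)) * M.
Proof.
  intros Hab Hcd H HM. unfold rect.
  assert (Hh : forall y, c <= y <= d -> Cmod (CI (fun x => f (x, y)) a b) <= (b - a) * M).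
  { intros y Hy. eapply isCI_bound; [exact Hab| |apply isCI_h with c d; auto].
    intros t Ht. apply HM. split; simpl; auto. }
  assert (Hv : forall x, a <= x <= b -> Cmod (CI (fun y => f (x, y)) c d) <= (d - c) * M).
  { intros x Hx. eapply isCI_bound; [exact Hcd| |apply isCI_v with a b; auto].
    intros t Ht. apply HM. split; simpl; auto. }
  eapply Rle_trans; [apply Cmod_triangle|]. rewrite Cmod_mult, Cmod_Ci, Rmult_1_l.
  generalize (Cmod_minus_le (CI (fun x => f (x, c)) a b) (CI (fun x => f (x, d)) a b)).
  generalize (Cmod_minus_le (CI (fun y => f (b, y)) c d) (CI (fun y => f (a, y)) c d)).
  generalize (Hh c ltac:(lra)) (Hh d ltac:(lra)) (Hv a ltac:(lra)) (Hv b ltac:(lra)). lra.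
Qed.

Lemma isCI_prim_h (F f : C -> C) a b y : a <= b -> (forall x, a <= x <= b -> cdv F (x, y) (f (x, y)) /\ cont f (x, y)) ->
  isCI (fun x => f (x, y)) a b (F (b, y) - F (a, y)).
Proof.
  intros Hab H. apply (isCI_FTC (fun x => F (x, y))); auto.
  - intros t Ht eps He. destruct (H t Ht) as [H1 _]. destruct (H1 eps He) as (d & Hd & K).
    exists d; split; auto. intros h Hh. specialize (K (RtoC h)). rewrite Cmod_R in K. specialize (K Hh).
    replace ((t + h)%R, y) with ((t, y) + RtoC h). 2:{ unfold RtoC, Cplus; simpl. f_equal; ring. }
    rewrite (Cmult_comm h). exact K.
  - intros t Ht. apply rcont_comp; [|apply rcont_h]. now apply H.
Qed.

Lemma isCI_prim_v (F f : C -> C) c d x : c <= d -> (forall y, c <= y <= d -> cdv F (x, y) (f (x, y)) /\ cont f (x, y)) ->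
  isCI (fun y => f (x, y)) c d (- Ci * (F (x, d) - F (x, c))).
Proof.
  intros Hab H. replace (- Ci * (F (x, d) - F (x, c))) with (- Ci * F (x, d) - - Ci * F (x, c)) by ring.
  apply (isCI_FTC (fun y => - Ci * F (x, y))); auto.
  - intros t Ht eps He. destruct (H t Ht) as [H1 _]. destruct (H1 eps He) as (dd & Hd & K).
    exists dd; split; auto. intros h Hh. specialize (K (RtoC h * Ci)). rewrite Cmod_mult, Cmod_R, Cmod_Ci, Rmult_1_r in K. specialize (K Hh).
    replace (x, (t + h)%R) with ((x, t) + RtoC h * Ci). 2:{ unfold RtoC, Cplus, Cmult, Ci; simpl. f_equal; ring. }
    replace (- Ci * F ((x, t) + h * Ci) - - Ci * F (x, t) - h * f (x, t)) with
      (- Ci * (F ((x, t) + h * Ci) - F (x, t) - f (x, t) * (h * Ci)) - (1 + Ci * Ci) * (h * f (x, t))) by ring.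
    replace (1 + Ci * Ci) with (RtoC 0) by (unfold RtoC, Cplus, Cmult, Ci; simpl; f_equal; ring).
    rewrite Cmult_0_l. unfold Cminus at 1. rewrite Copp_0, Cplus_0_r, Cmod_mult, Cmod_opp, Cmod_Ci, Rmult_1_l. exact K.
  - intros t Ht. apply rcont_comp; [|apply rcont_v]. now apply H.
Qed.

(** Affine functions have primitives, so they contribute nothing to the
    boundary integral in Goursat's argument. *)
Lemma rect_primitive (F f : C -> C) a b c d : a <= b -> c <= d ->
  (forall z, in_box a b c d z -> cdv F z (f z) /\ cont f z) -> rect f a b c d = 0.
Proof.
  intros Hab Hcd H. unfold rect.
  rewrite (isCI_CI _ _ _ _ (isCI_prim_h F f a b c Hab ltac:(intros; apply H; split; simpl; lra))).
  rewrite (isCI_CI _ _ _ _ (isCI_prim_h F f a b d Hab ltac:(intros; apply H; split; simpl; lra))).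
  rewrite (isCI_CI _ _ _ _ (isCI_prim_v F f c d a Hcd ltac:(intros; apply H; split; simpl; lra))).
  rewrite (isCI_CI _ _ _ _ (isCI_prim_v F f c d b Hcd ltac:(intros; apply H; split; simpl; lra))).
  transitivity ((1 + Ci * Ci) * (F (b, c) - F (a, c) - F (b, d) + F (a, d))); [ring|].
  replace (1 + Ci * Ci) with (RtoC 0) by (unfold RtoC, Cplus, Cmult, Ci; simpl; f_equal; ring). ring.
Qed.

Lemma rect_minus f g a b c d : a <= b -> c <= d -> contB f a b c d -> contB g a b c d ->
  rect (fun z => f z - g z) a b c d = rect f a b c d - rect g a b c d.
Proof.
  intros Hab Hcd Hf Hg. unfold rect.
  assert (Hh : forall y, c <= y <= d -> CI (fun x => f (x, y) - g (x, y)) a b = CI (fun x => f (x, y)) a b - CI (fun x => g (x, y)) a b).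
  { intros y Hy. apply isCI_CI, isCI_minus; apply isCI_h with c d; auto. }
  assert (Hv : forall x, a <= x <= b -> CI (fun y => f (x, y) - g (x, y)) c d = CI (fun y => f (x, y)) c d - CI (fun y => g (x, y)) c d).
  { intros y Hy. apply isCI_CI, isCI_minus; apply isCI_v with a b; auto. }
  rewrite !Hh, !Hv by lra. ring.
Qed.

Lemma nested_point (u w : nat -> R) : (forall k, 0 <= w k) -> (forall k, u k <= u (S k)) ->
  (forall k, u (S k) + w (S k) <= u k + w k) -> exists X : R, forall k, u k <= X <= u k + w k.
Proof.
  intros Hw Hu Hv.
  assert (Hu' : forall j k, (j <= k)%nat -> u j <= u k).
  { intros j k Hjk. induction Hjk; [lra|]. eapply Rle_trans; [eassumption|auto]. }
  assert (Hv' : forall j k, (j <= k)%nat -> u k + w k <= u j + w j).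
  { intros j k Hjk. induction Hjk; [lra|]. eapply Rle_trans; [apply Hv|auto]. }
  assert (Hb : forall j k, u j <= u k + w k).
  { intros j k. destruct (Nat.le_ge_cases j k) as [H|H].
    - generalize (Hu' _ _ H) (Hw k); lra.
    - generalize (Hv' _ _ H) (Hw j); lra. }
  destruct (completeness (fun x => exists k, x = u k)) as [X [HX1 HX2]].
  - exists (u O + w O)%R. intros x [k ->]. apply Hb.
  - exists (u O). now exists O.
  - exists X. intros k. split.
    + apply HX1. now exists k.
    + apply HX2. intros x [j ->]. apply Hb.
Qed.

Lemma half_pow_lt (M eps : R) : 0 < eps -> exists k : nat, M / 2 ^ k < eps.
Proof.
  intros He. destruct (Pow_x_infinity 2 ltac:(rewrite Rabs_pos_eq; lra) ((M + 1) / eps)%R) as [N HN].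
  exists N. specialize (HN N (le_n _)). rewrite Rabs_pos_eq in HN by (apply pow_le; lra).
  assert (H2 : 0 < 2 ^ N) by (apply pow_lt; lra).
  apply Rmult_lt_reg_r with (2 ^ N)%R; auto. unfold Rdiv at 1. rewrite Rmult_assoc, Rinv_l, Rmult_1_r by lra.
  apply Rge_le in HN. apply Rmult_le_compat_r with (r := eps) in HN; [|lra].
  unfold Rdiv in HN. rewrite Rmult_assoc, Rinv_l, Rmult_1_r in HN by lra. lra.
Qed.

(** Bisection: some quarter always keeps a quarter of the integral. At the
    common point of these rectangles the function is affine up to a term that
    is small compared with the perimeter times the diameter, which contradicts
    the lower bound. *)
Lemma Goursat f a b c d : a <= b -> c <= d -> (forall z, in_box a b c d z -> exists l, cdv f z l) -> rect f a b c d = 0.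
Proof.
  intros Hab Hcd Hf. apply Classical_Prop.NNPP. intros HN.
  assert (HE : 0 < Cmod (rect f a b c d)) by now apply Cmod_gt_0.
  set (eps := (Cmod (rect f a b c d) / 2)%R). assert (Heps : 0 < eps) by (unfold eps; lra).
  assert (Hct : contB f a b c d). { intros z Hz. destruct (Hf z Hz) as [l Hl]. eapply cdv_continuous; eauto. }
  set (A := (b - a)%R). set (B := (d - c)%R).
  assert (HA : 0 <= A) by (unfold A; lra). assert (HB : 0 <= B) by (unfold B; lra).
  set (bad := fun (k : nat) (p : R * R) => a <= fst p /\ fst p + A / 2 ^ k <= b /\ c <= snd p /\ snd p + B / 2 ^ k <= d /\
     eps / 4 ^ k < Cmod (rect f (fst p) (fst p + A / 2 ^ k) (snd p) (snd p + B / 2 ^ k))).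
  assert (H2 : forall k, 0 < / 2 ^ k) by (intros; apply Rinv_0_lt_compat, pow_lt; lra).
  assert (Half : forall M k, (M / 2 ^ k = M / 2 ^ (S k) + M / 2 ^ (S k))%R).
  { intros M k. simpl. field. apply pow_nonzero. lra. }
  assert (Pos : forall M k, 0 <= M -> 0 <= M / 2 ^ k) by (intros; apply Rmult_le_pos; auto; left; auto).
  assert (Step : forall k p, bad k p -> exists q, bad (S k) q /\ fst p <= fst q <= fst p + A / 2 ^ (S k) /\ snd p <= snd q <= snd p + B / 2 ^ (S k)).
  { intros k [x y] (B1 & B2 & B3 & B4 & B5). cbn [fst snd] in *.
    generalize (Half A k) (Half B k) (Pos A (S k) HA) (Pos B (S k) HB). 
    set (h := (A / 2 ^ S k)%R) in *. set (v := (B / 2 ^ S k)%R) in *. intros Eh Ev Ph Pv.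
    rewrite Eh, Ev in *.
    assert (Hc' : contB f x (x + (h + h)) y (y + (v + v))) by (apply contB_sub with a b c d; auto; lra).
    assert (E : rect f x (x + (h + h)) y (y + (v + v)) =
       rect f x (x + h) y (y + v) + rect f x (x + h) (y + v) (y + v + v) +
       (rect f (x + h) (x + h + h) y (y + v) + rect f (x + h) (x + h + h) (y + v) (y + v + v))).
    { rewrite (rect_split_h f x (x + h) (x + (h + h)) y (y + (v + v))) by (auto; lra).
      rewrite (rect_split_v f x (x + h) y (y + v) (y + (v + v))), (rect_split_v f (x + h) (x + (h + h)) y (y + v) (y + (v + v)));
        [replace (x + (h + h))%R with (x + h + h)%R by ring; replace (y + (v + v))%R with (y + v + v)%R by ring; reflexivity|..];
      try lra; (apply contB_sub with x (x + (h + h))%R y (y + (v + v))%R; auto; lra). }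
    assert (E4 : (eps / 4 ^ k = 4 * (eps / 4 ^ (S k)))%R) by (simpl; field; apply pow_nonzero; lra).
    rewrite E, E4 in B5.
    destruct (Rlt_dec (eps / 4 ^ S k) (Cmod (rect f x (x + h) y (y + v)))) as [G1|G1].
    { exists (x, y). unfold bad; simpl fst; simpl snd. fold h v. repeat split; try lra; auto. }
    destruct (Rlt_dec (eps / 4 ^ S k) (Cmod (rect f x (x + h) (y + v) (y + v + v)))) as [G2|G2].
    { exists (x, y + v)%R. unfold bad; cbn [fst snd]. fold h v. repeat split; try lra; auto. }
    destruct (Rlt_dec (eps / 4 ^ S k) (Cmod (rect f (x + h) (x + h + h) y (y + v)))) as [G3|G3].
    { exists (x + h, y)%R. unfold bad; cbn [fst snd]. fold h v. repeat split; try lra; auto. }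
    destruct (Rlt_dec (eps / 4 ^ S k) (Cmod (rect f (x + h) (x + h + h) (y + v) (y + v + v)))) as [G4|G4].
    { exists (x + h, y + v)%R. unfold bad; cbn [fst snd]. fold h v. repeat split; try lra; auto. }
    exfalso. 
    generalize (Cmod_triangle (rect f x (x + h) y (y + v) + rect f x (x + h) (y + v) (y + v + v)) (rect f (x + h) (x + h + h) y (y + v) + rect f (x + h) (x + h + h) (y + v) (y + v + v))).
    generalize (Cmod_triangle (rect f x (x + h) y (y + v)) (rect f x (x + h) (y + v) (y + v + v))).
    generalize (Cmod_triangle (rect f (x + h) (x + h + h) y (y + v)) (rect f (x + h) (x + h + h) (y + v) (y + v + v))). lra. }
  set (next := fun k p => epsilon (inhabits (0, 0)) (fun q => bad (S k) q /\ fst p <= fst q <= fst p + A / 2 ^ (S k) /\ snd p <= snd q <= snd p + B / 2 ^ (S k))).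
  set (s := fix s (k : nat) : R * R := match k with O => (a, c) | S j => next j (s j) end).
  assert (Hs : forall k, bad k (s k)).
  { induction k.
    - unfold bad; cbn [fst snd s]. replace (a + A / 2 ^ 0)%R with b by (unfold A; simpl; field). replace (c + B / 2 ^ 0)%R with d by (unfold B; simpl; field).
      repeat split; try lra. unfold eps. simpl. lra.
    - simpl. unfold next. exact (proj1 (epsilon_spec (inhabits (0, 0)) _ (Step k (s k) IHk))). }
  assert (Hn : forall k, fst (s k) <= fst (s (S k)) <= fst (s k) + A / 2 ^ (S k) /\ snd (s k) <= snd (s (S k)) <= snd (s k) + B / 2 ^ (S k)).
  { intros k. exact (proj2 (epsilon_spec (inhabits (0, 0)) _ (Step k (s k) (Hs k)))). }
  destruct (nested_point (fun k => fst (s k)) (fun k => A / 2 ^ k)%R) as [X HX].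
  { intros; now apply Pos. } { intros k; apply Hn. } { intros k. generalize (Hn k) (Half A k). lra. }
  destruct (nested_point (fun k => snd (s k)) (fun k => B / 2 ^ k)%R) as [Y HY].
  { intros; now apply Pos. } { intros k; apply Hn. } { intros k. generalize (Hn k) (Half B k). lra. }
  assert (HZ : in_box a b c d (X, Y)).
  { generalize (HX O) (HY O). simpl. unfold in_box, A, B; simpl. lra. }
  destruct (Hf _ HZ) as [l Hl].
  set (L := (A + B + 1)%R). assert (HL : 0 < L) by (unfold L; lra).
  assert (HLL : 0 < 4 * (L * L)) by nra.
  destruct (Hl (eps / (4 * (L * L)))%R) as (dl & Hdl & K); [apply Rdiv_lt_0_compat; auto|].
  destruct (half_pow_lt L dl Hdl) as [k Hk].
  destruct (Hs k) as (B1 & B2 & B3 & B4 & B5).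
  generalize (HX k) (HY k) (Pos A k HA) (Pos B k HB); intros HXk HYk PA PB.
  set (x := fst (s k)) in *. set (y := snd (s k)) in *.
  assert (Hin : contB f x (x + A / 2 ^ k) y (y + B / 2 ^ k)) by (apply contB_sub with a b c d; auto; lra).
  set (g := fun z : C => f (X, Y) + l * (z - (X, Y))).
  assert (Hg : forall z, cdv (fun z => f (X, Y) * z + l / 2 * ((z - (X, Y)) * (z - (X, Y)))) z (g z) /\ cont g z).
  { intros z. split.
    - eapply cdv_eq. 
      + apply cdv_plus. { apply cdv_scal, cdv_id. } apply cdv_scal.
        apply cdv_mult; (apply cdv_minus; [apply cdv_id|apply cdv_const]).
      + unfold g. field.
    - apply cont_plus; [apply cont_const|]. apply cont_mult; [apply cont_const|].
      apply cont_minus; [apply cont_id|apply cont_const]. }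
  assert (Eg : rect g x (x + A / 2 ^ k) y (y + B / 2 ^ k) = 0).
  { eapply rect_primitive; [lra|lra|]. intros z _. apply Hg. }
  assert (Ef : rect f x (x + A / 2 ^ k) y (y + B / 2 ^ k) = rect (fun z => f z - g z) x (x + A / 2 ^ k) y (y + B / 2 ^ k)).
  { rewrite rect_minus; auto; try lra. - rewrite Eg. ring. - intros z _. apply Hg. }
  rewrite Ef in B5. apply Rlt_not_le in B5. apply B5.
  eapply Rle_trans.
  { apply rect_bound with (M := (eps / (4 * (L * L)) * (L / 2 ^ k))%R); try lra.
    - intros z Hz. apply cont_minus; [now apply Hin|apply Hg].
    - intros z [Hz1 Hz2].
      assert (Hd : Cmod (z - (X, Y)) <= L / 2 ^ k).
      { eapply Rle_trans; [apply Cmod_le_re_im|].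
        assert (Rabs (Re (z - (X, Y))) <= A / 2 ^ k) by (destruct z; unfold Re in *; simpl in *; apply Rabs_le; lra).
        assert (Rabs (Im (z - (X, Y))) <= B / 2 ^ k) by (destruct z; unfold Im in *; simpl in *; apply Rabs_le; lra).
        unfold L, Rdiv. rewrite !Rmult_plus_distr_r. generalize (H2 k). unfold Rdiv in *. lra. }
      specialize (K (z - (X, Y)) ltac:(lra)). replace ((X, Y) + (z - (X, Y))) with z in K by ring.
      unfold g. replace (f z - (f (X, Y) + l * (z - (X, Y)))) with (f z - f (X, Y) - l * (z - (X, Y))) by ring.
      eapply Rle_trans; [exact K|]. apply Rmult_le_compat_l; auto. left. apply Rdiv_lt_0_compat; auto. }
  replace (eps / 4 ^ k)%R with (2 * (L / 2 ^ k) * (eps / (2 * (L * L)) * (L / 2 ^ k)))%R.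
  2:{ replace 4%R with (2 * 2)%R at 1 by ring. rewrite Rpow_mult_distr. field. split; [apply pow_nonzero|]; lra. }
  replace (eps / (2 * (L * L)))%R with (2 * (eps / (4 * (L * L))))%R by (field; lra).
  assert (0 < eps / (4 * (L * L))) by (apply Rdiv_lt_0_compat; auto).
  assert (0 < L / 2 ^ k) by (apply Rmult_lt_0_compat; auto).
  assert (x + A / 2 ^ k - x + (y + B / 2 ^ k - y) <= L / 2 ^ k).
  { unfold L, Rdiv. rewrite !Rmult_plus_distr_r. generalize (H2 k). lra. }
  set (w := (L / 2 ^ k)%R) in *. set (e := (eps / (4 * (L * L)))%R) in *.
  assert (0 <= e * w) by nra.
  nra.
Qed.

(** * Continuous functions on a box *)

(** Compactness of a box, in the form: a property that holds at small scales
    near every point holds at one uniform scale. *)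
Lemma box_compact (a b c d : R) (P : C -> R -> Prop) :
  (forall z, in_box a b c d z -> exists r : R, 0 < r /\ P z r) ->
  exists e : R, 0 < e /\ forall z, in_box a b c d z -> exists w r, in_box a b c d w /\ P w r /\ e <= r /\ Cmod (z - w) < 2 * r.
Proof.
  intros H.
  set (dl := fun x y : R => match excluded_middle_informative (exists r : R, 0 < r /\ P (x, y) r) with
     | left h => let (r, hr) := constructive_indefinite_description _ h in mkposreal r (proj1 hr)
     | right _ => mkposreal 1 Rlt_0_1 end).
  destruct (compactness_value_2d a b c d dl) as [e He]. exists e. split; [apply cond_pos|].
  intros [x y] [Hx Hy]. simpl in Hx, Hy.
  apply Classical_Prop.NNPP. intros N. apply (He x y Hx Hy). intros (u & v & Hu & Hv & K1 & K2 & K3).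
  apply N. exists (u, v). unfold dl in K1, K2, K3.
  destruct (excluded_middle_informative (exists r : R, 0 < r /\ P (u, v) r)) as [h|h].
  - destruct (constructive_indefinite_description _ h) as [r [Hr1 Hr2]]. simpl in *.
    exists r. repeat split; simpl; try lra; auto.
    eapply Rle_lt_trans; [apply Cmod_le_re_im|]. unfold Re, Im; simpl. unfold Rminus in *. lra.
  - exfalso. apply h. apply H. split; simpl; auto.
Qed.

Lemma box_unif f a b c d : contB f a b c d -> forall eps : R, 0 < eps -> exists dl : R, 0 < dl /\
  forall z w, in_box a b c d z -> in_box a b c d w -> Cmod (z - w) < dl -> Cmod (f z - f w) < eps.
Proof.
  intros Hf eps He.
  destruct (box_compact a b c d (fun z r => forall w, Cmod (w - z) < 4 * r -> Cmod (f w - f z) < eps / 2)) as (e & He' & K).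
  - intros z Hz. specialize (Hf z Hz (eps / 2)%R ltac:(lra)). apply locally_CE in Hf. destruct Hf as (r & Hr & L).
    exists (r / 4)%R. split; [lra|]. intros w Hw. apply L. lra.
  - exists e. split; auto. intros z w Hz Hw Hzw. destruct (K z Hz) as (u & r & Hu & L & Hr & Hzu).
    replace (f z - f w) with ((f z - f u) - (f w - f u)) by ring.
    eapply Rle_lt_trans; [apply Cmod_minus_le|].
    assert (Cmod (f z - f u) < eps / 2) by (apply L; lra).
    assert (Cmod (f w - f u) < eps / 2).
    { apply L. replace (w - u) with ((z - u) - (z - w)) by ring. eapply Rle_lt_trans; [apply Cmod_minus_le|]. lra. }
    lra.
Qed.

Lemma box_bounded f a b c d : contB f a b c d -> exists M : R, 0 < M /\ forall z, in_box a b c d z -> Cmod (f z) <= M.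
Proof.
  intros Hf.
  destruct (box_compact a b c d (fun z r => forall w, Cmod (w - z) < 2 * r -> Cmod (f w) <= / r)) as (e & He' & K).
  - intros z Hz. specialize (Hf z Hz 1%R Rlt_0_1). apply locally_CE in Hf. destruct Hf as (r & Hr & L).
    assert (H1 : 0 < 1 + Cmod (f z)) by (generalize (Cmod_ge_0 (f z)); lra).
    exists (Rmin (r / 2) (/ (1 + Cmod (f z)))). assert (Hm : 0 < Rmin (r / 2) (/ (1 + Cmod (f z)))).
    { apply Rmin_glb_lt; [lra|]. now apply Rinv_0_lt_compat. }
    split; auto. intros w Hw.
    assert (Cmod (f w) <= 1 + Cmod (f z)).
    { replace (f w) with ((f w - f z) + f z) by ring. eapply Rle_trans; [apply Cmod_triangle|].
      generalize (Rmin_l (r / 2) (/ (1 + Cmod (f z)))). intros.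
      specialize (L w ltac:(lra)). lra. }
    eapply Rle_trans; [exact H|].
    generalize (Rinv_le_contravar _ _ Hm (Rmin_r (r / 2) (/ (1 + Cmod (f z))))). now rewrite Rinv_inv.
  - exists (/ e)%R. split; [now apply Rinv_0_lt_compat|]. intros z Hz.
    destruct (K z Hz) as (w & r & Hw & L & Hr & Hzw). eapply Rle_trans; [now apply L|].
    now apply Rinv_le_contravar.
Qed.

Lemma rcont_bounded (f : R -> C) a b : rcont_on f a b -> exists M : R, 0 < M /\ forall t, a <= t <= b -> Cmod (f t) <= M.
Proof.
  intros H. destruct (bounded_continuity (K := R_AbsRing) (V := C_R_NormedModule) f a b) as [M HM].
  - intros x Hx. exact (proj1 (rcont_continuous _ _) (H x Hx)).
  - exists (Rabs M + 1)%R. split; [generalize (Rabs_pos M); lra|]. intros t Ht. specialize (HM t Ht). rewrite norm_CR in HM.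
    generalize (Rle_abs M). lra.
Qed.

Lemma rect_point f a c d : rect f a a c d = 0.
Proof. unfold rect. rewrite !(RInt_point (V := C_R_CompleteNormedModule)).
  change (0 - 0 + Ci * (CI (fun y => f (a, y)) c d - CI (fun y => f (a, y)) c d) = 0). ring. Qed.

(** The integral depends continuously on the vertical sides. Removing a thin
    strip around an exceptional line on which [f] is only continuous therefore
    changes nothing in the limit. *)
Lemma rect_line f a b c d e : a <= b -> c <= d -> contB f a b c d ->
  (forall a' b', a <= a' -> a' <= b' -> b' <= b -> (e < a' \/ b' < e) -> rect f a' b' c d = 0) -> rect f a b c d = 0.
Proof.
  intros Hab Hcd Hf Hz.
  destruct (Rlt_dec e a) as [H1|H1]; [apply Hz; lra|].
  destruct (Rlt_dec b e) as [H2|H2]; [apply Hz; lra|].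
  apply Classical_Prop.NNPP. intros HN. assert (HP : 0 < Cmod (rect f a b c d)) by now apply Cmod_gt_0.
  set (E := Cmod (rect f a b c d)) in *.
  destruct (box_bounded f a b c d Hf) as (M & HM & HMb).
  destruct (box_unif f a b c d Hf (E / (4 * (d - c + 1)))) as (dl & Hdl & Hu); [apply Rdiv_lt_0_compat; lra|].
  set (h := Rmin (dl / 4) (E / (16 * M))).
  assert (Hh : 0 < h) by (apply Rmin_glb_lt; [lra|apply Rdiv_lt_0_compat; lra]).
  assert (Hh1 : h <= dl / 4) by apply Rmin_l.
  assert (Hh2 : h * M <= E / 16).
  { assert (h <= E / (16 * M)) by apply Rmin_r. apply Rmult_le_compat_r with (r := M) in H; [|lra].
    replace (E / (16 * M) * M)%R with (E / 16)%R in H by (field; lra). exact H. }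
  set (p := Rmax a (e - h)). set (q := Rmin b (e + h)).
  assert (Hp : a <= p /\ e - h <= p /\ p <= e /\ (p = a \/ p < e)).
  { unfold p. repeat split; [apply Rmax_l|apply Rmax_r|apply Rmax_lub; lra|].
    destruct (Rle_dec a (e - h)); [right; rewrite Rmax_right by lra; lra|left; apply Rmax_left; lra]. }
  assert (Hq : q <= b /\ q <= e + h /\ e <= q /\ (q = b \/ e < q)).
  { unfold q. repeat split; [apply Rmin_l|apply Rmin_r|apply Rmin_glb; lra|].
    destruct (Rle_dec (e + h) b); [right; rewrite Rmin_right by lra; lra|left; apply Rmin_left; lra]. }
  assert (E1 : rect f a p c d = 0).
  { destruct Hp as (? & ? & ? & [->|?]); [apply rect_point|apply Hz; lra]. }
  assert (E2 : rect f q b c d = 0).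
  { destruct Hq as (? & ? & ? & [->|?]); [apply rect_point|apply Hz; lra]. }
  assert (E3 : rect f a b c d = rect f p q c d).
  { rewrite (rect_split_h f a p b) by (auto; lra). rewrite (rect_split_h f p q b); [|lra|lra|apply contB_sub with a b c d; auto; lra].
    rewrite E1, E2. ring. }
  assert (Hpq : contB f p q c d) by (apply contB_sub with a b c d; auto; lra).
  assert (Hb : Cmod (rect f p q c d) <= (q - p) * M + (q - p) * M + (d - c) * (E / (4 * (d - c + 1)))).
  { unfold rect. eapply Rle_trans; [apply Cmod_triangle|]. rewrite Cmod_mult, Cmod_Ci, Rmult_1_l.
    apply Rplus_le_compat.
    - eapply Rle_trans; [apply Cmod_minus_le|]. apply Rplus_le_compat.
      + apply (isCI_bound (fun x => f (x, c)) p q); [lra|intros t Ht; apply HMb; split; simpl; lra|apply isCI_h with c d; auto; lra].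
      + apply (isCI_bound (fun x => f (x, d)) p q); [lra|intros t Ht; apply HMb; split; simpl; lra|apply isCI_h with c d; auto; lra].
    - eapply isCI_bound; [exact Hcd| |apply isCI_minus; apply isCI_v with a b; auto; lra].
      intros t Ht. left. apply Hu; [split; simpl; lra|split; simpl; lra|].
      replace ((q, t) - (p, t)) with (RtoC (q - p)).
      + rewrite Cmod_R, Rabs_pos_eq; lra.
      + unfold RtoC, Cminus, Cplus, Copp; simpl. f_equal; ring. }
  rewrite <- E3 in Hb. fold E in Hb.
  assert ((d - c) * (E / (4 * (d - c + 1))) <= E / 4).
  { replace (E / 4)%R with ((d - c + 1) * (E / (4 * (d - c + 1))))%R by (field; lra).
    apply Rmult_le_compat_r; [left; apply Rdiv_lt_0_compat; lra|lra]. }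
  assert ((q - p) * M <= 2 * (h * M)) by nra. lra.
Qed.

(** Two exceptional lines are needed: one through the point at which Cauchy's
    formula is evaluated, one through a possible isolated singularity. *)
Lemma Goursat_two_lines f a b c d e1 e2 : a <= b -> c <= d -> contB f a b c d ->
  (forall z, in_box a b c d z -> Re z <> e1 -> Re z <> e2 -> exists l, cdv f z l) -> rect f a b c d = 0.
Proof.
  intros Hab Hcd Hf H. apply rect_line with e1; auto.
  intros a' b' H1 H2 H3 H4. assert (Hf' : contB f a' b' c d) by (apply contB_sub with a b c d; auto; lra).
  apply rect_line with e2; auto.
  intros a'' b'' K1 K2 K3 K4. apply Goursat; auto.
  intros z [Z1 Z2]. apply H; [split; lra|lra|lra].
Qed.

(** * Cauchy's formula on a rectangle *)

Definition on_bd (a b c d : R) (z : C) : Prop := in_box a b c d z /\ (Re z = a \/ Re z = b \/ Im z = c \/ Im z = d).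
Definition inside (a b c d : R) (z : C) : Prop := a < Re z < b /\ c < Im z < d.

Definition contD (f : C -> C) a b c d : Prop := forall z, on_bd a b c d z -> cont f z.

Definition is_rect (f : C -> C) a b c d (l : C) : Prop :=
  exists l1 l2 l3 l4, isCI (fun x => f (x, c)) a b l1 /\ isCI (fun x => f (x, d)) a b l2 /\
   isCI (fun y => f (b, y)) c d l3 /\ isCI (fun y => f (a, y)) c d l4 /\ l = l1 - l2 + Ci * (l3 - l4).

Lemma is_rect_rect f a b c d l : is_rect f a b c d l -> rect f a b c d = l.
Proof. intros (l1 & l2 & l3 & l4 & H1 & H2 & H3 & H4 & ->). unfold rect.
  now rewrite (isCI_CI _ _ _ _ H1), (isCI_CI _ _ _ _ H2), (isCI_CI _ _ _ _ H3), (isCI_CI _ _ _ _ H4). Qed.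

Lemma rect_is_rect f a b c d : a <= b -> c <= d -> contD f a b c d -> is_rect f a b c d (rect f a b c d).
Proof.
  intros Hab Hcd H.
  assert (forall y, y = c \/ y = d -> isCI (fun x => f (x, y)) a b (CI (fun x => f (x, y)) a b)).
  { intros y Hy. apply CI_isCI, exCI; auto. intros t Ht. apply rcont_comp; [|apply rcont_h].
    apply H. split; [split; simpl; lra|simpl; tauto]. }
  assert (forall x, x = a \/ x = b -> isCI (fun y => f (x, y)) c d (CI (fun y => f (x, y)) c d)).
  { intros x Hx. apply CI_isCI, exCI; auto. intros t Ht. apply rcont_comp; [|apply rcont_v].
    apply H. split; [split; simpl; lra|simpl; tauto]. }
  unfold rect. do 4 eexists. repeat split; eauto.
Qed.

Lemma is_rect_ext f g a b c d l : a <= b -> c <= d -> (forall z, on_bd a b c d z -> f z = g z) -> is_rect f a b c d l -> is_rect g a b c d l.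
Proof.
  intros Hab Hcd E (l1 & l2 & l3 & l4 & H1 & H2 & H3 & H4 & ->). exists l1, l2, l3, l4.
  repeat split; auto.
  - revert H1; apply isCI_ext; auto. intros t Ht; apply E; split; [split; simpl; lra|simpl; tauto].
  - revert H2; apply isCI_ext; auto. intros t Ht; apply E; split; [split; simpl; lra|simpl; tauto].
  - revert H3; apply isCI_ext; auto. intros t Ht; apply E; split; [split; simpl; lra|simpl; tauto].
  - revert H4; apply isCI_ext; auto. intros t Ht; apply E; split; [split; simpl; lra|simpl; tauto].
Qed.

Lemma is_rect_lin f g k a b c d l m : is_rect f a b c d l -> is_rect g a b c d m -> is_rect (fun z => f z - k * g z) a b c d (l - k * m).
Proof.
  intros (l1 & l2 & l3 & l4 & H1 & H2 & H3 & H4 & ->) (m1 & m2 & m3 & m4 & K1 & K2 & K3 & K4 & ->).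
  exists (l1 - k * m1), (l2 - k * m2), (l3 - k * m3), (l4 - k * m4).
  repeat split; try (apply isCI_minus; [assumption|now apply isCI_scal]). ring.
Qed.

Lemma is_rect_bound f a b c d l (M : R) : a <= b -> c <= d -> (forall z, on_bd a b c d z -> Cmod (f z) <= M) -> is_rect f a b c d l ->
  Cmod l <= 2 * ((b - a) + (d - c)) * M.
Proof.
  intros Hab Hcd E (l1 & l2 & l3 & l4 & H1 & H2 & H3 & H4 & ->).
  eapply Rle_trans; [apply Cmod_triangle|]. rewrite Cmod_mult, Cmod_Ci, Rmult_1_l.
  generalize (Cmod_minus_le l1 l2) (Cmod_minus_le l3 l4).
  generalize (isCI_bound (fun x => f (x, c)) _ _ _ M Hab ltac:(intros t Ht; apply E; split; [split; simpl; lra|simpl; tauto]) H1).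
  generalize (isCI_bound (fun x => f (x, d)) _ _ _ M Hab ltac:(intros t Ht; apply E; split; [split; simpl; lra|simpl; tauto]) H2).
  generalize (isCI_bound (fun y => f (b, y)) _ _ _ M Hcd ltac:(intros t Ht; apply E; split; [split; simpl; lra|simpl; tauto]) H3).
  generalize (isCI_bound (fun y => f (a, y)) _ _ _ M Hcd ltac:(intros t Ht; apply E; split; [split; simpl; lra|simpl; tauto]) H4).
  lra.
Qed.

(** Differentiation under the integral sign, from a remainder that is quadratic
    in the increment uniformly in the variable of integration. *)
Lemma CI_param (k : R -> C -> C) (k' : R -> C) a b z (r M : R) : a <= b -> 0 < r -> 0 <= M ->
  (forall w, Cmod (w - z) < r -> rcont_on (fun t => k t w) a b) -> rcont_on k' a b ->
  (forall t h, a <= t <= b -> Cmod h < r -> Cmod (k t (z + h) - k t z - k' t * h) <= M * (Cmod h * Cmod h)) ->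
  cdv (fun w => CI (fun t => k t w) a b) z (CI k' a b).
Proof.
  intros Hab Hr HM Hk Hk' HE eps He.
  set (N := ((b - a) * M + 1)%R). assert (HN : 0 < N) by (unfold N; nra).
  exists (Rmin r (eps / N)). split; [apply Rmin_glb_lt; auto; now apply Rdiv_lt_0_compat|].
  intros h Hh. generalize (Rmin_l r (eps / N)) (Rmin_r r (eps / N)); intros.
  assert (Hz : Cmod (z - z) < r) by (replace (z - z) with (RtoC 0) by ring; now rewrite Cmod_0).
  assert (Hzh : Cmod (z + h - z) < r) by (replace (z + h - z) with h by ring; lra).
  assert (Hi : isCI (fun t => k t (z + h) - k t z - h * k' t) a b (CI (fun t => k t (z + h)) a b - CI (fun t => k t z) a b - h * CI k' a b)).
  { apply isCI_minus; [apply isCI_minus|apply isCI_scal]; apply CI_isCI, exCI; auto. }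
  rewrite (Cmult_comm _ h).
  eapply Rle_trans. { eapply isCI_bound; [exact Hab| |exact Hi]. intros t Ht. cbv beta. rewrite (Cmult_comm h). apply HE; auto. lra. }
  generalize (Cmod_ge_0 h); intros.
  replace ((b - a) * (M * (Cmod h * Cmod h)))%R with (((b - a) * M * Cmod h) * Cmod h)%R by ring.
  apply Rmult_le_compat_r; auto.
  assert (Cmod h * N <= eps).
  { apply Rle_trans with (eps / N * N)%R; [apply Rmult_le_compat_r; lra|]. unfold Rdiv. rewrite Rmult_assoc, Rinv_l; lra. }
  unfold N in H2. nra.
Qed.

Lemma rect_param (k : C -> C -> C) (k' : C -> C) a b c d z (r M : R) : a <= b -> c <= d -> 0 < r -> 0 <= M ->
  (forall w, Cmod (w - z) < r -> contD (fun t => k t w) a b c d) -> contD k' a b c d ->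
  (forall t h, on_bd a b c d t -> Cmod h < r -> Cmod (k t (z + h) - k t z - k' t * h) <= M * (Cmod h * Cmod h)) ->
  cdv (fun w => rect (fun t => k t w) a b c d) z (rect k' a b c d).
Proof.
  intros Hab Hcd Hr HM Hk Hk' HE. unfold rect.
  assert (Hh : forall y, y = c \/ y = d -> cdv (fun w => CI (fun x => k (x, y) w) a b) z (CI (fun x => k' (x, y)) a b)).
  { intros y Hy. apply CI_param with r M; auto.
    - intros w Hw t Ht. apply (rcont_comp (fun t => k t w)); [|apply rcont_h]. apply (Hk w Hw). split; [split; simpl; lra|simpl; tauto].
    - intros t Ht. apply (rcont_comp k'); [|apply rcont_h]. apply Hk'. split; [split; simpl; lra|simpl; tauto].
    - intros t h Ht. apply HE. split; [split; simpl; lra|simpl; tauto]. }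
  assert (Hv : forall x, x = a \/ x = b -> cdv (fun w => CI (fun y => k (x, y) w) c d) z (CI (fun y => k' (x, y)) c d)).
  { intros y Hy. apply CI_param with r M; auto.
    - intros w Hw t Ht. apply (rcont_comp (fun t => k t w)); [|apply rcont_v]. apply (Hk w Hw). split; [split; simpl; lra|simpl; tauto].
    - intros t Ht. apply (rcont_comp k'); [|apply rcont_v]. apply Hk'. split; [split; simpl; lra|simpl; tauto].
    - intros t h Ht. apply HE. split; [split; simpl; lra|simpl; tauto]. }
  apply cdv_plus; [apply cdv_minus|apply cdv_scal, cdv_minus]; auto.
Qed.

(** The Cauchy integral of [f] over the boundary, without the factor 1 / (2 pi
    i); [Cau2] and [Cau3] are its first two derivatives. *)
Definition Cau1 (f : C -> C) a b c d (z : C) : C := rect (fun t => f t * / (t - z)) a b c d.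
Definition Cau2 (f : C -> C) a b c d (z : C) : C := rect (fun t => f t * / ((t - z) * (t - z))) a b c d.
Definition Cau3 (f : C -> C) a b c d (z : C) : C := rect (fun t => f t * (2 * / ((t - z) * (t - z) * (t - z)))) a b c d.

Lemma inside_dist a b c d z : inside a b c d z -> exists r : R, 0 < r /\ forall t, on_bd a b c d t -> r <= Cmod (t - z).
Proof.
  intros [[H1 H2] [H3 H4]].
  exists (Rmin (Rmin (Re z - a) (b - Re z)) (Rmin (Im z - c) (d - Im z))). split.
  { repeat apply Rmin_glb_lt; lra. }
  set (u := Rmin (Re z - a) (b - Re z)). set (v := Rmin (Im z - c) (d - Im z)).
  generalize (Rmin_l u v) (Rmin_r u v) (Rmin_l (Re z - a) (b - Re z)) (Rmin_r (Re z - a) (b - Re z)) (Rmin_l (Im z - c) (d - Im z)) (Rmin_r (Im z - c) (d - Im z)).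
  fold u v. intros ? ? ? ? ? ? t Ht.
  generalize (re_le_Cmod (t - z)) (im_le_Cmod (t - z)). 
  replace (Re (t - z)) with (Re t - Re z)%R by (destruct t, z; reflexivity).
  replace (Im (t - z)) with (Im t - Im z)%R by (destruct t, z; reflexivity).
  generalize (Rle_abs (Re t - Re z)) (Rle_abs (-(Re t - Re z))) (Rle_abs (Im t - Im z)) (Rle_abs (-(Im t - Im z))).
  rewrite !Rabs_Ropp. destruct Ht as [_ [K|[K|[K|K]]]]; lra.
Qed.

Lemma contD_bounded f a b c d : a <= b -> c <= d -> contD f a b c d -> exists M : R, 0 < M /\ forall z, on_bd a b c d z -> Cmod (f z) <= M.
Proof.
  intros Hab Hcd H.
  assert (Hh : forall y, y = c \/ y = d -> exists M : R, 0 < M /\ forall x, a <= x <= b -> Cmod (f (x, y)) <= M).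
  { intros y Hy. apply (rcont_bounded (fun x => f (x, y))). intros t Ht. apply rcont_comp; [|apply rcont_h]. apply H. split; [split; simpl; lra|simpl; tauto]. }
  assert (Hv : forall x, x = a \/ x = b -> exists M : R, 0 < M /\ forall y, c <= y <= d -> Cmod (f (x, y)) <= M).
  { intros y Hy. apply (rcont_bounded (fun x => f (y, x))). intros t Ht. apply rcont_comp; [|apply rcont_v]. apply H. split; [split; simpl; lra|simpl; tauto]. }
  destruct (Hh c ltac:(auto)) as (M1 & P1 & K1). destruct (Hh d ltac:(auto)) as (M2 & P2 & K2).
  destruct (Hv a ltac:(auto)) as (M3 & P3 & K3). destruct (Hv b ltac:(auto)) as (M4 & P4 & K4).
  exists (M1 + M2 + M3 + M4)%R. split; [lra|]. intros [x y] [[Hx Hy] Hb]. simpl in *.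
  destruct Hb as [K|[K|[K|K]]]; subst.
  - generalize (K3 y Hy); lra. - generalize (K4 y Hy); lra. - generalize (K1 x Hx); lra. - generalize (K2 x Hx); lra.
Qed.

Lemma contD_kernel f a b c d w : contD f a b c d -> (forall t, on_bd a b c d t -> t - w <> 0) ->
  contD (fun t => f t * / (t - w)) a b c d /\ contD (fun t => f t * / ((t - w) * (t - w))) a b c d /\
  contD (fun t => f t * (2 * / ((t - w) * (t - w) * (t - w)))) a b c d.
Proof.
  intros Hf Hn. repeat split; intros t Ht; (apply cont_mult; [now apply Hf|]).
  - apply (cont_inv (fun t => t - w)); [now apply Hn|]. apply cont_minus; [apply cont_id|apply cont_const].
  - apply (cont_inv (fun t => (t - w) * (t - w))); [apply Cmult_neq_0; now apply Hn|].
    apply cont_mult; (apply cont_minus; [apply cont_id|apply cont_const]).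
  - apply cont_mult; [apply cont_const|].
    apply (cont_inv (fun t => (t - w) * (t - w) * (t - w))); [repeat apply Cmult_neq_0; now apply Hn|].
    repeat apply cont_mult; (apply cont_minus; [apply cont_id|apply cont_const]).
Qed.

Lemma far_nonzero (u h : C) (r : R) : 0 < r -> r <= Cmod u -> Cmod h < r / 2 -> u <> 0 /\ u - h <> 0 /\ r / 2 <= Cmod (u - h).
Proof. intros Hr Hu Hh. generalize (Cmod_ge_sub u h). intros. repeat split; try lra; apply Cmod_gt_0; lra. Qed.

Lemma Cmod_inv_le (u : C) (r : R) : 0 < r -> r <= Cmod u -> Cmod (/ u) <= / r.
Proof. intros Hr Hu. rewrite Cmod_inv by (apply Cmod_gt_0; lra). now apply Rinv_le_contravar. Qed.

Lemma Cau1_cdv f a b c d z : a <= b -> c <= d -> contD f a b c d -> inside a b c d z -> cdv (Cau1 f a b c d) z (Cau2 f a b c d z).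
Proof.
  intros Hab Hcd Hf Hz. destruct (inside_dist _ _ _ _ _ Hz) as (r & Hr & Hd).
  destruct (contD_bounded f a b c d Hab Hcd Hf) as (M & HM & HMb).
  apply rect_param with (r / 2)%R (M * (/ r * (/ r * / (r / 2))))%R; auto; [lra| | | |].
  - repeat apply Rmult_le_pos; try lra; left; apply Rinv_0_lt_compat; lra.
  - intros w Hw. apply contD_kernel; auto. intros t Ht.
    replace (t - w) with ((t - z) - (w - z)) by ring. apply (far_nonzero _ _ r); auto.
  - apply contD_kernel; auto. intros t Ht. replace (t - z) with ((t - z) - 0) by ring. apply (far_nonzero _ _ r); auto. rewrite Cmod_0; lra.
  - intros t h Ht Hh. destruct (far_nonzero (t - z) h r Hr (Hd t Ht) Hh) as (N1 & N2 & N3).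
    replace (t - (z + h)) with (t - z - h) by ring. set (u := t - z) in *.
    replace (f t * / (u - h) - f t * / u - f t * / (u * u) * h) with (f t * (/ u * (/ u * / (u - h))) * (h * h)) by (field; auto).
    rewrite (Cmod_mult _ (h * h)), (Cmod_mult h h). apply Rmult_le_compat_r; [apply Rmult_le_pos; apply Cmod_ge_0|].
    rewrite !Cmod_mult. repeat (apply Rmult_le_compat; try (repeat apply Rmult_le_pos; apply Cmod_ge_0)); auto;
     apply Cmod_inv_le; auto; try lra; now apply Hd.
Qed.

Lemma Cau2_cdv f a b c d z : a <= b -> c <= d -> contD f a b c d -> inside a b c d z -> cdv (Cau2 f a b c d) z (Cau3 f a b c d z).
Proof.
  intros Hab Hcd Hf Hz. destruct (inside_dist _ _ _ _ _ Hz) as (r & Hr & Hd).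
  destruct (contD_bounded f a b c d Hab Hcd Hf) as (M & HM & HMb).
  assert (P : 0 < / r) by (now apply Rinv_0_lt_compat). assert (P2 : 0 < / (r / 2)) by (apply Rinv_0_lt_compat; lra).
  apply rect_param with (r / 2)%R (M * (2 * (/ r * / r * (/ (r / 2) * / (r / 2))) + (/ r * (/ r * / r) * / (r/2) * 2)))%R; auto; [lra| | | |].
  - apply Rmult_le_pos; [lra|]. apply Rplus_le_le_0_compat; repeat apply Rmult_le_pos; lra.
  - intros w Hw. apply contD_kernel; auto. intros t Ht.
    replace (t - w) with ((t - z) - (w - z)) by ring. apply (far_nonzero _ _ r); auto.
  - apply contD_kernel; auto. intros t Ht. replace (t - z) with ((t - z) - 0) by ring. apply (far_nonzero _ _ r); auto. rewrite Cmod_0; lra.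
  - intros t h Ht Hh. destruct (far_nonzero (t - z) h r Hr (Hd t Ht) Hh) as (N1 & N2 & N3).
    replace (t - (z + h)) with (t - z - h) by ring. set (u := t - z) in *.
    (* 1/(u-h)^2 - 1/u^2 - 2h/u^3 = h^2 (3u-2h)/(u^3 (u-h)^2) = h^2 (1/(u^2(u-h)^2) + 2/(u^3 (u-h))) *)
    replace (f t * / ((u - h) * (u - h)) - f t * / (u * u) - f t * (2 * / (u * u * u)) * h) with
      (f t * (/ u * / u * (/ (u - h) * / (u - h)) + / u * (/ u * / u) * / (u - h) * 2) * (h * h)) by (field; auto).
    rewrite (Cmod_mult _ (h * h)), (Cmod_mult h h). apply Rmult_le_compat_r; [apply Rmult_le_pos; apply Cmod_ge_0|].
    rewrite Cmod_mult. apply Rmult_le_compat; try apply Cmod_ge_0; auto.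
    assert (G : Cmod (/ u) <= / r) by (apply Cmod_inv_le; auto; now apply Hd).
    assert (G' : Cmod (/ (u - h)) <= / (r / 2)) by (apply Cmod_inv_le; auto; lra).
    assert (C2 : Cmod 2 = 2%R) by (rewrite Cmod_R; apply Rabs_pos_eq; lra).
    eapply Rle_trans; [apply Cmod_triangle|]. rewrite !Cmod_mult, C2. apply Rplus_le_compat.
    + eapply Rle_trans; [|apply Rmult_le_compat_r with (r := (/ r * / r * (/ (r / 2) * / (r / 2)))%R) (r1 := 1%R); [|lra]].
      * rewrite Rmult_1_l. repeat (apply Rmult_le_compat; try (repeat apply Rmult_le_pos; apply Cmod_ge_0)); auto.
      * repeat apply Rmult_le_pos; lra.
    + apply Rmult_le_compat_r; [lra|]. repeat (apply Rmult_le_compat; try (repeat apply Rmult_le_pos; apply Cmod_ge_0)); auto.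
Qed.

Definition wind a b c d (z : C) : C := Cau1 (fun _ => 1) a b c d z.

Lemma on_bd_far a b c d z t : inside a b c d z -> on_bd a b c d t -> t - z <> 0.
Proof. intros Hz Ht. destruct (inside_dist _ _ _ _ _ Hz) as (r & Hr & Hd). specialize (Hd t Ht). apply Cmod_gt_0. lra. Qed.

Lemma Im_inv (x y : R) : Im (1 * / (x, y)) = (- y / (x ^ 2 + y ^ 2))%R.
Proof. unfold Cinv, Cmult, Im; simpl. unfold Rdiv. ring. Qed.
Lemma Re_inv (x y : R) : Re (1 * / (x, y)) = (x / (x ^ 2 + y ^ 2))%R.
Proof. unfold Cinv, Cmult, Re; simpl. unfold Rdiv. ring. Qed.

(** In quotient form, Cauchy's formula rests on the invertibility of the
    winding integral. On a square each side contributes a positive imaginary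
    part, bounded below because |t - z|^2 <= 2 s^2. *)
Lemma wind_ge (a c s : R) z : 0 < s -> inside a (a + s) c (c + s) z -> 1 <= Im (wind a (a + s) c (c + s) z).
Proof.
  intros Hs Hz. unfold wind, Cau1.
  assert (Hc : contD (fun t => 1 * / (t - z)) a (a + s) c (c + s)).
  { apply contD_kernel; [intros t _; apply cont_const|]. intros t Ht. now apply (on_bd_far a (a + s) c (c + s)). }
  destruct (rect_is_rect _ a (a + s) c (c + s) ltac:(lra) ltac:(lra) Hc) as (l1 & l2 & l3 & l4 & H1 & H2 & H3 & H4 & ->).
  destruct Hz as [[Z1 Z2] [Z3 Z4]]. destruct z as [p q]. unfold Re in Z1, Z2. unfold Im in Z3, Z4. cbn [fst snd] in Z1, Z2, Z3, Z4.
  assert (HD : 0 < 2 * s ^ 2) by nra.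
  assert (Key : forall v N : R, 0 < v -> 0 < N -> N <= 2 * s ^ 2 -> v / (2 * s ^ 2) <= v / N).
  { intros v N Hv HN HN2. apply Rmult_le_compat_l; [lra|]. now apply Rinv_le_contravar. }
  assert (SP : forall u v : R, (u <> 0 \/ v <> 0)%R -> 0 < u ^ 2 + v ^ 2).
  { intros u v [N|N]; generalize (pow2_gt_0 _ N) (pow2_ge_0 u) (pow2_ge_0 v); lra. }
  assert (SL : forall u v : R, - s <= u <= s /\ - s <= v <= s -> u ^ 2 + v ^ 2 <= 2 * s ^ 2).
  { intros u v [Hu Hv]. assert (u ^ 2 <= s ^ 2) by nra. assert (v ^ 2 <= s ^ 2) by nra. lra. }
  assert (LB : forall (g : R -> R) (u w m l : R), u <= w -> is_RInt g u w l -> (forall x, u < x < w -> m <= g x) -> (w - u) * m <= l).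
  { intros g u w m l Huw Hg Hm. apply (is_RInt_le (fun _ => m) g u w); auto. apply (is_RInt_const (V := R_NormedModule)). }
  apply isCI_pair in H1 as [_ H1]. apply isCI_pair in H2 as [_ H2]. apply isCI_pair in H3 as [H3 _]. apply isCI_pair in H4 as [H4 _].
  assert (L1 : (a + s - a) * ((q - c) / (2 * s ^ 2)) <= Im l1).
  { apply (LB _ a (a + s)%R _ _ ltac:(lra) H1). intros x Hx. change ((x, c) - (p, q)) with ((x - p)%R, (c - q)%R). rewrite Im_inv.
    replace (- (c - q))%R with (q - c)%R by ring. apply Key; [lra|apply SP; first [left; lra|right; lra]|apply SL; lra]. }
  assert (L2 : (a + s - a) * ((c + s - q) / (2 * s ^ 2)) <= - Im l2).
  { apply (LB _ a (a + s)%R _ _ ltac:(lra) (is_RInt_opp (V := R_NormedModule) _ _ _ _ H2)). intros x Hx. change ((x, (c + s)%R) - (p, q)) with ((x - p)%R, (c + s - q)%R). rewrite Im_inv.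
    change (opp (- (c + s - q) / ((x - p) ^ 2 + (c + s - q) ^ 2))%R) with (- (- (c + s - q) / ((x - p) ^ 2 + (c + s - q) ^ 2)))%R.
    replace (- (- (c + s - q) / ((x - p) ^ 2 + (c + s - q) ^ 2)))%R with ((c + s - q) / ((x - p) ^ 2 + (c + s - q) ^ 2))%R by (unfold Rdiv; ring).
    apply Key; [lra|apply SP; first [left; lra|right; lra]|apply SL; lra]. }
  assert (L3 : (c + s - c) * ((a + s - p) / (2 * s ^ 2)) <= Re l3).
  { apply (LB _ c (c + s)%R _ _ ltac:(lra) H3). intros x Hx. change (((a + s)%R, x) - (p, q)) with ((a + s - p)%R, (x - q)%R). rewrite Re_inv.
    apply Key; [lra|apply SP; first [left; lra|right; lra]|apply SL; lra]. }
  assert (L4 : (c + s - c) * ((p - a) / (2 * s ^ 2)) <= - Re l4).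
  { apply (LB _ c (c + s)%R _ _ ltac:(lra) (is_RInt_opp (V := R_NormedModule) _ _ _ _ H4)). intros x Hx. change ((a, x) - (p, q)) with ((a - p)%R, (x - q)%R). rewrite Re_inv.
    change (opp ((a - p) / ((a - p) ^ 2 + (x - q) ^ 2))%R) with (- ((a - p) / ((a - p) ^ 2 + (x - q) ^ 2)))%R.
    replace (- ((a - p) / ((a - p) ^ 2 + (x - q) ^ 2)))%R with ((p - a) / ((a - p) ^ 2 + (x - q) ^ 2))%R by (unfold Rdiv; ring).
    apply Key; [lra|apply SP; first [left; lra|right; lra]|apply SL; lra]. }
  replace (Im (l1 - l2 + Ci * (l3 - l4))) with (Im l1 + - Im l2 + (Re l3 + - Re l4))%R by (destruct l1, l2, l3, l4; simpl; ring).
  replace 1%R with ((a + s - a) * ((q - c) / (2 * s ^ 2)) + (a + s - a) * ((c + s - q) / (2 * s ^ 2)) + ((c + s - c) * ((a + s - p) / (2 * s ^ 2)) + (c + s - c) * ((p - a) / (2 * s ^ 2))))%R by (field; lra).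
  lra.
Qed.

Lemma wind_nonzero a c s z : 0 < s -> inside a (a + s) c (c + s) z -> wind a (a + s) c (c + s) z <> 0 /\ 1 <= Cmod (wind a (a + s) c (c + s) z).
Proof. intros Hs Hz. generalize (wind_ge a c s z Hs Hz) (im_le_Cmod (wind a (a + s) c (c + s) z)) (Rle_abs (Im (wind a (a + s) c (c + s) z))).
  intros. split; [apply Cmod_gt_0|]; lra. Qed.

Lemma inside_near a b c d z : inside a b c d z -> nearC z (inside a b c d).
Proof.
  intros [[H1 H2] [H3 H4]]. apply locally_CE.
  exists (Rmin (Rmin (Re z - a) (b - Re z)) (Rmin (Im z - c) (d - Im z))). split.
  { repeat apply Rmin_glb_lt; lra. }
  set (u := Rmin (Re z - a) (b - Re z)). set (v := Rmin (Im z - c) (d - Im z)).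
  generalize (Rmin_l u v) (Rmin_r u v) (Rmin_l (Re z - a) (b - Re z)) (Rmin_r (Re z - a) (b - Re z)) (Rmin_l (Im z - c) (d - Im z)) (Rmin_r (Im z - c) (d - Im z)).
  fold u v. intros ? ? ? ? ? ? t Ht.
  generalize (re_le_Cmod (t - z)) (im_le_Cmod (t - z)). 
  replace (Re (t - z)) with (Re t - Re z)%R by (destruct t, z; reflexivity).
  replace (Im (t - z)) with (Im t - Im z)%R by (destruct t, z; reflexivity).
  generalize (Rle_abs (Re t - Re z)) (Rle_abs (-(Re t - Re z))) (Rle_abs (Im t - Im z)) (Rle_abs (-(Im t - Im z))).
  rewrite !Rabs_Ropp. intros. split; lra.
Qed.

Lemma inside_in_box a b c d z : inside a b c d z -> in_box a b c d z.
Proof. intros [H1 H2]. split; lra. Qed.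

(** Goursat's theorem for the difference quotient (f t - f z) / (t - z), which
    is continuous at [z]. The point [p] may be an isolated point without known
    derivative; the formula at [p] itself follows by continuity. *)
Lemma Cauchy_formula f a b c d p : contB f a b c d -> (forall z, in_box a b c d z -> z <> p -> exists l, cdv f z l) ->
  forall z, inside a b c d z -> f z * wind a b c d z = Cau1 f a b c d z.
Proof.
  intros Hf Hd.
  assert (HfD : contD f a b c d) by (intros t [Ht _]; now apply Hf).
  assert (H1D : contD (fun _ => 1) a b c d) by (intros t _; apply cont_const).
  assert (Gen : forall z, inside a b c d z -> z <> p -> f z * wind a b c d z = Cau1 f a b c d z).
  { intros z Hz Hzp.
    assert (Hab : a <= b) by (destruct Hz; lra). assert (Hcd : c <= d) by (destruct Hz; lra).
    destruct (Hd z (inside_in_box _ _ _ _ _ Hz) Hzp) as [l Hl].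
    set (g := fun t => if excluded_middle_informative (t = z) then l else (f t - f z) / (t - z)).
    assert (Eg : forall t, t <> z -> g t = (f t - f z) / (t - z)).
    { intros t Ht. unfold g. destruct (excluded_middle_informative (t = z)); tauto. }
    assert (Eg0 : g z = l) by (unfold g; destruct (excluded_middle_informative (z = z)); tauto).
    assert (En : forall t, t <> z -> nearC t (fun s => (f s - f z) / (s - z) = g s)).
    { intros t Ht. apply locally_CE. exists (Cmod (t - z)). split.
      - apply Cmod_gt_0. intros K. apply Ht. now apply Ceq_minus.
      - intros s Hs. symmetry. apply Eg. intros ->. rewrite Cmod_sub_sym in Hs. lra. }
    assert (Hg : contB g a b c d).
    { intros t Ht. destruct (Classical_Prop.classic (t = z)) as [->|N].
      - intros eps He. destruct (Hl (eps / 2)%R ltac:(lra)) as (dl & Hdl & K). apply locally_CE. exists dl. split; auto.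
        intros s Hs. rewrite Eg0. destruct (Classical_Prop.classic (s = z)) as [->|N].
        + rewrite Eg0. replace (l - l) with (RtoC 0) by ring. now rewrite Cmod_0.
        + rewrite Eg by auto. specialize (K _ Hs). replace (z + (s - z)) with s in K by ring.
          assert (Hsz : s - z <> 0) by (intros H; apply N; now apply Ceq_minus).
          assert (0 < Cmod (s - z)) by now apply Cmod_gt_0.
          replace ((f s - f z) / (s - z) - l) with ((f s - f z - l * (s - z)) * / (s - z)) by (field; auto).
          rewrite Cmod_mult, Cmod_inv by auto. apply Rle_lt_trans with (eps / 2)%R; [|lra].
          apply Rmult_le_reg_r with (Cmod (s - z)); auto. rewrite Rmult_assoc, Rinv_l by lra. lra.
      - apply cont_loc with (fun s => (f s - f z) / (s - z)); [now apply En|].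
        apply cont_div; [intros H; apply N; now apply Ceq_minus|apply cont_minus; [now apply Hf|apply cont_const]|apply cont_minus; [apply cont_id|apply cont_const]]. }
    assert (G0 : rect g a b c d = 0).
    { apply Goursat_two_lines with (Re z) (Re p); auto.
      intros t Ht N1 N2. assert (Nz : t <> z) by (now intros ->). assert (Np : t <> p) by (now intros ->).
      destruct (Hd t Ht Np) as [m Hm]. eexists. apply cdv_loc with (fun s => (f s - f z) / (s - z)); [now apply En|].
      apply cdv_div; [intros H; apply Nz; now apply Ceq_minus|apply cdv_minus; [exact Hm|apply cdv_const]|apply cdv_minus; [apply cdv_id|apply cdv_const]]. }
    assert (HI1 : is_rect (fun t => f t * / (t - z)) a b c d (Cau1 f a b c d z)).
    { apply rect_is_rect; auto. apply contD_kernel; auto. intros t Ht. now apply (on_bd_far a b c d). }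
    assert (HI2 : is_rect (fun t => 1 * / (t - z)) a b c d (wind a b c d z)).
    { apply rect_is_rect; auto. apply contD_kernel; auto. intros t Ht. now apply (on_bd_far a b c d). }
    generalize (is_rect_lin _ _ (f z) _ _ _ _ _ _ HI1 HI2). intros HI.
    assert (HI' : is_rect g a b c d (Cau1 f a b c d z - f z * wind a b c d z)).
    { revert HI. apply is_rect_ext; auto. intros t Ht. assert (N := on_bd_far _ _ _ _ _ _ Hz Ht).
      rewrite Eg by (intros ->; apply N; ring). field. exact N. }
    apply is_rect_rect in HI'. rewrite G0 in HI'. symmetry. apply Ceq_minus. now symmetry. }
  intros z Hz. destruct (Classical_Prop.classic (z = p)) as [->|N]; auto.
  assert (Hab : a <= b) by (destruct Hz; lra). assert (Hcd : c <= d) by (destruct Hz; lra).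
  apply (cont_agree (fun z => f z * wind a b c d z) (Cau1 f a b c d)).
  - apply cont_mult; [apply Hf; now apply inside_in_box|]. eapply cdv_continuous, Cau1_cdv; auto.
  - eapply cdv_continuous, Cau1_cdv; auto.
  - generalize (inside_near _ _ _ _ _ Hz). apply nearC_imp. intros w Hw Hwp. now apply Gen.
Qed.

Lemma square_disc z r t : in_box (Re z - r) (Re z - r + (r + r)) (Im z - r) (Im z - r + (r + r)) t -> Cmod (t - z) <= 2 * r.
Proof. intros [H1 H2]. eapply Rle_trans; [apply Cmod_le_re_im|].
  replace (Re (t - z)) with (Re t - Re z)%R by (destruct t, z; reflexivity).
  replace (Im (t - z)) with (Im t - Im z)%R by (destruct t, z; reflexivity).
  assert (Rabs (Re t - Re z) <= r) by (apply Rabs_le; lra). assert (Rabs (Im t - Im z) <= r) by (apply Rabs_le; lra). lra. Qed.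

Lemma square_center z (r : R) : 0 < r -> inside (Re z - r) (Re z - r + (r + r)) (Im z - r) (Im z - r + (r + r)) z.
Proof. intros; split; lra. Qed.

(** The derivative of the quotient [Cau1 f / wind]. *)
Definition qder f a b c d z := (Cau2 f a b c d z * wind a b c d z - Cau1 f a b c d z * Cau2 (fun _ => 1) a b c d z) / (wind a b c d z * wind a b c d z).

(** Cauchy's formula writes [f] as a quotient of two boundary integrals, each
    of which may be differentiated twice; this makes [f] twice differentiable.
    *)
Lemma Cau_quotient f a c s : 0 < s -> contD f a (a + s) c (c + s) ->
  (forall z, inside a (a + s) c (c + s) z -> f z * wind a (a + s) c (c + s) z = Cau1 f a (a + s) c (c + s) z) ->
  forall z, inside a (a + s) c (c + s) z -> cdv f z (qder f a (a + s) c (c + s) z) /\ exists l, cdv (qder f a (a + s) c (c + s)) z l.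
Proof.
  intros Hs Hf HC z Hz.
  assert (H1D : contD (fun _ => 1) a (a + s) c (c + s)) by (intros t _; apply cont_const).
  destruct (wind_nonzero a c s z Hs Hz) as [Hn _].
  assert (X1 := Cau1_cdv f a (a + s) c (c + s) z ltac:(lra) ltac:(lra) Hf Hz).
  assert (X2 := Cau2_cdv f a (a + s) c (c + s) z ltac:(lra) ltac:(lra) Hf Hz).
  assert (Y1 : cdv (wind a (a + s) c (c + s)) z (Cau2 (fun _ => 1) a (a + s) c (c + s) z)) by exact (Cau1_cdv _ a (a + s) c (c + s) z ltac:(lra) ltac:(lra) H1D Hz).
  assert (Y2 := Cau2_cdv _ a (a + s) c (c + s) z ltac:(lra) ltac:(lra) H1D Hz).
  split.
  - apply cdv_loc with (fun w => Cau1 f a (a + s) c (c + s) w / wind a (a + s) c (c + s) w).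
    + generalize (inside_near _ _ _ _ _ Hz). apply nearC_imp. intros w Hw. rewrite <- HC by exact Hw. field. now apply wind_nonzero.
    + exact (cdv_div _ _ z _ _ Hn X1 Y1).
  - eexists. exact (cdv_div _ _ z _ _ (Cmult_neq_0 _ _ Hn Hn)
      (cdv_minus _ _ z _ _ (cdv_mult _ _ z _ _ X2 Y1) (cdv_mult _ _ z _ _ X1 Y2)) (cdv_mult _ _ z _ _ Y1 Y1)).
Qed.

Lemma holo_of_square f a c s z : 0 < s -> contD f a (a + s) c (c + s) ->
  (forall z, inside a (a + s) c (c + s) z -> f z * wind a (a + s) c (c + s) z = Cau1 f a (a + s) c (c + s) z) ->
  inside a (a + s) c (c + s) z -> holo_at f z.
Proof. intros Hs Hf HC Hz. apply holoE. generalize (inside_near _ _ _ _ _ Hz). apply nearC_imp.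
  intros w Hw. eexists. eapply Cau_quotient; eauto. Qed.

(** Cauchy's formula tolerates one exceptional point, and its right-hand side
    is differentiable there. *)
Theorem holo_removable f a : nearC a (cont f) -> nearP a (fun z => exists l, cdv f z l) -> holo_at f a.
Proof.
  intros H1 H2. generalize (nearC_and _ _ _ H1 H2). intros H. apply locally_CE in H. destruct H as (d & Hd & H).
  set (r := (d / 3)%R). assert (Hr : 0 < r) by (unfold r; lra).
  apply holo_of_square with (Re a - r)%R (Im a - r)%R (r + r)%R; [lra| | |now apply square_center].
  - intros t [Ht _]. apply square_disc in Ht. apply H. unfold r in *; lra.
  - apply Cauchy_formula with a.
    + intros t Ht. apply square_disc in Ht. apply H. unfold r in *; lra.
    + intros t Ht Hta. apply square_disc in Ht. apply H; auto. unfold r in *; lra.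
Qed.

Lemma holo_disc f z (r : R) : (forall w, Cmod (w - z) <= 2 * r -> exists l, cdv f w l) -> 0 < r ->
  let a := (Re z - r)%R in let c := (Im z - r)%R in
  contB f a (a + (r + r)) c (c + (r + r)) /\
  forall w, inside a (a + (r + r)) c (c + (r + r)) w -> f w * wind a (a + (r + r)) c (c + (r + r)) w = Cau1 f a (a + (r + r)) c (c + (r + r)) w.
Proof.
  intros H Hr a c. assert (Hc : contB f a (a + (r + r)) c (c + (r + r))).
  { intros t Ht. apply square_disc in Ht. destruct (H t Ht) as [l Hl]. eapply cdv_continuous; eauto. }
  split; auto. apply Cauchy_formula with z; auto. intros t Ht _. apply square_disc in Ht. auto.
Qed.

(** By [Cau_quotient] the derivative is itself a differentiable expression in
    boundary integrals. *)
Theorem holo_derive f a : holo_at f a -> holo_at (C_derive f) a.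
Proof.
  intros H. apply holoE, locally_CE in H. destruct H as (d & Hd & H).
  set (r := (d / 3)%R). assert (Hr : 0 < r) by (unfold r; lra).
  destruct (holo_disc f a r) as [Hc HC]; auto. { intros w Hw. apply H. unfold r in *; lra. }
  set (u := (Re a - r)%R) in *. set (v := (Im a - r)%R) in *.
  assert (HD : contD f u (u + (r + r)) v (v + (r + r))) by (intros t [Ht _]; auto).
  assert (Hin : inside u (u + (r + r)) v (v + (r + r)) a) by now apply square_center.
  apply holo_loc with (qder f u (u + (r + r)) v (v + (r + r))).
  - generalize (inside_near _ _ _ _ _ Hin). apply nearC_imp. intros w Hw. symmetry. apply cdv_C_derive.
    apply (Cau_quotient f u v (r + r)%R ltac:(lra) HD HC w Hw).
  - apply holoE. generalize (inside_near _ _ _ _ _ Hin). apply nearC_imp. intros w Hw.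
    apply (Cau_quotient f u v (r + r)%R ltac:(lra) HD HC w Hw).
Qed.

(** All boundary integrals are bounded on the square of half side [r] about
    [z]; the constant collects the four sides of length 2 r for [Cau1], [Cau2]
    of [f] and of 1, the winding integral having modulus at least 1. *)
Theorem Cauchy_estimate f z (r M : R) : 0 < r -> (forall w, Cmod (w - z) <= 2 * r -> (exists l, cdv f w l) /\ Cmod (f w) <= M) ->
  forall l, cdv f z l -> Cmod l <= 128 * M / r.
Proof.
  intros Hr H l Hl.
  destruct (holo_disc f z r) as [Hc HC]; auto. { intros w Hw. now apply H. }
  set (u := (Re z - r)%R) in *. set (v := (Im z - r)%R) in *.
  assert (HD : contD f u (u + (r + r)) v (v + (r + r))) by (intros t [Ht _]; auto).
  assert (H1D : contD (fun _ => 1) u (u + (r + r)) v (v + (r + r))) by (intros t _; apply cont_const).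
  assert (Hin : inside u (u + (r + r)) v (v + (r + r)) z) by now apply square_center.
  destruct (Cau_quotient f u v (r + r)%R ltac:(lra) HD HC z Hin) as [K _].
  rewrite (cdv_unique _ _ _ _ Hl K). unfold qder.
  destruct (wind_nonzero u v (r + r)%R z ltac:(lra) Hin) as [Hn Hn1].
  assert (HM : 0 <= M). { eapply Rle_trans; [apply Cmod_ge_0|]. apply (H z). replace (z - z) with (RtoC 0) by ring. rewrite Cmod_0; lra. }
  assert (Dist : forall t, on_bd u (u + (r + r)) v (v + (r + r)) t -> r <= Cmod (t - z)).
  { intros t [_ Ht]. generalize (re_le_Cmod (t - z)) (im_le_Cmod (t - z)).
    replace (Re (t - z)) with (Re t - Re z)%R by (destruct t, z; reflexivity).
    replace (Im (t - z)) with (Im t - Im z)%R by (destruct t, z; reflexivity).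
    generalize (Rle_abs (Re t - Re z)) (Rle_abs (-(Re t - Re z))) (Rle_abs (Im t - Im z)) (Rle_abs (-(Im t - Im z))).
    rewrite !Rabs_Ropp. unfold u, v in Ht. lra. }
  assert (Est : forall g N, 0 <= N -> contD g u (u + (r + r)) v (v + (r + r)) -> (forall t, on_bd u (u + (r + r)) v (v + (r + r)) t -> Cmod (g t) <= N) ->
     Cmod (Cau1 g u (u + (r + r)) v (v + (r + r)) z) <= 8 * N /\ Cmod (Cau2 g u (u + (r + r)) v (v + (r + r)) z) <= 8 * N / r).
  { intros g N HN Hg Hb. split.
    - eapply Rle_trans.
      + apply is_rect_bound with (M := (N * / r)%R) (4 := rect_is_rect _ u (u + (r + r)) v (v + (r + r)) ltac:(lra) ltac:(lra) (proj1 (contD_kernel g _ _ _ _ z Hg (fun t Ht => on_bd_far _ _ _ _ _ _ Hin Ht)))); try lra.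
        intros t Ht. rewrite Cmod_mult. apply Rmult_le_compat; try apply Cmod_ge_0; auto. apply Cmod_inv_le; auto.
      + right. field. lra.
    - eapply Rle_trans.
      + apply is_rect_bound with (M := (N * (/ r * / r))%R) (4 := rect_is_rect _ u (u + (r + r)) v (v + (r + r)) ltac:(lra) ltac:(lra) (proj1 (proj2 (contD_kernel g _ _ _ _ z Hg (fun t Ht => on_bd_far _ _ _ _ _ _ Hin Ht))))); try lra.
        intros t Ht. rewrite Cmod_mult. apply Rmult_le_compat; try apply Cmod_ge_0; auto.
        assert (N0 := on_bd_far _ _ _ _ _ _ Hin Ht).
        replace (/ ((t - z) * (t - z))) with (/ (t - z) * / (t - z)) by (field; auto).
        rewrite Cmod_mult. apply Rmult_le_compat; try apply Cmod_ge_0; apply Cmod_inv_le; auto.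
      + right. field. lra. }
  destruct (Est f M HM HD) as [E1 E2]. { intros t [Ht _]. apply H. now apply square_disc. }
  destruct (Est (fun _ => 1) 1%R ltac:(lra) H1D) as [E3 E4]. { intros t _. rewrite Cmod_1. lra. }
  fold (wind u (u + (r + r)) v (v + (r + r)) z) in E3.
  unfold Cdiv. rewrite Cmod_mult, Cmod_inv by now apply Cmult_neq_0. rewrite Cmod_mult.
  apply Rle_trans with (128 * M / r * 1)%R; [|lra].
  apply Rmult_le_compat; [apply Cmod_ge_0| | |].
  - left. apply Rinv_0_lt_compat. nra.
  - eapply Rle_trans; [apply Cmod_minus_le|]. rewrite !Cmod_mult.
    replace (128 * M / r)%R with (8 * M / r * (8 * 1) + 8 * M * (8 * 1 / r))%R by (field; lra).
    apply Rplus_le_compat; (apply Rmult_le_compat; [apply Cmod_ge_0|apply Cmod_ge_0|assumption|assumption]).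
  - rewrite <- Rinv_1. apply Rinv_le_contravar; [lra|nra].
Qed.

(** Weierstrass: both sides of Cauchy's formula pass to the uniform limit. *)
Theorem holo_limit (F : nat -> C -> C) f a (r : R) : 0 < r ->
  (forall N z, Cmod (z - a) < r -> holo_at (F N) z) ->
  (forall eps : R, 0 < eps -> exists N, forall z, Cmod (z - a) < r -> Cmod (F N z - f z) <= eps) -> holo_at f a.
Proof.
  intros Hr HF HL.
  set (s := (r / 3)%R). assert (Hs : 0 < s) by (unfold s; lra).
  set (u := (Re a - s)%R) in *. set (v := (Im a - s)%R) in *.
  assert (Hbox : forall t, in_box u (u + (s + s)) v (v + (s + s)) t -> Cmod (t - a) < r).
  { intros t Ht. apply square_disc in Ht. unfold s in *; lra. }
  assert (Hcn : forall t, Cmod (t - a) < r -> cont f t).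
  { intros t Ht eps He. destruct (HL (eps / 3)%R ltac:(lra)) as [N HN].
    generalize (nearC_and _ _ _ (holo_cont _ _ (HF N t Ht) (eps / 3)%R ltac:(lra)) (nearC_disc t (r - Cmod (t - a)) ltac:(lra))).
    apply nearC_imp. intros w [K1 K2].
    assert (Cmod (w - a) < r). { replace (w - a) with ((w - t) + (t - a)) by ring. eapply Rle_lt_trans; [apply Cmod_triangle|lra]. }
    replace (f w - f t) with ((F N w - F N t) - (F N w - f w) + (F N t - f t)) by ring.
    eapply Rle_lt_trans; [apply Cmod_triangle|]. generalize (Cmod_minus_le (F N w - F N t) (F N w - f w)) (HN w H) (HN t Ht). lra. }
  assert (Hc : contD f u (u + (s + s)) v (v + (s + s))) by (intros t [Ht _]; auto).
  assert (H1D : contD (fun _ => 1) u (u + (s + s)) v (v + (s + s))) by (intros t _; apply cont_const).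
  apply holo_of_square with u v (s + s)%R; auto; [lra| |now apply square_center].
  intros z Hz. apply Classical_Prop.NNPP. intros HN.
  assert (HP : 0 < Cmod (f z * wind u (u + (s + s)) v (v + (s + s)) z - Cau1 f u (u + (s + s)) v (v + (s + s)) z)).
  { apply Cmod_gt_0. intros K. apply HN. now apply Ceq_minus. }
  set (W := wind u (u + (s + s)) v (v + (s + s)) z) in *.
  set (E := Cmod (f z * W - Cau1 f u (u + (s + s)) v (v + (s + s)) z)) in *.
  destruct (inside_dist _ _ _ _ _ Hz) as (dd & Hdd & Hdist).
  set (Q := (Cmod W + 8 * s / dd + 1)%R).
  assert (HQ0 : 0 < 8 * s / dd) by (apply Rdiv_lt_0_compat; lra).
  assert (HQ : 0 < Q) by (unfold Q; generalize (Cmod_ge_0 W); lra).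
  destruct (HL (E / (2 * Q))%R) as [N HNN]; [apply Rdiv_lt_0_compat; lra|].
  set (e := (E / (2 * Q))%R) in *.
  assert (He : 0 < e) by (apply Rdiv_lt_0_compat; lra).
  assert (HFc : contD (F N) u (u + (s + s)) v (v + (s + s))). { intros t [Ht _]. apply holo_cont. apply HF. now apply Hbox. }
  assert (HC : F N z * W = Cau1 (F N) u (u + (s + s)) v (v + (s + s)) z).
  { apply (Cauchy_formula (F N) u (u + (s + s)) v (v + (s + s)) a); auto.
    - intros t Ht. apply holo_cont. apply HF. now apply Hbox.
    - intros t Ht _. eexists. apply holo_cdv. apply HF. now apply Hbox. }
  assert (D1 : Cmod (Cau1 (F N) u (u + (s + s)) v (v + (s + s)) z - 1 * Cau1 f u (u + (s + s)) v (v + (s + s)) z) <= 8 * s / dd * e).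
  { eapply Rle_trans.
    - assert (Far : forall t, on_bd u (u + (s + s)) v (v + (s + s)) t -> t - z <> 0) by (intros t Ht; now apply (on_bd_far _ _ _ _ _ _ Hz)).
      assert (KF := proj1 (contD_kernel _ _ _ _ _ _ HFc Far)). assert (Kf := proj1 (contD_kernel _ _ _ _ _ _ Hc Far)).
      eapply is_rect_bound with (M := (e * / dd)%R); [| | |apply is_rect_lin; apply rect_is_rect; [lra|lra|exact KF|lra|lra|exact Kf]]; [lra|lra|].
      intros t Ht. cbv beta. replace (F N t * / (t - z) - 1 * (f t * / (t - z))) with ((F N t - f t) * / (t - z)) by ring.
      rewrite Cmod_mult. apply Rmult_le_compat; try apply Cmod_ge_0.
      + apply HNN. apply Hbox. apply Ht. + apply Cmod_inv_le; auto.
    - right. field. lra. }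
  assert (D2 : E <= Cmod W * e + 8 * s / dd * e).
  { unfold E. replace (f z * W - Cau1 f u (u + (s + s)) v (v + (s + s)) z) with
     ((Cau1 (F N) u (u + (s + s)) v (v + (s + s)) z - 1 * Cau1 f u (u + (s + s)) v (v + (s + s)) z) - W * (F N z - f z)) by (rewrite <- HC; ring).
    eapply Rle_trans; [apply Cmod_minus_le|]. rewrite Cmod_mult.
    assert (Cmod W * Cmod (F N z - f z) <= Cmod W * e); [|lra].
    apply Rmult_le_compat_l; [apply Cmod_ge_0|]. apply HNN, Hbox, inside_in_box, Hz. }
  assert (e * Q = E / 2)%R by (unfold e; field; lra).
  unfold Q in H. nra.
Qed.

Lemma isCI_zero a b : isCI (fun _ => RtoC 0) a b (RtoC 0).
Proof. assert (E : RtoC (b - a) * 0 = 0) by ring. generalize (isCI_const 0 a b). now rewrite E. Qed.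

Lemma C_const_of_cdv0 f : (forall z, cdv f z 0) -> forall z w, f z = f w.
Proof.
  intros H. 
  assert (Hh : forall y x1 x2, x1 <= x2 -> f (x1, y) = f (x2, y)).
  { intros y x1 x2 Hx. symmetry. apply Ceq_minus.
    apply (isCI_unique (fun _ => RtoC 0) x1 x2).
    - apply (isCI_prim_h f (fun _ => RtoC 0)); auto. intros; split; [apply H|apply cont_const].
    - apply isCI_zero. }
  assert (Hv : forall x y1 y2, y1 <= y2 -> f (x, y1) = f (x, y2)).
  { intros x y1 y2 Hy. symmetry. apply Ceq_minus.
    assert (K : - Ci * (f (x, y2) - f (x, y1)) = 0).
    { apply (isCI_unique (fun _ => RtoC 0) y1 y2).
      - apply (isCI_prim_v f (fun _ => RtoC 0)); auto. intros; split; [apply H|apply cont_const].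
      - apply isCI_zero. }
    apply Classical_Prop.NNPP. intros N. apply (Cmult_neq_0 (- Ci) _) in N; auto.
    intros E. apply Ci_nz. replace Ci with (- - Ci) by ring. rewrite E. ring. }
  intros [x y] [x' y']. transitivity (f (x', y)).
  - destruct (Rle_dec x x'); [apply Hh; lra|symmetry; apply Hh; lra].
  - destruct (Rle_dec y y'); [apply Hv; lra|symmetry; apply Hv; lra].
Qed.

(** The Cauchy estimate on discs of growing radius. *)
Theorem Liouville f (M : R) : (forall z, exists l, cdv f z l) -> (forall z, Cmod (f z) <= M) -> forall z w, f z = f w.
Proof.
  intros H HM. apply C_const_of_cdv0. intros z. destruct (H z) as [l Hl].
  replace (RtoC 0) with l; auto. apply Classical_Prop.NNPP. intros N. assert (P : 0 < Cmod l) by now apply Cmod_gt_0.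
  assert (M0 : 0 <= M) by (eapply Rle_trans; [apply Cmod_ge_0|apply (HM z)]).
  assert (Hr : 0 < 256 * (M + 1) / Cmod l) by (apply Rdiv_lt_0_compat; lra).
  assert (E := Cauchy_estimate f z _ M Hr (fun w _ => conj (H w) (HM w)) l Hl).
  replace (128 * M / (256 * (M + 1) / Cmod l))%R with (Cmod l * (M / (2 * (M + 1))))%R in E by (field; lra).
  assert (M / (2 * (M + 1)) < 1). { apply Rmult_lt_reg_r with (2 * (M + 1))%R; [lra|]. unfold Rdiv. rewrite Rmult_assoc, Rinv_l; lra. }
  nra.
Qed.

(** The quotient by [z - a], with the derivative as its value at [a], has a
    removable singularity. *)
Theorem holo_factor f a : holo_at f a -> f a = 0 ->
  exists g, holo_at g a /\ g a = C_derive f a /\ forall z, f z = (z - a) * g z.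
Proof.
  intros H H0. set (g := fun z => if excluded_middle_informative (z = a) then C_derive f a else f z / (z - a)).
  assert (Eg : forall z, z <> a -> g z = f z / (z - a)).
  { intros t Ht. unfold g. destruct (excluded_middle_informative (t = a)); tauto. }
  assert (Eg0 : g a = C_derive f a) by (unfold g; destruct (excluded_middle_informative (a = a)); tauto).
  assert (Nz : forall z, z <> a -> z - a <> 0) by (intros z N K; apply N; now apply Ceq_minus).
  exists g. split; [|split; auto].
  - apply holo_removable.
    + assert (Hc := holo_near_cont _ _ H). revert Hc. intros Hc.
      assert (Hd := holo_cdv _ _ H).
      generalize (nearC_and _ _ _ Hc (nearC_all a (fun _ => True) (fun _ => I))). apply nearC_imp. intros z [Hz _].
      destruct (Classical_Prop.classic (z = a)) as [->|N].
      * intros eps He. destruct (Hd (eps / 2)%R ltac:(lra)) as (dl & Hdl & K). apply locally_CE. exists dl. split; auto.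
        intros s Hs. rewrite Eg0. destruct (Classical_Prop.classic (s = a)) as [->|N].
        { rewrite Eg0. replace (C_derive f a - C_derive f a) with (RtoC 0) by ring. now rewrite Cmod_0. }
        rewrite Eg by auto. specialize (K _ Hs). replace (a + (s - a)) with s in K by ring. rewrite H0 in K.
        assert (Hsz := Nz s N). assert (0 < Cmod (s - a)) by now apply Cmod_gt_0.
        replace (f s / (s - a) - C_derive f a) with ((f s - 0 - C_derive f a * (s - a)) * / (s - a)) by (field; auto).
        rewrite Cmod_mult, Cmod_inv by auto. apply Rle_lt_trans with (eps / 2)%R; [|lra].
        apply Rmult_le_reg_r with (Cmod (s - a)); auto. rewrite Rmult_assoc, Rinv_l by lra. lra.
      * apply cont_loc with (fun s => f s / (s - a)).
        { apply locally_CE. exists (Cmod (z - a)). split; [now apply Cmod_gt_0, Nz|]. intros s Hs. symmetry. apply Eg. intros ->. rewrite Cmod_sub_sym in Hs. lra. }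
        apply cont_div; [now apply Nz|exact Hz|apply cont_minus; [apply cont_id|apply cont_const]].
    + assert (Hc := holo_near_cdv _ _ H). revert Hc. apply nearC_imp. intros z Hz N. eexists.
      apply cdv_loc with (fun s => f s / (s - a)).
      { apply locally_CE. exists (Cmod (z - a)). split; [now apply Cmod_gt_0, Nz|]. intros s Hs. symmetry. apply Eg. intros ->. rewrite Cmod_sub_sym in Hs. lra. }
      apply cdv_div; [now apply Nz|exact Hz|apply cdv_minus; [apply cdv_id|apply cdv_const]].
  - intros z. destruct (Classical_Prop.classic (z = a)) as [->|N].
    + rewrite H0. ring. + rewrite Eg by auto. field. now apply Nz.
Qed.

(** * Lattices and elliptic functions *)

Lemma fun_choice {S T : Type} (P : S -> T -> Prop) : (forall a, exists b, P a b) -> exists f : S -> T, forall a, P a (f a).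
Proof. intros H. exists (fun a => proj1_sig (constructive_indefinite_description _ (H a))). intros a. apply proj2_sig. Qed.

Lemma Re_plus (a b : C) : Re (a + b) = (Re a + Re b)%R. Proof. reflexivity. Qed.
Lemma Im_plus (a b : C) : Im (a + b) = (Im a + Im b)%R. Proof. reflexivity. Qed.
Lemma Re_minus (a b : C) : Re (a - b) = (Re a - Re b)%R. Proof. reflexivity. Qed.
Lemma Im_minus (a b : C) : Im (a - b) = (Im a - Im b)%R. Proof. reflexivity. Qed.
Lemma Re_Rmult (r : R) (a : C) : Re (RtoC r * a) = (r * Re a)%R. Proof. unfold Re; simpl; ring. Qed.
Lemma Im_Rmult (r : R) (a : C) : Im (RtoC r * a) = (r * Im a)%R. Proof. unfold Im; simpl; ring. Qed.
Lemma C_ext (a b : C) : Re a = Re b -> Im a = Im b -> a = b.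
Proof. destruct a, b; unfold Re, Im; simpl; intros; subst; auto. Qed.

Lemma lattice_0 tau : lattice tau 0.
Proof. exists 0%Z, 0%Z. ring. Qed.
Lemma lattice_1 tau : lattice tau 1.
Proof. exists 1%Z, 0%Z. ring. Qed.
Lemma lattice_tau tau : lattice tau tau.
Proof. exists 0%Z, 1%Z. ring. Qed.
Lemma lattice_opp tau l : lattice tau l -> lattice tau (- l).
Proof. intros (m & n & ->). exists (- m)%Z, (- n)%Z. rewrite !opp_IZR, !RtoC_opp. zring. Qed.
Lemma lattice_plus tau l l' : lattice tau l -> lattice tau l' -> lattice tau (l + l').
Proof. intros (m & n & ->) (m' & n' & ->). exists (m + m')%Z, (n + n')%Z. rewrite !plus_IZR, !RtoC_plus. zring. Qed.
Lemma lattice_minus tau l l' : lattice tau l -> lattice tau l' -> lattice tau (l - l').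
Proof. intros. apply lattice_plus; auto. now apply lattice_opp. Qed.
Lemma lattice_sub_iff tau a l : lattice tau l -> (lattice tau (a + l) <-> lattice tau a).
Proof. intros H. split; intros K.
  - replace a with (a + l - l) by ring. now apply lattice_minus.
  - now apply lattice_plus. Qed.

Lemma IZR_abs_lt_1 (n : Z) : Rabs (IZR n) < 1 -> n = 0%Z.
Proof. intros H. apply Rabs_def2 in H. destruct H as [H1 H2].
  assert (H3 : IZR (-1) < IZR n) by lra. apply lt_IZR in H1, H3. lia. Qed.

(** A lower bound for the modulus of a nonzero period: periods off the real
    line have imaginary part at least Im tau, the others are integers. *)
Definition lat_gap (tau : C) : R := Rmin 1 (Im tau).

Lemma lat_gap_pos tau : 0 < Im tau -> 0 < lat_gap tau.
Proof. intros. apply Rmin_glb_lt; lra. Qed.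

Lemma lattice_discrete tau l : 0 < Im tau -> lattice tau l -> Cmod l < lat_gap tau -> l = 0.
Proof.
  intros Ht (m & n & ->) H. generalize (Rmin_l 1 (Im tau)) (Rmin_r 1 (Im tau)). fold (lat_gap tau). intros G1 G2.
  assert (Hn : n = 0%Z).
  { apply IZR_abs_lt_1. assert (K := im_le_Cmod (IZR m + IZR n * tau)).
    rewrite Im_plus, Im_Rmult, im_RtoC, Rplus_0_l, Rabs_mult, (Rabs_pos_eq (Im tau)) in K by lra.
    apply Rmult_lt_reg_r with (Im tau); auto. lra. }
  subst n. replace (IZR m + 0 * tau) with (RtoC (IZR m)) in * by (rewrite Cmult_0_l; ring).
  rewrite Cmod_R in H. assert (m = 0%Z) by (apply IZR_abs_lt_1; lra). now subst m.
Qed.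

Lemma nonlattice_near tau a : 0 < Im tau -> nearP a (fun z => ~ lattice tau z).
Proof.
  intros Ht. assert (G := lat_gap_pos tau Ht).
  destruct (Classical_Prop.classic (exists z0, z0 <> a /\ lattice tau z0 /\ Cmod (z0 - a) < lat_gap tau / 2)) as [(z0 & N & L & Hd)|N].
  - apply locally_CE. exists (Cmod (z0 - a)). split. { apply Cmod_gt_0. intros K. apply N. now apply Ceq_minus. }
    intros z Hz Nz Lz. assert (E : z - z0 = 0).
    { apply (lattice_discrete tau); auto. now apply lattice_minus.
      replace (z - z0) with ((z - a) - (z0 - a)) by ring. eapply Rle_lt_trans; [apply Cmod_minus_le|lra]. }
    assert (z = z0) by now apply Ceq_minus. subst. lra.
  - apply locally_CE. exists (lat_gap tau / 2)%R. split; [lra|]. intros z Hz Nz Lz. apply N. now exists z.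
Qed.

Lemma nonlattice_open tau a : 0 < Im tau -> ~ lattice tau a -> nearC a (fun z => ~ lattice tau z).
Proof. intros Ht Ha. generalize (nonlattice_near tau a Ht). apply nearC_imp. intros z Hz.
  destruct (Classical_Prop.classic (z = a)) as [->|N]; auto. Qed.

Lemma nearC_shift a l (P : C -> Prop) : nearC (a + l) P -> nearC a (fun z => P (z + l)).
Proof. rewrite !locally_CE. intros (d & Hd & H). exists d; split; auto. intros z Hz. apply H.
  replace (z + l - (a + l)) with (z - a) by ring. exact Hz. Qed.
Lemma nearP_shift a l (P : C -> Prop) : nearP (a + l) P -> nearP a (fun z => P (z + l)).
Proof. intros H. apply nearC_shift in H. revert H. apply nearC_imp. intros z Hz N. apply Hz. intros K. apply N.
  apply (proj2 (Ceq_minus z a)). replace (z - a) with (z + l - (a + l)) by ring. rewrite K. ring. Qed.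

(** The real coordinates of [z] in the basis (1, tau) of C are [cx] and [cy].
    *)
Definition cy (tau z : C) : R := (Im z / Im tau)%R.
Definition cx (tau z : C) : R := (Re z - cy tau z * Re tau)%R.
Lemma coords tau z : 0 < Im tau -> z = RtoC (cx tau z) + RtoC (cy tau z) * tau.
Proof. intros Ht. apply C_ext.
  - rewrite Re_plus, Re_Rmult, re_RtoC. unfold cx. ring.
  - rewrite Im_plus, Im_Rmult, im_RtoC. unfold cy. field. lra. Qed.

Lemma reduce_cell tau z : 0 < Im tau -> exists x y l, (0 <= x <= 1)%R /\ (0 <= y <= 1)%R /\ lattice tau l /\ z = (RtoC x + RtoC y * tau) + l.
Proof.
  intros Ht.
  assert (Fl : forall r : R, exists (n : Z) (f : R), r = (IZR n + f)%R /\ 0 <= f <= 1).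
  { intros r. exists (Int_part r), (frac_part r). generalize (base_fp r). unfold frac_part. intros. split; [ring|lra]. }
  destruct (Fl (cx tau z)) as (m & x & Ex & Hx). destruct (Fl (cy tau z)) as (n & y & Ey & Hy).
  exists x, y, (RtoC (IZR m) + RtoC (IZR n) * tau). repeat split; try lra. { now exists m, n. }
  rewrite (coords tau z Ht) at 1. rewrite Ex, Ey, !RtoC_plus. zring.
Qed.

Lemma periodic_bounded tau f : 0 < Im tau -> periodic tau f -> (forall z, cont f z) -> exists M : R, forall z, Cmod (f z) <= M.
Proof.
  intros Ht Hp Hc.
  set (F := fun w : C => f (RtoC (Re w) + RtoC (Im w) * tau)).
  assert (HF : forall w, cont F w).
  { intros w. apply (cont_comp f (fun w => RtoC (Re w) + RtoC (Im w) * tau)); [apply Hc|].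
    apply cont_plus; [|apply cont_mult; [|apply cont_const]]; intros eps He; generalize (nearC_disc w eps He); apply nearC_imp; intros v Hv.
    - rewrite <- RtoC_minus, Cmod_R. eapply Rle_lt_trans; [apply (re_le_Cmod (v - w))|exact Hv].
    - rewrite <- RtoC_minus, Cmod_R. eapply Rle_lt_trans; [apply (im_le_Cmod (v - w))|exact Hv]. }
  destruct (box_bounded F 0 1 0 1 (fun z _ => HF z)) as (M & HM & K).
  exists M. intros z. destruct (reduce_cell tau z Ht) as (x & y & l & Hx & Hy & Hl & ->).
  rewrite Hp by auto. apply (K (x, y)). split; simpl; auto.
Qed.

Lemma periodic_const tau f : 0 < Im tau -> periodic tau f -> (forall z, holo_at f z) -> forall z w, f z = f w.
Proof.
  intros Ht Hp Hh. destruct (periodic_bounded tau f Ht Hp (fun z => holo_cont _ _ (Hh z))) as [M HM].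
  apply (Liouville f M); auto. intros z. eexists. apply holo_cdv, Hh.
Qed.

Lemma periodic_ext tau f g : 0 < Im tau -> periodic tau f -> (forall a, cont g a) -> (forall a, nearP a (fun z => f z = g z)) -> periodic tau g.
Proof.
  intros Ht Hp Hc HE z l Hl. apply (cont_agree (fun z => g (z + l)) g z); auto.
  - apply (cont_comp g (fun z => z + l)); auto. apply cont_plus; [apply cont_id|apply cont_const].
  - generalize (nearP_and _ _ _ (HE z) (nearP_shift z l _ (HE (z + l)))). apply nearP_imp. intros w [H1 H2].
    now rewrite <- H1, <- H2, Hp.
Qed.

(** The local pieces agree where they meet by continuity, so their values at
    the base points define one entire function. *)
Lemma entire_glue f : (forall a, exists g, holo_at g a /\ nearP a (fun z => f z = g z)) ->
  exists F, (forall a, holo_at F a) /\ forall a, nearP a (fun z => f z = F z).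
Proof.
  intros H. destruct (fun_choice (fun (a : C) (g : C -> C) => holo_at g a /\ nearP a (fun z => f z = g z)) H) as [G HG].
  set (F := fun a => G a a).
  assert (HF : forall a, nearC a (fun z => G a z = F z)).
  { intros a. destruct (HG a) as [H1 H2].
    generalize (nearC_and _ _ _ (nearP_open _ _ H2) (holo_near_cont _ _ H1)). apply nearC_imp. intros z [K1 K2].
    destruct (Classical_Prop.classic (z = a)) as [->|N]; [reflexivity|]. specialize (K1 N). destruct (HG z) as [H3 H4].
    apply (cont_agree (G a) (G z) z); [exact K2|now apply holo_cont|].
    generalize (nearP_and _ _ _ H4 (nearP_of _ _ K1)). apply nearP_imp. intros w [-> ->]. reflexivity. }
  exists F. split; intros a; destruct (HG a) as [H1 H2].
  - now apply holo_loc with (G a).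
  - generalize (nearP_and _ _ _ H2 (nearP_of _ _ (HF a))). apply nearP_imp. intros w [-> ->]. reflexivity.
Qed.

(** Once the singularities are removed the function is bounded on a period
    cell, hence constant by Liouville's theorem. *)
Lemma elliptic_const tau f : 0 < Im tau -> periodic tau f -> (forall a, exists g, holo_at g a /\ nearP a (fun z => f z = g z)) ->
  exists c, forall a, nearP a (fun z => f z = c).
Proof.
  intros Ht Hp H. destruct (entire_glue f H) as (F & HF & HE).
  exists (F 0). intros a. generalize (HE a). apply nearP_imp. intros z ->.
  apply (periodic_const tau F Ht); [|exact HF]. apply (periodic_ext tau f); [exact Ht|exact Hp|intros; now apply holo_cont|exact HE].
Qed.

Lemma Czpow_nonzero (z : C) (n : Z) : z <> 0 -> Czpow z n <> 0.
Proof. intros N. destruct n; simpl; [apply C1_nz|now apply Cpow_nz|].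
  intros K. apply C1_nz. rewrite <- (Cinv_l _ (Cpow_nz _ (Pos.to_nat p) N)). rewrite K. ring. Qed.

Lemma Czpow_opp (z : C) (n : Z) : z <> 0 -> Czpow z (- n) = / Czpow z n.
Proof. intros N. destruct n; simpl; auto.
  - field. - field. now apply Cpow_nz. Qed.

Lemma Cpow_add (z : C) n m : z ^ (n + m) = z ^ n * z ^ m.
Proof. induction n; simpl; [ring|]. rewrite IHn. ring. Qed.

Lemma Czpow_sub_nat (z : C) (n m : nat) : z <> 0 -> Czpow z (Z.of_nat n - Z.of_nat m) = z ^ n / z ^ m.
Proof.
  intros N. assert (Nn := Cpow_nz z n N). assert (Nm := Cpow_nz z m N).
  assert (P : forall k, Czpow z (Z.of_nat k) = z ^ k).
  { intros [|k]; auto. simpl. now rewrite SuccNat2Pos.id_succ. }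
  destruct (Nat.le_ge_cases m n) as [H|H].
  - replace (Z.of_nat n - Z.of_nat m)%Z with (Z.of_nat (n - m)) by lia. rewrite P.
    replace n with ((n - m) + m)%nat at 2 by lia. rewrite Cpow_add. field. exact Nm.
  - replace (Z.of_nat n - Z.of_nat m)%Z with (- Z.of_nat (m - n))%Z by lia. rewrite Czpow_opp, P by auto.
    replace m with ((m - n) + n)%nat at 2 by lia. rewrite Cpow_add. field. split; auto. now apply Cpow_nz.
Qed.

Lemma Z_as_sub (n : Z) : exists a b : nat, n = (Z.of_nat a - Z.of_nat b)%Z.
Proof. exists (Z.to_nat n), (Z.to_nat (- n)). lia. Qed.

Lemma Czpow_add (z : C) (n m : Z) : z <> 0 -> Czpow z (n + m) = Czpow z n * Czpow z m.
Proof.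
  intros N. destruct (Z_as_sub n) as (a & b & ->), (Z_as_sub m) as (c & d & ->).
  replace (Z.of_nat a - Z.of_nat b + (Z.of_nat c - Z.of_nat d))%Z with (Z.of_nat (a + c) - Z.of_nat (b + d))%Z by lia.
  rewrite !Czpow_sub_nat, !Cpow_add by auto. field. split; now apply Cpow_nz.
Qed.

Lemma holo_Czpow n a b : (0 <= n)%Z -> holo_at (fun z => Czpow (z - a) n) b.
Proof. intros Hn. destruct n; simpl; [apply holo_const| |lia]. apply holo_pow, holo_minus; [apply holo_id|apply holo_const]. Qed.

(** Orders that ignore the value at the base point: products and inverses then
    need no care about the value 0 that sections take at their poles. *)
Definition ordge (f : C -> C) (a : C) (n : Z) : Prop :=
  exists g, holo_at g a /\ nearP a (fun z => f z = Czpow (z - a) n * g z).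
Definition ordeq (f : C -> C) (a : C) (n : Z) : Prop :=
  exists g, holo_at g a /\ g a <> 0 /\ nearP a (fun z => f z = Czpow (z - a) n * g z).

Lemma Csub_nz (z a : C) : z <> a -> z - a <> 0.
Proof. intros N K. apply N. now apply Ceq_minus. Qed.

Lemma ordeq_ge f a n : ordeq f a n -> ordge f a n.
Proof. intros (g & H1 & _ & H2). now exists g. Qed.

Lemma ordge_mult f h a n m : ordge f a n -> ordge h a m -> ordge (fun z => f z * h z) a (n + m).
Proof. intros (g & H1 & H2) (k & K1 & K2). exists (fun z => g z * k z). split; [now apply holo_mult|].
  generalize (nearP_and _ _ _ H2 K2). apply nearC_imp. intros z H N. destruct (H N) as [-> ->].
  rewrite Czpow_add by now apply Csub_nz. ring. Qed.
Lemma ordeq_mult f h a n m : ordeq f a n -> ordeq h a m -> ordeq (fun z => f z * h z) a (n + m).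
Proof. intros (g & H1 & N1 & H2) (k & K1 & N2 & K2). exists (fun z => g z * k z). split; [now apply holo_mult|]. split; [now apply Cmult_neq_0|].
  generalize (nearP_and _ _ _ H2 K2). apply nearC_imp. intros z H N. destruct (H N) as [-> ->].
  rewrite Czpow_add by now apply Csub_nz. ring. Qed.
Lemma ordeq_inv f a n : ordeq f a n -> ordeq (fun z => / f z) a (- n).
Proof. intros (g & H1 & N1 & H2). exists (fun z => / g z). split; [now apply holo_inv|]. split.
  - intros K. apply C1_nz. rewrite <- (Cinv_l _ N1), K. ring.
  - generalize (nearC_and _ _ _ H2 (cont_nonzero _ _ (holo_cont _ _ H1) N1)). apply nearC_imp. intros z [H Ng] N. rewrite (H N).
    assert (Nz := Csub_nz _ _ N). rewrite Czpow_opp by auto. field. split; auto. now apply Czpow_nonzero. Qed.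
Lemma ordge_le f a n m : (m <= n)%Z -> ordge f a n -> ordge f a m.
Proof. intros Hm (g & H1 & H2). exists (fun z => Czpow (z - a) (n - m) * g z). split.
  - apply holo_mult; auto. apply holo_Czpow. lia.
  - revert H2. apply nearC_imp. intros z H N. rewrite (H N). rewrite Cmult_assoc, <- Czpow_add by now apply Csub_nz. do 2 f_equal. lia. Qed.
Lemma ordge_0 f a : ordge f a 0 <-> exists g, holo_at g a /\ nearP a (fun z => f z = g z).
Proof. split; intros (g & H1 & H2); exists g; (split; auto); revert H2; apply nearP_imp; intros z ->; simpl; ring. Qed.

Lemma H0_ordge tau D f : H0 tau D f -> forall a, ordge f a (- D a).
Proof. intros [_ H] a. destruct (H a) as (g & H1 & H2). exists g. split; auto. now apply nearP_of. Qed.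
Lemma is_div_ordeq tau f D : is_div tau f D -> forall a, ordeq f a (D a).
Proof. intros [_ H] a. destruct (H a) as (g & H1 & H2 & H3). exists g. repeat split; auto. now apply nearP_of. Qed.

(** Correcting the values at isolated points turns a function with the right
    orders into a genuine one with that divisor. *)
Lemma is_div_of_ord tau f D : 0 < Im tau -> periodic tau f -> (forall a l, lattice tau l -> D (a + l) = D a) -> (forall a, nearP a (fun z => D z = 0%Z)) ->
  (forall a, ordeq f a (D a)) -> exists F, is_div tau F D /\ forall a, nearP a (fun z => F z = f z).
Proof.
  intros Ht Hp HD HD0 H.
  destruct (fun_choice (fun (a : C) (g : C -> C) => holo_at g a /\ g a <> 0 /\ nearP a (fun z => f z = Czpow (z - a) (D a) * g z)) H) as [G HG].
  set (F := fun a => Czpow 0 (D a) * G a a).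
  assert (Z0 : forall a : C, a - a = 0) by (intros; ring).
  assert (HF : forall a, nearC a (fun z => F z = Czpow (z - a) (D a) * G a z)).
  { intros a. destruct (HG a) as (H1 & H2 & H3).
    generalize (nearC_and _ _ _ (nearC_and _ _ _ (HD0 a) (nearP_open _ _ H3)) (nearC_open _ _ (holo_near_cont _ _ H1))).
    apply nearC_imp. intros z [[K0 K1] K2]. unfold F.
    destruct (Classical_Prop.classic (z = a)) as [->|N]; [now rewrite Z0|].
    destruct (HG z) as (H4 & H5 & H6). rewrite (K0 N) in *. simpl. rewrite Cmult_1_l.
    apply (cont_agree (G z) (fun w => Czpow (w - a) (D a) * G a w)).
    - now apply holo_cont. 
    - apply cont_mult; [|now apply nearC_pt].
      destruct (D a); simpl.
      + apply cont_const.
      + apply holo_cont. apply holo_pow, holo_minus; [apply holo_id|apply holo_const].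
      + apply cont_inv; [now apply Cpow_nz, Csub_nz|]. apply holo_cont. apply holo_pow, holo_minus; [apply holo_id|apply holo_const].
    - generalize (nearP_and _ _ _ H6 (nearP_of _ _ (K1 N))). apply nearP_imp. intros w [E1 E2]. rewrite <- E2, E1. simpl. ring. }
  exists F. split; [split|].
  - intros z l Hl. unfold F. rewrite HD by auto. f_equal.
    destruct (HG z) as (H1 & H2 & H3), (HG (z + l)) as (K1 & K2 & K3). rewrite HD in K3 by auto.
    apply (cont_agree (fun w => G (z + l) (w + l)) (G z)); [|now apply holo_cont|].
    + apply (cont_comp (G (z + l)) (fun w => w + l)); [now apply holo_cont|apply cont_plus; [apply cont_id|apply cont_const]].
    + generalize (nearP_and _ _ _ H3 (nearP_shift z l _ K3)). apply nearC_imp. intros w Hw N. destruct (Hw N) as [E1 E2].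
      rewrite Hp in E2 by auto. rewrite E1 in E2. replace (w + l - (z + l)) with (w - z) in E2 by ring.
      assert (Nz := Czpow_nonzero _ (D z) (Csub_nz _ _ N)).
      apply (f_equal (fun v => / Czpow (w - z) (D z) * v)) in E2. rewrite !Cmult_assoc, Cinv_l, !Cmult_1_l in E2 by auto. now symmetry.
  - intros a. destruct (HG a) as (H1 & H2 & H3). exists (G a). repeat split; auto.
  - intros a. destruct (HG a) as (H1 & H2 & H3). generalize (nearP_and _ _ _ H3 (nearP_of _ _ (HF a))). apply nearP_imp. intros z [-> ->]. reflexivity.
Qed.

(** * The complex exponential *)

Definition cexp (z : C) : C := ((exp (Re z) * cos (Im z))%R, (exp (Re z) * sin (Im z))%R).

Lemma cexp_plus z w : cexp (z + w) = cexp z * cexp w.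
Proof. unfold cexp. rewrite Re_plus, Im_plus, exp_plus, cos_plus, sin_plus. apply C_ext; unfold Re, Im; simpl; ring. Qed.
Lemma cexp_0 : cexp 0 = 1.
Proof. unfold cexp. rewrite re_RtoC, im_RtoC, exp_0, cos_0, sin_0. apply C_ext; unfold Re, Im; simpl; ring. Qed.
Lemma cexp_opp_r z : cexp z * cexp (- z) = 1.
Proof. rewrite <- cexp_plus. replace (z + - z) with (RtoC 0) by ring. apply cexp_0. Qed.
Lemma cexp_nz z : cexp z <> 0.
Proof. intros K. apply C1_nz. rewrite <- (cexp_opp_r z), K. ring. Qed.
Lemma cexp_opp z : cexp (- z) = / cexp z.
Proof. assert (N := cexp_nz z). transitivity (/ cexp z * (cexp z * cexp (- z))); [field; auto|]. rewrite cexp_opp_r. ring. Qed.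
Lemma Cmod_cexp z : Cmod (cexp z) = exp (Re z).
Proof.
  assert (P := exp_pos (Re z)). unfold Cmod, cexp. cbn [fst snd].
  replace ((exp (Re z) * cos (Im z)) ^ 2 + (exp (Re z) * sin (Im z)) ^ 2)%R with (exp (Re z) ^ 2)%R.
  - rewrite sqrt_pow2; lra.
  - transitivity (exp (Re z) ^ 2 * (Rsqr (sin (Im z)) + Rsqr (cos (Im z))))%R; [rewrite sin2_cos2; ring|unfold Rsqr; ring].
Qed.

Lemma o_small (f : R -> R) (l : R) : derivable_pt_lim f 0 l -> forall eps : R, 0 < eps -> exists d : R, 0 < d /\
  forall h, Rabs h < d -> Rabs (f h - f 0 - l * h) <= eps * Rabs h.
Proof.
  intros H eps He. destruct (H eps He) as [d Hd]. exists d. split; [apply cond_pos|]. intros h Hh.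
  destruct (Req_dec h 0) as [->|N].
  - replace (f 0 - f 0 - l * 0)%R with 0%R by ring. rewrite Rabs_R0. lra.
  - specialize (Hd h N Hh). rewrite Rplus_0_l in Hd.
    replace (f h - f 0 - l * h)%R with (((f h - f 0) / h - l) * h)%R by (field; auto).
    rewrite Rabs_mult. apply Rmult_le_compat_r; [apply Rabs_pos|lra].
Qed.

(** The exponential law reduces the claim to the origin, where it combines the
    real derivatives of exp, cos and sin. *)
Lemma cdv_cexp z : cdv cexp z (cexp z).
Proof.
  assert (H0 : cdv cexp 0 1).
  { intros eps He. set (e := Rmin 1 (eps / 12)). assert (He' : 0 < e) by (apply Rmin_glb_lt; lra).
    assert (He1 : e <= 1) by apply Rmin_l. assert (He2 : e <= eps / 12) by apply Rmin_r.
    destruct (o_small exp 1 derivable_pt_lim_exp_0 e He') as (d1 & Hd1 & K1).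
    assert (D2 := derivable_pt_lim_cos 0). rewrite sin_0, Ropp_0 in D2.
    assert (D3 := derivable_pt_lim_sin 0). rewrite cos_0 in D3.
    destruct (o_small cos 0 D2 e He') as (d2 & Hd2 & K2). destruct (o_small sin 1 D3 e He') as (d3 & Hd3 & K3).
    exists (Rmin (Rmin d1 d2) (Rmin d3 e)). split; [apply Rmin_glb_lt; apply Rmin_glb_lt; assumption|]. intros h Hh.
    assert (Hm := Rmin_l (Rmin d1 d2) (Rmin d3 e)). assert (Hm' := Rmin_r (Rmin d1 d2) (Rmin d3 e)).
    assert (Hm1 := Rmin_l d1 d2). assert (Hm2 := Rmin_r d1 d2). assert (Hm3 := Rmin_l d3 e). assert (Hm4 := Rmin_r d3 e).
    assert (Hx := re_le_Cmod h). assert (Hy := im_le_Cmod h).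
    specialize (K1 (Re h) ltac:(lra)). specialize (K2 (Im h) ltac:(lra)). specialize (K3 (Im h) ltac:(lra)).
    rewrite exp_0 in K1. rewrite cos_0 in K2. rewrite sin_0 in K3.
    rewrite Cplus_0_l, cexp_0. set (x := Re h) in *. set (y := Im h) in *.
    set (X := (exp x - 1 - 1 * x)%R) in *. set (Y := (cos y - 1 - 0 * y)%R) in *. set (W := (sin y - 0 - 1 * y)%R) in *.
    assert (E : cexp h - 1 - 1 * h = RtoC (X + Y + (X + x) * Y) + RtoC (W + (X + x) * (W + y)) * Ci).
    { rewrite Cmult_1_l. unfold X, Y, W. apply C_ext.
      - rewrite !Re_minus, Re_plus, re_mult_Ci, im_RtoC, !re_RtoC. change (Re (cexp h)) with (exp x * cos y)%R. fold x. ring.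
      - rewrite !Im_minus, Im_plus, Im_Rmult, !im_RtoC. change (Im (cexp h)) with (exp x * sin y)%R. change (Im Ci) with 1%R. fold y. ring. }
    rewrite E. eapply Rle_trans; [apply Cmod_triangle|]. rewrite Cmod_mult, Cmod_Ci, !Cmod_R, Rmult_1_r.
    assert (Px := Rabs_pos x). assert (Py := Rabs_pos y). assert (Ph := Cmod_ge_0 h).
    assert (T1 := Rabs_triang (X + Y) ((X + x) * Y)). assert (T2 := Rabs_triang X Y). assert (T3 := Rabs_triang W ((X + x) * (W + y))).
    assert (T4 := Rabs_triang X x). assert (T5 := Rabs_triang W y). rewrite Rabs_mult in T1, T3.
    assert (PX := Rabs_pos X). assert (PY := Rabs_pos Y). assert (PW := Rabs_pos W).
    set (m := Cmod h) in *.
    assert (B1 : Rabs X <= e * m) by nra. assert (B2 : Rabs Y <= e * m) by nra. assert (B3 : Rabs W <= e * m) by nra.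
    assert (B4 : Rabs (X + x) <= 2 * m) by nra. assert (B5 : Rabs (W + y) <= 2 * m) by nra.
    assert (B6 : Rabs (X + x) * Rabs Y <= 2 * m * (e * m)). { apply Rmult_le_compat; auto using Rabs_pos. }
    assert (B7 : Rabs (X + x) * Rabs (W + y) <= 2 * m * (2 * m)). { apply Rmult_le_compat; auto using Rabs_pos. }
    assert (m <= e) by lra.
    assert (2 * m * (e * m) <= 2 * e * m) by nra.
    assert (2 * m * (2 * m) <= 4 * e * m) by nra.
    nra. }
  intros eps He. assert (P := exp_pos (Re z)).
  destruct (H0 (eps / exp (Re z))%R) as (d & Hd & K). { now apply Rdiv_lt_0_compat. }
  exists d. split; auto. intros h Hh. specialize (K h Hh). rewrite Cplus_0_l, cexp_0 in K.
  rewrite cexp_plus. replace (cexp z * cexp h - cexp z - cexp z * h) with (cexp z * (cexp h - 1 - 1 * h)) by ring.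
  rewrite Cmod_mult, Cmod_cexp. apply Rmult_le_compat_l with (r := exp (Re z)) in K; [|lra].
  replace (exp (Re z) * (eps / exp (Re z) * Cmod h))%R with (eps * Cmod h)%R in K by (field; lra). exact K.
Qed.

Lemma holo_cexp f a : holo_at f a -> holo_at (fun w => cexp (f w)) a.
Proof. intros H. apply (holo_comp cexp f); auto. apply holoE, nearC_all. intros z. eexists. apply cdv_cexp. Qed.

Definition tpi : C := RtoC (2 * PI) * Ci.

Lemma tpi_nz : tpi <> 0.
Proof. apply Cmult_neq_0; [|apply Ci_nz]. intros H. apply RtoC_inj in H. generalize PI_RGT_0. lra. Qed.

Lemma Re_tpi z : Re (tpi * z) = (- 2 * PI * Im z)%R.
Proof. unfold tpi, Re, Im; simpl. ring. Qed.
Lemma Im_tpi z : Im (tpi * z) = (2 * PI * Re z)%R.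
Proof. unfold tpi, Re, Im; simpl. ring. Qed.

Lemma cexp_tpi_Z (n : Z) : cexp (tpi * RtoC (IZR n)) = 1.
Proof.
  unfold cexp. rewrite Re_tpi, Im_tpi, im_RtoC, re_RtoC, Rmult_0_r, exp_0.
  assert (G : forall k : nat, cos (2 * PI * INR k) = 1%R /\ sin (2 * PI * INR k) = 0%R).
  { intros k. replace (2 * PI * INR k)%R with (0 + 2 * INR k * PI)%R by ring. rewrite cos_period, sin_period, cos_0, sin_0. auto. }
  destruct (Z_le_gt_dec 0 n) as [Hn|Hn].
  - replace n with (Z.of_nat (Z.to_nat n)) by lia. rewrite <- INR_IZR_INZ. destruct (G (Z.to_nat n)) as [-> ->]. apply C_ext; unfold Re, Im; simpl; ring.
  - replace n with (- Z.of_nat (Z.to_nat (- n)))%Z by lia. rewrite opp_IZR, <- INR_IZR_INZ.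
    replace (2 * PI * - INR (Z.to_nat (- n)))%R with (- (2 * PI * INR (Z.to_nat (- n))))%R by ring.
    rewrite cos_neg, sin_neg. destruct (G (Z.to_nat (- n))) as [-> ->]. apply C_ext; unfold Re, Im; simpl; ring.
Qed.

(** The modulus forces [v] to be real, and then sin (pi v) = 0. *)
Lemma cexp_tpi_1 (v : C) : cexp (tpi * v) = 1 -> exists n : Z, v = RtoC (IZR n).
Proof.
  intros H. assert (Hm : Cmod (cexp (tpi * v)) = 1%R) by (rewrite H; apply Cmod_1).
  rewrite Cmod_cexp, Re_tpi in Hm.
  assert (Hi : Im v = 0%R).
  { rewrite <- exp_0 in Hm. apply exp_inv in Hm. generalize PI_RGT_0. intros. nra. }
  assert (Hs : sin (PI * Re v) = 0%R).
  { apply (f_equal Re) in H. unfold cexp, Re in H. cbn [fst] in H. fold (Re (tpi * v)) in H. rewrite Re_tpi, Im_tpi, Hi, Rmult_0_r, exp_0, Rmult_1_l in H.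
    replace (2 * PI * Re v)%R with (2 * (PI * Re v))%R in H by ring. rewrite cos_2a_sin in H.
    change (1 - 2 * sin (PI * Re v) * sin (PI * Re v) = 1)%R in H. nra. }
  destruct (sin_eq_0_0 _ Hs) as [k Hk]. exists k. apply C_ext; [|rewrite im_RtoC; auto].
  rewrite re_RtoC. generalize PI_RGT_0. intros. apply Rmult_eq_reg_l with PI; lra.
Qed.

(** * The product Phi(v) = prod (1 - q^n v) *)

Fixpoint qprod (q v : C) (N : nat) : C :=
  match N with O => 1 | S n => qprod q v n * (1 - q ^ n * v) end.

(** The geometric sum 1 + Q + ... + Q^(N-1), in closed form. *)
Definition geo (Q : R) (N : nat) : R := ((1 - Q ^ N) / (1 - Q))%R.

Lemma geo_S Q N : Q < 1 -> geo Q (S N) = (geo Q N + Q ^ N)%R.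
Proof. intros H. unfold geo. simpl. field. lra. Qed.

Lemma exp_ge_1p x : (1 + x <= exp x)%R.
Proof. destruct (Req_dec x 0) as [->|N]; [rewrite exp_0; lra|]. left. now apply exp_ineq1. Qed.

(** Each factor is at most exp (|v| |q|^n), so the product is compared with the
    exponential of a geometric sum. *)
Lemma qprod_bounds q v N : Cmod q < 1 ->
  Cmod (qprod q v N) <= exp (Cmod v * geo (Cmod q) N) /\ Cmod (qprod q v N - 1) <= exp (Cmod v * geo (Cmod q) N) - 1.
Proof.
  intros Hq. assert (P := Cmod_ge_0 q). induction N as [|N [I1 I2]].
  - simpl. unfold geo. simpl. replace ((1 - 1) / (1 - Cmod q))%R with 0%R by (field; lra). rewrite Rmult_0_r, exp_0, Cmod_1.
    replace (1 - 1) with (RtoC 0) by ring. rewrite Cmod_0. lra.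
  - cbn [qprod]. rewrite geo_S, Rmult_plus_distr_l, exp_plus by auto.
    set (E := exp (Cmod v * geo (Cmod q) N)) in *. set (t := (Cmod v * Cmod q ^ N)%R).
    assert (Et := exp_ge_1p t). assert (PE : 0 < E) by apply exp_pos.
    assert (Hm : Cmod (q ^ N * v) = t) by (rewrite Cmod_mult, Cmod_pow; unfold t; ring).
    assert (Pt : 0 <= t) by (rewrite <- Hm; apply Cmod_ge_0).
    assert (H1 : Cmod (1 - q ^ N * v) <= 1 + t). { eapply Rle_trans; [apply Cmod_minus_le|]. rewrite Cmod_1, Hm. lra. }
    split.
    + rewrite Cmod_mult. apply Rmult_le_compat; try apply Cmod_ge_0; lra.
    + replace (qprod q v N * (1 - q ^ N * v) - 1) with ((qprod q v N - 1) - qprod q v N * (q ^ N * v)) by ring.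
      eapply Rle_trans; [apply Cmod_minus_le|]. rewrite Cmod_mult, Hm.
      assert (Cmod (qprod q v N) * t <= E * t) by (apply Rmult_le_compat_r; auto). nra.
Qed.

Lemma geo_le Q N : 0 <= Q -> Q < 1 -> geo Q N <= / (1 - Q).
Proof. intros H0 H. unfold geo, Rdiv. rewrite <- (Rmult_1_l (/ (1 - Q))) at 2. apply Rmult_le_compat_r.
  - left. apply Rinv_0_lt_compat. lra.
  - generalize (pow_le Q N H0). lra. Qed.

(** Bound for all partial products; [qK] is the constant in their geometric
    rate of convergence. *)
Definition qE (q v : C) : R := exp (Cmod v * / (1 - Cmod q)).

Lemma qprod_le q v N : Cmod q < 1 -> Cmod (qprod q v N) <= qE q v /\ Cmod (qprod q v N - 1) <= qE q v - 1.
Proof.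
  intros Hq. destruct (qprod_bounds q v N Hq) as [H1 H2].
  assert (exp (Cmod v * geo (Cmod q) N) <= qE q v); [|lra].
  unfold qE. destruct (Rle_lt_or_eq_dec (Cmod v * geo (Cmod q) N) (Cmod v * / (1 - Cmod q))) as [H|H].
  - apply Rmult_le_compat_l; [apply Cmod_ge_0|]. apply geo_le; auto. apply Cmod_ge_0.
  - left. now apply exp_increasing.
  - rewrite H. lra.
Qed.

Lemma qprod_cauchy q v N k : Cmod q < 1 -> Cmod (qprod q v (N + k) - qprod q v N) <= Cmod v * qE q v * Cmod q ^ N * geo (Cmod q) k.
Proof.
  intros Hq. assert (P := Cmod_ge_0 q). induction k as [|k IH].
  - rewrite Nat.add_0_r. replace (qprod q v N - qprod q v N) with (RtoC 0) by ring. rewrite Cmod_0. unfold geo. simpl. replace ((1 - 1) / (1 - Cmod q))%R with 0%R by (field; lra). lra.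
  - rewrite Nat.add_succ_r. cbn [qprod]. rewrite geo_S by auto.
    replace (qprod q v (N + k) * (1 - q ^ (N + k) * v) - qprod q v N) with ((qprod q v (N + k) - qprod q v N) - qprod q v (N + k) * (q ^ (N + k) * v)) by ring.
    eapply Rle_trans; [apply Cmod_minus_le|]. rewrite !Cmod_mult, Cmod_pow, pow_add.
    assert (Cmod (qprod q v (N + k)) * (Cmod q ^ N * Cmod q ^ k * Cmod v) <= qE q v * (Cmod q ^ N * Cmod q ^ k * Cmod v)).
    { apply Rmult_le_compat_r; [|now apply qprod_le]. repeat apply Rmult_le_pos; try apply pow_le; auto. apply Cmod_ge_0. }
    nra.
Qed.

Definition qK (q v : C) : R := (2 * (Cmod v * qE q v * / (1 - Cmod q)))%R.

Lemma real_cauchy (u : nat -> R) (K Q : R) : 0 <= Q -> Q < 1 -> (forall N k, Rabs (u (N + k)%nat - u N) <= K * Q ^ N) -> exists l : R, forall N, Rabs (u N - l) <= K * Q ^ N.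
Proof.
  intros HQ0 HQ H.
  assert (Hlim : forall eps : R, 0 < eps -> exists N, forall n, (n >= N)%nat -> K * Q ^ n < eps).
  { intros eps He. destruct (pow_lt_1_zero Q ltac:(rewrite Rabs_pos_eq; auto) (eps / (Rabs K + 1))) as [N HN].
    { apply Rdiv_lt_0_compat; auto. generalize (Rabs_pos K); lra. }
    exists N. intros n Hn. specialize (HN n Hn). rewrite Rabs_pos_eq in HN by now apply pow_le.
    assert (PK := Rabs_pos K). assert (K * Q ^ n <= Rabs K * Q ^ n) by (apply Rmult_le_compat_r; [now apply pow_le|apply Rle_abs]).
    apply Rmult_lt_compat_r with (r := (Rabs K + 1)%R) in HN; [|lra].
    unfold Rdiv in HN. rewrite Rmult_assoc, Rinv_l in HN by lra. generalize (pow_le Q n HQ0). nra. }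
  destruct (Rcomplete.R_complete u) as [l Hl].
  - intros eps He. destruct (Hlim (eps / 2)%R ltac:(lra)) as [N HN]. exists N. intros n m Hn Hm. unfold Rdist.
    replace (u n - u m)%R with ((u n - u N) - (u m - u N))%R by ring.
    eapply Rle_lt_trans; [apply (Rabs_triang (u n - u N) (- (u m - u N)))|]. rewrite Rabs_Ropp.
    assert (A1 := H N (n - N)%nat). assert (A2 := H N (m - N)%nat).
    replace (N + (n - N))%nat with n in A1 by lia. replace (N + (m - N))%nat with m in A2 by lia.
    specialize (HN N (le_n _)). lra.
  - exists l. intros N. apply Rnot_lt_le. intros HN.
    destruct (Hl (Rabs (u N - l) - K * Q ^ N)%R ltac:(lra)) as [M HM]. specialize (HM (N + M)%nat ltac:(lia)). unfold Rdist in HM.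
    assert (A1 := H N M). assert (T := Rabs_triang (u (N + M)%nat - l) (- (u (N + M)%nat - u N))). rewrite Rabs_Ropp in T.
    replace (u (N + M)%nat - l + - (u (N + M)%nat - u N))%R with (u N - l)%R in T by ring. lra.
Qed.

Lemma qprod_lim q v : Cmod q < 1 -> exists l : C, forall N, Cmod (qprod q v N - l) <= qK q v * Cmod q ^ N.
Proof.
  intros Hq. assert (P := Cmod_ge_0 q).
  assert (H : forall N k, Cmod (qprod q v (N + k) - qprod q v N) <= qK q v / 2 * Cmod q ^ N).
  { intros N k. eapply Rle_trans; [now apply qprod_cauchy|]. unfold qK.
    replace (2 * (Cmod v * qE q v * / (1 - Cmod q)) / 2 * Cmod q ^ N)%R with (Cmod v * qE q v * Cmod q ^ N * / (1 - Cmod q))%R by (field; lra).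
    apply Rmult_le_compat_l; [|now apply geo_le]. repeat apply Rmult_le_pos; try apply Cmod_ge_0; [left; apply exp_pos|apply pow_le; auto]. }
  destruct (real_cauchy (fun N => Re (qprod q v N)) (qK q v / 2) (Cmod q) P Hq) as [x Hx].
  { intros N k. eapply Rle_trans; [|apply H]. apply (re_le_Cmod (qprod q v (N + k) - qprod q v N)). }
  destruct (real_cauchy (fun N => Im (qprod q v N)) (qK q v / 2) (Cmod q) P Hq) as [y Hy].
  { intros N k. eapply Rle_trans; [|apply H]. apply (im_le_Cmod (qprod q v (N + k) - qprod q v N)). }
  exists (x, y). intros N. eapply Rle_trans; [apply Cmod_le_re_im|]. rewrite Re_minus, Im_minus. specialize (Hx N). specialize (Hy N).
  change (Re (x, y)) with x. change (Im (x, y)) with y. lra.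
Qed.

(** The infinite product, chosen with its rate of convergence; the rate alone
    determines the limit. *)
Definition Phi (q v : C) : C := epsilon (inhabits (RtoC 0)) (fun l => forall N, Cmod (qprod q v N - l) <= qK q v * Cmod q ^ N).

Lemma Phi_spec q v : Cmod q < 1 -> forall N, Cmod (qprod q v N - Phi q v) <= qK q v * Cmod q ^ N.
Proof. intros Hq. exact (epsilon_spec (inhabits (RtoC 0)) _ (qprod_lim q v Hq)). Qed.

Lemma small_pow (K Q eps : R) : 0 <= Q -> Q < 1 -> 0 < eps -> exists N, K * Q ^ N < eps.
Proof.
  intros HQ0 HQ He. destruct (pow_lt_1_zero Q ltac:(rewrite Rabs_pos_eq; auto) (eps / (Rabs K + 1))) as [N HN].
  { apply Rdiv_lt_0_compat; auto. generalize (Rabs_pos K); lra. }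
  exists N. specialize (HN N (le_n _)). rewrite Rabs_pos_eq in HN by now apply pow_le.
  assert (PK := Rabs_pos K). assert (K * Q ^ N <= Rabs K * Q ^ N) by (apply Rmult_le_compat_r; [now apply pow_le|apply Rle_abs]).
  apply Rmult_lt_compat_r with (r := (Rabs K + 1)%R) in HN; [|lra].
  unfold Rdiv in HN. rewrite Rmult_assoc, Rinv_l in HN by lra. generalize (pow_le Q N HQ0). nra.
Qed.

Lemma Czero_of_small (z : C) (K Q : R) : 0 <= Q -> Q < 1 -> (forall N, Cmod z <= K * Q ^ N) -> z = 0.
Proof. intros HQ0 HQ H. apply Cmod_eq_0. apply Rle_antisym; [|apply Cmod_ge_0]. apply Rnot_lt_le. intros HP.
  destruct (small_pow K Q _ HQ0 HQ HP) as [N HN]. specialize (H N). lra. Qed.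

Lemma qprod_shift q v N : qprod q v (S N) = (1 - v) * qprod q (q * v) N.
Proof. induction N. - simpl. ring. - cbn [qprod] in *. rewrite IHN. simpl. ring. Qed.

Lemma qK_pos q v : Cmod q < 1 -> 0 <= qK q v.
Proof. intros H. unfold qK, qE. repeat apply Rmult_le_pos; try lra; try apply Cmod_ge_0; [left; apply exp_pos|]. left. apply Rinv_0_lt_compat. lra. Qed.

(** Splitting off the first factor; this identity is the source of the
    quasi-periodicity of theta. *)
Lemma Phi_functional q v : Cmod q < 1 -> Phi q v = (1 - v) * Phi q (q * v).
Proof.
  intros Hq. apply Ceq_minus. assert (P := Cmod_ge_0 q).
  apply Czero_of_small with (qK q v + Cmod (1 - v) * qK q (q * v))%R (Cmod q); auto.
  intros N. assert (H1 := Phi_spec q v Hq (S N)). assert (H2 := Phi_spec q (q * v) Hq N). rewrite qprod_shift in H1.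
  replace (Phi q v - (1 - v) * Phi q (q * v)) with ((1 - v) * (qprod q (q * v) N - Phi q (q * v)) - ((1 - v) * qprod q (q * v) N - Phi q v)) by ring.
  eapply Rle_trans; [apply Cmod_minus_le|]. rewrite Cmod_mult.
  assert (Cmod (1 - v) * Cmod (qprod q (q * v) N - Phi q (q * v)) <= Cmod (1 - v) * (qK q (q * v) * Cmod q ^ N)) by (apply Rmult_le_compat_l; [apply Cmod_ge_0|auto]).
  assert (qK q v * Cmod q ^ S N <= qK q v * Cmod q ^ N). { apply Rmult_le_compat_l; [now apply qK_pos|]. simpl. generalize (pow_le _ N P). nra. }
  lra.
Qed.

Lemma Phi_near_1 q v : Cmod q < 1 -> Cmod (Phi q v - 1) <= qE q v - 1.
Proof.
  intros Hq. apply Rnot_lt_le. intros H. destruct (small_pow (qK q v) (Cmod q) (Cmod (Phi q v - 1) - (qE q v - 1)) (Cmod_ge_0 q) Hq ltac:(lra)) as [N HN].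
  assert (H1 := Phi_spec q v Hq N). destruct (qprod_le q v N Hq) as [_ H2].
  replace (Phi q v - 1) with ((qprod q v N - 1) - (qprod q v N - Phi q v)) in HN, H by ring.
  generalize (Cmod_minus_le (qprod q v N - 1) (qprod q v N - Phi q v)). lra.
Qed.

Lemma exp_small x : 0 <= x <= / 2 -> exp x - 1 <= 2 * x.
Proof.
  intros Hx. assert (H := exp_ge_1p (- x)). assert (E : (exp x * exp (- x) = 1)%R) by (rewrite <- exp_plus, Rplus_opp_r; apply exp_0).
  assert (P := exp_pos x). assert (exp x * (1 - x) <= 1) by (rewrite <- E; apply Rmult_le_compat_l; lra). nra.
Qed.

Lemma Phi_close q v : Cmod q < 1 -> Cmod v * / (1 - Cmod q) <= / 2 -> Cmod (Phi q v - 1) <= 2 * (Cmod v * / (1 - Cmod q)).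
Proof.
  intros Hq H. eapply Rle_trans; [now apply Phi_near_1|]. apply exp_small. split; auto.
  apply Rmult_le_pos; [apply Cmod_ge_0|]. left. apply Rinv_0_lt_compat. lra.
Qed.

(** The rate of convergence is uniform on discs, so Weierstrass' theorem
    applies. *)
Lemma holo_Phi q a : Cmod q < 1 -> holo_at (Phi q) a.
Proof.
  intros Hq. assert (P := Cmod_ge_0 q).
  assert (Pi : 0 < / (1 - Cmod q)) by (apply Rinv_0_lt_compat; lra).
  apply holo_limit with (F := fun N v => qprod q v N) (r := 1%R); [lra| |].
  - intros N z _. induction N; simpl; [apply holo_const|]. apply holo_mult; auto. apply holo_minus; [apply holo_const|]. apply holo_mult; [apply holo_const|apply holo_id].
  - set (b := RtoC (Cmod a + 1)). assert (Pb : Cmod b = (Cmod a + 1)%R) by (unfold b; rewrite Cmod_R; apply Rabs_pos_eq; generalize (Cmod_ge_0 a); lra).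
    intros eps He. destruct (small_pow (qK q b) (Cmod q) eps P Hq He) as [N HN]. exists N. intros z Hz.
    eapply Rle_trans; [now apply Phi_spec|]. apply Rle_trans with (qK q b * Cmod q ^ N)%R; [|lra].
    apply Rmult_le_compat_r; [now apply pow_le|].
    assert (Hzb : Cmod z <= Cmod b). { rewrite Pb. replace z with ((z - a) + a) by ring. eapply Rle_trans; [apply Cmod_triangle|lra]. }
    assert (Hm : qE q z <= qE q b).
    { unfold qE. assert (T : Cmod z * / (1 - Cmod q) <= Cmod b * / (1 - Cmod q)) by (apply Rmult_le_compat_r; lra).
      destruct T as [T|T]; [left; now apply exp_increasing|rewrite T; lra]. }
    unfold qK. apply Rmult_le_compat_l; [lra|]. apply Rmult_le_compat_r; [lra|].
    apply Rmult_le_compat; auto; [apply Cmod_ge_0|]. left. apply exp_pos.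
Qed.

Lemma Phi_0_ind q v n : Cmod q < 1 -> (forall k, q ^ k * v <> 1) -> Phi q v = 0 -> Phi q (q ^ n * v) = 0.
Proof.
  intros Hq Hn H. induction n. - simpl. now replace (1 * v) with v by ring.
  - rewrite Phi_functional in IHn by auto. apply Classical_Prop.NNPP. intros N.
    revert IHn. replace (q * (q ^ n * v)) with (q ^ S n * v) by (simpl; ring). apply Cmult_neq_0; auto.
    intros K. apply (Hn n). symmetry. now apply Ceq_minus.
Qed.

(** If no factor vanished, the functional equation would carry the zero to the
    points q^n v, which tend to 0, where Phi is close to 1. *)
Lemma Phi_zero q v : Cmod q < 1 -> Phi q v = 0 -> exists n, q ^ n * v = 1.
Proof.
  intros Hq H. apply Classical_Prop.NNPP. intros N. assert (P := Cmod_ge_0 q).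
  assert (N' : forall k, q ^ k * v <> 1) by (intros k K; apply N; now exists k).
  assert (Pi : 0 < / (1 - Cmod q)) by (apply Rinv_0_lt_compat; lra).
  destruct (small_pow (Cmod v * / (1 - Cmod q)) (Cmod q) (/ 4) P Hq ltac:(lra)) as [n Hn].
  assert (E := Phi_0_ind q v n Hq N' H).
  assert (M : Cmod (q ^ n * v) * / (1 - Cmod q) < / 4) by (rewrite Cmod_mult, Cmod_pow; lra).
  generalize (Phi_close q (q ^ n * v) Hq ltac:(lra)). rewrite E. replace (0 - 1) with (- RtoC 1) by ring. rewrite Cmod_opp, Cmod_1. lra.
Qed.

(** * The theta function *)

Definition nome (tau : C) : C := cexp (tpi * tau).
Definition ew (w : C) : C := cexp (tpi * w).
(** By Jacobi's triple product this is, up to a constant, the classical theta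
    series; the product form shows its zeros, which are simple and lie on the
    lattice. *)
Definition theta (tau w : C) : C := Phi (nome tau) (ew w) * Phi (nome tau) (nome tau * / ew w).

Lemma Cmod_ew w : Cmod (ew w) = exp (- 2 * PI * Im w).
Proof. unfold ew. now rewrite Cmod_cexp, Re_tpi. Qed.
Lemma nome_lt_1 tau : 0 < Im tau -> Cmod (nome tau) < 1.
Proof. intros H. change (Cmod (ew tau) < 1). rewrite Cmod_ew, <- exp_0. apply exp_increasing. generalize PI_RGT_0. nra. Qed.
Lemma ew_nz w : ew w <> 0.
Proof. apply cexp_nz. Qed.
Lemma ew_plus a b : ew (a + b) = ew a * ew b.
Proof. unfold ew. rewrite <- cexp_plus. f_equal. ring. Qed.
Lemma ew_opp a : ew (- a) = / ew a.
Proof. unfold ew. rewrite <- cexp_opp. f_equal. ring. Qed.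
Lemma ew_Z (n : Z) : ew (RtoC (IZR n)) = 1.
Proof. apply cexp_tpi_Z. Qed.
Lemma ew_1 : ew 1 = 1.
Proof. exact (ew_Z 1). Qed.
Lemma ew_0 : ew 0 = 1.
Proof. exact (ew_Z 0). Qed.
Lemma ew_pow n w : ew w ^ n = ew (RtoC (INR n) * w).
Proof. induction n. - simpl. rewrite Cmult_0_l, ew_0. reflexivity.
  - cbn [Cpow]. rewrite IHn, <- ew_plus, S_INR, RtoC_plus. f_equal. ring. Qed.
Lemma holo_ew a : holo_at ew a.
Proof. apply holo_cexp, holo_mult; [apply holo_const|apply holo_id]. Qed.
Lemma cdv_ew a : cdv ew a (tpi * ew a).
Proof. eapply cdv_eq; [apply (cdv_comp cexp (fun w => tpi * w) a); [apply cdv_cexp|apply cdv_scal, cdv_id]|]. unfold ew. ring. Qed.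

(** A property of periods that is inherited by sums and opposites need only be
    checked on 1 and tau. *)
Lemma lattice_ind (tau : C) (Q : C -> Prop) : Q 1 -> Q tau -> (forall l l', Q l -> Q l' -> Q (l + l')) -> (forall l, Q l -> Q (- l)) ->
  forall l, lattice tau l -> Q l.
Proof.
  intros Q1 Qt Qadd Qopp l (m & n & ->).
  assert (Q0 : Q 0) by (replace (RtoC 0) with (1 + - (1)) by ring; auto).
  assert (Qn : forall l, Q l -> forall k : nat, Q (RtoC (INR k) * l)).
  { intros l Hl k. induction k. - simpl. rewrite Cmult_0_l. exact Q0.
    - rewrite S_INR, RtoC_plus. replace ((INR k + 1) * l) with (INR k * l + l) by ring. auto. }
  assert (Qz : forall l, Q l -> forall k : Z, Q (RtoC (IZR k) * l)).
  { intros l Hl k. destruct (Z_le_gt_dec 0 k).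
    - replace k with (Z.of_nat (Z.to_nat k)) by lia. rewrite <- INR_IZR_INZ. auto.
    - replace k with (- Z.of_nat (Z.to_nat (- k)))%Z by lia. rewrite opp_IZR, <- INR_IZR_INZ, RtoC_opp.
      replace (- INR (Z.to_nat (- k)) * l) with (- (INR (Z.to_nat (- k)) * l)) by ring. auto. }
  apply Qadd; [|now apply Qz].
  replace (RtoC (IZR m)) with (RtoC (IZR m) * 1) by (apply Cmult_1_r). now apply Qz.
Qed.

Section Theta.
Variable tau : C.
Hypothesis Ht : 0 < Im tau.
Let q := nome tau.

Lemma theta_1 w : theta tau (w + 1) = theta tau w.
Proof. unfold theta. now rewrite ew_plus, ew_1, Cmult_1_r. Qed.

Lemma theta_tau w : theta tau (w + tau) = - / ew w * theta tau w.
Proof.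
  assert (Hq := nome_lt_1 tau Ht). unfold theta. rewrite ew_plus. change (ew tau) with q. fold q in Hq |- *.
  assert (Nw := ew_nz w). assert (Nq : q <> 0) by apply ew_nz.
  replace (q * / (ew w * q)) with (/ ew w) by (field; auto).
  rewrite (Phi_functional q (ew w)), (Phi_functional q (/ ew w)) by auto.
  rewrite (Cmult_comm (ew w) q). field. exact Nw.
Qed.

(** The multipliers for 1 and tau are exponentials of affine functions, and
    these are stable under composition. *)
Lemma theta_lattice l : lattice tau l -> exists A B, forall w, theta tau (w + l) = cexp (A * w + B) * theta tau w.
Proof.
  revert l. apply lattice_ind.
  - exists 0, 0. intros w. replace (0 * w + 0) with (RtoC 0) by ring. rewrite cexp_0, theta_1. ring.
  - exists (- tpi), (tpi * (/ 2)). intros w. rewrite theta_tau. f_equal. rewrite cexp_plus.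
    replace (- tpi * w) with (- (tpi * w)) by ring. rewrite cexp_opp. fold (ew w).
    replace (cexp (tpi * / 2)) with (- RtoC 1); [ring|].
    unfold cexp. rewrite Re_tpi, Im_tpi.
    replace (Im (/ 2)) with 0%R by (unfold Im, Cinv; simpl; field). replace (Re (/ 2)) with (/ 2)%R by (unfold Re, Cinv; simpl; field).
    rewrite Rmult_0_r, exp_0. replace (2 * PI * / 2)%R with PI by field. rewrite cos_PI, sin_PI.
    apply C_ext; unfold Re, Im; simpl; ring.
  - intros l l' (A & B & H) (A' & B' & H'). exists (A + A'), (A' * l + B' + B). intros w.
    rewrite Cplus_assoc, H', H, Cmult_assoc, <- cexp_plus. f_equal. f_equal. ring.
  - intros l (A & B & H). exists (- A), (A * l - B). intros w. specialize (H (w + - l)).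
    replace (w + - l + l) with w in H by ring. rewrite H, Cmult_assoc, <- cexp_plus.
    replace (- A * w + (A * l - B) + (A * (w + - l) + B)) with (RtoC 0) by ring. rewrite cexp_0. ring.
Qed.

Lemma ew_eq_1 v : ew v = 1 -> exists n : Z, v = RtoC (IZR n).
Proof. apply cexp_tpi_1. Qed.

Lemma theta_zero w : theta tau w = 0 -> lattice tau w.
Proof.
  intros H. assert (Hq := nome_lt_1 tau Ht).
  assert (Case : Phi q (ew w) = 0 \/ Phi q (q * / ew w) = 0).
  { destruct (Classical_Prop.classic (Phi q (ew w) = 0)); auto. right. apply Classical_Prop.NNPP. intros N.
    revert H. unfold theta. fold q. now apply Cmult_neq_0. }
  assert (Iz : forall k : nat, RtoC (INR k) = RtoC (IZR (Z.of_nat k))) by (intros; now rewrite INR_IZR_INZ).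
  destruct Case as [E|E]; apply Phi_zero in E; auto; destruct E as [k E].
  - change q with (ew tau) in E. rewrite ew_pow, <- ew_plus in E. apply ew_eq_1 in E. destruct E as [n E].
    exists n, (- Z.of_nat k)%Z. rewrite opp_IZR, RtoC_opp, <- Iz. rewrite <- E. ring.
  - change q with (ew tau) in E. rewrite ew_pow, <- ew_opp, <- !ew_plus in E. apply ew_eq_1 in E. destruct E as [n E].
    exists (- n)%Z, (Z.of_nat (S k)). rewrite opp_IZR, RtoC_opp, <- Iz, S_INR, RtoC_plus. rewrite <- E. ring.
Qed.

Lemma holo_theta a : holo_at (theta tau) a.
Proof.
  assert (Hq := nome_lt_1 tau Ht). apply holo_mult.
  - apply (holo_comp (Phi q) ew); [now apply holo_Phi|apply holo_ew].
  - apply (holo_comp (Phi q) (fun w => q * / ew w)); [now apply holo_Phi|]. apply holo_mult; [apply holo_const|]. apply holo_inv; [apply ew_nz|apply holo_ew].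
Qed.

Lemma Phi_nome_nz : Phi q q <> 0.
Proof.
  intros H. assert (Hq := nome_lt_1 tau Ht). fold q in Hq. apply Phi_zero in H; auto. destruct H as [n H].
  apply (f_equal Cmod) in H. rewrite Cmod_mult, Cmod_pow, Cmod_1 in H.
  assert (P := Cmod_ge_0 q). assert (Cmod q ^ n <= 1). { rewrite <- (pow1 n). apply pow_incr. lra. } nra.
Qed.

(** The factor 1 - e(w) carries the zero; the remaining ones do not vanish at
    the origin since |q| < 1. *)
Lemma theta_at_0 : exists g, holo_at g 0 /\ g 0 <> 0 /\ forall w, theta tau w = w * g w.
Proof.
  assert (Hq := nome_lt_1 tau Ht). fold q in Hq.
  destruct (holo_factor (fun w => 1 - ew w) 0) as (k & K1 & K2 & K3).
  { apply holo_minus; [apply holo_const|apply holo_ew]. } { rewrite ew_0. ring. }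
  assert (K0 : k 0 <> 0).
  { rewrite K2. rewrite (cdv_C_derive _ _ (0 - tpi * ew 0)). - rewrite ew_0. intros E. apply tpi_nz. rewrite <- (Cmult_1_r tpi). 
      replace (tpi * 1) with (- (0 - tpi * 1)) by ring. rewrite E. ring.
    - apply cdv_minus; [apply cdv_const|apply cdv_ew]. }
  exists (fun w => k w * (Phi q (q * ew w) * Phi q (q * / ew w))). split; [|split].
  - apply holo_mult; auto. apply holo_mult.
    + apply (holo_comp (Phi q) (fun w => q * ew w)); [now apply holo_Phi|]. apply holo_mult; [apply holo_const|apply holo_ew].
    + apply (holo_comp (Phi q) (fun w => q * / ew w)); [now apply holo_Phi|]. apply holo_mult; [apply holo_const|]. apply holo_inv; [apply ew_nz|apply holo_ew].
  - rewrite ew_0. replace (q * / 1) with q by field. rewrite Cmult_1_r. repeat apply Cmult_neq_0; auto; apply Phi_nome_nz.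
  - intros w. unfold theta. fold q. rewrite (Phi_functional q (ew w)) by auto.
    replace (1 - ew w) with (w * k w) by (rewrite K3; ring). ring.
Qed.

Lemma theta_at_lattice a : lattice tau a -> exists g, holo_at g a /\ g a <> 0 /\ forall w, theta tau w = (w - a) * g w.
Proof.
  intros Ha. destruct (theta_lattice a Ha) as (A & B & H). destruct theta_at_0 as (g & G1 & G2 & G3).
  exists (fun w => cexp (A * (w - a) + B) * g (w - a)). assert (E : a - a = 0) by ring. split; [|split].
  - apply holo_mult.
    + apply holo_cexp. apply holo_plus; [|apply holo_const]. apply holo_mult; [apply holo_const|]. apply holo_minus; [apply holo_id|apply holo_const].
    + apply (holo_comp g (fun w => w - a)); [now rewrite E|]. apply holo_minus; [apply holo_id|apply holo_const].
  - apply Cmult_neq_0; [apply cexp_nz|now rewrite E].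
  - intros w. specialize (H (w - a)). replace (w - a + a) with w in H by ring. rewrite H, G3. ring.
Qed.

Definition lattice_mult_nat (tau a : C) : nat := if excluded_middle_informative (lattice tau a) then 1%nat else 0%nat.

Lemma theta_local a : exists g, holo_at g a /\ g a <> 0 /\ forall w, theta tau w = (w - a) ^ lattice_mult_nat tau a * g w.
Proof.
  unfold lattice_mult_nat. destruct (excluded_middle_informative (lattice tau a)) as [H|H].
  - destruct (theta_at_lattice a H) as (g & G1 & G2 & G3). exists g. repeat split; auto. intros w. rewrite G3. simpl. ring.
  - exists (theta tau). split; [apply holo_theta|]. split; [intros K; now apply H, theta_zero|]. intros w. simpl. ring.
Qed.

Lemma theta_eq0 a : lattice tau a -> theta tau a = 0.
Proof. intros H. destruct (theta_at_lattice a H) as (g & _ & _ & G). rewrite G. ring. Qed.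

(** * The quasi-periodic logarithmic derivative and the elliptic form *)

(** Its translates by periods differ from it by constants, [0] for 1 and [-
    tpi] for tau, so its derivative is elliptic. *)
Definition theta_dlog (w : C) : C := C_derive (theta tau) w / theta tau w.

Lemma cdv_theta w : cdv (theta tau) w (C_derive (theta tau) w).
Proof. apply holo_cdv, holo_theta. Qed.

Lemma theta_nz w : ~ lattice tau w -> theta tau w <> 0.
Proof. intros H K. now apply H, theta_zero. Qed.

Lemma holo_theta_dlog w : ~ lattice tau w -> holo_at theta_dlog w.
Proof. intros H. apply holo_div; [now apply theta_nz|apply holo_derive, holo_theta|apply holo_theta]. Qed.

Lemma cdv_shift f l z m : cdv f (z + l) m -> cdv (fun w => f (w + l)) z m.
Proof. intros H. eapply cdv_eq; [apply (cdv_comp f (fun w => w + l) z m 1); [exact H|]|ring].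
  eapply cdv_eq; [apply cdv_plus; [apply cdv_id|apply cdv_const]|ring]. Qed.

Lemma theta_dlog_1 w : theta_dlog (w + 1) = theta_dlog w.
Proof. unfold theta_dlog. rewrite theta_1. f_equal. apply (cdv_unique (theta tau) w); [|apply cdv_theta].
  apply cdv_ext with (fun w => theta tau (w + 1)); [apply theta_1|]. apply cdv_shift, cdv_theta. Qed.

Lemma theta_dlog_tau w : ~ lattice tau w -> theta_dlog (w + tau) = theta_dlog w - tpi.
Proof.
  intros H. assert (N := theta_nz w H). assert (Nw := ew_nz w). unfold theta_dlog.
  assert (D : C_derive (theta tau) (w + tau) = - / ew w * (C_derive (theta tau) w - tpi * theta tau w)).
  { apply (cdv_unique (fun w => theta tau (w + tau)) w); [apply cdv_shift, cdv_theta|].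
    apply cdv_ext with (fun w => - / ew w * theta tau w); [intros; symmetry; apply theta_tau|].
    eapply cdv_eq; [apply cdv_mult; [apply cdv_opp, cdv_inv; [exact Nw|apply cdv_ew]|apply cdv_theta]|]. cbv beta. field. exact Nw. }
  rewrite D, theta_tau. field. auto.
Qed.

Lemma theta_dlog_lattice l : lattice tau l -> exists c, forall w, ~ lattice tau w -> theta_dlog (w + l) = theta_dlog w + c.
Proof.
  intros Hl. destruct (theta_lattice l Hl) as (A & B & H). exists A. intros w Hw. assert (N := theta_nz w Hw).
  unfold theta_dlog. assert (Nc := cexp_nz (A * w + B)).
  assert (D : C_derive (theta tau) (w + l) = cexp (A * w + B) * (C_derive (theta tau) w + A * theta tau w)).
  { apply (cdv_unique (fun w => theta tau (w + l)) w); [apply cdv_shift, cdv_theta|].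
    apply cdv_ext with (fun w => cexp (A * w + B) * theta tau w); [intros; symmetry; apply H|].
    eapply cdv_eq.
    - apply cdv_mult; [|apply cdv_theta]. apply (cdv_comp cexp (fun w => A * w + B)); [apply cdv_cexp|]. apply cdv_plus; [apply cdv_scal, cdv_id|apply cdv_const].
    - cbv beta. ring. }
  rewrite D, H. field. auto.
Qed.

Lemma theta_dlog_local a : lattice tau a -> exists h, holo_at h a /\ nearP a (fun w => theta_dlog w = / (w - a) + h w).
Proof.
  intros Ha. destruct (theta_at_lattice a Ha) as (g & G1 & G2 & G3).
  exists (fun w => C_derive g w / g w). split; [apply holo_div; auto; now apply holo_derive|].
  generalize (nearC_and _ _ _ (holo_near_cdv _ _ G1) (cont_nonzero _ _ (holo_cont _ _ G1) G2)). apply nearC_imp. intros w [K1 K2] N.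
  assert (Nz := Csub_nz _ _ N). unfold theta_dlog.
  assert (D : C_derive (theta tau) w = (1 - 0) * g w + (w - a) * C_derive g w).
  { apply cdv_C_derive. apply cdv_ext with (fun w => (w - a) * g w); [intros; symmetry; apply G3|].
    exact (cdv_mult _ _ _ _ _ (cdv_minus _ _ _ _ _ (cdv_id w) (cdv_const a w)) K1). }
  rewrite D, G3. field. auto.
Qed.

(** The function of z_1 - z_2 that gives eta: minus the derivative of theta' /
    theta is a Weierstrass function up to a constant, and the constant [PI / Im
    tau] makes its class antiholomorphic (see [eta_prim_rdf]). *)
Definition eta_fun (w : C) : C := if excluded_middle_informative (lattice tau w) then 0 else - (C_derive theta_dlog w + RtoC (PI / Im tau)).

Lemma eta_fun_lattice w : lattice tau w -> eta_fun w = 0.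
Proof. intros H. unfold eta_fun. destruct (excluded_middle_informative (lattice tau w)); tauto. Qed.
Lemma eta_fun_off w : ~ lattice tau w -> eta_fun w = - (C_derive theta_dlog w + RtoC (PI / Im tau)).
Proof. intros H. unfold eta_fun. destruct (excluded_middle_informative (lattice tau w)); tauto. Qed.

Lemma eta_fun_periodic : periodic tau eta_fun.
Proof.
  intros w l Hl. destruct (Classical_Prop.classic (lattice tau w)) as [H|H].
  - rewrite !eta_fun_lattice; auto. now apply lattice_plus.
  - assert (H' : ~ lattice tau (w + l)) by (rewrite lattice_sub_iff; auto). rewrite !eta_fun_off by auto. do 2 f_equal.
    destruct (theta_dlog_lattice l Hl) as [c Hc].
    apply (cdv_unique (fun w => theta_dlog (w + l)) w); [apply cdv_shift, holo_cdv, holo_theta_dlog; auto|].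
    apply cdv_loc with (fun w => theta_dlog w + c).
    + generalize (nonlattice_open tau w Ht H). apply nearC_imp. intros z Hz. now rewrite Hc.
    + eapply cdv_eq; [apply cdv_plus; [apply holo_cdv, holo_theta_dlog; auto|apply cdv_const]|]. ring.
Qed.

Lemma holo_eta_fun w : ~ lattice tau w -> holo_at eta_fun w.
Proof.
  intros H. apply holo_loc with (fun w => - (C_derive theta_dlog w + RtoC (PI / Im tau))).
  - generalize (nonlattice_open tau w Ht H). apply nearC_imp. intros z Hz. now rewrite eta_fun_off.
  - apply holo_opp, holo_plus; [apply holo_derive, holo_theta_dlog; auto|apply holo_const].
Qed.

Lemma eta_fun_local a : lattice tau a -> exists h, holo_at h a /\ nearP a (fun w => eta_fun w = / ((w - a) * (w - a)) + h w).
Proof.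
  intros Ha. destruct (theta_dlog_local a Ha) as (h & H1 & H2).
  exists (fun w => - (C_derive h w + RtoC (PI / Im tau))). split.
  { apply holo_opp, holo_plus; [now apply holo_derive|apply holo_const]. }
  generalize (nearP_and _ _ _ (nonlattice_near tau a Ht) (nearP_and _ _ _ (nearP_open _ _ H2) (nearP_of _ _ (holo_near_cdv _ _ H1)))).
  apply nearC_imp. intros w Hw N. destruct (Hw N) as (K1 & K2 & K3). assert (Nz := Csub_nz _ _ N).
  rewrite eta_fun_off by auto. replace (C_derive theta_dlog w) with (- (1 - 0) / ((w - a) * (w - a)) + C_derive h w). { field. exact Nz. }
  symmetry. apply cdv_C_derive. apply cdv_loc with (fun w => / (w - a) + h w).
  - revert K2. apply nearC_imp. auto.
  - apply cdv_plus; auto. apply (cdv_inv (fun w => w - a)); auto. apply cdv_minus; [apply cdv_id|apply cdv_const].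
Qed.

End Theta.

Lemma holo_shift f l a : holo_at f (a + l) -> holo_at (fun w => f (w + l)) a.
Proof. intros H. apply (holo_comp f (fun w => w + l)); auto. apply holo_plus; [apply holo_id|apply holo_const]. Qed.

(** Subtracting the residue times [theta_dlog] leaves an entire function with
    constant increments along the periods, hence an affine one. Its increment
    along 1 kills the slope, and then the one along tau kills the residue. *)
Lemma simple_pole_const tau f b : 0 < Im tau -> periodic tau f -> (forall a, ~ lattice tau (a - b) -> ordge f a 0) -> ordge f b (-1) ->
  exists c, forall a, nearP a (fun z => f z = c).
Proof.
  intros Ht Hp Hreg (g & G1 & G2). set (r := g b).
  set (k := fun z => f z - r * theta_dlog tau (z + - b)).
  destruct (holo_factor (fun z => g z - r) b) as (g1 & H1 & _ & H2).
  { apply holo_minus; [exact G1|apply holo_const]. } { unfold r; ring. }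
  destruct (entire_glue k) as (F & F1 & F2).
  { intros a. destruct (Classical_Prop.classic (lattice tau (a - b))) as [La|La].
    - destruct (theta_dlog_local tau Ht (a - b) La) as (h & h1 & h2).
      exists (fun z => g1 (z + - (a - b)) - r * h (z + - b)). split.
      + apply holo_minus; [|apply holo_mult; [apply holo_const|]]; apply holo_shift.
        * replace (a + - (a - b)) with b by ring. exact H1.
        * exact h1.
      + generalize (nearP_and _ _ _ (nearP_shift a (- (a - b)) _ ltac:(replace (a + - (a - b)) with b by ring; exact G2)) (nearP_shift a (- b) _ h2)).
        apply nearC_imp. intros z Hz N. destruct (Hz N) as [E1 E2]. unfold k. rewrite E2.
        rewrite <- (Hp z (- (a - b))) by now apply lattice_opp. rewrite E1.
        replace (z + - (a - b) - b) with (z - a) by ring. replace (z + - b - (a - b)) with (z - a) by ring.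
        assert (Nz := Csub_nz _ _ N). specialize (H2 (z + - (a - b))). replace (z + - (a - b) - b) with (z - a) in H2 by ring.
        replace (g (z + - (a - b))) with ((z - a) * g1 (z + - (a - b)) + r) by (rewrite <- H2; ring). simpl. field. exact Nz.
    - destruct (proj1 (ordge_0 _ _) (Hreg a La)) as (h & h1 & h2).
      exists (fun z => h z - r * theta_dlog tau (z + - b)). split.
      + apply holo_minus; auto. apply holo_mult; [apply holo_const|]. apply holo_shift. now apply holo_theta_dlog.
      + revert h2. apply nearP_imp. intros z Hz. unfold k. now rewrite Hz. }
  assert (FT : forall l c, lattice tau l -> (forall w, ~ lattice tau w -> theta_dlog tau (w + l) = theta_dlog tau w + c) -> forall z, F (z + l) = F z - r * c).
  { intros l c Hl Hc z. apply (cont_agree (fun z => F (z + l)) (fun z => F z - r * c) z).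
    - apply holo_cont, holo_shift, F1.
    - apply cont_minus; [apply holo_cont, F1|apply cont_const].
    - generalize (nearP_and _ _ _ (nearP_and _ _ _ (F2 z) (nearP_shift z l _ (F2 (z + l)))) (nearP_shift z (- b) _ (nonlattice_near tau (z + - b) Ht))).
      apply nearP_imp. intros w [[E1 E2] E3]. rewrite <- E1, <- E2. unfold k. rewrite Hp by auto.
      replace (w + l + - b) with (w + - b + l) by ring. rewrite Hc by auto. ring. }
  assert (DP : periodic tau (C_derive F)).
  { intros z l Hl. destruct (theta_dlog_lattice tau Ht l Hl) as [c Hc]. specialize (FT l c Hl Hc).
    apply (cdv_unique (fun w => F (w + l)) z); [apply cdv_shift, holo_cdv, F1|].
    apply cdv_ext with (fun w => F w - r * c); [intros; symmetry; apply FT|].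
    eapply cdv_eq; [apply cdv_minus; [apply holo_cdv, F1|apply cdv_const]|ring]. }
  assert (DC := periodic_const tau (C_derive F) Ht DP (fun z => holo_derive _ _ (F1 z))).
  set (s := C_derive F 0) in *.
  assert (FA : forall z, F z - s * z = F 0 - s * 0).
  { intros z. apply (C_const_of_cdv0 (fun z => F z - s * z)). intros w. eapply cdv_eq.
    - apply cdv_minus; [apply holo_cdv, F1|apply cdv_scal, cdv_id].
    - rewrite (DC w 0). fold s. ring. }
  assert (FE : forall z, F z = F 0 + s * z). { intros z. specialize (FA z). replace (F z) with (F z - s * z + s * z) by ring. rewrite FA. ring. }
  assert (S0 : s = 0).
  { assert (K0 : forall w, ~ lattice tau w -> theta_dlog tau (w + 1) = theta_dlog tau w + 0) by (intros; rewrite theta_dlog_1 by auto; ring).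
    assert (K := FT 1 0 (lattice_1 tau) K0 0). rewrite Cplus_0_l, (FE 1) in K.
    replace s with (F 0 + s * 1 - F 0) by ring. rewrite K. ring. }
  assert (R0 : r = 0).
  { assert (K0 : forall w, ~ lattice tau w -> theta_dlog tau (w + tau) = theta_dlog tau w + - tpi) by (intros; rewrite theta_dlog_tau by auto; ring).
    assert (K := FT tau (- tpi) (lattice_tau tau) K0 0). rewrite Cplus_0_l, (FE tau), S0 in K.
    apply Classical_Prop.NNPP. intros N. apply (Cmult_neq_0 r tpi N tpi_nz).
    replace (r * tpi) with (F 0 - r * - tpi - (F 0 + 0 * tau)) by ring. rewrite <- K. ring. }
  exists (F 0). intros a. generalize (F2 a). apply nearP_imp. intros z E. unfold k in E. rewrite R0 in E.
  replace (f z) with (f z - 0 * theta_dlog tau (z + - b)) by ring. rewrite E, FE, S0. ring.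
Qed.

(** * Real differentials *)

(** Real differentiability of a complex function, [L] being the differential;
    antiholomorphic forms require it. *)
Definition rdf (G : C -> C) (z : C) (L : C -> C) : Prop :=
  forall eps : R, 0 < eps -> exists d : R, 0 < d /\ forall h, Cmod h < d -> Cmod (G (z + h) - G z - L h) <= eps * Cmod h.

Lemma rdfE (G : C -> C) z (a b : C) :
  filterdiff (K := R_AbsRing) (U := C_R_NormedModule) (V := C_R_NormedModule) G (locally z) (fun dz : C => a * dz + b * Cconj dz) <->
  rdf G z (fun h => a * h + b * Cconj h).
Proof.
  split.
  - intros [_ H] eps He. specialize (H z (fun P K => K) (mkposreal _ He)). apply (locally_CE z) in H. destruct H as (d & Hd & H).
    exists d. split; auto. intros h Hh. specialize (H (z + h)). replace (z + h - z) with h in H by ring. specialize (H Hh).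
    change (norm (K := R_AbsRing) (V := C_R_NormedModule) (G (z + h) + - G z + - (a * (z + h + - z) + b * Cconj (z + h + - z))) <= eps * norm (K := R_AbsRing) (V := C_R_NormedModule) (z + h + - z)) in H.
    rewrite !norm_CR in H. replace (z + h + - z) with h in H by ring. exact H.
  - intros H. split.
    + split.
      * intros x y. change (a * (x + y) + b * Cconj (x + y) = a * x + b * Cconj x + (a * y + b * Cconj y)).
        replace (Cconj (x + y)) with (Cconj x + Cconj y) by (apply C_ext; unfold Re, Im; simpl; ring). ring.
      * intros k x. rewrite !scal_R_Cmult. replace (Cconj (k * x)) with (k * Cconj x) by (destruct x; apply C_ext; unfold Re, Im; simpl; ring).
        change (a * (k * x) + b * (k * Cconj x) = k * (a * x + b * Cconj x)). ring.
      * exists (Cmod a + Cmod b + 1)%R. generalize (Cmod_ge_0 a) (Cmod_ge_0 b). intros. split; [lra|]. intros x. rewrite !norm_CR.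
        eapply Rle_trans; [apply Cmod_triangle|]. rewrite !Cmod_mult, Cmod_conj. generalize (Cmod_ge_0 x). nra.
    + intros x Hx. assert (E : z = x) by (apply (is_filter_lim_locally_unique (K := R_AbsRing) (V := C_R_NormedModule)) in Hx; exact Hx). subst x.
      intros [eps He]. destruct (H eps He) as (d & Hd & K). apply (locally_CE z). exists d. split; auto. intros y Hy.
      specialize (K _ Hy). replace (z + (y - z)) with y in K by ring.
      change (norm (K := R_AbsRing) (V := C_R_NormedModule) (G y + - G z + - (a * (y + - z) + b * Cconj (y + - z))) <= eps * norm (K := R_AbsRing) (V := C_R_NormedModule) (y + - z)).
      rewrite !norm_CR. exact K.
Qed.

Lemma rdf_ext (G : C -> C) z L L' : (forall h, L h = L' h) -> rdf G z L -> rdf G z L'.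
Proof. intros E H eps He. destruct (H eps He) as (d & Hd & K). exists d. split; auto. intros h Hh. rewrite <- E. auto. Qed.
Lemma rdf_loc (G G' : C -> C) z L : nearC z (fun w => G w = G' w) -> rdf G z L -> rdf G' z L.
Proof. intros E H eps He. assert (E0 := nearC_pt _ _ E). apply locally_CE in E. destruct E as (d0 & Hd0 & E). destruct (H eps He) as (d & Hd & K).
  exists (Rmin d0 d). split; [now apply Rmin_glb_lt|]. intros h Hh. rewrite <- E0, <- E.
  - apply K. eapply Rlt_le_trans; [exact Hh|apply Rmin_r].
  - replace (z + h - z) with h by ring. eapply Rlt_le_trans; [exact Hh|apply Rmin_l]. Qed.
Lemma rdf_plus (G G' : C -> C) z L L' : rdf G z L -> rdf G' z L' -> rdf (fun w => G w + G' w) z (fun h => L h + L' h).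
Proof. intros H H' eps He. destruct (H (eps / 2)%R ltac:(lra)) as (d & Hd & K). destruct (H' (eps / 2)%R ltac:(lra)) as (d' & Hd' & K').
  exists (Rmin d d'). split; [now apply Rmin_glb_lt|]. intros h Hh.
  specialize (K h (Rlt_le_trans _ _ _ Hh (Rmin_l _ _))). specialize (K' h (Rlt_le_trans _ _ _ Hh (Rmin_r _ _))).
  replace (G (z + h) + G' (z + h) - (G z + G' z) - (L h + L' h)) with ((G (z + h) - G z - L h) + (G' (z + h) - G' z - L' h)) by ring.
  eapply Rle_trans; [apply Cmod_triangle|lra]. Qed.
Lemma rdf_cdv f z l : cdv f z l -> rdf f z (fun h => l * h).
Proof. auto. Qed.
Lemma rdf_lin (G : C -> C) z : (forall x y, G (x + y) = G x + G y) -> rdf G z G.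
Proof. intros H eps He. exists 1%R. split; [lra|]. intros h _. rewrite H. replace (G z + G h - G z - G h) with (RtoC 0) by ring.
  rewrite Cmod_0. apply Rmult_le_pos; [lra|apply Cmod_ge_0]. Qed.
Lemma rdf_scal (c : C) (G : C -> C) z L : rdf G z L -> rdf (fun w => c * G w) z (fun h => c * L h).
Proof. intros H eps He. assert (P := Cmod_ge_0 c). destruct (H (eps / (Cmod c + 1))%R) as (d & Hd & K). { apply Rdiv_lt_0_compat; lra. }
  exists d. split; auto. intros h Hh. replace (c * G (z + h) - c * G z - c * L h) with (c * (G (z + h) - G z - L h)) by ring.
  rewrite Cmod_mult. specialize (K h Hh). assert (P2 := Cmod_ge_0 h).
  apply Rle_trans with (Cmod c * (eps / (Cmod c + 1) * Cmod h))%R; [now apply Rmult_le_compat_l|].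
  replace (Cmod c * (eps / (Cmod c + 1) * Cmod h))%R with (eps * Cmod h * (Cmod c / (Cmod c + 1)))%R by (field; lra).
  rewrite <- (Rmult_1_r (eps * Cmod h)) at 2. apply Rmult_le_compat_l; [nra|].
  apply Rmult_le_reg_r with (Cmod c + 1)%R; [lra|]. unfold Rdiv. rewrite Rmult_assoc, Rinv_l; lra. Qed.
Lemma rdf_comp_mul (G : C -> C) (u z : C) L : u <> 0 -> rdf G (u * z) L -> rdf (fun w => G (u * w)) z (fun h => L (u * h)).
Proof. intros Nu H eps He. assert (P : 0 < Cmod u) by now apply Cmod_gt_0.
  destruct (H (eps / Cmod u)%R) as (d & Hd & K). { now apply Rdiv_lt_0_compat. }
  exists (d / Cmod u)%R. split; [now apply Rdiv_lt_0_compat|]. intros h Hh. specialize (K (u * h)). rewrite Cmod_mult in K.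
  replace (u * (z + h)) with (u * z + u * h) by ring. 
  assert (Cmod u * Cmod h < d). { apply Rmult_lt_compat_l with (r := Cmod u) in Hh; auto. replace (Cmod u * (d / Cmod u))%R with d in Hh by (field; lra). exact Hh. }
  specialize (K H0). replace (eps / Cmod u * (Cmod u * Cmod h))%R with (eps * Cmod h)%R in K by (field; lra). exact K. Qed.

Section Primitive.
Variable tau : C.
Hypothesis Ht : 0 < Im tau.

(** The term linear in Im w compensates the increment [- tpi] of [theta_dlog]
    along tau. It is the price for a single-valued primitive: its differential
    contributes both the constant of [eta_fun] and an antiholomorphic form. *)
Definition eta_prim (w : C) : C := if excluded_middle_informative (lattice tau w) then 0 else - (theta_dlog tau w + tpi * RtoC (Im w / Im tau)).

Lemma eta_prim_lattice w : lattice tau w -> eta_prim w = 0.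
Proof. intros H. unfold eta_prim. destruct (excluded_middle_informative (lattice tau w)); tauto. Qed.
Lemma eta_prim_off w : ~ lattice tau w -> eta_prim w = - (theta_dlog tau w + tpi * RtoC (Im w / Im tau)).
Proof. intros H. unfold eta_prim. destruct (excluded_middle_informative (lattice tau w)); tauto. Qed.

Lemma eta_prim_periodic : periodic tau eta_prim.
Proof.
  assert (Q : forall l, lattice tau l -> (lattice tau l /\ forall w, eta_prim (w + l) = eta_prim w)).
  { apply lattice_ind.
    - split; [apply lattice_1|]. intros w. destruct (Classical_Prop.classic (lattice tau w)) as [H|H].
      + rewrite !eta_prim_lattice; auto. apply lattice_plus; auto using lattice_1.
      + rewrite !eta_prim_off; auto. 2:{ rewrite lattice_sub_iff; auto using lattice_1. } rewrite theta_dlog_1, Im_plus, im_RtoC, Rplus_0_r by auto. reflexivity.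
    - split; [apply lattice_tau|]. intros w. destruct (Classical_Prop.classic (lattice tau w)) as [H|H].
      + rewrite !eta_prim_lattice; auto. apply lattice_plus; auto using lattice_tau.
      + rewrite !eta_prim_off; auto. 2:{ rewrite lattice_sub_iff; auto using lattice_tau. } rewrite theta_dlog_tau, Im_plus by auto.
        replace ((Im w + Im tau) / Im tau)%R with (Im w / Im tau + 1)%R by (field; lra). rewrite RtoC_plus. ring.
    - intros l l' [L1 H1] [L2 H2]. split; [now apply lattice_plus|]. intros w. rewrite Cplus_assoc, H2, H1. reflexivity.
    - intros l [L1 H1]. split; [now apply lattice_opp|]. intros w. rewrite <- (H1 (w + - l)). f_equal. ring. }
  intros w l Hl. now apply Q.
Qed.

Lemma eta_prim_rdf z : ~ lattice tau z -> rdf eta_prim z (fun h => eta_fun tau z * h + RtoC (PI / Im tau) * Cconj h).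
Proof.
  intros Hz. apply rdf_loc with (fun w => - (1) * theta_dlog tau w + - tpi * RtoC (Im w / Im tau)).
  { generalize (nonlattice_open tau z Ht Hz). apply nearC_imp. intros w Hw. rewrite eta_prim_off by auto. ring. }
  apply rdf_ext with (fun h => - (1) * (C_derive (theta_dlog tau) z * h) + - tpi * RtoC (Im h / Im tau)).
  2:{ apply rdf_plus; apply rdf_scal.
      - apply rdf_cdv, holo_cdv, holo_theta_dlog; auto.
      - apply (rdf_lin (fun h => RtoC (Im h / Im tau))). intros x y. rewrite Im_plus, <- RtoC_plus. f_equal. field. lra. }
  intros h. rewrite eta_fun_off by auto. unfold tpi.
  replace (- (RtoC (2 * PI) * Ci) * RtoC (Im h / Im tau)) with (RtoC (PI / Im tau) * (Cconj h - h)). { ring. }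
  destruct h as [x y]. apply C_ext; unfold Re, Im; simpl; field; exact (Rgt_not_eq _ _ Ht).
Qed.
End Primitive.

(** * Gradients and metrics of constant curvature *)

(** [p] encodes the gradient as d/dx - i d/dy, so that harmonic functions are
    those for which [p] is holomorphic. *)
Definition is_grad (k : C -> R) (w p : C) : Prop :=
  forall eps : R, 0 < eps -> exists d : R, 0 < d /\ forall h, Cmod h < d -> Rabs (k (w + h)%C - k w - Re (p * h)%C) <= eps * Cmod h.

Lemma grad_small k w p : is_grad k w p -> forall eps : R, 0 < eps -> exists d : R, 0 < d /\ forall h, Cmod h < d ->
  Rabs (k (w + h)%C - k w) <= (Cmod p + 1) * Cmod h /\ Rabs (k (w + h)%C - k w) < eps.
Proof.
  intros H eps He. destruct (H 1%R Rlt_0_1) as (d & Hd & K). assert (P := Cmod_ge_0 p).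
  exists (Rmin d (eps / (Cmod p + 1))). split. { apply Rmin_glb_lt; auto. apply Rdiv_lt_0_compat; lra. }
  intros h Hh. specialize (K h (Rlt_le_trans _ _ _ Hh (Rmin_l _ _))).
  assert (A1 : Rabs (k (w + h)%C - k w) <= (Cmod p + 1) * Cmod h).
  { replace (k (w + h)%C - k w)%R with ((k (w + h)%C - k w - Re (p * h)%C) + Re (p * h)%C)%R by ring.
    eapply Rle_trans; [apply Rabs_triang|]. assert (T := re_le_Cmod (p * h)). rewrite Cmod_mult in T. lra. }
  split; auto. eapply Rle_lt_trans; [exact A1|].
  assert (Hh2 := Rlt_le_trans _ _ _ Hh (Rmin_r _ _)). apply Rmult_lt_compat_l with (r := (Cmod p + 1)%R) in Hh2; [|lra].
  replace ((Cmod p + 1) * (eps / (Cmod p + 1)))%R with eps in Hh2 by (field; lra). exact Hh2.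
Qed.

Lemma grad_loc k k' w p : nearC w (fun z => k z = k' z) -> is_grad k w p -> is_grad k' w p.
Proof. intros E H eps He. assert (E0 := nearC_pt _ _ E). apply locally_CE in E. destruct E as (d0 & Hd0 & E). destruct (H eps He) as (d & Hd & K).
  exists (Rmin d0 d). split; [now apply Rmin_glb_lt|]. intros h Hh. rewrite <- E0, <- E.
  - apply K. eapply Rlt_le_trans; [exact Hh|apply Rmin_r].
  - replace (w + h - w) with h by ring. eapply Rlt_le_trans; [exact Hh|apply Rmin_l]. Qed.
Lemma grad_eq k w p p' : is_grad k w p -> p = p' -> is_grad k w p'.
Proof. now intros H <-. Qed.
Lemma grad_plus k k' w p p' : is_grad k w p -> is_grad k' w p' -> is_grad (fun z => k z + k' z)%R w (p + p').
Proof. intros H H' eps He. destruct (H (eps / 2)%R ltac:(lra)) as (d & Hd & K). destruct (H' (eps / 2)%R ltac:(lra)) as (d' & Hd' & K').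
  exists (Rmin d d'). split; [now apply Rmin_glb_lt|]. intros h Hh.
  specialize (K h (Rlt_le_trans _ _ _ Hh (Rmin_l _ _))). specialize (K' h (Rlt_le_trans _ _ _ Hh (Rmin_r _ _))).
  replace ((p + p') * h) with (p * h + p' * h) by ring. rewrite Re_plus.
  replace (k (w + h)%C + k' (w + h)%C - (k w + k' w) - (Re (p * h)%C + Re (p' * h)%C))%R with ((k (w + h)%C - k w - Re (p * h)%C) + (k' (w + h)%C - k' w - Re (p' * h)%C))%R by ring.
  eapply Rle_trans; [apply Rabs_triang|lra]. Qed.
Lemma grad_chain (f : R -> R) k w p d : derivable_pt_lim f (k w) d -> is_grad k w p -> is_grad (fun z => f (k z)) w (RtoC d * p).
Proof.
  intros Hf Hk eps He. assert (P := Cmod_ge_0 p). assert (Pd := Rabs_pos d).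
  destruct (Hf (eps / (2 * (Cmod p + 1)))%R) as [e He1]. { apply Rdiv_lt_0_compat; lra. }
  destruct (grad_small k w p Hk e (cond_pos e)) as (d1 & Hd1 & K1).
  destruct (Hk (eps / (2 * (Rabs d + 1)))%R) as (d2 & Hd2 & K2). { apply Rdiv_lt_0_compat; lra. }
  exists (Rmin d1 d2). split; [now apply Rmin_glb_lt|]. intros h Hh.
  destruct (K1 h (Rlt_le_trans _ _ _ Hh (Rmin_l _ _))) as [B1 B2]. specialize (K2 h (Rlt_le_trans _ _ _ Hh (Rmin_r _ _))).
  set (t := (k (w + h)%C - k w)%R) in *.
  assert (C1 : Rabs (f (k w + t)%R - f (k w) - d * t) <= eps / (2 * (Cmod p + 1)) * Rabs t).
  { destruct (Req_dec t 0) as [->|N].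
    - rewrite Rplus_0_r. replace (f (k w) - f (k w) - d * 0)%R with 0%R by ring. rewrite Rabs_R0. lra.
    - specialize (He1 t N B2). replace (f (k w + t)%R - f (k w) - d * t)%R with (((f (k w + t)%R - f (k w)) / t - d) * t)%R by (field; auto).
      rewrite Rabs_mult. apply Rmult_le_compat_r; [apply Rabs_pos|lra]. }
  replace (k (w + h)%C) with (k w + t)%R by (unfold t; ring).
  replace (d * p * h) with (d * (p * h)) by ring. rewrite Re_Rmult.
  replace (f (k w + t) - f (k w) - d * Re (p * h)%C)%R with ((f (k w + t) - f (k w) - d * t) + d * (t - Re (p * h)%C))%R by ring.
  eapply Rle_trans; [apply Rabs_triang|]. rewrite Rabs_mult.
  assert (Ph := Cmod_ge_0 h).
  assert (D1 : eps / (2 * (Cmod p + 1)) * Rabs t <= eps / 2 * Cmod h).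
  { apply Rle_trans with (eps / (2 * (Cmod p + 1)) * ((Cmod p + 1) * Cmod h))%R.
    - apply Rmult_le_compat_l; auto. left. apply Rdiv_lt_0_compat; lra.
    - right. field. lra. }
  assert (D2 : Rabs d * Rabs (t - Re (p * h)%C) <= eps / 2 * Cmod h).
  { apply Rle_trans with ((Rabs d + 1) * (eps / (2 * (Rabs d + 1)) * Cmod h))%R.
    - apply Rmult_le_compat; auto using Rabs_pos; lra.
    - right. field. lra. }
  lra.
Qed.
Lemma grad_scal (c : R) k w p : is_grad k w p -> is_grad (fun z => c * k z)%R w (RtoC c * p).
Proof. intros H. apply (grad_chain (fun t => c * t)%R k w p c); auto.
  apply is_derive_Reals. auto_derive; auto; ring. Qed.
Lemma grad_const (c : R) w : is_grad (fun _ => c) w 0.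
Proof. intros eps He. exists 1%R. split; [lra|]. intros h _. replace (0 * h) with (RtoC 0) by ring. rewrite re_RtoC.
  replace (c - c - 0)%R with 0%R by ring. rewrite Rabs_R0. apply Rmult_le_pos; [lra|apply Cmod_ge_0]. Qed.
Lemma grad_Re f w l : cdv f w l -> is_grad (fun z => Re (f z)) w l.
Proof. intros H eps He. destruct (H eps He) as (d & Hd & K). exists d. split; auto. intros h Hh.
  eapply Rle_trans; [|apply (K h Hh)]. apply (re_le_Cmod (f (w + h)%C - f w - l * h)). Qed.
Lemma grad_Im w : is_grad Im w (- Ci).
Proof. intros eps He. exists 1%R. split; [lra|]. intros h _. replace (Im (w + h) - Im w - Re (- Ci * h)%C)%R with 0%R.
  - rewrite Rabs_R0. apply Rmult_le_pos; [lra|apply Cmod_ge_0]. - rewrite Im_plus. unfold Re, Im; simpl; ring. Qed.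

Lemma grad_comp_mul k (u w p : C) : u <> 0 -> is_grad k (u * w) p -> is_grad (fun z => k (u * z)) w (u * p).
Proof. intros Nu H eps He. assert (P : 0 < Cmod u) by now apply Cmod_gt_0.
  destruct (H (eps / Cmod u)%R) as (d & Hd & K). { now apply Rdiv_lt_0_compat. }
  exists (d / Cmod u)%R. split; [now apply Rdiv_lt_0_compat|]. intros h Hh. specialize (K (u * h)). rewrite Cmod_mult in K.
  replace (u * (w + h)) with (u * w + u * h) by ring. 
  assert (Cmod u * Cmod h < d). { apply Rmult_lt_compat_l with (r := Cmod u) in Hh; auto. replace (Cmod u * (d / Cmod u))%R with d in Hh by (field; lra). exact Hh. }
  specialize (K H0). replace (eps / Cmod u * (Cmod u * Cmod h))%R with (eps * Cmod h)%R in K by (field; lra).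
  replace (u * p * h) with (p * (u * h)) by ring. exact K. Qed.

Lemma Cmod2_plus a b : (Cmod (a + b) ^ 2 = Cmod a ^ 2 + 2 * Re (Cconj a * b)%C + Cmod b ^ 2)%R.
Proof. rewrite !Cmod2_alt, Re_plus, Im_plus. unfold Re, Im; simpl; ring. Qed.

Lemma grad_Cmod2 f w l : cdv f w l -> is_grad (fun z => Cmod (f z) ^ 2)%R w (2 * (Cconj (f w) * l)).
Proof.
  intros H eps He. set (a := f w). assert (Pa := Cmod_ge_0 a). assert (Pl := Cmod_ge_0 l).
  set (e := Rmin 1 (eps / (4 * (Cmod a + 1)))). assert (He1 : 0 < e) by (apply Rmin_glb_lt; [lra|apply Rdiv_lt_0_compat; lra]).
  assert (He2 : e <= 1) by apply Rmin_l.
  assert (He3 : e * (4 * (Cmod a + 1)) <= eps).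
  { assert (T : e <= eps / (4 * (Cmod a + 1))) by apply Rmin_r. apply Rmult_le_compat_r with (r := (4 * (Cmod a + 1))%R) in T; [|lra].
    replace (eps / (4 * (Cmod a + 1)) * (4 * (Cmod a + 1)))%R with eps in T by (field; lra). exact T. }
  destruct (H e He1) as (d & Hd & K).
  set (m := ((Cmod l + 1) * (Cmod l + 1))%R).
  assert (Hm : 0 < m) by (unfold m; nra).
  exists (Rmin d (eps / (2 * m))). split; [apply Rmin_glb_lt; auto; apply Rdiv_lt_0_compat; lra|]. intros h Hh.
  specialize (K h (Rlt_le_trans _ _ _ Hh (Rmin_l _ _))). assert (Hh2 := Rlt_le_trans _ _ _ Hh (Rmin_r _ _)).
  set (b := f (w + h)%C - f w). fold b in K.
  replace (f (w + h)%C) with (a + b) by (unfold a, b; ring). rewrite Cmod2_plus.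
  assert (Pb : Cmod b <= (Cmod l + 1) * Cmod h).
  { replace b with (b - l * h + l * h) by ring. eapply Rle_trans; [apply Cmod_triangle|]. rewrite Cmod_mult. assert (Ph := Cmod_ge_0 h). nra. }
  replace (Cmod a ^ 2 + 2 * Re (Cconj a * b)%C + Cmod b ^ 2 - Cmod a ^ 2 - Re (2 * (Cconj a * l) * h)%C)%R with (2 * Re (Cconj a * (b - l * h))%C + Cmod b ^ 2)%R.
  2:{ replace (2 * (Cconj a * l) * h) with (RtoC 2 * (Cconj a * (l * h))) by ring. rewrite Re_Rmult.
      replace (Cconj a * (b - l * h)) with (Cconj a * b - Cconj a * (l * h)) by ring. rewrite Re_minus. ring. }
  eapply Rle_trans; [apply Rabs_triang|]. rewrite (Rabs_pos_eq (Cmod b ^ 2)) by apply pow2_ge_0.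
  rewrite Rabs_mult, (Rabs_pos_eq 2) by lra.
  assert (T := re_le_Cmod (Cconj a * (b - l * h))). rewrite Cmod_mult, Cmod_conj in T.
  assert (Ph := Cmod_ge_0 h). assert (Pb0 := Cmod_ge_0 b).
  assert (T2 : Cmod a * Cmod (b - l * h) <= Cmod a * (e * Cmod h)) by (apply Rmult_le_compat_l; auto).
  assert (T3 : Cmod b ^ 2 <= m * Cmod h * Cmod h).
  { replace (m * Cmod h * Cmod h)%R with (((Cmod l + 1) * Cmod h) ^ 2)%R by (unfold m; ring). apply pow_incr. lra. }
  assert (T4 : m * Cmod h <= eps / 2).
  { apply Rmult_lt_compat_l with (r := m) in Hh2; auto. replace (m * (eps / (2 * m)))%R with (eps / 2)%R in Hh2 by (field; lra). lra. }
  assert (T5 : m * Cmod h * Cmod h <= eps / 2 * Cmod h) by (apply Rmult_le_compat_r; auto).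
  assert (T6 : 4 * (Cmod a * e) * Cmod h <= eps * Cmod h) by (apply Rmult_le_compat_r; auto; nra).
  nra.
Qed.

Lemma Cconj_nz (z : C) : z <> 0 -> Cconj z <> 0.
Proof. intros N K. apply N. apply Cmod_eq_0. rewrite <- Cmod_conj, K. apply Cmod_0. Qed.

Lemma grad_ln_Cmod2 (f : C -> C) w l : f w <> 0 -> cdv f w l -> is_grad (fun z => ln (Cmod (f z) ^ 2)) w (2 * (l / f w)).
Proof.
  intros N H. assert (P : 0 < Cmod (f w)) by now apply Cmod_gt_0. assert (P2 : (0 < Cmod (f w) ^ 2)%R) by (apply pow_lt; auto).
  eapply grad_eq; [apply (grad_chain ln (fun z => Cmod (f z) ^ 2)%R); [apply derivable_pt_lim_ln; exact P2|apply grad_Cmod2; exact H]|].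
  rewrite RtoC_inv by lra. assert (E : RtoC (Cmod (f w) ^ 2) = f w * Cconj (f w)) by apply Cmod2_conj.
  rewrite E. assert (Nc := Cconj_nz _ N).
  field. auto.
Qed.

Lemma grad_unique k w p p' : is_grad k w p -> is_grad k w p' -> p = p'.
Proof.
  intros H H'. apply Ceq_minus. apply Classical_Prop.NNPP. intros N. assert (P : 0 < Cmod (p - p')) by now apply Cmod_gt_0.
  destruct (H (Cmod (p - p') / 4)%R ltac:(lra)) as (d & Hd & K). destruct (H' (Cmod (p - p') / 4)%R ltac:(lra)) as (d' & Hd' & K').
  set (m := Rmin d d'). assert (Hm : 0 < m) by now apply Rmin_glb_lt. assert (m <= d) by apply Rmin_l. assert (m <= d') by apply Rmin_r.
  set (s := (m / (2 * Cmod (p - p')))%R). assert (Hs : 0 < s) by (apply Rdiv_lt_0_compat; lra).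
  set (h := RtoC s * Cconj (p - p')).
  assert (Mh : Cmod h = (m / 2)%R). { unfold h. rewrite Cmod_mult, Cmod_conj, Cmod_R, Rabs_pos_eq by lra. unfold s. field. lra. }
  specialize (K h ltac:(lra)). specialize (K' h ltac:(lra)).
  assert (E : (Re (p * h)%C - Re (p' * h)%C)%R = (Cmod (p - p') * (m / 2))%R).
  { rewrite <- Re_minus. replace (p * h - p' * h)%C with (RtoC s * ((p - p') * Cconj (p - p'))) by (unfold h; ring).
    rewrite <- Cmod2_conj, <- RtoC_mult, re_RtoC. unfold s. field. lra. }
  assert (T := Rabs_triang (k (w + h)%C - k w - Re (p' * h)%C) (- (k (w + h)%C - k w - Re (p * h)%C))). rewrite Rabs_Ropp in T.
  replace (k (w + h)%C - k w - Re (p' * h)%C + - (k (w + h)%C - k w - Re (p * h)%C))%R with (Re (p * h)%C - Re (p' * h)%C)%R in T by ring.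
  rewrite E, Rabs_pos_eq in T by (apply Rmult_le_pos; lra). rewrite Mh in *. nra.
Qed.

Lemma grad_partials k w p : is_grad k w p ->
  is_derive (fun x => k (x, Im w)) (Re w) (Re p) /\ is_derive (fun y => k (Re w, y)) (Im w) (- Im p)%R.
Proof.
  intros H. destruct w as [x0 y0]. cbn [Re Im fst snd]. split; apply is_derive_Reals; intros eps He;
  destruct (H (eps / 2)%R ltac:(lra)) as (d & Hd & K); exists (mkposreal d Hd); simpl; intros h N Hh.
  - specialize (K (RtoC h)). rewrite Cmod_R in K. specialize (K Hh).
    replace ((x0, y0) + RtoC h) with ((x0 + h)%R, y0) in K by (apply C_ext; unfold Re, Im; simpl; ring).
    replace (Re (p * h)%C) with (Re p * h)%R in K by (unfold Re; simpl; ring).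
    apply Rmult_lt_reg_r with (Rabs h); [now apply Rabs_pos_lt|]. rewrite <- Rabs_mult.
    replace (((k ((x0 + h)%R, y0) - k (x0, y0)) / h - Re p) * h)%R with (k ((x0 + h)%R, y0) - k (x0, y0) - Re p * h)%R by (field; auto).
    assert (0 < Rabs h) by now apply Rabs_pos_lt. unfold Re, Im in *. cbn [fst snd] in *. nra.
  - specialize (K (RtoC h * Ci)). rewrite Cmod_mult, Cmod_Ci, Cmod_R, Rmult_1_r in K. specialize (K Hh).
    replace ((x0, y0) + RtoC h * Ci) with (x0, (y0 + h)%R) in K by (apply C_ext; unfold Re, Im; simpl; ring).
    replace (Re (p * (h * Ci))%C) with (- Im p * h)%R in K by (unfold Re, Im; simpl; ring).
    apply Rmult_lt_reg_r with (Rabs h); [now apply Rabs_pos_lt|]. rewrite <- Rabs_mult.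
    replace (((k (x0, (y0 + h)%R) - k (x0, y0)) / h - - Im p) * h)%R with (k (x0, (y0 + h)%R) - k (x0, y0) - - Im p * h)%R by (field; auto).
    assert (0 < Rabs h) by now apply Rabs_pos_lt. unfold Re, Im in *. cbn [fst snd] in *. nra.
Qed.

Lemma grad_dxy k w p : is_grad k w p -> d_x k w = Re p /\ d_y k w = (- Im p)%R.
Proof. intros H. destruct (grad_partials k w p H) as [H1 H2]. split; now apply is_derive_unique. Qed.

Notation contR := (continuous (T := C_UniformSpace) (U := R_UniformSpace)).

Lemma contRE (k : C -> R) w : contR k w <-> forall eps : R, 0 < eps -> nearC w (fun z => Rabs (k z - k w) < eps).
Proof.
  split.
  - intros H eps He. apply (H (fun y => Rabs (y - k w) < eps)). exists (mkposreal eps He). intros y Hy. exact Hy.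
  - intros H P [e He]. generalize (H e (cond_pos e)). apply nearC_imp. intros z Hz. apply He. exact Hz.
Qed.

Lemma grad_contR k w p : is_grad k w p -> contR k w.
Proof. intros H. apply contRE. intros eps He. destruct (grad_small k w p H eps He) as (d & Hd & K). apply locally_CE. exists d. split; auto.
  intros z Hz. specialize (K _ Hz). replace (w + (z - w)) with z in K by ring. apply K. Qed.

Lemma Cn_at_loc n : forall k k' a, nearC a (fun w => k w = k' w) -> Cn_at n k a -> Cn_at n k' a.
Proof.
  assert (CL : forall (k k' : C -> R) (w : C), nearC w (fun z => k z = k' z) -> contR k w -> contR k' w).
  { intros k k' w E H. rewrite contRE in *. intros eps He. generalize (nearC_and _ _ _ E (H eps He)). apply nearC_imp.
    intros z [E1 E2]. now rewrite <- E1, <- (nearC_pt _ _ E). }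
  assert (X : forall (k k' : C -> R) (w : C), nearC w (fun z => k z = k' z) -> locally (Re w) (fun x => k (x, Im w) = k' (x, Im w))).
  { intros k k' w E. apply locally_CE in E. destruct E as (d & Hd & E). exists (mkposreal d Hd). intros x Hx. apply E.
    replace ((x, Im w) - w) with (RtoC (x - Re w)); [now rewrite Cmod_R|]. apply C_ext; unfold Re, Im; simpl; ring. }
  assert (Y : forall (k k' : C -> R) (w : C), nearC w (fun z => k z = k' z) -> locally (Im w) (fun y => k (Re w, y) = k' (Re w, y))).
  { intros k k' w E. apply locally_CE in E. destruct E as (d & Hd & E). exists (mkposreal d Hd). intros y Hy. apply E.
    replace ((Re w, y) - w) with (RtoC (y - Im w) * Ci); [now rewrite Cmod_mult, Cmod_Ci, Cmod_R, Rmult_1_r|]. apply C_ext; unfold Re, Im; simpl; ring. }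
  induction n; intros k k' a E H.
  - simpl in *. generalize (nearC_and _ _ _ (nearC_open _ _ E) H). apply nearC_imp. intros w [K1 K2]. now apply CL with k.
  - destruct H as (H1 & H2 & H3). repeat split.
    + generalize (nearC_and _ _ _ (nearC_open _ _ E) H1). apply nearC_imp. intros w [K1 (K2 & K3 & K4)]. repeat split.
      * now apply CL with k.
      * apply ex_derive_ext_loc with (fun x => k (x, Im w)); auto.
      * apply ex_derive_ext_loc with (fun y => k (Re w, y)); auto.
    + apply IHn with (d_x k); auto. generalize (nearC_open _ _ E). apply nearC_imp. intros w K. now apply Derive_ext_loc, X.
    + apply IHn with (d_y k); auto. generalize (nearC_open _ _ E). apply nearC_imp. intros w K. now apply Derive_ext_loc, Y.
Qed.

Lemma smooth_step n k p a : nearC a (fun w => is_grad k w (p w)) -> Cn_at n (fun w => Re (p w)) a -> Cn_at n (fun w => - Im (p w))%R a -> Cn_at (S n) k a.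
Proof.
  intros H H1 H2. repeat split.
  - revert H. apply nearC_imp. intros w K. split; [eapply grad_contR; eauto|]. destruct (grad_partials _ _ _ K). split; eexists; eauto.
  - apply Cn_at_loc with (fun w => Re (p w)); auto. revert H. apply nearC_imp. intros w K. symmetry. now apply grad_dxy.
  - apply Cn_at_loc with (fun w => - Im (p w))%R; auto. revert H. apply nearC_imp. intros w K. symmetry. now apply grad_dxy.
Qed.

(** Partial derivatives of the real part of a holomorphic function are again
    real parts of holomorphic functions, which drives the induction on the
    order. *)
Lemma smooth_Re n : forall h a, holo_at h a -> Cn_at n (fun w => Re (h w)) a.
Proof.
  induction n; intros h a H.
  - simpl. generalize (holo_near_cdv _ _ H). apply nearC_imp. intros w K. eapply grad_contR, grad_Re; eauto.
  - apply smooth_step with (C_derive h).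
    + generalize (holo_near_cdv _ _ H). apply nearC_imp. intros w K. now apply grad_Re.
    + apply IHn. now apply holo_derive.
    + apply Cn_at_loc with (fun w => Re (Ci * C_derive h w)).
      * apply nearC_all. intros w. unfold Re, Im; simpl; ring.
      * apply (IHn (fun w => Ci * C_derive h w)). apply holo_mult; [apply holo_const|now apply holo_derive].
Qed.

(** The gradient of a germ of Laplacian [c] differs from that of c |w|^2 / 4 by
    a holomorphic function. This form of the curvature condition is stable
    under the operations below and is equivalent to the one with second
    derivatives, by the next two lemmas. *)
Definition curv_germ (c : R) (k : C -> R) (a : C) : Prop :=
  exists p : C -> C, nearC a (fun w => is_grad k w (p w)) /\ holo_at (fun w => p w - RtoC (c / 2) * Cconj w) a.

Lemma curv_germ_smooth c k a : curv_germ c k a -> smooth_at k a /\ nearC a (fun w => laplacian k w = c).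
Proof.
  intros (p & H1 & H2). set (H := fun w : C => p w - RtoC (c / 2) * Cconj w) in *. change (holo_at H a) in H2.
  assert (E1 : forall w, Re (p w) = Re (H w + RtoC (c / 2) * w)).
  { intros w. replace (p w) with (H w + RtoC (c / 2) * Cconj w) by (unfold H; ring). rewrite !Re_plus, !Re_Rmult. reflexivity. }
  assert (E2 : forall w, (- Im (p w))%R = Re (Ci * H w - Ci * RtoC (c / 2) * w)).
  { intros w. replace (p w) with (H w + RtoC (c / 2) * Cconj w) by (unfold H; ring). rewrite Re_minus, Im_plus, Im_Rmult. unfold Re, Im; simpl; ring. }
  clearbody H.
  assert (X1 : holo_at (fun w => H w + RtoC (c / 2) * w) a) by (apply holo_plus; [exact H2|apply holo_mult; [apply holo_const|apply holo_id]]).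
  assert (X2 : holo_at (fun w => Ci * H w - Ci * RtoC (c / 2) * w) a).
  { apply holo_minus; (apply holo_mult; [apply holo_const|]); [exact H2|apply holo_id]. }
  split.
  - intros [|n].
    + simpl. revert H1. apply nearC_imp. intros w K. eapply grad_contR; eauto.
    + apply smooth_step with p; auto.
      * apply Cn_at_loc with (fun w => Re (H w + RtoC (c / 2) * w)); [apply nearC_all; intros; now rewrite E1|]. now apply (smooth_Re n (fun w => H w + RtoC (c / 2) * w)).
      * apply Cn_at_loc with (fun w => Re (Ci * H w - Ci * RtoC (c / 2) * w)); [apply nearC_all; intros; now rewrite E2|]. now apply (smooth_Re n (fun w => Ci * H w - Ci * RtoC (c / 2) * w)).
  - generalize (nearC_and _ _ _ (nearC_open _ _ H1) (holo_near_cdv _ _ H2)). apply nearC_imp. intros w [K1 K2].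
    unfold laplacian.
    assert (G1 : is_grad (d_x k) w (C_derive H w + RtoC (c / 2) * 1)).
    { apply grad_loc with (fun w => Re (H w + RtoC (c / 2) * w)).
      - revert K1. apply nearC_imp. intros z K. rewrite <- E1. symmetry. now apply grad_dxy.
      - apply grad_Re. apply cdv_plus; [exact K2|apply cdv_scal, cdv_id]. }
    assert (G2 : is_grad (d_y k) w (Ci * C_derive H w - Ci * RtoC (c / 2) * 1)).
    { apply grad_loc with (fun w => Re (Ci * H w - Ci * RtoC (c / 2) * w)).
      - revert K1. apply nearC_imp. intros z K. rewrite <- E2. symmetry. now apply grad_dxy.
      - apply grad_Re. apply cdv_minus; [apply cdv_scal; exact K2|apply cdv_scal, cdv_id]. }
    rewrite (proj1 (grad_dxy _ _ _ G1)), (proj2 (grad_dxy _ _ _ G2)). unfold Re, Im; simpl. field.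
Qed.

(** The mean value theorem along the two sides of a rectangle. *)
Lemma grad_of_partials k w : nearC w (fun z => ex_derive (fun x => k (x, Im z)) (Re z) /\ ex_derive (fun y => k (Re z, y)) (Im z)) ->
  contR (d_x k) w -> contR (d_y k) w -> is_grad k w (d_x k w, (- d_y k w)%R).
Proof.
  intros H Cx Cy eps He. rewrite contRE in Cx, Cy.
  generalize (nearC_and _ _ _ H (nearC_and _ _ _ (Cx (eps / 2)%R ltac:(lra)) (Cy (eps / 2)%R ltac:(lra)))). intros K.
  apply locally_CE in K. destruct K as (d & Hd & K). exists d. split; auto. intros [u v] Hh. destruct w as [x0 y0].
  assert (Hu := Rle_lt_trans _ _ _ (re_le_Cmod (u, v)) Hh). assert (Hv := Rle_lt_trans _ _ _ (im_le_Cmod (u, v)) Hh).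
  assert (Hu0 := re_le_Cmod (u, v)). assert (Hv0 := im_le_Cmod (u, v)).
  unfold Re in Hu, Hu0. unfold Im in Hv, Hv0. cbn [fst snd] in *.
  assert (Near : forall s t, Rabs s <= Rabs u -> Rabs t <= Rabs v -> Cmod (((x0 + s)%R, (y0 + t)%R) - (x0, y0)) < d).
  { intros s t Hs Htt. eapply Rle_lt_trans; [|exact Hh]. unfold Cmod. cbn [fst snd Cminus Cplus Copp].
    apply sqrt_le_1_alt. replace (x0 + s + - x0)%R with s by ring. replace (y0 + t + - y0)%R with t by ring.
    rewrite <- (pow2_abs s), <- (pow2_abs t), <- (pow2_abs u), <- (pow2_abs v).
    apply Rplus_le_compat; apply pow_incr; split; auto using Rabs_pos. }
  assert (R0 : Rabs 0 <= Rabs u) by (rewrite Rabs_R0; apply Rabs_pos).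
  assert (R0' : Rabs 0 <= Rabs v) by (rewrite Rabs_R0; apply Rabs_pos).
  assert (Btw : forall a b c : R, Rmin a (a + b) <= c <= Rmax a (a + b) -> Rabs (c - a) <= Rabs b).
  { intros a b c. unfold Rmin, Rmax. destruct (Rle_dec a (a + b)); intros; unfold Rabs; repeat destruct Rcase_abs; lra. }
  assert (DX : forall c, Rmin x0 (x0 + u) <= c <= Rmax x0 (x0 + u) -> is_derive (fun x => k (x, y0 + v)%R) c (d_x k (c, (y0 + v)%R))).
  { intros c Hc. destruct (K (c, (y0 + v)%R)) as [[E _] _]. 
    - replace c with (x0 + (c - x0))%R by ring. apply Near; auto. lra.
    - apply Derive_correct in E. exact E. }
  assert (DY : forall c, Rmin y0 (y0 + v) <= c <= Rmax y0 (y0 + v) -> is_derive (fun y => k (x0, y)) c (d_y k (x0, c))).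
  { intros c Hc. destruct (K (x0, c)) as [[_ E] _].
    - replace c with (y0 + (c - y0))%R by ring. replace x0 with (x0 + 0)%R at 1 by ring. apply Near; auto.
    - apply Derive_correct in E. exact E. }
  destruct (MVT_gen (fun x => k (x, y0 + v)%R) x0 (x0 + u) (fun x => d_x k (x, (y0 + v)%R))) as (c1 & Hc1 & M1).
  { intros c Hc. apply DX. lra. }
  { intros c Hc. apply continuity_pt_filterlim. apply (ex_derive_continuous (K := R_AbsRing) (V := R_NormedModule)). eexists. apply DX; auto. }
  destruct (MVT_gen (fun y => k (x0, y)) y0 (y0 + v) (fun y => d_y k (x0, y))) as (c2 & Hc2 & M2).
  { intros c Hc. apply DY. lra. }
  { intros c Hc. apply continuity_pt_filterlim. apply (ex_derive_continuous (K := R_AbsRing) (V := R_NormedModule)). eexists. apply DY; auto. }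
  assert (N1 : Rabs (d_x k (c1, (y0 + v)%R) - d_x k (x0, y0)) < eps / 2).
  { apply K. replace c1 with (x0 + (c1 - x0))%R by ring. apply Near; auto. lra. }
  assert (N2 : Rabs (d_y k (x0, c2) - d_y k (x0, y0)) < eps / 2).
  { apply K. replace c2 with (y0 + (c2 - y0))%R by ring. replace x0 with (x0 + 0)%R at 1 by ring. apply Near; auto. }
  change ((x0, y0) + (u, v)) with ((x0 + u)%R, (y0 + v)%R).
  replace (Re ((d_x k (x0, y0), (- d_y k (x0, y0))%R) * (u, v))) with (d_x k (x0, y0) * u + d_y k (x0, y0) * v)%R by (unfold Re; simpl; ring).
  replace (k ((x0 + u)%R, (y0 + v)%R) - k (x0, y0) - (d_x k (x0, y0) * u + d_y k (x0, y0) * v))%R with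
    ((d_x k (c1, (y0 + v)%R) - d_x k (x0, y0)) * u + (d_y k (x0, c2) - d_y k (x0, y0)) * v)%R.
  2:{ replace (x0 + u - x0)%R with u in M1 by ring. replace (y0 + v - y0)%R with v in M2 by ring. rewrite !Rmult_minus_distr_r. lra. }
  eapply Rle_trans; [apply Rabs_triang|]. rewrite !Rabs_mult.
  assert (A1 := Rabs_pos u). assert (A2 := Rabs_pos v). nra.
Qed.

(** The Cauchy-Riemann equations for the gradient minus that of c |w|^2 / 4:
    one is the value of the Laplacian, the other is the symmetry of second
    derivatives. *)
Lemma smooth_curv_germ c k a : smooth_at k a -> nearC a (fun w => laplacian k w = c) -> curv_germ c k a.
Proof.
  intros Hs Hl. set (p := fun w => (d_x k w, (- d_y k w)%R)).
  destruct (Hs 2%nat) as (S1 & (S2 & S3 & S4) & (S5 & S6 & S7)). simpl in S3, S4, S6, S7.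
  assert (Gk : nearC a (fun w => is_grad k w (p w))).
  { generalize (nearC_and _ _ _ (nearC_open _ _ S1) (nearC_and _ _ _ S2 S5)). apply nearC_imp. intros w (K1 & K2 & K3).
    apply grad_of_partials; [|apply K2|apply K3]. revert K1. apply nearC_imp. intros z Z; apply Z. }
  exists p. split; auto. apply holoE.
  generalize (nearC_and _ _ _ (nearC_and _ _ _ Hl (nearC_open _ _ S1)) (nearC_and _ _ _ (nearC_and _ _ _ (nearC_open _ _ S2) (nearC_open _ _ S5)) (nearC_and _ _ _ (nearC_and _ _ _ S3 S4) (nearC_and _ _ _ S6 S7)))).
  apply nearC_imp. intros w ((L & W1) & (W2 & W5) & (W3 & W4) & (W6 & W7)).
  assert (Gx : is_grad (d_x k) w (d_x (d_x k) w, (- d_y (d_x k) w)%R)).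
  { apply grad_of_partials; auto. revert W2. apply nearC_imp. intros z Z; apply Z. }
  assert (Gy : is_grad (d_y k) w (d_x (d_y k) w, (- d_y (d_y k) w)%R)).
  { apply grad_of_partials; auto. revert W5. apply nearC_imp. intros z Z; apply Z. }
  assert (Sch : d_x (d_y k) w = d_y (d_x k) w).
  { destruct w as [x y]. apply (Schwarz (fun u v => k (u, v)) x y).
    - generalize (nearC_and _ _ _ W1 (nearC_and _ _ _ W2 W5)). intros K. apply locally_CE in K. destruct K as (d & Hd & K).
      assert (Hd2 : 0 < d / 2) by lra. exists (mkposreal _ Hd2). intros u v Hu Hv. simpl in Hu, Hv.
      destruct (K (u, v)) as ((_ & K1 & K2) & (_ & K3 & K4) & (_ & K5 & K6)).
      { eapply Rle_lt_trans; [apply Cmod_le_re_im|]. rewrite Re_minus, Im_minus. unfold Re, Im; cbn [fst snd]. lra. }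
      unfold Re, Im in *; cbn [fst snd] in *. repeat split; auto.
    - intros eps. rewrite contRE in W6. generalize (W6 eps (cond_pos eps)). intros K. apply locally_CE in K. destruct K as (d & Hd & K).
      assert (Hd2 : 0 < d / 2) by lra. exists (mkposreal _ Hd2). intros u v Hu Hv. simpl in Hu, Hv. apply (K (u, v)).
      eapply Rle_lt_trans; [apply Cmod_le_re_im|]. rewrite Re_minus, Im_minus. unfold Re, Im; cbn [fst snd]. lra.
    - intros eps. rewrite contRE in W4. generalize (W4 eps (cond_pos eps)). intros K. apply locally_CE in K. destruct K as (d & Hd & K).
      assert (Hd2 : 0 < d / 2) by lra. exists (mkposreal _ Hd2). intros u v Hu Hv. simpl in Hu, Hv. apply (K (u, v)).
      eapply Rle_lt_trans; [apply Cmod_le_re_im|]. rewrite Re_minus, Im_minus. unfold Re, Im; cbn [fst snd]. lra. }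
  set (l := ((d_x (d_x k) w - c / 2)%R, (- d_y (d_x k) w)%R)).
  exists l. intros eps He. destruct (Gx (eps / 2)%R ltac:(lra)) as (d1 & Hd1 & K1). destruct (Gy (eps / 2)%R ltac:(lra)) as (d2 & Hd2 & K2).
  exists (Rmin d1 d2). split; [now apply Rmin_glb_lt|]. intros h Hh.
  specialize (K1 h (Rlt_le_trans _ _ _ Hh (Rmin_l _ _))). specialize (K2 h (Rlt_le_trans _ _ _ Hh (Rmin_r _ _))).
  eapply Rle_trans; [apply Cmod_le_re_im|].
  unfold laplacian in L.
  replace (Re (p (w + h) - (c / 2)%R * Cconj (w + h) - (p w - (c / 2)%R * Cconj w) - l * h)) with (d_x k (w + h)%C - d_x k w - Re ((d_x (d_x k) w, (- d_y (d_x k) w)%R) * h)%C)%R.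
  2:{ unfold p, l, Re; simpl; ring. }
  replace (Im (p (w + h) - (c / 2)%R * Cconj (w + h) - (p w - (c / 2)%R * Cconj w) - l * h)) with (- (d_y k (w + h)%C - d_y k w - Re ((d_x (d_y k) w, (- d_y (d_y k) w)%R) * h)%C))%R.
  2:{ rewrite Sch. replace (d_y (d_y k) w) with (c - d_x (d_x k) w)%R by lra. unfold p, l, Re, Im; simpl. field. }
  rewrite Rabs_Ropp. lra.
Qed.

(** * The explicit metric *)

(** The squared norm of the canonical meromorphic frame of O(2 Theta) at w,
    when Theta is the origin: the Gaussian factor makes |theta|^4 periodic, and
    as log |theta| is harmonic off the lattice it alone produces the curvature.
    *)
Definition metric (tau w : C) : R := (Cmod (theta tau w) ^ 4 * exp (4 * PI * Im w - 4 * PI * Im w ^ 2 / Im tau))%R.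

(** The Laplacian of the potential that corresponds to the curvature form 2
    omega_0. *)
Definition metric_curv (tau : C) : R := (8 * PI / Im tau)%R.

Section Metric.
Variable tau : C.
Hypothesis Ht : 0 < Im tau.

Lemma metric_periodic w l : lattice tau l -> metric tau (w + l) = metric tau w.
Proof.
  intros Hl. revert l Hl w. apply (lattice_ind tau (fun l => forall w, metric tau (w + l) = metric tau w)).
  - intros w. unfold metric. rewrite theta_1, Im_plus, im_RtoC, Rplus_0_r by auto. reflexivity.
  - intros w. unfold metric. rewrite theta_tau, Im_plus by auto. rewrite Cmod_mult, Cmod_opp, Cmod_inv by apply ew_nz. rewrite Cmod_ew.
    rewrite <- exp_Ropp. rewrite Rpow_mult_distr.
    replace (exp (- (-2 * PI * Im w)) ^ 4)%R with (exp (8 * PI * Im w)).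
    2:{ simpl. rewrite Rmult_1_r, <- !exp_plus. f_equal. ring. }
    rewrite (Rmult_comm (exp _) (Cmod (theta tau w) ^ 4)), Rmult_assoc, <- exp_plus. do 2 f_equal. field. lra.
  - intros l l' H H' w. rewrite Cplus_assoc, H', H. reflexivity.
  - intros l H w. rewrite <- (H (w + - l)). f_equal. ring.
Qed.

Lemma metric_local a : exists k, curv_germ (metric_curv tau) k a /\ nearC a (fun w => metric tau w = (Cmod (w - a) ^ (4 * lattice_mult_nat tau a) * exp (- k w))%R).
Proof.
  destruct (theta_local tau Ht a) as (g & G1 & G2 & G3).
  exists (fun w => 4 * PI / Im tau * (Im w * Im w) + (- (4 * PI) * Im w + (-2) * ln (Cmod (g w) ^ 2)))%R. split.
  - exists (fun w => RtoC (4 * PI / Im tau) * (RtoC (2 * Im w) * - Ci) + (RtoC (- (4 * PI)) * - Ci + RtoC (-2) * (2 * (C_derive g w / g w)))). split.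
    + generalize (nearC_and _ _ _ (holo_near_cdv _ _ G1) (cont_nonzero _ _ (holo_cont _ _ G1) G2)). apply nearC_imp. intros w [K1 K2].
      apply grad_plus; [|apply grad_plus]; apply grad_scal.
      * apply (grad_chain (fun t => t * t)%R Im); [|apply grad_Im]. apply is_derive_Reals. auto_derive; auto; ring.
      * apply grad_Im.
      * now apply grad_ln_Cmod2.
    + apply holo_ext with (fun w => - RtoC (4 * PI / Im tau) * w + (RtoC (- (4 * PI)) * - Ci + RtoC (-2) * (2 * (C_derive g w / g w)))).
      * intros w. replace (RtoC (metric_curv tau / 2)) with (RtoC (4 * PI / Im tau)) by (f_equal; unfold metric_curv; field; lra).
        replace (RtoC (2 * Im w) * - Ci) with (Cconj w - w). { ring. } destruct w; apply C_ext; unfold Re, Im; simpl; ring.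
      * apply holo_plus; [apply holo_mult; [apply holo_const|apply holo_id]|]. apply holo_plus; [apply holo_const|].
        apply holo_mult; [apply holo_const|]. apply holo_mult; [apply holo_const|]. apply holo_div; auto. now apply holo_derive.
  - generalize (cont_nonzero _ _ (holo_cont _ _ G1) G2). apply nearC_imp. intros w N. unfold metric. rewrite G3, Cmod_mult, Cmod_pow.
    assert (P : 0 < Cmod (g w)) by now apply Cmod_gt_0.
    rewrite Rpow_mult_distr, <- pow_mult, Rmult_assoc. rewrite (Nat.mul_comm (lattice_mult_nat tau a)). f_equal.
    replace (- (4 * PI / Im tau * (Im w * Im w) + (- (4 * PI) * Im w + -2 * ln (Cmod (g w) ^ 2))))%R with
      (ln (Cmod (g w) ^ 2) + ln (Cmod (g w) ^ 2) + (4 * PI * Im w - 4 * PI * Im w ^ 2 / Im tau))%R by (field; lra).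
    rewrite !exp_plus, !exp_ln by (apply pow_lt; auto). ring.
Qed.
End Metric.

(** * Divisor classes of degree zero *)

Definition lattice_mult (tau a : C) : Z := if excluded_middle_informative (lattice tau a) then 1%Z else 0%Z.

Lemma lattice_mult_yes tau a : lattice tau a -> lattice_mult tau a = 1%Z.
Proof. intros H. unfold lattice_mult. destruct (excluded_middle_informative (lattice tau a)); tauto. Qed.
Lemma lattice_mult_no tau a : ~ lattice tau a -> lattice_mult tau a = 0%Z.
Proof. intros H. unfold lattice_mult. destruct (excluded_middle_informative (lattice tau a)); tauto. Qed.
Lemma lattice_sym tau a b : lattice tau (a - b) -> lattice tau (b - a).
Proof. intros H. replace (b - a) with (- (a - b)) by ring. now apply lattice_opp. Qed.
Lemma lattice_mult_sym tau a b : lattice_mult tau (a - b) = lattice_mult tau (b - a).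
Proof. destruct (Classical_Prop.classic (lattice tau (a - b))) as [H|H].
  - rewrite !lattice_mult_yes; auto. now apply lattice_sym.
  - rewrite !lattice_mult_no; auto. intros K. now apply H, lattice_sym. Qed.

Lemma mult_cons tau x n D a : mult tau ((x, n) :: D) a = (n * lattice_mult tau (x - a)%C + mult tau D a)%Z.
Proof. unfold lattice_mult. simpl. destruct (excluded_middle_informative (lattice tau (x - a))); lia. Qed.

Lemma mult_two tau x y a : mult tau [(x, 1%Z); (y, (-1)%Z)] a = (lattice_mult tau (x - a)%C - lattice_mult tau (y - a)%C)%Z.
Proof. rewrite !mult_cons. change (mult tau [] a) with 0%Z. lia. Qed.

Lemma lattice_mult_shift tau a l : lattice tau l -> lattice_mult tau (a - l) = lattice_mult tau a.
Proof. intros Hl. assert (E := lattice_sub_iff tau a (- l) (lattice_opp _ _ Hl)). change (a + - l) with (a - l) in E.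
  destruct (Classical_Prop.classic (lattice tau a)). - rewrite !lattice_mult_yes; tauto. - rewrite !lattice_mult_no; tauto. Qed.

Lemma mult_periodic tau D a l : lattice tau l -> mult tau D (a + l) = mult tau D a.
Proof. intros Hl. induction D as [|[x n] D IH]; [reflexivity|]. rewrite !mult_cons, IH. replace (x - (a + l)) with (x - a - l) by ring. now rewrite lattice_mult_shift. Qed.

Lemma mult_isolated tau D a : 0 < Im tau -> nearP a (fun z => mult tau D z = 0%Z).
Proof.
  intros Ht. induction D as [|[x n] D IH]. - now apply nearC_all.
  - generalize (nearP_and _ _ _ IH (nearP_shift a (- x) _ (nonlattice_near tau (a + - x) Ht))). apply nearP_imp. intros z [H1 H2].
    rewrite mult_cons, H1, lattice_mult_no; [lia|]. intros K. apply H2. now apply lattice_sym.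
Qed.

Section Jac.
Variable tau : C.
Hypothesis Ht : 0 < Im tau.

(** Only orders matter for linear equivalence, since isolated values can be
    corrected. *)
Lemma lin_equivE D E : lin_equiv tau D E <-> exists f, periodic tau f /\ forall a, ordeq f a (mult tau D a - mult tau E a).
Proof.
  split.
  - intros [f Hf]. exists f. split; [apply Hf|]. now apply is_div_ordeq with (1 := Hf).
  - intros (f & Hp & Hf). destruct (is_div_of_ord tau f (fun a => (mult tau D a - mult tau E a)%Z) Ht Hp) as (F & HF & _); auto.
    + intros a l Hl. now rewrite !mult_periodic.
    + intros a. generalize (nearP_and _ _ _ (mult_isolated tau D a Ht) (mult_isolated tau E a Ht)). apply nearP_imp. intros z [-> ->]. reflexivity.
    + now exists F.
Qed.

Lemma ordeq_one a : ordeq (fun _ => 1) a 0.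
Proof. exists (fun _ => 1). split; [apply holo_const|]. split; [apply C1_nz|]. apply nearC_all. intros z _. simpl. ring. Qed.

Lemma lin_equiv_of_mult D E : (forall a, mult tau D a = mult tau E a) -> lin_equiv tau D E.
Proof. intros H. apply lin_equivE. exists (fun _ => 1). split; [now intros z l _|]. intros a. rewrite H, Z.sub_diag. apply ordeq_one. Qed.

Lemma lin_equiv_sym D E : lin_equiv tau D E -> lin_equiv tau E D.
Proof. rewrite !lin_equivE. intros (f & Hp & Hf). exists (fun z => / f z). split.
  - intros z l Hl. now rewrite Hp. - intros a. replace (mult tau E a - mult tau D a)%Z with (- (mult tau D a - mult tau E a))%Z by lia. now apply ordeq_inv. Qed.

Lemma lin_equiv_trans D E G : lin_equiv tau D E -> lin_equiv tau E G -> lin_equiv tau D G.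
Proof. rewrite !lin_equivE. intros (f & Hp & Hf) (h & Kp & Hh). exists (fun z => f z * h z). split.
  - intros z l Hl. now rewrite Hp, Kp. - intros a. replace (mult tau D a - mult tau G a)%Z with ((mult tau D a - mult tau E a) + (mult tau E a - mult tau G a))%Z by lia. now apply ordeq_mult. Qed.

Lemma J0_eq (L L' : J0 tau) : proj1_sig L = proj1_sig L' -> L = L'.
Proof. destruct L as [L p], L' as [L' p']. simpl. intros ->. f_equal. apply Classical_Prop.proof_irrelevance. Qed.

Lemma phi_eq x y x' y' : phi tau x y = phi tau x' y' <-> lin_equiv tau [(x, 1%Z); (y, (-1)%Z)] [(x', 1%Z); (y', (-1)%Z)].
Proof.
  split; intros H.
  - apply (f_equal (@proj1_sig _ _)) in H. cbn [phi proj1_sig] in H. rewrite H. now apply lin_equiv_of_mult.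
  - apply J0_eq. cbn [phi proj1_sig]. apply functional_extensionality. intros D. apply propositional_extensionality. split; intros K.
    + apply lin_equiv_trans with (2 := K). now apply lin_equiv_sym.
    + now apply lin_equiv_trans with (1 := H).
Qed.

Lemma const_not_zero f a c n : nearP a (fun z => f z = c) -> ordeq f a n -> (0 < n)%Z -> False.
Proof.
  intros Hc (g & G1 & G2 & G3) Hn.
  assert (Z0 : a - a = 0) by ring.
  assert (E : c = Czpow (a - a) n * g a).
  { apply (cont_agree (fun _ => c) (fun z => Czpow (z - a) n * g z)); [apply cont_const| |].
    - apply holo_cont, holo_mult; auto. apply holo_Czpow. lia.
    - generalize (nearP_and _ _ _ Hc G3). apply nearP_imp. intros z [E1 E2]. congruence. }
  rewrite Z0 in E. replace (Czpow 0 n) with (RtoC 0) in E.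
  2:{ destruct n as [|p|p]; try lia. simpl. destruct (Pos2Nat.is_succ p) as [k ->]. simpl. ring. }
  rewrite Cmult_0_l in E. subst c.
  apply G2. apply (cont_agree g (fun _ => 0)); [now apply holo_cont|apply cont_const|].
  generalize (nearP_and _ _ _ Hc G3). apply nearC_imp. intros z H N. destruct (H N) as [E1 E2]. rewrite E1 in E2.
  apply Classical_Prop.NNPP. intros Ng. symmetry in E2. revert E2. apply Cmult_neq_0; auto. now apply Czpow_nonzero, Csub_nz.
Qed.

(** A function with divisor w - w' would have a single simple pole, hence be
    constant. *)
Lemma AJ_inj w w' : AJ tau w = AJ tau w' -> lattice tau (w - w').
Proof.
  intros H. apply Classical_Prop.NNPP. intros N. apply phi_eq, lin_equivE in H. destruct H as (f & Hp & Hf).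
  assert (Ef : forall a, ordeq f a (lattice_mult tau (w - a)%C - lattice_mult tau (w' - a)%C)).
  { intros a. specialize (Hf a). rewrite !mult_two in Hf. replace (lattice_mult tau (w - a)%C - lattice_mult tau (w' - a)%C)%Z with (lattice_mult tau (w - a)%C - lattice_mult tau (RtoC 0 - a)%C - (lattice_mult tau (w' - a)%C - lattice_mult tau (RtoC 0 - a)%C))%Z by lia. exact Hf. }
  assert (L0 : forall a : C, lattice tau (a - a)). { intros a. replace (a - a) with (RtoC 0) by ring. apply lattice_0. }
  destruct (simple_pole_const tau f w' Ht Hp) as [c Hc].
  - intros a Ha. apply ordge_le with (2 := ordeq_ge _ _ _ (Ef a)). rewrite (lattice_mult_no tau (w' - a)) by (intros K; now apply Ha, lattice_sym).
    unfold lattice_mult. destruct (excluded_middle_informative (lattice tau (w - a))); lia.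
  - apply ordge_le with (2 := ordeq_ge _ _ _ (Ef w')). rewrite (lattice_mult_yes tau (w' - w')), (lattice_mult_no tau (w - w')); auto. lia.
  - apply (const_not_zero f w c _ (Hc w) (Ef w)). rewrite (lattice_mult_yes tau (w - w)) by auto. rewrite (lattice_mult_no tau (w' - w)); [lia|]. intros K. now apply N, lattice_sym.
Qed.

Lemma Cinv_mult_nz (c t : C) : c <> 0 -> / (c * t) = / c * / t.
Proof. intros N. destruct (Classical_Prop.classic (t = 0)) as [->|Nt]. - rewrite Cmult_0_r, Cinv_0. ring. - field. auto. Qed.

Lemma theta_ordeq b a : ordeq (fun w => theta tau (w - b)) a (lattice_mult tau (b - a)).
Proof.
  destruct (theta_local tau Ht (a - b)) as (g & G1 & G2 & G3). exists (fun w => g (w + - b)). split; [now apply holo_shift|]. split; [exact G2|].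
  apply nearC_all. intros z N. rewrite G3. replace (z - b - (a - b)) with (z - a) by ring. change (z + - b) with (z - b). f_equal.
  rewrite lattice_mult_sym. unfold lattice_mult_nat, lattice_mult. destruct (excluded_middle_informative (lattice tau (a - b))); simpl; ring.
Qed.

Lemma theta_quot_periodic x y : periodic tau (fun w => theta tau (w - x) * theta tau (w - 0) * / theta tau (w - y) * / theta tau (w - (x - y))).
Proof.
  intros w l Hl. destruct (theta_lattice tau Ht l Hl) as (A & B & H).
  assert (H' : forall b, theta tau (w + l - b) = cexp (A * (w - b) + B) * theta tau (w - b)).
  { intros b. rewrite <- H. f_equal. ring. }
  rewrite !H', !Cinv_mult_nz by apply cexp_nz. rewrite <- !cexp_opp.
  transitivity ((cexp (A * (w - x) + B) * cexp (A * (w - 0) + B) * cexp (- (A * (w - y) + B)) * cexp (- (A * (w - (x - y)) + B))) *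
    (theta tau (w - x) * theta tau (w - 0) * / theta tau (w - y) * / theta tau (w - (x - y)))); [ring|].
  rewrite <- !cexp_plus. replace (A * (w - x) + B + (A * (w - 0) + B) + - (A * (w - y) + B) + - (A * (w - (x - y)) + B)) with (RtoC 0) by ring.
  rewrite cexp_0. ring.
Qed.

(** Abel's theorem by an explicit quotient of translates of theta, whose
    multipliers cancel because the zeros and the poles have the same sum. *)
Lemma phi_AJ x y : phi tau x y = AJ tau (x - y).
Proof.
  apply phi_eq, lin_equivE. eexists. split; [apply (theta_quot_periodic x y)|]. intros a. rewrite !mult_two.
  replace (lattice_mult tau (x - a)%C - lattice_mult tau (y - a)%C - (lattice_mult tau (x - y - a)%C - lattice_mult tau (RtoC 0 - a)%C))%Z with
    (lattice_mult tau (x - a)%C + lattice_mult tau (RtoC 0 - a)%C + - lattice_mult tau (y - a)%C + - lattice_mult tau (x - y - a)%C)%Z by lia.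
  repeat apply ordeq_mult; try apply ordeq_inv; apply theta_ordeq.
Qed.

Lemma AJ_lattice w l : lattice tau l -> AJ tau (w + l) = AJ tau w.
Proof.
  intros Hl. apply phi_eq, lin_equiv_of_mult. intros a. rewrite !mult_two. f_equal.
  replace (w - a) with (w + l - a - l) by ring. now rewrite (lattice_mult_shift tau (w + l - a) l Hl).
Qed.

(** For the theta characteristic O_X: a section of O(x - y) has at most a
    simple pole, at x, so it is constant, and its zero at y kills it unless x =
    y on the curve. *)
Lemma Theta_nil x y : Theta tau [] (phi tau x y) <-> lattice tau (x - y).
Proof.
  split.
  - intros (D & HD & f & Hf & z & Nz). apply Classical_Prop.NNPP. intros N.
    cbn [phi proj1_sig] in HD. apply lin_equivE in HD. destruct HD as (h & Hp & Hh).
    rewrite app_nil_r in Hf. assert (Of := H0_ordge _ _ _ Hf).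
    assert (K : forall a, ordge (fun z => f z * / h z) a (lattice_mult tau (y - a)%C - lattice_mult tau (x - a)%C)).
    { intros a. specialize (Hh a). rewrite mult_two in Hh.
      replace (lattice_mult tau (y - a)%C - lattice_mult tau (x - a)%C)%Z with (- mult tau D a + - (lattice_mult tau (x - a)%C - lattice_mult tau (y - a)%C - mult tau D a))%Z by lia.
      apply ordge_mult; [apply Of|]. now apply ordeq_ge, ordeq_inv. }
    assert (Kp : periodic tau (fun z => f z * / h z)). { intros w l Hl. rewrite Hp by auto. rewrite (proj1 Hf) by auto. reflexivity. }
    assert (L0 : forall a : C, lattice tau (a - a)). { intros a. replace (a - a) with (RtoC 0) by ring. apply lattice_0. }
    destruct (simple_pole_const tau (fun z => f z * / h z) x Ht Kp) as [c Hc].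
    + intros a Ha. apply ordge_le with (2 := K a). rewrite (lattice_mult_no tau (x - a)) by (intros Q; now apply Ha, lattice_sym).
      unfold lattice_mult. destruct (excluded_middle_informative (lattice tau (y - a))); lia.
    + apply ordge_le with (2 := K x). rewrite (lattice_mult_yes tau (x - x)) by auto. unfold lattice_mult. destruct (excluded_middle_informative (lattice tau (y - x))); lia.
    + (* the constant vanishes because of the zero at y *)
      assert (C0 : c = 0).
      { assert (K1 : ordge (fun z => f z * / h z) y 1).
        { apply ordge_le with (2 := K y). rewrite (lattice_mult_yes tau (y - y)) by auto. rewrite (lattice_mult_no tau (x - y)) by auto. lia. }
        destruct K1 as (g & G1 & G2).
        transitivity ((y - y) * g y); [|ring].
        apply (cont_agree (fun _ => c) (fun z => (z - y) * g z)); [apply cont_const| |].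
        - apply holo_cont, holo_mult; auto. apply holo_minus; [apply holo_id|apply holo_const].
        - generalize (nearP_and _ _ _ (Hc y) G2). apply nearP_imp. intros v [E1 E2]. rewrite <- E1, E2. simpl. ring. }
      subst c. destruct (proj2 Hf z) as (g & G1 & G2).
      destruct (Hh z) as (k & K1 & K2 & K3).
      assert (g z = 0).
      { apply (cont_agree g (fun _ => 0)); [now apply holo_cont|apply cont_const|].
        generalize (nearP_and _ _ _ (nearP_and _ _ _ (Hc z) K3) (nearP_of _ _ (nearC_and _ _ _ G2 (cont_nonzero _ _ (holo_cont _ _ K1) K2)))).
        apply nearC_imp. intros v H Nv. destruct (H Nv) as [[E1 E2] [E3 E4]].
        assert (Nh : h v <> 0). { rewrite E2. apply Cmult_neq_0; auto. now apply Czpow_nonzero, Csub_nz. }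
        assert (Ef : f v = 0). { replace (f v) with (f v * / h v * h v) by (field; auto). rewrite E1. ring. }
        rewrite Ef in E3. apply Classical_Prop.NNPP. intros Ng. symmetry in E3. revert E3. apply Cmult_neq_0; auto. now apply Czpow_nonzero, Csub_nz. }
      apply Nz. rewrite (nearC_pt _ _ G2), H. ring.
  - intros H. exists []. split.
    + cbn [phi proj1_sig]. apply lin_equiv_of_mult. intros a. rewrite mult_two. change (mult tau [] a) with 0%Z.
      replace (x - a) with (y - a - - (x - y)) by ring. rewrite lattice_mult_shift by now apply lattice_opp. lia.
    + exists (fun _ => 1). split.
      * split; [now intros z l _|]. intros a. exists (fun _ => 1). split; [apply holo_const|]. apply nearC_all. intros z. simpl. ring.
      * exists 0. apply C1_nz.
Qed.

End Jac.

(** * Functions of two complex variables *)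

Notation locC2 := (locally (T := prod_UniformSpace C_UniformSpace C_UniformSpace)).

Lemma locC2E (p : C * C) (P : C * C -> Prop) : locC2 p P <-> exists d : R, 0 < d /\ forall z, Cmod (fst z - fst p) < d -> Cmod (snd z - snd p) < d -> P z.
Proof.
  split.
  - intros [d H]. exists d. split; [apply cond_pos|]. intros z H1 H2. apply H. split; now apply C_NormedModule_mixin_compat1.
  - intros (d & Hd & H). assert (Hd2 : 0 < d / 2) by lra. exists (mkposreal _ Hd2). intros z [H1 H2].
    assert (B : forall a b : C, ball (M := C_UniformSpace) a (d / 2) b -> Cmod (b - a) < d).
    { intros a b [B1 B2]. change (Rabs (fst b - fst a) < d / 2) in B1. change (Rabs (snd b - snd a) < d / 2) in B2.
      eapply Rle_lt_trans; [apply Cmod_le_re_im|]. rewrite Re_minus, Im_minus. unfold Re, Im, Rminus in *. lra. }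
    apply H; now apply B.
Qed.

Notation C2 := (prod_NormedModule C_AbsRing C_NormedModule C_NormedModule).

(** Differentiability in two complex variables with an explicit modulus, [a]
    and [b] being the partial derivatives. *)
Definition d2 (f : C * C -> C) (q : C * C) (a b : C) : Prop :=
  forall eps : R, 0 < eps -> exists d : R, 0 < d /\ forall h k : C, Cmod h < d -> Cmod k < d ->
    Cmod (f (fst q + h, snd q + k) - f q - (a * h + b * k)) <= eps * (Cmod h + Cmod k).

Lemma norm_C2_ge (h k : C) : Cmod h + Cmod k <= 2 * norm (K := C_AbsRing) (V := C2) (h, k).
Proof.
  change (norm (K := C_AbsRing) (V := C2) (h, k)) with (sqrt (Cmod h ^ 2 + Cmod k ^ 2)).
  assert (P1 := Cmod_ge_0 h). assert (P2 := Cmod_ge_0 k).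
  assert (Cmod h <= sqrt (Cmod h ^ 2 + Cmod k ^ 2)). { rewrite <- (sqrt_pow2 (Cmod h)) at 1 by auto. apply sqrt_le_1_alt. generalize (pow2_ge_0 (Cmod k)). lra. }
  assert (Cmod k <= sqrt (Cmod h ^ 2 + Cmod k ^ 2)). { rewrite <- (sqrt_pow2 (Cmod k)) at 1 by auto. apply sqrt_le_1_alt. generalize (pow2_ge_0 (Cmod h)). lra. }
  lra.
Qed.
Lemma norm_C2_le (h k : C) : norm (K := C_AbsRing) (V := C2) (h, k) <= Cmod h + Cmod k.
Proof.
  change (norm (K := C_AbsRing) (V := C2) (h, k)) with (sqrt (Cmod h ^ 2 + Cmod k ^ 2)).
  assert (P1 := Cmod_ge_0 h). assert (P2 := Cmod_ge_0 k).
  rewrite <- (sqrt_pow2 (Cmod h + Cmod k)) by lra. apply sqrt_le_1_alt. nra.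
Qed.

Lemma linear_form_bound (a b x y : C) : Cmod (a * x + b * y) <= (2 * (Cmod a + Cmod b) + 1) * norm (K := C_AbsRing) (V := C2) (x, y).
Proof.
  assert (T := norm_C2_ge x y). eapply Rle_trans; [apply Cmod_triangle|]. rewrite !Cmod_mult.
  assert (Px := Cmod_ge_0 x). assert (Py := Cmod_ge_0 y). assert (Pa := Cmod_ge_0 a). assert (Pb := Cmod_ge_0 b).
  set (n := norm (K := C_AbsRing) (V := C2) (x, y)) in *. 
  assert (Cmod a * Cmod x <= Cmod a * (2 * n)) by (apply Rmult_le_compat_l; lra).
  assert (Cmod b * Cmod y <= Cmod b * (2 * n)) by (apply Rmult_le_compat_l; lra). nra.
Qed.

Lemma d2_filterdiff f q a b : d2 f q a b -> ex_filterdiff (K := C_AbsRing) (U := C2) (V := C_NormedModule) f (locally (T := C2) q).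
Proof.
  intros H. exists (fun v : C * C => a * fst v + b * snd v). split.
  - split.
    + intros [x1 x2] [y1 y2]. change (a * (x1 + y1) + b * (x2 + y2) = a * x1 + b * x2 + (a * y1 + b * y2)). ring.
    + intros k [x1 x2]. change (a * (k * x1) + b * (k * x2) = k * (a * x1 + b * x2)). ring.
    + exists (2 * (Cmod a + Cmod b) + 1)%R. assert (Pa := Cmod_ge_0 a). assert (Pb := Cmod_ge_0 b). split; [lra|]. intros [x y].
      exact (linear_form_bound a b x y).
  - intros x Hx. assert (E : q = x) by (apply (is_filter_lim_locally_unique (K := C_AbsRing) (V := C2)) in Hx; exact Hx). subst x.
    intros [eps He]. destruct (H (eps / 2)%R ltac:(lra)) as (d & Hd & K). apply (locC2E q). exists d. split; auto.
    intros [z1 z2] H1 H2. destruct q as [q1 q2]. cbn [fst snd] in *. specialize (K _ _ H1 H2).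
    replace (q1 + (z1 - q1)) with z1 in K by ring. replace (q2 + (z2 - q2)) with z2 in K by ring.
    change (Cmod (f (z1, z2) - f (q1, q2) - (a * (z1 - q1) + b * (z2 - q2))) <= eps * norm (K := C_AbsRing) (V := C2) (z1 - q1, z2 - q2)).
    eapply Rle_trans; [exact K|]. assert (T := norm_C2_ge (z1 - q1) (z2 - q2)). nra.
Qed.

Lemma filterdiff_d2 f q : ex_filterdiff (K := C_AbsRing) (U := C2) (V := C_NormedModule) f (locally (T := C2) q) -> exists a b, d2 f q a b.
Proof.
  intros [L [[La Ls _] H]]. exists (L (RtoC 1, RtoC 0)), (L (RtoC 0, RtoC 1)). intros eps He. specialize (H q (fun P K => K) (mkposreal _ He)).
  apply (locC2E q) in H. destruct H as (d & Hd & H). exists d. split; auto. intros h k Hh Hk. destruct q as [q1 q2]. cbn [fst snd] in *.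
  specialize (H (q1 + h, q2 + k)). cbn [fst snd] in H. replace (q1 + h - q1) with h in H by ring. replace (q2 + k - q2) with k in H by ring. specialize (H Hh Hk).
  change (Cmod (f (q1 + h, q2 + k) - f (q1, q2) - L (q1 + h - q1, q2 + k - q2)) <= eps * norm (K := C_AbsRing) (V := C2) (q1 + h - q1, q2 + k - q2)) in H.
  replace (q1 + h - q1) with h in H by ring. replace (q2 + k - q2) with k in H by ring.
  assert (E : L (h, k) = L (RtoC 1, RtoC 0) * h + L (RtoC 0, RtoC 1) * k).
  { transitivity (L (plus (G := C2) (scal (K := C_AbsRing) (V := C2) h (RtoC 1, RtoC 0)) (scal (K := C_AbsRing) (V := C2) k (RtoC 0, RtoC 1)))).
    - f_equal. change ((h, k) = (h * 1 + k * 0, h * 0 + k * 1)). f_equal; ring.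
    - rewrite La, !Ls. change (h * L (RtoC 1, RtoC 0) + k * L (RtoC 0, RtoC 1) = L (RtoC 1, RtoC 0) * h + L (RtoC 0, RtoC 1) * k). ring. }
  rewrite E in H. eapply Rle_trans; [exact H|]. apply Rmult_le_compat_l; [lra|apply norm_C2_le].
Qed.

Lemma holo2_diff f a1 a2 : holo_at f (a1 - a2) -> holo2_at (fun z => f (fst z - snd z)) (a1, a2).
Proof.
  intros H. apply holoE, locally_CE in H. destruct H as (d & Hd & H). apply (locC2E (a1, a2)). exists (d / 2)%R. split; [lra|].
  intros [q1 q2] H1 H2. cbn [fst snd] in *. destruct (H (q1 - q2)) as [l Hl].
  { replace (q1 - q2 - (a1 - a2)) with ((q1 - a1) - (q2 - a2)) by ring. eapply Rle_lt_trans; [apply Cmod_minus_le|lra]. }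
  apply d2_filterdiff with (a := l) (b := - l). intros eps He. destruct (Hl eps He) as (e & He' & K). exists (e / 2)%R. split; [lra|].
  intros h k Hh Hk. cbn [fst snd]. specialize (K (h - k)). assert (T := Cmod_minus_le h k). specialize (K ltac:(lra)).
  replace (q1 + h - (q2 + k)) with (q1 - q2 + (h - k)) by ring. replace (l * h + - l * k) with (l * (h - k)) by ring.
  eapply Rle_trans; [exact K|]. apply Rmult_le_compat_l; lra.
Qed.

Lemma holo2_slice g a1 a2 : holo2_at g (a1, a2) -> holo_at (fun w => g (w, a2)) a1.
Proof.
  intros H. apply (locC2E (a1, a2)) in H. destruct H as (d & Hd & H). apply holoE, locally_CE. exists d. split; auto.
  intros w Hw. destruct (filterdiff_d2 g (w, a2)) as (a & b & K).
  { apply H; cbn [fst snd]; auto. replace (a2 - a2) with (RtoC 0) by ring. now rewrite Cmod_0. }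
  exists a. intros eps He. destruct (K eps He) as (e & He' & L). exists e. split; auto. intros h Hh.
  specialize (L h 0 Hh ltac:(rewrite Cmod_0; auto)). cbn [fst snd] in L. rewrite Cplus_0_r, Cmult_0_r, Cplus_0_r, Cmod_0, Rplus_0_r in L. exact L.
Qed.

Lemma near2_slice a1 a2 (P : C * C -> Prop) : locC2 (a1, a2) P -> nearC a1 (fun w => P (w, a2)).
Proof. intros H. apply locC2E in H. destruct H as (d & Hd & H). apply locally_CE. exists d. split; auto. intros w Hw. apply H; cbn [fst snd]; auto.
  replace (a2 - a2) with (RtoC 0) by ring. now rewrite Cmod_0. Qed.

Lemma near2_diff a1 a2 (P : C -> Prop) : nearC (a1 - a2) P -> locC2 (a1, a2) (fun z => P (fst z - snd z)).
Proof. intros H. apply locally_CE in H. destruct H as (d & Hd & H). apply locC2E. exists (d / 2)%R. split; [lra|]. intros [z1 z2] H1 H2. cbn [fst snd] in *.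
  apply H. replace (z1 - z2 - (a1 - a2)) with ((z1 - a1) - (z2 - a2)) by ring. eapply Rle_lt_trans; [apply Cmod_minus_le|lra]. Qed.

(** * Integrals over a period cell *)

(** The type of an equation between integrals is often a structure over C,
    which [ring] does not recognise. *)
Ltac cring := match goal with |- @eq _ ?a ?b => change (@eq C a b) end; ring.

Definition cell_int (K : C -> C) : C := CI (fun y => CI (fun x => K (x, y)) 0 1) 0 1.

Lemma exCI_gen f a b : (forall t, rcont f t) -> ex_RInt (V := C_R_NormedModule) f a b.
Proof. intros H. apply (ex_RInt_continuous (V := C_R_CompleteNormedModule)). intros z _. now apply rcont_continuous. Qed.
Lemma isCI_gen f a b : (forall t, rcont f t) -> isCI f a b (CI f a b).
Proof. intros H. now apply CI_isCI, exCI_gen. Qed.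

Lemma rcont_row K y : (forall z, cont K z) -> forall x, rcont (fun x => K (x, y)) x.
Proof. intros H x. apply rcont_comp; [apply H|apply rcont_h]. Qed.
Lemma rcont_col K x : (forall z, cont K z) -> forall y, rcont (fun y => K (x, y)) y.
Proof. intros H y. apply rcont_comp; [apply H|apply rcont_v]. Qed.

Lemma CI_ext f g a b : (forall t, f t = g t) -> CI f a b = CI g a b.
Proof. intros H. f_equal. now apply functional_extensionality. Qed.

Lemma CI_bound_abs f a b (M : R) : (forall t, rcont f t) -> (forall t, Rmin a b <= t <= Rmax a b -> Cmod (f t) <= M) -> Cmod (CI f a b) <= Rabs (b - a) * M.
Proof.
  intros Hc H. destruct (Rle_dec a b) as [L|L].
  - rewrite Rmin_left, Rmax_right in H by auto. rewrite Rabs_pos_eq by lra. eapply isCI_bound; [exact L|exact H|now apply isCI_gen].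
  - rewrite Rmin_right, Rmax_left in H by lra. rewrite Rabs_left1 by lra.
    assert (E : CI f a b = - CI f b a). { apply isCI_CI. apply (is_RInt_swap (V := C_R_NormedModule)). now apply isCI_gen. }
    rewrite E, Cmod_opp. replace (- (b - a))%R with (a - b)%R by ring. eapply isCI_bound; [lra|exact H|now apply isCI_gen].
Qed.

Lemma rcont_CI K a b : (forall z, cont K z) -> forall y, rcont (fun y => CI (fun x => K (x, y)) a b) y.
Proof.
  intros H y eps He.
  destruct (box_unif K (Rmin a b) (Rmax a b) (y - 1) (y + 1) (fun z _ => H z) (eps / (Rabs (b - a) + 1))) as (d & Hd & U).
  { apply Rdiv_lt_0_compat; auto. generalize (Rabs_pos (b - a)); lra. }
  exists (Rmin d 1). split; [apply Rmin_glb_lt; lra|]. intros s Hs. assert (S1 := Rmin_l d 1). assert (S2 := Rmin_r d 1).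
  assert (E : CI (fun x => K (x, s)) a b - CI (fun x => K (x, y)) a b = CI (fun x => K (x, s) - K (x, y)) a b).
  { symmetry. apply isCI_CI. apply isCI_minus; apply isCI_gen; now apply rcont_row. }
  cbv beta. rewrite E. apply Rle_lt_trans with (Rabs (b - a) * (eps / (Rabs (b - a) + 1)))%R.
  - apply CI_bound_abs.
    + intros t. apply (rcont_comp (fun z => z) (fun x => K (x, s) - K (x, y))); [apply cont_id|]. 
      intros e Hee. destruct (rcont_plus (fun x => K (x, s)) (fun x => - (1) * K (x, y)) t (rcont_row K s H t)
         (rcont_mult (fun _ => - (1)) (fun x => K (x, y)) t (rcont_const _ _) (rcont_row K y H t)) e Hee) as (d' & Hd' & Q).
      exists d'. split; auto. intros r Hr. specialize (Q r Hr). replace (K (r, s) - K (r, y) - (K (t, s) - K (t, y))) with (K (r, s) + - (1) * K (r, y) - (K (t, s) + - (1) * K (t, y))) by ring. exact Q.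
    + intros t Htt. left. apply Rabs_def2 in Hs. apply U; [split; simpl; lra|split; simpl; lra|].
      replace ((t, s) - (t, y)) with (RtoC (s - y) * Ci) by (apply C_ext; unfold Re, Im; simpl; ring).
      rewrite Cmod_mult, Cmod_Ci, Cmod_R, Rmult_1_r. apply Rabs_def1; lra.
  - assert (P := Rabs_pos (b - a)). apply Rmult_lt_reg_r with (Rabs (b - a) + 1)%R; [lra|].
    replace (Rabs (b - a) * (eps / (Rabs (b - a) + 1)) * (Rabs (b - a) + 1))%R with (Rabs (b - a) * eps)%R by (field; lra). nra.
Qed.

Lemma cell_int_plus K L : (forall z, cont K z) -> (forall z, cont L z) -> cell_int (fun z => K z + L z) = cell_int K + cell_int L.
Proof.
  intros HK HL. unfold cell_int. apply isCI_CI.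
  apply (isCI_ext (fun y => CI (fun x => K (x, y)) 0 1 + CI (fun x => L (x, y)) 0 1)); [lra| |].
  - intros y _. symmetry. apply isCI_CI, isCI_plus; apply isCI_gen; now apply rcont_row.
  - apply isCI_plus; apply isCI_gen; now apply rcont_CI.
Qed.
Lemma cell_int_scal c K : (forall z, cont K z) -> cell_int (fun z => c * K z) = c * cell_int K.
Proof.
  intros HK. unfold cell_int. apply isCI_CI.
  apply (isCI_ext (fun y => c * CI (fun x => K (x, y)) 0 1)); [lra| |].
  - intros y _. symmetry. apply isCI_CI, isCI_scal, isCI_gen. now apply rcont_row.
  - apply isCI_scal, isCI_gen. now apply rcont_CI.
Qed.

(** Fubini's theorem for continuous functions: both iterated integrals have the
    same derivative in an upper bound. *)
Lemma CI_swap_der K : (forall z, cont K z) -> isCI (fun x => CI (fun y => K (x, y)) 0 1) 0 1 (CI (fun y => CI (fun x => K (x, y)) 0 1) 0 1).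
Proof.
  intros H.
  assert (HT : forall z : C, cont (fun z => K (Im z, Re z)) z).
  { intros z. apply (cont_comp K (fun z => (Im z, Re z))); [apply H|]. intros eps He. generalize (nearC_disc z eps He). apply nearC_imp. intros w Hw.
    replace (Cmod ((Im w, Re w) - (Im z, Re z))) with (Cmod (w - z)); auto. unfold Cmod. f_equal. unfold Re, Im; simpl. ring. }
  assert (HB : forall a b x, rcont (fun y => CI (fun x => K (x, y)) a b) x) by (intros; now apply rcont_CI).
  assert (Split : forall t h y, CI (fun x => K (x, y)) 0 (t + h) - CI (fun x => K (x, y)) 0 t = CI (fun x => K (x, y)) t (t + h)).
  { intros t h y. assert (X := isCI_Chasles (fun x => K (x, y)) 0 t (t + h) _ _ (isCI_gen _ 0 t (rcont_row K y H)) (isCI_gen _ t (t + h) (rcont_row K y H))).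
    apply isCI_CI in X. rewrite X. ring. }
  set (F := (fun t => CI (fun y => CI (fun x => K (x, y)) 0 t) 0 1) : R -> C).
  assert (F0 : F 0%R = 0).
  { unfold F. apply isCI_CI. apply (isCI_ext (fun _ => RtoC 0)); [lra| |apply isCI_zero]. intros y _. symmetry. apply (RInt_point (V := C_R_CompleteNormedModule)). }
  replace (CI (fun y => CI (fun x => K (x, y)) 0 1) 0 1) with (F 1%R - F 0%R) by (rewrite F0; unfold F; ring).
  apply isCI_FTC; [lra| |].
  - intros t Htt eps He.
    destruct (box_unif K (t - 1) (t + 1) 0 1 (fun z _ => H z) eps He) as (d & Hd & U).
    exists (Rmin d 1). split; [apply Rmin_glb_lt; lra|]. intros h Hh. assert (S1 := Rmin_l d 1). assert (S2 := Rmin_r d 1).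
    assert (E : F (t + h)%R - F t - h * CI (fun y => K (t, y)) 0 1 = CI (fun y => CI (fun x => K (x, y)) t (t + h) - h * K (t, y)) 0 1).
    { symmetry. apply isCI_CI. apply isCI_minus.
      - apply (isCI_ext (fun y => CI (fun x => K (x, y)) 0 (t + h) - CI (fun x => K (x, y)) 0 t)); [lra| |].
        + intros y _. apply Split. + apply isCI_minus; now apply isCI_gen.
      - apply isCI_scal, isCI_gen. now apply rcont_col. }
    rewrite E. replace (eps * Rabs h)%R with ((1 - 0) * (eps * Rabs h))%R by ring.
    eapply isCI_bound; [lra| |apply CI_isCI, exCI; [lra|]].
    + intros y Hy. cbv beta.
      assert (E2 : CI (fun x => K (x, y)) t (t + h) - h * K (t, y) = CI (fun x => K (x, y) - K (t, y)) t (t + h)).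
      { symmetry. apply isCI_CI. apply isCI_minus; [apply isCI_gen; now apply rcont_row|]. replace h with (t + h - t)%R at 2 by ring. apply isCI_const. }
      rewrite E2. rewrite Rmult_comm. replace h with (t + h - t)%R at 2 by ring.
      apply CI_bound_abs.
      * intros s. intros e Hee. destruct (rcont_row K y H s e Hee) as (d' & Hd' & Q). exists d'. split; auto. intros r Hr. specialize (Q r Hr).
        replace (K (r, y) - K (t, y) - (K (s, y) - K (t, y))) with (K (r, y) - K (s, y)) by ring. exact Q.
      * intros s Hs. left. apply Rabs_def2 in Hh.
        assert (Hst : Rabs (s - t) <= Rabs h).
        { revert Hs. unfold Rmin, Rmax. destruct (Rle_dec t (t + h)); intros; unfold Rabs; repeat destruct Rcase_abs; lra. }
        assert (Rabs h < Rmin d 1) by (apply Rabs_def1; lra).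
        assert (B := Rle_abs (s - t)). assert (B' := Rle_abs (- (s - t))). rewrite Rabs_Ropp in B'.
        apply U; [split; simpl; lra|split; simpl; lra|].
        replace ((s, y) - (t, y)) with (RtoC (s - t)) by (apply C_ext; unfold Re, Im; simpl; ring). rewrite Cmod_R. lra.
    + intros y _. intros e Hee. destruct (rcont_plus (fun y => CI (fun x => K (x, y)) t (t + h)) (fun y => - h * K (t, y)) y (HB _ _ y)
         (rcont_mult (fun _ => - h) (fun y => K (t, y)) y (rcont_const _ _) (rcont_col K t H y)) e Hee) as (d' & Hd' & Q).
      exists d'. split; auto. intros r Hr. specialize (Q r Hr).
      match goal with |- Cmod ?X < _ => replace X with (CI (fun x => K (x, r)) t (t + h) + - h * K (t, r) - (CI (fun x => K (x, y)) t (t + h) + - h * K (t, y))) by ring end. exact Q.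
  - intros t _. exact (rcont_CI (fun z => K (Im z, Re z)) 0 1 HT t).
Qed.

Lemma cell_int_swap K : (forall z, cont K z) -> cell_int (fun z => K (Im z, Re z)) = cell_int K.
Proof. intros H. unfold cell_int. cbn [Re Im fst snd]. apply isCI_CI. now apply CI_swap_der. Qed.

Definition periodic1 (f : R -> C) : Prop := forall (x : R) (n : Z), f (x + IZR n)%R = f x.

Lemma CI_shift f s : (forall t, rcont f t) -> periodic1 f -> CI (fun x => f (x + s)%R) 0 1 = CI f 0 1.
Proof.
  intros Hc Hp.
  assert (E1 : forall a b, CI (fun x => f (x + s)%R) a b = CI f (a + s) (b + s)).
  { intros a b. assert (X := RInt_comp_lin (V := C_R_CompleteNormedModule) f 1 s a b ltac:(apply exCI_gen; auto)).
    rewrite !Rmult_1_l in X. rewrite <- X. apply CI_ext. intros t. rewrite Rmult_1_l. rewrite scal_R_Cmult. symmetry. apply Cmult_1_l. }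
  rewrite E1. rewrite Rplus_0_l.
  assert (A1 := isCI_Chasles f s 0 (1 + s) _ _ (isCI_gen f s 0 Hc) (isCI_gen f 0 (1 + s) Hc)).
  assert (A2 := isCI_Chasles f 0 1 (1 + s) _ _ (isCI_gen f 0 1 Hc) (isCI_gen f 1 (1 + s) Hc)).
  assert (A3 : CI f 1 (1 + s) = CI f 0 s).
  { assert (X := RInt_comp_lin (V := C_R_CompleteNormedModule) f 1 1 0 s ltac:(apply exCI_gen; auto)).
    rewrite !Rmult_1_l, Rplus_0_l in X. rewrite (Rplus_comm s 1) in X. rewrite <- X. apply CI_ext. intros t. rewrite Rmult_1_l, scal_R_Cmult.
    change (f (t + 1)%R) with (f (t + IZR 1)%R). rewrite Hp. apply Cmult_1_l. }
  assert (A4 : CI f 0 s = - CI f s 0). { apply isCI_CI. apply (is_RInt_swap (V := C_R_NormedModule)). now apply isCI_gen. }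
  apply isCI_CI in A1. apply isCI_CI in A2. rewrite A1, A2, A3, A4. cring.
Qed.

Lemma CI_neg f : (forall t, rcont f t) -> periodic1 f -> CI (fun x => f (- x)%R) 0 1 = CI f 0 1.
Proof.
  intros Hc Hp. assert (X := RInt_comp_lin (V := C_R_CompleteNormedModule) f (-1) 1 0 1 ltac:(apply exCI_gen; auto)).
  replace (-1 * 0 + 1)%R with 1%R in X by ring. replace (-1 * 1 + 1)%R with 0%R in X by ring.
  assert (A : CI f 0 1 = - CI f 1 0). { apply isCI_CI. apply (is_RInt_swap (V := C_R_NormedModule)). now apply isCI_gen. }
  rewrite A, <- X.
  assert (Hn : forall t, rcont (fun x => f (- x)%R) t).
  { intros t eps He. destruct (Hc (- t)%R eps He) as (d & Hd & Q). exists d. split; auto. intros r Hr. apply Q.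
    replace (- r - - t)%R with (- (r - t))%R by ring. now rewrite Rabs_Ropp. }
  assert (S : forall c : C, c = Copp (- (1) * c)) by (intros; ring).
  transitivity (Copp (- (1) * CI (fun x => f (- x)%R) 0 1)); [apply S|]. apply (f_equal Copp). symmetry. apply isCI_CI.
  apply (isCI_ext (fun x => - (1) * f (- x)%R)); [lra| |apply isCI_scal, isCI_gen; auto].
  intros t _. rewrite scal_R_Cmult. replace (RtoC (-1)) with (- RtoC 1) by (rewrite <- RtoC_opp; f_equal; ring). f_equal. replace (-1 * t + 1)%R with (- t + IZR 1)%R by ring. symmetry. apply Hp.
Qed.

Definition periodic2 (K : C -> C) : Prop := forall (x y : R) (m n : Z), K ((x + IZR m)%R, (y + IZR n)%R) = K (x, y).

Definition int_matrix (a b c d : Z) (z : C) : C := ((IZR a * Re z + IZR b * Im z)%R, (IZR c * Re z + IZR d * Im z)%R).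

Lemma cont_int_matrix a b c d z : cont (int_matrix a b c d) z.
Proof.
  intros eps He. set (M := (Rabs (IZR a) + Rabs (IZR b) + Rabs (IZR c) + Rabs (IZR d) + 1)%R).
  assert (Pa := Rabs_pos (IZR a)). assert (Pb := Rabs_pos (IZR b)). assert (Pc := Rabs_pos (IZR c)). assert (Pd := Rabs_pos (IZR d)).
  assert (HM : 0 < M) by (unfold M; lra).
  generalize (nearC_disc z (eps / M) ltac:(now apply Rdiv_lt_0_compat)). apply nearC_imp. intros w Hw.
  eapply Rle_lt_trans; [apply Cmod_le_re_im|]. 
  assert (X := re_le_Cmod (w - z)). assert (Y := im_le_Cmod (w - z)).
  replace (Re (int_matrix a b c d w - int_matrix a b c d z)) with (IZR a * Re (w - z) + IZR b * Im (w - z))%R by (unfold int_matrix; rewrite Re_minus, Im_minus; unfold Re, Im; simpl; ring).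
  replace (Im (int_matrix a b c d w - int_matrix a b c d z)) with (IZR c * Re (w - z) + IZR d * Im (w - z))%R by (unfold int_matrix; rewrite Re_minus, Im_minus; unfold Re, Im; simpl; ring).
  assert (T1 := Rabs_triang (IZR a * Re (w - z)) (IZR b * Im (w - z))). assert (T2 := Rabs_triang (IZR c * Re (w - z)) (IZR d * Im (w - z))).
  rewrite !Rabs_mult in T1, T2. set (m := Cmod (w - z)) in *. assert (Pm : 0 <= m) by apply Cmod_ge_0.
  apply Rmult_lt_compat_l with (r := M) in Hw; auto. replace (M * (eps / M))%R with eps in Hw by (field; lra).
  assert (Rabs (IZR a) * Rabs (Re (w - z)) <= Rabs (IZR a) * m) by (apply Rmult_le_compat_l; auto).
  assert (Rabs (IZR b) * Rabs (Im (w - z)) <= Rabs (IZR b) * m) by (apply Rmult_le_compat_l; auto).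
  assert (Rabs (IZR c) * Rabs (Re (w - z)) <= Rabs (IZR c) * m) by (apply Rmult_le_compat_l; auto).
  assert (Rabs (IZR d) * Rabs (Im (w - z)) <= Rabs (IZR d) * m) by (apply Rmult_le_compat_l; auto).
  unfold M in Hw. nra.
Qed.

Lemma periodic2_int_matrix K a b c d : periodic2 K -> periodic2 (fun z => K (int_matrix a b c d z)).
Proof. intros H x y m n. unfold int_matrix. cbn [Re Im fst snd].
  rewrite <- (H (IZR a * x + IZR b * y)%R (IZR c * x + IZR d * y)%R (a * m + b * n)%Z (c * m + d * n)%Z).
  rewrite !plus_IZR, !mult_IZR. f_equal. f_equal; ring. Qed.

(** A triangular change of basis is a shear followed by sign changes, and
    one-variable integrals over a period are invariant under both. *)
Lemma cell_int_upper K a b d : (forall z, cont K z) -> periodic2 K -> (a * d = 1 \/ a * d = -1)%Z -> cell_int (fun z => K (int_matrix a b 0 d z)) = cell_int K.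
Proof.
  intros Hc Hp Hd.
  assert (Pr : forall y, periodic1 (fun x => K (x, y))). { intros y x n. rewrite <- (Hp x y n 0%Z). f_equal. f_equal. ring. }
  assert (In : forall y, CI (fun x => K (int_matrix a b 0 d (x, y))) 0 1 = CI (fun x => K (x, IZR d * y)%R) 0 1).
  { intros y. unfold int_matrix. cbn [Re Im fst snd]. set (v := (IZR d * y)%R). set (s := (IZR b * y)%R).
    assert (Ea : (a = 1 \/ a = -1)%Z) by (destruct a as [|[]|[]], d as [|[]|[]]; lia).
    transitivity (CI (fun x => K ((IZR a * x + s)%R, v)) 0 1).
    { apply CI_ext. intros t. f_equal. f_equal. unfold v. ring. }
    assert (Hs : forall t, rcont (fun x => K ((x + s)%R, v)) t).
    { intros t eps He. destruct (rcont_row K v Hc (t + s)%R eps He) as (e & He' & Q). exists e. split; auto. intros r Hr. apply Q. now replace (r + s - (t + s))%R with (r - t)%R by ring. }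
    destruct Ea as [-> | ->].
    - rewrite <- (CI_shift (fun x => K (x, v)) s (rcont_row K v Hc) (Pr v)). apply CI_ext. intros t. f_equal. f_equal. ring.
    - rewrite <- (CI_shift (fun x => K (x, v)) s (rcont_row K v Hc) (Pr v)).
      rewrite <- (CI_neg (fun x => K ((x + s)%R, v)) Hs).
      + apply CI_ext. intros t. f_equal. f_equal. ring.
      + intros x n. rewrite <- (Pr v (x + s)%R n). f_equal. f_equal. ring. }
  unfold cell_int. rewrite (CI_ext _ (fun y => CI (fun x => K (x, IZR d * y)%R) 0 1)) by exact In.
  assert (Ed : (d = 1 \/ d = -1)%Z) by (destruct a as [|[]|[]], d as [|[]|[]]; lia).
  destruct Ed as [-> | ->].
  - apply CI_ext. intros y. apply CI_ext. intros x. now rewrite Rmult_1_l.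
  - rewrite <- (CI_neg (fun y => CI (fun x => K (x, y)) 0 1)).
    + apply CI_ext. intros y. apply CI_ext. intros x. f_equal. f_equal. ring.
    + now apply rcont_CI.
    + intros y n. apply CI_ext. intros x. rewrite <- (Hp x y 0%Z n). f_equal. f_equal. ring.
Qed.

(** The integral over a cell does not depend on the basis of the lattice.
    Euclid's algorithm on the first column reduces the matrix to a triangular
    one by shears and exchanges of the coordinates. *)
Theorem cell_int_GL2 K a b c d : (forall z, cont K z) -> periodic2 K -> (a * d - b * c = 1 \/ a * d - b * c = -1)%Z -> cell_int (fun z => K (int_matrix a b c d z)) = cell_int K.
Proof.
  assert (G : forall n K a b c d, (Z.abs_nat c < n)%nat -> (forall z, cont K z) -> periodic2 K -> (a * d - b * c = 1 \/ a * d - b * c = -1)%Z -> cell_int (fun z => K (int_matrix a b c d z)) = cell_int K).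
  { clear. induction n; intros K a b c d Hn Hc Hp Hd; [lia|].
    destruct (Z.eq_dec c 0) as [->|Nc]. { apply cell_int_upper; auto. lia. }
    set (k := (a / c)%Z). set (r := (a mod c)%Z).
    assert (Ea : a = (c * k + r)%Z) by now apply Z.div_mod.
    assert (Hr : (Z.abs_nat r < n)%nat). { assert (B := Z.mod_bound_or a c Nc). fold r in B. lia. }
    set (K1 := fun z => K (int_matrix 1 k 0 1 z)).
    set (K2 := fun z => K1 (Im z, Re z)).
    assert (C1 : forall z, cont K1 z). { intros z. apply (cont_comp K (int_matrix 1 k 0 1)); auto. apply cont_int_matrix. }
    assert (E2 : K2 = fun z => K1 (int_matrix 0 1 1 0 z)). { apply functional_extensionality. intros z. unfold K2. f_equal. unfold int_matrix. f_equal; ring. }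
    assert (C2 : forall z, cont K2 z). { rewrite E2. intros z. apply (cont_comp K1 (int_matrix 0 1 1 0)); auto. apply cont_int_matrix. }
    assert (P1 : periodic2 K1) by now apply periodic2_int_matrix.
    assert (P2 : periodic2 K2) by (rewrite E2; now apply periodic2_int_matrix).
    transitivity (cell_int (fun z => K2 (int_matrix c d r (b - k * d) z))).
    - f_equal. apply functional_extensionality. intros z. unfold K2, K1. f_equal. unfold int_matrix. cbn [Re Im fst snd]. rewrite Ea.
      rewrite plus_IZR, minus_IZR, !mult_IZR. f_equal; ring.
    - assert (Hdet : (c * (b - k * d) - d * r = 1 \/ c * (b - k * d) - d * r = -1)%Z).
      { replace (c * (b - k * d) - d * r)%Z with (- (a * d - b * c))%Z by (rewrite Ea; ring). lia. }
      rewrite (IHn K2 c d r (b - k * d)%Z Hr C2 P2 Hdet). transitivity (cell_int K1); [now apply cell_int_swap|]. apply cell_int_upper; auto. }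
  intros Hc Hp Hd. apply (G (S (Z.abs_nat c))); auto.
Qed.

(** * Integrals against the metric *)

Lemma cont_RtoC_Cmod f a : cont f a -> cont (fun w => RtoC (Cmod (f w))) a.
Proof. intros H eps He. generalize (H eps He). apply nearC_imp. intros w Hw. rewrite <- RtoC_minus, Cmod_R.
  eapply Rle_lt_trans; [|exact Hw]. apply Rabs_le. generalize (Cmod_ge_sub (f w) (f a)) (Cmod_ge_sub (f a) (f w)). rewrite (Cmod_sub_sym (f a)). lra. Qed.
Lemma cont_RtoC_Re a : cont (fun w => RtoC (Re w)) a.
Proof. intros eps He. generalize (nearC_disc a eps He). apply nearC_imp. intros v Hv. rewrite <- RtoC_minus, Cmod_R. eapply Rle_lt_trans; [apply (re_le_Cmod (v - a))|exact Hv]. Qed.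
Lemma cont_RtoC_Im a : cont (fun w => RtoC (Im w)) a.
Proof. intros eps He. generalize (nearC_disc a eps He). apply nearC_imp. intros v Hv. rewrite <- RtoC_minus, Cmod_R. eapply Rle_lt_trans; [apply (im_le_Cmod (v - a))|exact Hv]. Qed.
Lemma cexp_R x : cexp (RtoC x) = RtoC (exp x).
Proof. unfold cexp. rewrite re_RtoC, im_RtoC, cos_0, sin_0. unfold RtoC. f_equal; ring. Qed.

Definition cell (tau z : C) : C := RtoC (Re z) + RtoC (Im z) * tau.
Lemma cont_cell tau a : cont (cell tau) a.
Proof. apply cont_plus; [apply cont_RtoC_Re|apply cont_mult; [apply cont_RtoC_Im|apply cont_const]]. Qed.

Definition metric_exponent (tau w : C) : R := (4 * PI * Im w - 4 * PI * Im w ^ 2 / Im tau)%R.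

Section Ex.
Variable tau : C.
Hypothesis Ht : 0 < Im tau.

Lemma cont_exp_metric_exponent a : cont (fun w => RtoC (exp (metric_exponent tau w))) a.
Proof.
  apply cont_ext with (fun w => cexp (RtoC (4 * PI) * RtoC (Im w) - RtoC (4 * PI / Im tau) * (RtoC (Im w) * RtoC (Im w)))).
  - intros w. rewrite <- cexp_R. f_equal. rewrite <- !RtoC_mult, <- RtoC_minus. f_equal. unfold metric_exponent. field. lra.
  - apply (cont_comp cexp (fun w => RtoC (4 * PI) * RtoC (Im w) - RtoC (4 * PI / Im tau) * (RtoC (Im w) * RtoC (Im w)))); [eapply cdv_continuous, cdv_cexp|].
    apply cont_minus; apply cont_mult; try apply cont_const; try apply cont_mult; apply cont_RtoC_Im.
Qed.

Lemma cont_metric a : cont (fun w => RtoC (metric tau w)) a.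
Proof.
  apply cont_ext with (fun w => RtoC (Cmod (theta tau w)) * RtoC (Cmod (theta tau w)) * (RtoC (Cmod (theta tau w)) * RtoC (Cmod (theta tau w))) * RtoC (exp (metric_exponent tau w))).
  - intros w. rewrite <- !RtoC_mult. f_equal. unfold metric, metric_exponent. ring.
  - assert (T : cont (fun w => RtoC (Cmod (theta tau w))) a) by (apply cont_RtoC_Cmod, holo_cont, holo_theta; auto).
    repeat apply cont_mult; auto. apply cont_exp_metric_exponent.
Qed.

Lemma metric_lattice w : lattice tau w -> metric tau w = 0%R.
Proof. intros H. unfold metric. rewrite theta_eq0 by auto. rewrite Cmod_0. ring. Qed.
Lemma metric_pos w : ~ lattice tau w -> 0 < metric tau w.
Proof. intros H. apply Rmult_lt_0_compat; [|apply exp_pos]. apply pow_lt, Cmod_gt_0, theta_nz; auto. Qed.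
Lemma metric_ge0 w : 0 <= metric tau w.
Proof. apply Rmult_le_pos; [|left; apply exp_pos]. apply pow_le, Cmod_ge_0. Qed.

(** The double pole of [eta_fun] is absorbed by the fourth order zero of the
    metric. *)
Lemma cont_eta_metric a : cont (fun w => eta_fun tau w * RtoC (metric tau w)) a.
Proof.
  destruct (Classical_Prop.classic (lattice tau a)) as [La|La].
  2:{ apply cont_mult; [apply holo_cont, holo_eta_fun; auto|apply cont_metric]. }
  destruct (eta_fun_local tau Ht a La) as (h & h1 & h2). destruct (theta_at_lattice tau Ht a La) as (g & G1 & _ & G3).
  set (V := fun w => 1 + (w - a) * (w - a) * h w).
  assert (CV : cont V a). { apply cont_plus; [apply cont_const|]. apply cont_mult; [|now apply holo_cont]. apply cont_mult; (apply cont_minus; [apply cont_id|apply cont_const]). }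
  assert (V0 : V a = 1) by (unfold V; ring).
  set (M := (2 * (Cmod (g a) + 1) ^ 4 * (exp (metric_exponent tau a) + 1))%R).
  assert (Pg := Cmod_ge_0 (g a)). assert (Pe := exp_pos (metric_exponent tau a)).
  assert (PM : 0 < M) by (unfold M; repeat apply Rmult_lt_0_compat; try apply pow_lt; lra).
  intros eps He. rewrite (eta_fun_lattice tau a La), Cmult_0_l.
  generalize (nearC_and _ _ _ (nearC_and _ _ _ h2 (CV 1%R Rlt_0_1)) (nearC_and _ _ _ (nearC_and _ _ _ (holo_cont _ _ G1 1%R Rlt_0_1) (cont_exp_metric_exponent a 1%R Rlt_0_1)) (nearC_and _ _ _ (nearC_disc a 1 Rlt_0_1) (nearC_disc a (eps / M) ltac:(now apply Rdiv_lt_0_compat))))).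
  apply nearC_imp. intros w [[K1 K2] [[K3 K4] [K5 K6]]].
  replace (eta_fun tau w * RtoC (metric tau w) - 0) with (eta_fun tau w * RtoC (metric tau w)) by ring.
  destruct (Classical_Prop.classic (w = a)) as [->|N]. { rewrite eta_fun_lattice by auto. rewrite Cmult_0_l, Cmod_0. exact He. }
  specialize (K1 N). assert (Nz := Csub_nz _ _ N). assert (Pz : 0 < Cmod (w - a)) by now apply Cmod_gt_0.
  assert (E1 : Cmod (eta_fun tau w) = (Cmod (V w) * / (Cmod (w - a) * Cmod (w - a)))%R).
  { rewrite <- Cmod_mult, <- Cmod_inv, <- Cmod_mult by now apply Cmult_neq_0. f_equal. rewrite K1. unfold V. field. exact Nz. }
  rewrite Cmod_mult, Cmod_R, (Rabs_pos_eq (metric tau w)) by apply metric_ge0. unfold metric. fold (metric_exponent tau w). rewrite E1, G3, Cmod_mult.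
  replace (Cmod (V w) * / (Cmod (w - a) * Cmod (w - a)) * ((Cmod (w - a) * Cmod (g w)) ^ 4 * exp (metric_exponent tau w)))%R with
    (Cmod (w - a) * (Cmod (w - a) * (Cmod (V w) * Cmod (g w) ^ 4 * exp (metric_exponent tau w))))%R by (field; lra).
  assert (B1 : Cmod (V w) <= 2). { replace (V w) with (V w - V a + 1) by (rewrite V0; ring). eapply Rle_trans; [apply Cmod_triangle|]. rewrite Cmod_1. lra. }
  assert (B2 : Cmod (g w) <= Cmod (g a) + 1). { replace (g w) with (g w - g a + g a) by ring. eapply Rle_trans; [apply Cmod_triangle|]. lra. }
  assert (B3 : exp (metric_exponent tau w) <= exp (metric_exponent tau a) + 1). { rewrite <- RtoC_minus, Cmod_R in K4. apply Rabs_def2 in K4. lra. }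
  assert (B : Cmod (V w) * Cmod (g w) ^ 4 * exp (metric_exponent tau w) <= M).
  { unfold M. apply Rmult_le_compat; [apply Rmult_le_pos; [apply Cmod_ge_0|apply pow_le, Cmod_ge_0]|left; apply exp_pos| |exact B3].
    apply Rmult_le_compat; [apply Cmod_ge_0|apply pow_le, Cmod_ge_0|exact B1|]. apply pow_incr. split; [apply Cmod_ge_0|exact B2]. }
  set (X := (Cmod (V w) * Cmod (g w) ^ 4 * exp (metric_exponent tau w))%R) in *.
  assert (PX : 0 <= X). { apply Rmult_le_pos; [|left; apply exp_pos]. apply Rmult_le_pos; [apply Cmod_ge_0|apply pow_le, Cmod_ge_0]. }
  apply Rle_lt_trans with (Cmod (w - a) * M)%R. { apply Rmult_le_compat_l; [lra|]. nra. }
  apply Rmult_lt_compat_r with (r := M) in K6; auto. replace (eps / M * M)%R with eps in K6 by (field; lra). exact K6.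
Qed.

Definition cell_metric (z : C) : C := RtoC (metric tau (cell tau z)).
Definition cell_eta (z : C) : C := eta_fun tau (cell tau z) * RtoC (metric tau (cell tau z)).

Lemma cont_cell_metric z : cont cell_metric z.
Proof. apply (cont_comp (fun w => RtoC (metric tau w)) (cell tau)); [apply cont_metric|apply cont_cell]. Qed.
Lemma cont_cell_eta z : cont cell_eta z.
Proof. apply (cont_comp (fun w => eta_fun tau w * RtoC (metric tau w)) (cell tau)); [apply cont_eta_metric|apply cont_cell]. Qed.

(** In the applications the integrand is merely bounded below near the
    horizontal sides of the cell, while the middle half carries the bulk of the
    integral. *)
Lemma cell_int_bound_mid K (m0 m1 : R) : (forall z, cont K z) -> (forall x y, 0 <= x <= 1 -> 0 <= y <= 1 -> m0 <= Re (K (x, y))) ->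
  (forall x y, 0 <= x <= 1 -> / 4 <= y <= 3 / 4 -> m1 <= Re (K (x, y))) -> (m0 / 2 + m1 / 2)%R <= Re (cell_int K).
Proof.
  intros Hc H0 H1.
  assert (A : forall m y, (forall x, 0 <= x <= 1 -> m <= Re (K (x, y))) -> m <= Re (CI (fun x => K (x, y)) 0 1)).
  { intros m y Hy. assert (X := isCI_gen (fun x => K (x, y)) 0 1 (rcont_row K y Hc)). apply isCI_pair in X as [X _].
    replace m with ((1 - 0) * m)%R by ring. apply (is_RInt_le (fun _ => m) (fun x => Re (K (x, y))) 0 1); [lra| |exact X|].
    - apply (is_RInt_const (V := R_NormedModule)). - intros x Hx. apply Hy; lra. }
  set (f := fun y => CI (fun x => K (x, y)) 0 1).
  assert (B : forall a b m, a <= b -> (forall y, a <= y <= b -> m <= Re (f y)) -> (b - a) * m <= Re (CI f a b)).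
  { intros a b m Hab Hm. assert (X := isCI_gen f a b (rcont_CI K 0 1 Hc)). apply isCI_pair in X as [X _].
    apply (is_RInt_le (fun _ => m) (fun y => Re (f y)) a b); [lra| |exact X|].
    - apply (is_RInt_const (V := R_NormedModule)). - intros x Hx. apply Hm; lra. }
  assert (E : cell_int K = CI f 0 (/ 4) + CI f (/ 4) (3 / 4) + CI f (3 / 4) 1).
  { unfold cell_int. apply isCI_CI. apply isCI_Chasles with (3 / 4)%R; [apply isCI_Chasles with (/ 4)%R|]; apply isCI_gen; apply (rcont_CI K 0 1 Hc). }
  rewrite E, !Re_plus.
  assert (B1 := B 0%R (/ 4)%R m0 ltac:(lra) ltac:(intros y Hy; apply A; intros x Hx; apply H0; lra)).
  assert (B2 := B (/ 4)%R (3 / 4)%R m1 ltac:(lra) ltac:(intros y Hy; apply A; intros x Hx; apply H1; lra)).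
  assert (B3 := B (3 / 4)%R 1%R m0 ltac:(lra) ltac:(intros y Hy; apply A; intros x Hx; apply H0; lra)).
  lra.
Qed.

Lemma cell_Im z : Im (cell tau z) = (Im z * Im tau)%R.
Proof. unfold cell. rewrite Im_plus, Im_Rmult, im_RtoC. ring. Qed.

Lemma cell_lattice x y : lattice tau (cell tau (x, y)) -> exists n : Z, y = IZR n.
Proof. intros (m & n & E). exists n. apply (f_equal Im) in E. rewrite cell_Im, Im_plus, Im_Rmult, im_RtoC in E. unfold Im in E at 1; cbn [snd] in E.
  apply Rmult_eq_reg_r with (Im tau); lra. Qed.

Lemma mid_not_int y (n : Z) : / 4 <= y <= 3 / 4 -> y <> IZR n.
Proof. intros H E. subst y. assert (0 < IZR n < 1) as [A B] by lra. apply lt_IZR in A, B. lia. Qed.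

Lemma cell_int_metric_nz : cell_int cell_metric <> 0.
Proof.
  assert (Hb : exists M : R, 0 < M /\ forall z, in_box 0 1 (/ 4) (3 / 4) z -> Cmod (/ cell_metric z) <= M).
  { apply box_bounded. intros z [Hx Hy]. apply cont_inv; [|apply cont_cell_metric]. unfold cell_metric. intros E. apply RtoC_inj in E.
    destruct z as [x y]. unfold Im in Hy; cbn [snd] in Hy.
    assert (N : ~ lattice tau (cell tau (x, y))). { intros L. destruct (cell_lattice _ _ L) as [n En]. now apply (mid_not_int y n). }
    generalize (metric_pos _ N). lra. }
  destruct Hb as (M & HM & Hb).
  assert (L : (0 / 2 + / M / 2)%R <= Re (cell_int cell_metric)).
  { apply cell_int_bound_mid; [apply cont_cell_metric| |].
    - intros x y _ _. unfold cell_metric. rewrite re_RtoC. apply metric_ge0.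
    - intros x y Hx Hy. specialize (Hb (x, y) ltac:(split; simpl; lra)). unfold cell_metric in *. rewrite re_RtoC.
      assert (N : ~ lattice tau (cell tau (x, y))). { intros L. destruct (cell_lattice _ _ L) as [n En]. now apply (mid_not_int y n). }
      assert (P := metric_pos _ N). rewrite Cmod_inv, Cmod_R, Rabs_pos_eq in Hb by (try lra; intros E; apply RtoC_inj in E; lra).
      rewrite <- (Rinv_inv (metric tau (cell tau (x, y)))). apply Rinv_le_contravar; auto. now apply Rinv_0_lt_compat. }
  intros E. rewrite E, re_RtoC in L. assert (0 < / M) by now apply Rinv_0_lt_compat. lra.
Qed.

(** * Sections of K_S(2 Delta) *)

(** Adding a constant to [eta_fun] preserves the double pole with its
    coefficient, and the value 0 at the poles. *)
Definition eta_add (c w : C) : C := if excluded_middle_informative (lattice tau w) then 0 else eta_fun tau w + c.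
Definition diff_section (c : C) (z : C * C) : C := eta_add c (fst z - snd z).

Lemma eta_add_lattice c w : lattice tau w -> eta_add c w = 0.
Proof. intros H. unfold eta_add. destruct (excluded_middle_informative (lattice tau w)); tauto. Qed.
Lemma eta_add_off c w : ~ lattice tau w -> eta_add c w = eta_fun tau w + c.
Proof. intros H. unfold eta_add. destruct (excluded_middle_informative (lattice tau w)); tauto. Qed.

Lemma eta_add_periodic c : periodic tau (eta_add c).
Proof. intros w l Hl. destruct (Classical_Prop.classic (lattice tau w)) as [H|H].
  - rewrite !eta_add_lattice; auto. now apply lattice_plus.
  - rewrite !eta_add_off; auto; [now rewrite (eta_fun_periodic tau Ht w l Hl)|]. now rewrite lattice_sub_iff. Qed.
Lemma holo_eta_add c w : ~ lattice tau w -> holo_at (eta_add c) w.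
Proof. intros H. apply holo_loc with (fun w => eta_fun tau w + c).
  - generalize (nonlattice_open tau w Ht H). apply nearC_imp. intros z Hz. now rewrite eta_add_off.
  - apply holo_plus; [apply holo_eta_fun; auto|apply holo_const]. Qed.

Lemma eta_add_local c a : lattice tau a -> exists h, holo_at h a /\ nearC a (fun w => eta_add c w = (1 + (w - a) * (w - a) * h w) / ((w - a) * (w - a))).
Proof.
  intros Ha. destruct (eta_fun_local tau Ht a Ha) as (h & h1 & h2). exists (fun w => h w + c). split; [apply holo_plus; [exact h1|apply holo_const]|].
  generalize (nearC_and _ _ _ h2 (nonlattice_near tau a Ht)). apply nearC_imp. intros w [K1 K2].
  destruct (Classical_Prop.classic (w = a)) as [->|N].
  - rewrite eta_add_lattice by auto. replace ((a - a) * (a - a)) with (RtoC 0) by ring. unfold Cdiv. rewrite Cinv_0. ring.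
  - rewrite eta_add_off, K1 by auto. assert (Nz := Csub_nz _ _ N). field. exact Nz.
Qed.

Lemma diff_section_germ c a : exists v, holo2_at v (a, a) /\ locally (a, a) (fun z : C * C => diff_section c z = (v z / (fst z - snd z) ^ 2)) /\ v (a, a) = 1.
Proof.
  destruct (eta_add_local c 0 (lattice_0 tau)) as (h & h1 & h2).
  assert (Z0 : a - a = 0) by ring.
  set (V := fun w => 1 + (w - 0) * (w - 0) * h w).
  exists (fun z => V (fst z - snd z)). split; [|split].
  - apply (holo2_diff V). rewrite Z0. apply holo_plus; [apply holo_const|]. apply holo_mult; auto.
    apply holo_mult; (apply holo_minus; [apply holo_id|apply holo_const]).
  - rewrite <- Z0 in h2. generalize (near2_diff a a _ h2). apply filter_imp. intros z Hz. unfold diff_section, V. etransitivity; [exact Hz|]. rewrite Z0. simpl.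
    replace (fst z - snd z - 0) with (fst z - snd z) by ring. unfold Cdiv. f_equal. f_equal. ring.
  - cbn [fst snd]. rewrite Z0. unfold V. ring.
Qed.

Lemma diff_section_section c : H0_KS2Delta tau (diff_section c).
Proof.
  split; [|split].
  - intros z1 z2 l1 l2 H1 H2. unfold diff_section. cbn [fst snd]. replace (z1 + l1 - (z2 + l2)) with (z1 - z2 + (l1 - l2)) by ring.
    apply eta_add_periodic. now apply lattice_minus.
  - intros a1 a2 H. apply (holo2_diff (eta_add c)). now apply holo_eta_add.
  - intros a. destruct (diff_section_germ c a) as (v & H1 & H2 & _). now exists v.
Qed.

(** * The reproducing section exists *)

Lemma twoTheta_nil x y : twoTheta tau [] (phi tau x y) = if excluded_middle_informative (lattice tau (x - y)) then 2%Z else 0%Z.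
Proof. unfold twoTheta. assert (E := Theta_nil tau Ht x y).
  destruct (excluded_middle_informative (Theta tau [] (phi tau x y))), (excluded_middle_informative (lattice tau (x - y))); tauto. Qed.

Lemma twoTheta_AJ w : twoTheta tau [] (AJ tau w) = if excluded_middle_informative (lattice tau w) then 2%Z else 0%Z.
Proof. unfold AJ. rewrite twoTheta_nil. now replace (w - 0) with w by ring. Qed.

(** A section over the Jacobian of the covering by C; only functions invariant
    under the lattice are composed with it. *)
Definition AJ_lift (L : J0 tau) : C := epsilon (inhabits (RtoC 0)) (fun w => AJ tau w = L).
Lemma AJ_lift_AJ w : lattice tau (AJ_lift (AJ tau w) - w).
Proof. apply AJ_inj; auto. exact (epsilon_spec (inhabits (RtoC 0)) (fun v => AJ tau v = AJ tau w) (ex_intro _ w eq_refl)). Qed.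

Lemma descend {T : Type} (f : C -> T) : (forall w l, lattice tau l -> f (w + l) = f w) -> forall w, f (AJ_lift (AJ tau w)) = f w.
Proof. intros H w. rewrite <- (H w _ (AJ_lift_AJ w)). f_equal. ring. Qed.

(** The constant that makes the section orthogonal to the constants for the
    metric. *)
Definition sigma_shift : C := - (cell_int cell_eta / cell_int cell_metric).

Lemma orthogonality : cell_int (fun z => eta_add sigma_shift (cell tau z) * RtoC (metric tau (cell tau z))) = 0.
Proof.
  transitivity (cell_int (fun z => cell_eta z + sigma_shift * cell_metric z)).
  - f_equal. apply functional_extensionality. intros z. unfold cell_eta, cell_metric.
    destruct (Classical_Prop.classic (lattice tau (cell tau z))) as [L|L].
    + rewrite metric_lattice by auto. ring. + rewrite eta_add_off by auto. ring.
  - rewrite cell_int_plus, cell_int_scal; [|apply cont_cell_metric|apply cont_cell_eta|].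
    + unfold sigma_shift. assert (N := cell_int_metric_nz). field. exact N.
    + intros z. apply cont_mult; [apply cont_const|apply cont_cell_metric].
Qed.

(** Vanishing at the origin lowers the double pole to a simple one, so such a
    section is a multiple of the canonical frame. *)
Lemma VV0_const t : VV0 tau [] t -> exists c, forall w, ~ lattice tau w -> t (AJ tau w) = c.
Proof.
  intros [[Hp Ho] Hv]. set (f := fun w => t (AJ tau w)).
  assert (R : forall a, ~ lattice tau a -> exists g, holo_at g a /\ nearC a (fun z => f z = g z)).
  { intros a Ha. destruct (Ho a) as (g & G1 & G2). cbv beta in G2. rewrite twoTheta_AJ in G2. destruct (excluded_middle_informative (lattice tau a)) as [|_]; [tauto|].
    exists g. split; auto. revert G2. apply nearC_imp. intros z Hz. unfold f. rewrite Hz. simpl. ring. }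
  destruct (simple_pole_const tau f 0 Ht Hp) as [c Hc].
  - intros a Ha. replace (a - 0) with a in Ha by ring. destruct (R a Ha) as (g & G1 & G2). apply ordge_0. exists g. split; auto. now apply nearP_of.
  - destruct Hv as (g & G1 & G0 & G2). destruct (holo_factor g 0 G1 G0) as (g1 & K1 & _ & K3). exists g1. split; auto.
    cbv beta in G2. rewrite twoTheta_AJ in G2. destruct (excluded_middle_informative (lattice tau 0)) as [_|N]; [|now destruct (N (lattice_0 tau))].
    revert G2. apply nearC_imp. intros z Hz N. unfold f. rewrite Hz, K3. simpl. replace (z - 0) with z by ring. field. exact N.
  - exists c. intros w Hw. destruct (R w Hw) as (g & G1 & G2).
    apply (cont_agree f (fun _ => c)).
    + apply cont_loc with g; [|now apply holo_cont]. revert G2. apply nearC_imp. auto.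
    + apply cont_const.
    + apply Hc.
Qed.

(** With F = O_X the isomorphism of line bundles is multiplication by 1, the
    sections vanishing at the origin are the constants, and orthogonality to
    them fixes the additive constant. *)
Theorem is_sigma_exists : exists u, is_sigma tau u.
Proof.
  assert (Pc : forall w l, lattice tau l -> eta_add sigma_shift (w + l) = eta_add sigma_shift w) by (intros; now apply eta_add_periodic).
  assert (Pr : forall w l, lattice tau l -> metric tau (w + l) = metric tau w) by (intros; now apply metric_periodic).
  exists (diff_section sigma_shift). split; [apply diff_section_section|]. split.
  { intros a. destruct (diff_section_germ sigma_shift a) as (v & H1 & H2 & H3). now exists v. }
  exists [], (fun L => metric tau (AJ_lift L)), (fun _ => RtoC 1), (fun L => eta_add sigma_shift (AJ_lift L)).
  split; [|split; [|split; [|split]]].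
  - exists (fun _ => 1). split; [now intros z l _|]. intros a. exists (fun _ => 1). split; [apply holo_const|]. split; [apply C1_nz|].
    apply nearC_all. intros z. simpl. ring.
  - intros a. destruct (metric_local tau Ht a) as (k & K1 & K2). destruct (curv_germ_smooth _ _ _ K1) as [S1 S2].
    exists k. split; [exact S1|]. split.
    + revert K2. apply nearC_imp. intros w Hw. rewrite (descend (metric tau) Pr), Hw. f_equal. rewrite twoTheta_AJ. unfold lattice_mult_nat.
      destruct (excluded_middle_informative (lattice tau a)); simpl.
      * rewrite Cmult_1_r, Cmod_mult. ring.
      * rewrite Cmod_1. ring.
    + revert S2. apply nearC_imp. intros w ->. unfold metric_curv, omega0. replace (Im (Cconj 1 * Ci)) with 1%R by (unfold Im; simpl; ring).
      assert (P := PI_RGT_0). field. split; lra.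
  - split; [reflexivity|]. intros a1 a2. exists (fun _ => 1).
    assert (T1 : holo2_at (fun _ => RtoC 1) (a1, a2)). { apply (holo2_diff (fun _ => RtoC 1)). apply holo_const. }
    split; [exact T1|]. split; [apply C1_nz|].
    apply filter_forall. intros z. rewrite twoTheta_nil. unfold twoDelta. rewrite Z.sub_diag. simpl. ring.
  - split.
    + split.
      * intros w l Hl. now rewrite AJ_lattice.
      * intros a. rewrite twoTheta_AJ. destruct (excluded_middle_informative (lattice tau a)) as [La|La].
        -- destruct (eta_add_local sigma_shift a La) as (h & h1 & h2). exists (fun w => 1 + (w - a) * (w - a) * h w). split.
           ++ apply holo_plus; [apply holo_const|]. apply holo_mult; auto. apply holo_mult; (apply holo_minus; [apply holo_id|apply holo_const]).
           ++ revert h2. apply nearC_imp. intros w Hw. rewrite (descend (eta_add sigma_shift) Pc), Hw. simpl. unfold Cdiv. rewrite Cmult_1_r. ring.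
        -- exists (eta_add sigma_shift). split; [now apply holo_eta_add|]. apply nearC_all. intros w. rewrite (descend (eta_add sigma_shift) Pc). simpl. ring.
    + intros t HT. destruct (VV0_const t HT) as [c Hc]. unfold inner.
      transitivity (cell_int (fun z => Cconj c * (eta_add sigma_shift (cell tau z) * RtoC (metric tau (cell tau z))))).
      * unfold cell_int. apply CI_ext. intros y. apply CI_ext. intros x. cbv zeta. rewrite (descend (eta_add sigma_shift) Pc), (descend (metric tau) Pr).
        change (cell tau (x, y)) with (RtoC x + RtoC y * tau).
        replace (omega0 tau 1 tau) with 1%R by (unfold omega0, Im; simpl; field; unfold Im in Ht; lra).
        destruct (Classical_Prop.classic (lattice tau (RtoC x + RtoC y * tau))) as [L|L].
        -- rewrite (metric_lattice _ L), Rmult_0_l. cring.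
        -- rewrite (Hc _ L), Rmult_1_r. cring.
      * rewrite cell_int_scal, orthogonality; [ring|]. intros z.
        apply cont_ext with (fun z => cell_eta z + sigma_shift * cell_metric z).
        -- intros v. unfold cell_eta, cell_metric. destruct (Classical_Prop.classic (lattice tau (cell tau v))) as [L|L].
           ++ rewrite metric_lattice by auto. ring. ++ rewrite eta_add_off by auto. ring.
        -- apply cont_plus; [apply cont_cell_eta|]. apply cont_mult; [apply cont_const|apply cont_cell_metric].
  - intros z1 z2 HN. rewrite Theta_nil in HN by auto. unfold diff_section. cbn [fst snd]. rewrite phi_AJ by auto. rewrite (descend (eta_add sigma_shift) Pc). ring.
Qed.

End Ex.

(** * The section eta exists *)

Section Eta.
Variable tau : C.
Hypothesis Ht : 0 < Im tau.

(** A double pole without residue in the coordinate w - p has the same shape in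
    the coordinate zeta: normalised by the derivative at p, it differs from 1 /
    zeta^2 by a function that extends over p. *)
Lemma chart_expansion (zeta H : C -> C) p : holo_at zeta p -> zeta p = 0 -> C_derive zeta p <> 0 -> holo_at H p ->
  exists M, holo_at M p /\ nearP p (fun w =>
    (/ ((w - p) * (w - p)) + H w) / (C_derive zeta p * C_derive zeta w) = / (zeta w * zeta w) + M w).
Proof.
  intros Hz Z0 Nz0 HH. destruct (holo_factor zeta p Hz Z0) as (b & B1 & B2 & B3).
  set (b0 := C_derive zeta p) in *. assert (Nb : b p <> 0) by now rewrite B2.
  assert (B1' := holo_derive _ _ B1).
  set (dz := fun w => b w + (w - p) * C_derive b w).
  assert (Hd : holo_at dz p). { apply holo_plus; [exact B1|]. apply holo_mult; [|exact B1']. apply holo_minus; [apply holo_id|apply holo_const]. }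
  assert (Ed : nearC p (fun w => C_derive zeta w = dz w)).
  { generalize (holo_near_cdv _ _ B1). apply nearC_imp. intros w K. apply cdv_C_derive. apply cdv_ext with (fun w => (w - p) * b w); [intros; symmetry; apply B3|].
    eapply cdv_eq; [apply cdv_mult; [apply cdv_minus; [apply cdv_id|apply cdv_const]|exact K]|]. unfold dz. ring. }
  set (N0 := fun w => b w * b w - b0 * dz w).
  assert (H0 : holo_at N0 p). { apply holo_minus; [now apply holo_mult|]. apply holo_mult; [apply holo_const|exact Hd]. }
  assert (V0 : N0 p = 0). { unfold N0, dz. rewrite B2. ring. }
  assert (D0 : C_derive N0 p = 0).
  { apply cdv_C_derive. eapply cdv_eq.
    - apply cdv_minus; [apply cdv_mult; apply holo_cdv, B1|]. apply cdv_scal. apply cdv_plus; [apply holo_cdv, B1|].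
      apply cdv_mult; [apply cdv_minus; [apply cdv_id|apply cdv_const]|apply holo_cdv, B1'].
    - cbv beta. rewrite B2. ring. }
  destruct (holo_factor N0 p H0 V0) as (N1 & K1 & K2 & K3). rewrite D0 in K2.
  destruct (holo_factor N1 p K1 K2) as (N2 & L1 & _ & L3).
  assert (Np : dz p <> 0). { unfold dz. replace (b p + (p - p) * C_derive b p) with (b p) by ring. exact Nb. }
  exists (fun w => (N2 w + H w * (b w * b w)) / (b0 * dz w * (b w * b w))). split.
  - apply holo_div.
    + repeat apply Cmult_neq_0; auto.
    + apply holo_plus; [exact L1|]. apply holo_mult; [exact HH|]. apply holo_mult; exact B1.
    + apply holo_mult; [apply holo_mult; [apply holo_const|exact Hd]|apply holo_mult; exact B1].
  - generalize (nearC_and _ _ _ Ed (nearC_and _ _ _ (cont_nonzero _ _ (holo_cont _ _ Hd) Np) (cont_nonzero _ _ (holo_cont _ _ B1) Nb))).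
    apply nearC_imp. intros w (E1 & E2 & E3) Nw. assert (Nz := Csub_nz _ _ Nw).
    rewrite E1, B3. assert (EN : b w * b w - b0 * dz w = (w - p) * ((w - p) * N2 w)) by (rewrite <- L3, <- K3; reflexivity).
    assert (EN2 : N2 w = (b w * b w - b0 * dz w) / ((w - p) * (w - p))) by (rewrite EN; field; exact Nz).
    rewrite EN2. field. auto.
Qed.

Lemma chart_der_nz W zeta p : is_chart tau W zeta -> W p -> C_derive zeta p <> 0.
Proof.
  intros (_ & _ & _ & Hc) Hp. destruct (Hc p Hp) as (H1 & psi & P1 & P2 & P3). intros E.
  apply C1_nz. rewrite <- (cdv_unique (fun z => psi (zeta z)) p (C_derive psi (zeta p) * C_derive zeta p) 1).
  - rewrite E. ring.
  - apply cdv_comp; now apply holo_cdv.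
  - apply cdv_loc with (fun z => z); [|apply cdv_id]. revert P2. apply nearC_imp. auto.
Qed.

Lemma chart_der_periodic W zeta z l : is_chart tau W zeta -> W z -> lattice tau l -> C_derive zeta (z + l) = C_derive zeta z.
Proof.
  intros (Ho & Hp & _ & Hc) Hz Hl. destruct (Hc z Hz) as (H1 & _). destruct (Hc (z + l) (proj1 (Hp z l Hz Hl))) as (H2 & _).
  apply (cdv_unique zeta z); [|now apply holo_cdv]. apply cdv_loc with (fun w => zeta (w + l)).
  - generalize (Ho z Hz). apply nearC_imp. intros w Hw. now apply Hp.
  - apply cdv_shift, holo_cdv, H2.
Qed.

Lemma mult_pole p a : mult tau [(p, 2%Z)] a = (2 * lattice_mult tau (p - a))%Z.
Proof. rewrite mult_cons. change (mult tau [] a) with 0%Z. lia. Qed.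

Lemma eta_section_H0 p (k : C) : H0 tau (mult tau [(p, 2%Z)]) (fun w => eta_add tau 0 (w - p) / k).
Proof.
  split.
  - intros w l Hl. f_equal. rewrite <- (eta_add_periodic tau Ht 0 (w - p) l Hl). f_equal. ring.
  - intros a. rewrite mult_pole. destruct (Classical_Prop.classic (lattice tau (p - a))) as [L|L].
    + rewrite lattice_mult_yes by auto. assert (L' : lattice tau (a - p)) by now apply lattice_sym.
      destruct (eta_add_local tau Ht 0 (a - p) L') as (h & h1 & h2).
      exists (fun w => (1 + (w - a) * (w - a) * h (w + - p)) / k). split.
      * apply holo_mult; [|apply holo_const]. apply holo_plus; [apply holo_const|]. apply holo_mult; [apply holo_mult; (apply holo_minus; [apply holo_id|apply holo_const])|].
        apply holo_shift. exact h1.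
      * generalize (nearC_shift a (- p) _ h2). apply nearC_imp. intros w Hw. change (w - p) with (w + - p). rewrite Hw.
        replace (w + - p - (a - p)) with (w - a) by ring. simpl. unfold Cdiv. rewrite Cmult_1_r. ring.
    + rewrite lattice_mult_no by auto. exists (fun w => eta_add tau 0 (w + - p) / k). split.
      * apply holo_mult; [|apply holo_const]. apply holo_shift. apply holo_eta_add; auto. intros K. now apply L, lattice_sym.
      * apply nearC_all. intros w. simpl. change (w - p) with (w + - p). ring.
Qed.

Lemma rdf_shift (G : C -> C) l z L : rdf G (z + l) L -> rdf (fun w => G (w + l)) z L.
Proof. intros H eps He. destruct (H eps He) as (d & Hd & K). exists d. split; auto. intros h Hh. replace (z + h + l) with (z + l + h) by ring. auto. Qed.

(** The primitive [eta_prim] exhibits the class as that of an antiholomorphic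
    form. *)
Lemma eta_section_class p (k : C) : class_in_H01 tau p (fun w => eta_add tau 0 (w - p) / k).
Proof.
  set (b := RtoC (PI / Im tau) / k).
  exists (fun _ => - Cconj b), (fun w => / k * eta_prim tau (w + - p)). split; [|split].
  - split; [now intros z l _|]. intros a. exists (fun _ => - Cconj b). split; [apply holo_const|]. apply nearC_all. intros z. simpl. ring.
  - intros w l Hl. f_equal. rewrite <- (eta_prim_periodic tau Ht (w + - p) l Hl). f_equal. ring.
  - intros z Hz.
    assert (X : rdf (fun w => / k * eta_prim tau (w + - p)) z (fun h => (eta_add tau 0 (z - p) / k) * h + b * Cconj h)).
    { apply rdf_ext with (fun h => / k * (eta_fun tau (z + - p) * h + RtoC (PI / Im tau) * Cconj h)).
      - intros h. rewrite eta_add_off by auto. unfold b. change (z - p) with (z + - p). unfold Cdiv. ring.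
      - apply rdf_scal. apply (rdf_shift (eta_prim tau)). apply eta_prim_rdf; auto. }
    apply rdfE in X. revert X. 
    replace (fun dz : C => eta_add tau 0 (z - p) / k * dz + b * Cconj dz) with (fun dz : C => eta_add tau 0 (z - p) / k * dz - Cconj (- Cconj b) * Cconj dz); auto.
    apply functional_extensionality. intros h. replace (Cconj (- Cconj b)) with (- b) by (destruct b; apply C_ext; unfold Re, Im; simpl; ring). ring.
Qed.

(** The function h of the definition lives on the image of the chart. It is
    defined through an arbitrary preimage, which is harmless since the chart
    separates points of the curve, and is holomorphic because the chart has
    holomorphic local inverses. *)
Theorem is_eta_exists : exists u, is_eta tau u.
Proof.
  exists (diff_section tau 0). split; [now apply diff_section_section|]. intros W zeta p HW Hp Hzp.
  assert (Nk := chart_der_nz W zeta p HW Hp). set (k := C_derive zeta p) in *.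
  assert (Ef : (fun w => diff_section tau 0 (w, p) / k) = (fun w => eta_add tau 0 (w - p) / k)) by reflexivity. rewrite Ef.
  split; [apply eta_section_H0|]. split; [apply eta_section_class|].
  assert (HW' := HW). destruct HW' as (Ho & Hper & Hinj & Hc).
  destruct (Hc p Hp) as (Zp & psi & P1 & P2 & P3). rewrite Hzp in P1, P3.
  destruct (eta_fun_local tau Ht 0 (lattice_0 tau)) as (H & h1 & h2).
  destruct (chart_expansion zeta (fun w => H (w + - p)) p Zp Hzp Nk) as (M & M1 & M2).
  { apply holo_shift. replace (p + - p) with (RtoC 0) by ring. exact h1. }
  set (val := fun w : C => eta_add tau 0 (w - p) / (k * C_derive zeta w)).
  assert (Vper : forall w w', W w -> W w' -> zeta w = zeta w' -> val w = val w').
  { intros w w' Ww Ww' E. assert (L := Hinj w w' Ww Ww' E). unfold val.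
    replace w with (w' + (w - w')) by ring. rewrite (chart_der_periodic W zeta w' (w - w') HW Ww' L). f_equal.
    replace (w' + (w - w') - p) with (w' - p + (w - w')) by ring. now apply eta_add_periodic. }
  set (pre := fun x : C => epsilon (inhabits (RtoC 0)) (fun w => W w /\ zeta w = x)).
  assert (Hpre : forall w, W w -> W (pre (zeta w)) /\ zeta (pre (zeta w)) = zeta w).
  { intros w Ww. exact (epsilon_spec (inhabits (RtoC 0)) (fun v => W v /\ zeta v = zeta w) (ex_intro _ w (conj Ww eq_refl))). }
  set (h := fun x : C => if excluded_middle_informative (x = 0) then M p else val (pre x) - / (x ^ 2)).
  assert (Hv : forall w, W w -> zeta w <> 0 -> h (zeta w) = val w - / (zeta w ^ 2)).
  { intros w Ww N. unfold h. destruct (excluded_middle_informative (zeta w = 0)) as [E|_]; [tauto|].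
    destruct (Hpre w Ww) as [Q1 Q2]. now rewrite (Vper _ w Q1 Ww Q2). }
  assert (Zl : forall w, W w -> (zeta w = 0 <-> lattice tau (w - p))).
  { intros w Ww. split; intros E.
    - apply Hinj; auto. congruence.
    - replace w with (p + (w - p)) by ring. rewrite (proj2 (Hper p (w - p) Hp E)). exact Hzp. }
  exists h. split.
  - intros w0 W0. destruct (Classical_Prop.classic (zeta w0 = 0)) as [E0|E0].
    + rewrite E0.
      assert (Psi0 : psi 0 = p). { rewrite <- Hzp. exact (nearC_pt _ _ P2). }
      apply holo_loc with (fun x => M (psi x)).
      * assert (Cpsi := holo_cont _ _ P1). 
        assert (Q : nearP p (fun w => W w /\ val w = / (zeta w * zeta w) + M w)).
        { generalize (nearC_and _ _ _ (Ho p Hp) (nearC_and _ _ _ M2 (nearC_and _ _ _ (nearP_shift p (- p) (fun z => eta_fun tau z = / ((z - 0) * (z - 0)) + H z) ltac:(replace (p + - p) with (RtoC 0) by ring; exact h2))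
              (nearP_shift p (- p) _ (nonlattice_near tau (p + - p) Ht))))).
          apply nearC_imp. intros w (Q1 & Q2 & Q3 & Q4) N. split; auto. rewrite <- (Q2 N). unfold val. f_equal.
          change (w - p) with (w + - p). rewrite eta_add_off, (Q3 N) by exact (Q4 N). replace (w + - p - 0) with (w + - p) by ring. ring. }
        assert (Q' : nearC (RtoC 0) (fun x => psi x <> p -> W (psi x) /\ val (psi x) = / (zeta (psi x) * zeta (psi x)) + M (psi x))).
        { apply (cont_near psi (RtoC 0) (fun w : C => w <> p -> W w /\ val w = / (zeta w * zeta w) + M w) Cpsi). rewrite Psi0. exact Q. }
        generalize (nearC_and _ _ _ Q' P3). apply nearC_imp. intros x [R1 R2].
        destruct (Classical_Prop.classic (x = 0)) as [->|Nx].
        { rewrite Psi0. unfold h. destruct (excluded_middle_informative (RtoC 0 = 0)); tauto. }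
        assert (Np : psi x <> p). { intros E. apply Nx. rewrite <- R2, E. exact Hzp. }
        destruct (R1 Np) as [S1 S2]. rewrite <- R2 at 2. rewrite Hv; auto; [|now rewrite R2]. rewrite S2. simpl.
        replace (zeta (psi x) * (zeta (psi x) * 1)) with (zeta (psi x) * zeta (psi x)) by ring. ring.
      * apply (holo_comp M psi); auto. now rewrite Psi0.
    + destruct (Hc w0 W0) as (Zw & psi0 & R1 & R2 & R3).
      assert (Psi0 : psi0 (zeta w0) = w0) by exact (nearC_pt _ _ R2).
      apply holo_loc with (fun x => eta_add tau 0 (psi0 x + - p) / (k * C_derive zeta (psi0 x)) - / (x ^ 2)).
      * generalize (nearC_and _ _ _ (cont_near psi0 (zeta w0) W (holo_cont _ _ R1) ltac:(rewrite Psi0; exact (Ho w0 W0))) (nearC_and _ _ _ R3 (cont_nonzero (fun x => x) (zeta w0) (cont_id _) E0))).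
        apply nearC_imp. intros x (S1 & S2 & S3). rewrite <- S2 at 4. rewrite Hv; auto; [|now rewrite S2]. rewrite S2. reflexivity.
      * apply holo_minus.
        -- apply holo_div.
           ++ apply Cmult_neq_0; auto. rewrite Psi0. now apply (chart_der_nz W).
           ++ apply (holo_comp (fun w => eta_add tau 0 (w + - p)) psi0); auto. rewrite Psi0. apply (holo_shift (eta_add tau 0)). apply holo_eta_add; auto.
              intros L. apply E0. now apply Zl.
           ++ apply holo_mult; [apply holo_const|]. apply (holo_comp (C_derive zeta) psi0); auto. rewrite Psi0. now apply holo_derive.
        -- apply holo_inv; [now apply Cpow_nz|]. apply holo_pow, holo_id.
  - intros w Ww Nw. assert (Nz : zeta w <> 0) by (intros E; now apply Nw, Zl).
    rewrite Hv by auto. unfold val. assert (Nd := chart_der_nz W zeta w HW Ww). field. split; [|split]; auto.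
Qed.
End Eta.

(** * Uniqueness of eta and of the metric *)

(** The properties of [eta_fun] that matter below. They are preserved by
    homotheties, so that a form given by another basis of the lattice may be
    used. *)
Definition ref_form (tau : C) (P : C -> C) : Prop :=
  periodic tau P /\ (forall a, ~ lattice tau a -> holo_at P a) /\
  (exists H, holo_at H 0 /\ nearP 0 (fun w => P w = / (w * w) + H w)) /\
  exists G beta, periodic tau G /\ forall z, ~ lattice tau z -> rdf G z (fun h => P z * h + beta * Cconj h).

(** The corresponding properties of [metric], for the canonical frame of O(2
    Theta) with Theta the origin. *)
Definition ref_metric (tau : C) (R : C -> R) : Prop :=
  (forall w l, lattice tau l -> R (w + l) = R w) /\
  forall a, exists k, curv_germ (metric_curv tau) k a /\ nearC a (fun w => R w = (Cmod (w - a) ^ (4 * lattice_mult_nat tau a) * exp (- k w))%R).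

(** The fundamental theorem of calculus along a segment. *)
Lemma line_const (S : C -> C) z v : (forall t : R, 0 <= t <= 1 -> rdf S (z + RtoC t * v) (fun _ => 0)) -> S (z + v) = S z.
Proof.
  intros H. apply Ceq_minus.
  replace (S (z + v)) with (S (z + RtoC 1 * v)) by (f_equal; ring). replace (S z) with (S (z + RtoC 0 * v)) by (f_equal; ring).
  apply (isCI_unique (fun _ => RtoC 0) 0 1); [|apply isCI_zero].
  apply (isCI_FTC (fun t => S (z + RtoC t * v)) (fun _ => RtoC 0)); [lra| |].
  - intros t Ht eps He. assert (P := Cmod_ge_0 v).
    destruct (H t Ht (eps / (Cmod v + 1))%R) as (d & Hd & K). { apply Rdiv_lt_0_compat; lra. }
    exists (d / (Cmod v + 1))%R. split; [apply Rdiv_lt_0_compat; lra|]. intros h Hh. assert (Ph := Rabs_pos h).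
    assert (Mh : Cmod (RtoC h * v) < d).
    { rewrite Cmod_mult, Cmod_R. apply Rmult_lt_compat_r with (r := (Cmod v + 1)%R) in Hh; [|lra].
      replace (d / (Cmod v + 1) * (Cmod v + 1))%R with d in Hh by (field; lra). nra. }
    specialize (K _ Mh). replace (z + RtoC (t + h) * v) with (z + RtoC t * v + RtoC h * v) by (rewrite RtoC_plus; ring).
    rewrite Cmult_0_r. eapply Rle_trans; [exact K|]. rewrite Cmod_mult, Cmod_R.
    replace (eps / (Cmod v + 1) * (Rabs h * Cmod v))%R with (eps * Rabs h * (Cmod v / (Cmod v + 1)))%R by (field; lra).
    rewrite <- (Rmult_1_r (eps * Rabs h)) at 2. apply Rmult_le_compat_l; [nra|]. apply Rmult_le_reg_r with (Cmod v + 1)%R; [lra|]. unfold Rdiv. rewrite Rmult_assoc, Rinv_l; lra.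
  - intros t _. apply rcont_const.
Qed.

Section Unique.
Variable tau : C.
Hypothesis Ht : 0 < Im tau.

(** A chart around the origin: on the translates of a small disc by the
    lattice, the representative that lies in the disc. *)
Definition disc_radius : R := (lat_gap tau / 4)%R.
Definition disc_dom (z : C) : Prop := exists v, lattice tau (z - v) /\ Cmod v < disc_radius.
Definition disc_coord (z : C) : C := epsilon (inhabits (RtoC 0)) (fun v => lattice tau (z - v) /\ Cmod v < disc_radius).

Lemma disc_coord_spec z : disc_dom z -> lattice tau (z - disc_coord z) /\ Cmod (disc_coord z) < disc_radius.
Proof. intros H. exact (epsilon_spec (inhabits (RtoC 0)) (fun v => lattice tau (z - v) /\ Cmod v < disc_radius) H). Qed.
Lemma disc_coord_eq z v : lattice tau (z - v) -> Cmod v < disc_radius -> disc_dom z /\ disc_coord z = v.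
Proof.
  intros L Hv. assert (Hz : disc_dom z) by now exists v. split; auto. destruct (disc_coord_spec z Hz) as [L' Hv'].
  apply Ceq_minus. apply (lattice_discrete tau); auto.
  - replace (disc_coord z - v) with ((z - v) - (z - disc_coord z)) by ring. now apply lattice_minus.
  - eapply Rle_lt_trans; [apply Cmod_minus_le|]. generalize (lat_gap_pos tau Ht). unfold disc_radius in *. lra.
Qed.

Lemma disc_coord_near a : disc_dom a -> nearC a (fun z => disc_dom z /\ disc_coord z = z - (a - disc_coord a)).
Proof.
  intros Ha. destruct (disc_coord_spec a Ha) as [L Hv]. generalize (nearC_disc a (disc_radius - Cmod (disc_coord a)) ltac:(lra)). apply nearC_imp. intros z Hz.
  apply disc_coord_eq.
  - replace (z - (z - (a - disc_coord a))) with (a - disc_coord a) by ring. exact L.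
  - replace (z - (a - disc_coord a)) with ((z - a) + disc_coord a) by ring. eapply Rle_lt_trans; [apply Cmod_triangle|]. lra.
Qed.

Lemma disc_coord_chart : is_chart tau disc_dom disc_coord.
Proof.
  split; [|split; [|split]].
  - intros a Ha. generalize (disc_coord_near a Ha). apply nearC_imp. intros z Hz; apply Hz.
  - intros z l Hz Hl. destruct (disc_coord_spec z Hz) as [L Hv]. apply disc_coord_eq; auto. replace (z + l - disc_coord z) with (z - disc_coord z + l) by ring. now apply lattice_plus.
  - intros z z' Hz Hz' E. destruct (disc_coord_spec z Hz) as [L _], (disc_coord_spec z' Hz') as [L' _]. rewrite <- E in L'.
    replace (z - z') with ((z - disc_coord z) - (z' - disc_coord z)) by ring. now apply lattice_minus.
  - intros a Ha. assert (N := disc_coord_near a Ha). destruct (disc_coord_spec a Ha) as [L Hv]. split; [|exists (fun x => x + (a - disc_coord a)); split; [|split]].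
    + apply holo_loc with (fun z => z - (a - disc_coord a)).
      * revert N. apply nearC_imp. intros z [_ ->]. reflexivity.
      * apply holo_minus; [apply holo_id|apply holo_const].
    + apply holo_plus; [apply holo_id|apply holo_const].
    + revert N. apply nearC_imp. intros z [_ ->]. ring.
    + generalize (nearC_disc (disc_coord a) (disc_radius - Cmod (disc_coord a)) ltac:(lra)). apply nearC_imp. intros x Hx. apply disc_coord_eq.
      * replace (x + (a - disc_coord a) - x) with (a - disc_coord a) by ring. exact L.
      * replace x with ((x - disc_coord a) + disc_coord a) by ring. eapply Rle_lt_trans; [apply Cmod_triangle|]. lra.
Qed.

Lemma disc_radius_pos : 0 < disc_radius.
Proof. unfold disc_radius. generalize (lat_gap_pos tau Ht). lra. Qed.

(** The difference of u and P is holomorphic, hence constant, and its class is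
    antiholomorphic. Integrating along 1 and tau shows that a holomorphic form
    whose class is antiholomorphic vanishes. The coefficient of the double pole
    of u is read off in the chart at the origin. *)
Theorem eta_unique u P : is_eta tau u -> ref_form tau P -> forall w, ~ lattice tau w -> u (w, RtoC 0) = P w.
Proof.
  intros [_ Hu] (Pp & Ph & (H & H1 & H2) & G & beta & Gp & Gd).
  assert (R0 := disc_radius_pos).
  destruct (disc_coord_eq 0 0) as [Hw0 Hz0]. { replace (0 - 0) with (RtoC 0) by ring. apply lattice_0. } { rewrite Cmod_0. exact R0. }
  assert (N0 := disc_coord_near 0 Hw0). rewrite Hz0 in N0.
  assert (D0 : nearC (RtoC 0) (fun z : C => C_derive disc_coord z = 1)).
  { generalize (nearC_open _ _ N0). apply nearC_imp. intros z Hz. apply cdv_C_derive. apply cdv_loc with (fun z => z - (0 - 0)).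
    - revert Hz. apply nearC_imp. intros v [_ ->]. reflexivity.
    - eapply cdv_eq; [apply cdv_minus; [apply cdv_id|apply cdv_const]|ring]. }
  destruct (Hu disc_dom disc_coord 0 disc_coord_chart Hw0 Hz0) as (Hf & (al & G1 & Hal & G1p & G1d) & h & Hh & Hfh).
  rewrite (nearC_pt _ _ D0) in *.
  set (f := fun w => u (w, RtoC 0) / 1) in *.
  assert (Hh0 : holo_at h 0). { rewrite <- Hz0. now apply Hh. }
  assert (Ef : nearP 0 (fun w : C => f w = / (w * w) + h w)).
  { generalize (nearC_and _ _ _ (nearC_and _ _ _ N0 D0) (nonlattice_near tau 0 Ht)). apply nearC_imp. intros w [[[K1 K2] K3] K4] N.
    specialize (K4 N). unfold f; cbv beta; rewrite Hfh; [|exact K1|now replace (w - 0) with w by ring].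
    rewrite K2, K3. replace (w - (0 - 0)) with w by ring. simpl. rewrite Cmult_1_r. replace (w * (w * 1)) with (w * w) by ring. ring. }
  assert (Hreg : forall a, ~ lattice tau a -> exists g, holo_at g a /\ nearC a (fun z => f z = g z)).
  { intros a Ha. destruct (proj2 Hf a) as (g & g1 & g2). exists g. split; auto. revert g2. apply nearC_imp. intros z Hz. rewrite Hz.
    rewrite mult_pole, lattice_mult_no; [simpl; ring|]. intros L. apply Ha. replace a with (- (0 - a)) by ring. now apply lattice_opp. }
  assert (fp := proj1 Hf).
  destruct (elliptic_const tau (fun w => f w - P w) Ht) as [kap Hk].
  - intros w l Hl. now rewrite fp, Pp.
  - intros a. destruct (Classical_Prop.classic (lattice tau a)) as [La|La].
    + exists (fun w => h (w + - a) - H (w + - a)). split.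
      * apply holo_minus; apply holo_shift; replace (a + - a) with (RtoC 0) by ring; auto.
      * assert (S : nearP a (fun w => f (w + - a) = / ((w + - a) * (w + - a)) + h (w + - a) /\ P (w + - a) = / ((w + - a) * (w + - a)) + H (w + - a))).
        { apply (nearP_shift a (- a) (fun w => f w = / (w * w) + h w /\ P w = / (w * w) + H w)). replace (a + - a) with (RtoC 0) by ring. now apply nearP_and. }
        revert S. apply nearP_imp. intros w [E1 E2]. rewrite <- (fp w (- a)), <- (Pp w (- a)) by now apply lattice_opp. rewrite E1, E2. ring.
    + destruct (Hreg a La) as (g & g1 & g2). exists (fun w => g w - P w). split; [apply holo_minus; auto|]. apply nearP_of. revert g2. apply nearC_imp. intros z ->. reflexivity.
  - assert (FP : forall w, ~ lattice tau w -> f w = P w + kap).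
    { intros w Hw. destruct (Hreg w Hw) as (g & g1 & g2).
      assert (E : f w - P w = kap).
      { apply (cont_agree (fun z => f z - P z) (fun _ => kap)); [|apply cont_const|apply Hk].
        apply cont_minus; [|apply holo_cont; auto]. apply cont_loc with g; [|now apply holo_cont]. revert g2. apply nearC_imp. auto. }
      rewrite <- E. ring. }
    assert (alc : forall z, al z = al 0).
    { intros z. apply (periodic_const tau al Ht); [apply Hal|]. intros a. destruct (proj2 Hal a) as (g & g1 & g2). apply holo_loc with g; auto.
      revert g2. apply nearC_imp. intros v ->. simpl. ring. }
    set (b := - Cconj (al 0) - beta).
    set (S := fun w => G1 w + (- (1) * G w + (- kap * w + - b * Cconj w))).
    assert (Sd : forall z, ~ lattice tau z -> rdf S z (fun _ => 0)).
    { intros z Hz.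
      assert (X1 : rdf G1 z (fun h => f z * h + - Cconj (al 0) * Cconj h)).
      { apply (rdfE G1 z (f z) (- Cconj (al 0))). specialize (G1d z). replace (z - 0) with z in G1d by ring. specialize (G1d Hz).
        replace (fun dz : C => f z * dz + - Cconj (al 0) * Cconj dz) with (fun dz : C => f z * dz - Cconj (al z) * Cconj dz); [exact G1d|].
        apply functional_extensionality. intros dz. rewrite alc. ring. }
      apply rdf_ext with (fun h => (f z * h + - Cconj (al 0) * Cconj h) + (- (1) * (P z * h + beta * Cconj h) + (- kap * h + - b * Cconj h))).
      - intros x. rewrite (FP z Hz). unfold b. ring.
      - apply rdf_plus; [exact X1|]. apply rdf_plus; [apply rdf_scal; now apply Gd|]. apply rdf_plus; apply rdf_scal.
        + apply (rdf_lin (fun w => w)). reflexivity.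
        + apply (rdf_lin Cconj). intros x y. apply Cplus_conj. }
    set (b0 := RtoC (/ 2) + RtoC (/ 2) * tau).
    assert (NL : forall x y : R, (forall n : Z, x <> IZR n) \/ (forall n : Z, y <> IZR n) -> ~ lattice tau (RtoC x + RtoC y * tau)).
    { intros x y Hxy (m & n & E).
      assert (Ey : y = IZR n). { apply (f_equal Im) in E. rewrite !Im_plus, !Im_Rmult, !im_RtoC in E. apply Rmult_eq_reg_r with (Im tau); lra. }
      assert (Ex : x = IZR m). { apply (f_equal Re) in E. rewrite !Re_plus, !Re_Rmult, !re_RtoC in E. rewrite Ey in E. lra. }
      destruct Hxy as [K|K]; [exact (K m Ex)|exact (K n Ey)]. }
    assert (Hhalf : forall n : Z, (/ 2)%R <> IZR n). { intros n. apply mid_not_int. lra. }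
    assert (S1 : S (b0 + 1) = S b0).
    { apply line_const. intros t _. apply Sd. replace (b0 + RtoC t * 1) with (RtoC (/ 2 + t) + RtoC (/ 2) * tau) by (unfold b0; rewrite RtoC_plus; ring). apply NL. auto. }
    assert (S2 : S (b0 + tau) = S b0).
    { apply line_const. intros t _. apply Sd. replace (b0 + RtoC t * tau) with (RtoC (/ 2) + RtoC (/ 2 + t) * tau) by (unfold b0; rewrite RtoC_plus; ring). apply NL. auto. }
    unfold S in S1, S2. rewrite (G1p b0 1 (lattice_1 tau)), (Gp b0 1 (lattice_1 tau)), Cplus_conj in S1.
    rewrite (G1p b0 tau (lattice_tau tau)), (Gp b0 tau (lattice_tau tau)), Cplus_conj in S2.
    replace (Cconj 1) with (RtoC 1) in S1 by (apply C_ext; unfold Re, Im; simpl; ring).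
    assert (E1 : b = - kap).
    { apply Ceq_minus. match type of S1 with ?X = ?Y => transitivity (Y - X); [ring|rewrite S1; ring] end. }
    assert (E2 : kap * (tau - Cconj tau) = 0).
    { rewrite E1 in S2. match type of S2 with ?X = ?Y => transitivity (Y - X); [ring|rewrite S2; ring] end. }
    assert (K0 : kap = 0).
    { apply Classical_Prop.NNPP. intros N. revert E2. apply Cmult_neq_0; auto. intros E. apply (f_equal Im) in E. rewrite Im_minus, im_conj, im_RtoC in E. lra. }
    intros w Hw. specialize (FP w Hw). rewrite K0 in FP. unfold f in FP. replace (u (w, RtoC 0)) with (u (w, RtoC 0) / 1) by field. rewrite FP. ring.
Qed.

(** The logarithm of such a function has an elliptic holomorphic gradient,
    hence a constant one; periodicity along 1 and tau then kills this constant,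
    the logarithm being real. *)
Lemma potential_const (E : C -> R) : (forall w l, lattice tau l -> E (w + l) = E w) ->
  (forall a, exists (K : C -> R) (p : C -> C), nearC a (fun w => is_grad K w (p w)) /\ holo_at p a /\ nearP a (fun w => E w = exp (K w))) ->
  exists c : R, forall a, nearP a (fun w => E w = c).
Proof.
  intros Ep H.
  assert (H' : forall a, exists K : C -> R, (exists p : C -> C, nearC a (fun w => is_grad K w (p w)) /\ holo_at p a) /\ nearP a (fun w => E w = exp (K w))).
  { intros a. destruct (H a) as (K & p & K1 & K2 & K3). exists K. split; auto. now exists p. }
  destruct (fun_choice _ H') as [KK HK].
  assert (CC : forall K w p, is_grad K w p -> cont (fun z => RtoC (K z)) w).
  { intros K w p Hg eps He. destruct (grad_small K w p Hg eps He) as (d & Hd & Q). apply locally_CE. exists d. split; auto. intros z Hz.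
    specialize (Q _ Hz). replace (w + (z - w)) with z in Q by ring. rewrite <- RtoC_minus, Cmod_R. apply Q. }
  assert (Agree : forall K K' w p p', is_grad K w p -> is_grad K' w p' -> nearP w (fun z => exp (K z) = exp (K' z)) -> K w = K' w).
  { intros K K' w p p' Hg Hg' HE. apply RtoC_inj. apply (cont_agree (fun z => RtoC (K z)) (fun z => RtoC (K' z))); [eapply CC; eauto|eapply CC; eauto|].
    revert HE. apply nearP_imp. intros z Hz. f_equal. now apply exp_inv. }
  set (Ks := fun a => KK a a).
  assert (Loc : forall a, nearC a (fun w => Ks w = KK a w)).
  { intros a. destruct (HK a) as [(p & P1 & P2) P3]. generalize (nearC_and _ _ _ (nearP_open _ _ P3) P1). apply nearC_imp. intros w [Q1 Q2].
    destruct (Classical_Prop.classic (w = a)) as [->|N]; [reflexivity|]. destruct (HK w) as [(p' & P1' & P2') P3'].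
    apply (Agree (KK w) (KK a) w (p' w) (p w)); [exact (nearC_pt _ _ P1')|exact Q2|].
    generalize (nearP_and _ _ _ P3' (nearP_of _ _ (Q1 N))). apply nearP_imp. intros z [<- <-]. reflexivity. }
  assert (Kp : forall w l, lattice tau l -> Ks (w + l) = Ks w).
  { intros w l Hl. destruct (HK w) as [(p & P1 & P2) P3], (HK (w + l)) as [(p' & P1' & P2') P3'].
    apply (Agree (fun z => KK (w + l) (z + l)) (KK w) w (p' (w + l)) (p w)).
    - intros eps He. destruct (nearC_pt _ _ P1' eps He) as (d & Hd & Q). exists d. split; auto. intros x Hx. replace (w + x + l) with (w + l + x) by ring. auto.
    - exact (nearC_pt _ _ P1).
    - generalize (nearP_and _ _ _ P3 (nearP_shift w l _ P3')). apply nearP_imp. intros z [E1 E2]. rewrite <- E1, <- E2. now apply Ep. }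
  assert (Gr : forall a, exists p : C -> C, nearC a (fun w => is_grad Ks w (p w)) /\ holo_at p a).
  { intros a. destruct (HK a) as [(p & P1 & P2) P3]. exists p. split; auto.
    generalize (nearC_and _ _ _ P1 (nearC_open _ _ (Loc a))). apply nearC_imp. intros w [Q1 Q2]. apply grad_loc with (KK a); auto. revert Q2. apply nearC_imp. auto. }
  destruct (fun_choice (fun a q => is_grad Ks a q)) as [q Hq].
  { intros a. destruct (Gr a) as (p & P1 & _). exists (p a). exact (nearC_pt _ _ P1). }
  assert (qh : forall a, holo_at q a).
  { intros a. destruct (Gr a) as (p & P1 & P2). apply holo_loc with p; auto. revert P1. apply nearC_imp. intros w P1. eapply grad_unique; eauto. }
  assert (qp : periodic tau q).
  { intros w l Hl. apply (grad_unique Ks w); [|apply Hq]. intros eps He. destruct (Hq (w + l) eps He) as (d & Hd & Q). exists d. split; auto.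
    intros x Hx. specialize (Q x Hx). replace (w + l + x) with (w + x + l) in Q by ring. rewrite (Kp (w + x) l Hl), (Kp w l Hl) in Q. exact Q. }
  assert (qc := periodic_const tau q Ht qp qh).
  set (c := q 0).
  set (S := fun w => RtoC (Ks w) + - RtoC (Re (c * w))).
  assert (Sd : forall z, rdf S z (fun _ => 0)).
  { intros z eps He. destruct (Hq z eps He) as (d & Hd & Q). exists d. split; auto. intros x Hx. specialize (Q x Hx). rewrite (qc z 0) in Q. fold c in Q.
    unfold S. rewrite <- !RtoC_opp, <- !RtoC_plus, <- RtoC_minus.
    replace (RtoC (Ks (z + x)%C + - Re (c * (z + x))%C - (Ks z + - Re (c * z)%C)) - 0) with (RtoC (Ks (z + x)%C - Ks z - Re (c * x)%C)).
    - now rewrite Cmod_R.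
    - unfold Cminus. rewrite Copp_0, Cplus_0_r. f_equal. replace (c * (z + x)) with (c * z + c * x) by ring. rewrite Re_plus. ring. }
  assert (Sc : forall z v, S (z + v) = S z) by (intros; apply line_const; auto).
  assert (A1 : Re c = 0%R).
  { assert (X := Sc 0 1). unfold S in X. rewrite Cplus_0_l in X. rewrite <- (Cplus_0_l 1) in X at 1. rewrite (Kp 0 1 (lattice_1 tau)) in X.
    rewrite <- !RtoC_opp, <- !RtoC_plus in X. apply RtoC_inj in X. replace (c * 1) with c in X by ring. replace (c * 0) with (RtoC 0) in X by ring. rewrite re_RtoC in X. lra. }
  assert (A2 : Re (c * tau) = 0%R).
  { assert (X := Sc 0 tau). unfold S in X. rewrite (Kp 0 tau (lattice_tau tau)), Cplus_0_l in X.
    rewrite <- !RtoC_opp, <- !RtoC_plus in X. apply RtoC_inj in X. replace (c * 0) with (RtoC 0) in X by ring. rewrite re_RtoC in X. lra. }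
  assert (A3 : Im c = 0%R).
  { replace (Re (c * tau)) with (Re c * Re tau - Im c * Im tau)%R in A2 by (unfold Re, Im; simpl; ring). rewrite A1 in A2. nra. }
  assert (c0 : c = 0) by (apply C_ext; [rewrite re_RtoC|rewrite im_RtoC]; auto).
  assert (Kc : forall w : C, Ks w = Ks (RtoC 0)).
  { intros w. assert (X := Sc 0 w). unfold S in X. rewrite c0, !Cmult_0_l, Cplus_0_l in X. rewrite re_RtoC, <- !RtoC_opp, <- !RtoC_plus in X. apply RtoC_inj in X. lra. }
  exists (exp (Ks (RtoC 0))). intros a. destruct (HK a) as [_ P3]. generalize (nearP_and _ _ _ P3 (nearP_of _ _ (Loc a))). apply nearP_imp. intros w [-> E2].
  rewrite <- E2. now rewrite Kc.
Qed.

(** * Isolated exceptional points do not affect the integral *)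

(** Equality off isolated points is propagated along the interval by a supremum
    argument. *)
Lemma isCI_isolated (f g : R -> C) a b : a <= b -> (forall t, rcont g t) ->
  (forall x, exists d : R, 0 < d /\ forall y, y <> x -> Rabs (y - x) < d -> f y = g y) -> isCI f a b (CI g a b).
Proof.
  intros Hab Hg H.
  set (Q := fun t => a <= t <= b /\ isCI f a t (CI g a t)).
  assert (Step : forall t s, a <= t <= s -> s <= b -> Q t -> (forall y, t < y < s -> f y = g y) -> Q s).
  { intros t s Hts Hs [_ Hq] E. split; [lra|]. 
    replace (CI g a s) with (Cplus (CI g a t) (CI g t s)).
    - apply isCI_Chasles with t; auto. apply (isCI_ext g); [lra| |now apply isCI_gen]. intros y Hy. symmetry. now apply E.
    - symmetry. apply isCI_CI. apply isCI_Chasles with t; now apply isCI_gen. }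
  assert (Qa : Q a). { split; [lra|]. rewrite (RInt_point (V := C_R_CompleteNormedModule)). apply (is_RInt_point (V := C_R_NormedModule)). }
  destruct (completeness Q) as [s [Hs1 Hs2]].
  { exists b. intros t [Ht1 _]. lra. } { now exists a. }
  assert (Has : a <= s) by now apply Hs1.
  assert (Hsb : s <= b). { apply Hs2. intros t [Ht1 _]. lra. }
  destruct (H s) as (d & Hd & Hd').
  assert (Ex : exists t, Q t /\ s - d < t <= s).
  { apply Classical_Prop.NNPP. intros N. assert (s <= s - d); [|lra]. apply Hs2. intros t Qt. apply Rnot_lt_le. intros Hlt. apply N. exists t. split; auto. }
  destruct Ex as (t & Qt & Ht1).
  assert (Qs : Q s). { apply (Step t); auto; [destruct Qt; lra|]. intros y Hy. apply Hd'; [lra|]. apply Rabs_def1; lra. }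
  destruct (Rle_lt_or_eq_dec s b Hsb) as [Hlt|He].
  - set (s' := Rmin b (s + d / 2)). assert (M1 := Rmin_l b (s + d / 2)). assert (M2 := Rmin_r b (s + d / 2)). fold s' in M1, M2.
    assert (s < s') by (apply Rmin_glb_lt; lra).
    assert (Q s'). { apply (Step s); auto; [lra|]. intros y Hy. apply Hd'; [lra|]. apply Rabs_def1; lra. }
    assert (s' <= s) by now apply Hs1. lra.
  - subst s. apply Qs.
Qed.

(** * The orthogonality relation satisfied when sigma = eta *)

(** The data behind sigma - a theta characteristic, a Hermitian structure, an
    isomorphism of line bundles given by m - are arbitrary. The section 1 / m
    vanishes at the origin, so sigma is orthogonal to it. With rho the squared
    norm of the frame, s * conj (1 / m) * rho = (s m) * (rho / |m|^2). Here s m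
    is eta, and rho / |m|^2 has the zeros and the curvature of the reference
    metric, to which it is proportional by [potential_const]. *)
Theorem sigma_eta_orthogonal u P Rr : is_sigma tau u -> is_eta tau u -> ref_form tau P -> ref_metric tau Rr ->
  (forall z, cont (fun w => P w * RtoC (Rr w)) z) ->
  cell_int (fun z => P (cell tau z) * RtoC (Rr (cell tau z))) = 0.
Proof.
  intros (_ & _ & E & rho & m & s & _ & Hrho & [mp ml] & [_ Horth] & Hu) Heta HP [Rp Rl] HPR.
  assert (Eta := eta_unique u P Heta HP).
  set (Th := fun w => Theta tau E (AJ tau w)).
  set (n1 := fun w => twoTheta tau E (AJ tau w)).
  set (dl := fun w => twoDelta tau w 0).
  set (mm := fun w => m (w, RtoC 0)).
  assert (dlE : forall a, dl a = (2 * Z.of_nat (lattice_mult_nat tau a))%Z).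
  { intros a. unfold dl, twoDelta, lattice_mult_nat. replace (a - 0) with a by ring. destruct (excluded_middle_informative (lattice tau a)); reflexivity. }
  assert (n1E : forall a, n1 a = if excluded_middle_informative (Th a) then 2%Z else 0%Z) by reflexivity.
  assert (mmp : periodic tau mm).
  { intros w l Hl. unfold mm. rewrite <- (mp w (RtoC 0) l (RtoC 0) Hl (lattice_0 tau)). now rewrite Cplus_0_r. }
  assert (Loc : forall a, exists g, holo_at g a /\ g a <> 0 /\ nearC a (fun w => mm w = Czpow (w - a) (n1 a - dl a) * g w)).
  { intros a. destruct (ml a 0) as (g & G1 & G2 & G3). exists (fun w => g (w, RtoC 0)). split; [now apply holo2_slice|]. split; [exact G2|].
    generalize (near2_slice _ _ _ G3). apply nearC_imp. intros w Hw. unfold mm. cbn [fst snd] in Hw. etransitivity; [exact Hw|]. cbn [fst snd].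
    replace (w - 0 - (a - 0)) with (w - a) by ring. reflexivity. }
  assert (Np : forall a, nearP a (fun w => ~ lattice tau w /\ ~ Th w /\ mm w <> 0)).
  { intros a. destruct (Loc a) as (g & G1 & G2 & G3). generalize (nearC_and _ _ _ G3 (nearC_and _ _ _ (nonlattice_near tau a Ht) (cont_nonzero _ _ (holo_cont _ _ G1) G2))).
    apply nearC_imp. intros w (K1 & K2 & K3) N. specialize (K2 N). assert (Nm : mm w <> 0). { rewrite K1. apply Cmult_neq_0; auto. now apply Czpow_nonzero, Csub_nz. }
    repeat split; auto. intros T. apply Nm. destruct (Loc w) as (g' & _ & _ & G3'). rewrite (nearC_pt _ _ G3'), n1E, dlE.
    destruct (excluded_middle_informative (Th w)) as [_|F]; [|tauto]. unfold lattice_mult_nat. destruct (excluded_middle_informative (lattice tau w)); [tauto|].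
    replace (w - w) with (RtoC 0) by ring. simpl. ring. }
  assert (Reg : forall w, ~ lattice tau w -> ~ Th w -> mm w <> 0).
  { intros w L T. destruct (Loc w) as (g & _ & G2 & G3). rewrite (nearC_pt _ _ G3), n1E, dlE.
    destruct (excluded_middle_informative (Th w)) as [F|_]; [tauto|]. unfold lattice_mult_nat. destruct (excluded_middle_informative (lattice tau w)); [tauto|]. simpl. now rewrite Cmult_1_l. }
  (* 1 / m along z_2 = 0, with the conventional value 0 on Theta *)
  set (t0 := fun w => if excluded_middle_informative (Th w) then RtoC 0 else / mm w).
  assert (t0p : forall w l, lattice tau l -> t0 (w + l) = t0 w).
  { intros w l Hl. unfold t0, Th. rewrite AJ_lattice, mmp by auto. reflexivity. }
  set (t := fun L => t0 (AJ_lift tau L)).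
  assert (tE : forall w, t (AJ tau w) = t0 w) by (intros; now apply (descend tau Ht t0 t0p)).
  assert (t0loc : forall a, exists g, holo_at g a /\ g a = Czpow 0 (dl a) * g a /\ (lattice tau a -> g a = 0) /\ nearC a (fun w => t0 w = Czpow (w - a) (- n1 a) * g w)).
  { intros a. destruct (Loc a) as (g & G1 & G2 & G3). exists (fun w => Czpow (w - a) (dl a) * / g w).
    assert (A0 : a - a = 0) by ring.
    assert (Hdl : Czpow 0 (dl a) * Czpow 0 (dl a) = Czpow 0 (dl a)). { rewrite dlE. unfold lattice_mult_nat. destruct (excluded_middle_informative (lattice tau a)); simpl; ring. }
    split; [|split; [|split]].
    - apply holo_mult; [|now apply holo_inv]. apply holo_Czpow. rewrite dlE. lia.
    - rewrite A0, Cmult_assoc, Hdl. reflexivity.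
    - intros L. rewrite A0, dlE. unfold lattice_mult_nat. destruct (excluded_middle_informative (lattice tau a)); [|tauto]. simpl. ring.
    - generalize (nearC_and _ _ _ (nearC_and _ _ _ G3 (cont_nonzero _ _ (holo_cont _ _ G1) G2)) (Np a)). apply nearC_imp. intros w [[K1 K2] K3].
      destruct (Classical_Prop.classic (w = a)) as [->|N].
      + unfold t0. rewrite K1, A0, n1E. destruct (excluded_middle_informative (Th a)) as [T|T]; [simpl; rewrite Cmult_0_l, Cinv_0; ring|].
        rewrite dlE. unfold lattice_mult_nat. destruct (excluded_middle_informative (lattice tau a)); simpl.
        * rewrite Cmult_0_l, Cinv_0, Cmult_0_l, Cinv_0. ring.
        * rewrite Cmult_1_l. ring.
      + destruct (K3 N) as (_ & T & _). unfold t0. destruct (excluded_middle_informative (Th w)) as [F|_]; [tauto|].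
        assert (Nz := Csub_nz _ _ N). rewrite K1. replace (n1 a - dl a)%Z with (n1 a + - dl a)%Z by lia. rewrite Czpow_add, !Czpow_opp by auto.
        field. repeat split; auto; now apply Czpow_nonzero. }
  assert (Ht0 : VV0 tau E t).
  { split.
    - split.
      + intros w l Hl. now rewrite !tE, t0p.
      + intros a. destruct (t0loc a) as (g & G1 & _ & _ & G3). exists g. split; auto. revert G3. apply nearC_imp. intros w Hw. rewrite tE. exact Hw.
    - destruct (t0loc 0) as (g & G1 & _ & G2 & G3). exists g. split; auto. split; [apply G2, lattice_0|]. revert G3. apply nearC_imp. intros w Hw. rewrite tE. exact Hw. }
  specialize (Horth t Ht0).
  (* Near every point the quotient of the densities is exp (k' - k - log |g|^2) off that
     point, with a harmonic exponent because both potentials have the same Laplacian. *)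
  set (EE := fun w => (rho (AJ tau w) / (Cmod (mm w) ^ 2 * Rr w))%R).
  assert (EEl : forall a, exists (K : C -> R) (p : C -> C), nearC a (fun w => is_grad K w (p w)) /\ holo_at p a /\ nearP a (fun w => EE w = exp (K w)) /\ (~ lattice tau a -> ~ Th a -> EE a = exp (K a))).
  { intros a. destruct (Hrho a) as (k & S1 & S2 & S3). destruct (Rl a) as (k' & (p' & P1' & P2') & S4). destruct (Loc a) as (g & G1 & G2 & G3).
    assert (S3' : nearC a (fun w => laplacian k w = metric_curv tau)).
    { revert S3. apply nearC_imp. intros w Hw. unfold omega0 in Hw. replace (Im (Cconj 1 * Ci)) with 1%R in Hw by (unfold Im; simpl; ring).
      assert (PP := PI_RGT_0). unfold metric_curv. apply (f_equal (fun x => x * (4 * PI))%R) in Hw. replace (laplacian k w / (4 * PI) * (4 * PI))%R with (laplacian k w) in Hw by (field; lra).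
      rewrite Hw. field. lra. }
    destruct (smooth_curv_germ _ _ _ S1 S3') as (p & P1 & P2).
    assert (Ng := cont_nonzero _ _ (holo_cont _ _ G1) G2).
    exists (fun w => k' w + ((-1) * k w + (-1) * ln (Cmod (g w) ^ 2)))%R, (fun w => p' w + (RtoC (-1) * p w + RtoC (-1) * (2 * (C_derive g w / g w)))).
    assert (Form : nearC a (fun w => rho (AJ tau w) = (Cmod (Czpow (w - a) (n1 a)) ^ 2 * exp (- k w))%R /\ mm w = Czpow (w - a) (n1 a - dl a) * g w /\ g w <> 0 /\ Rr w = (Cmod (w - a) ^ (4 * lattice_mult_nat tau a) * exp (- k' w))%R)).
    { repeat apply nearC_and; auto. }
    assert (Expo : forall w, g w <> 0 -> exp (k' w + ((-1) * k w + (-1) * ln (Cmod (g w) ^ 2)))%R = (exp (- k w) / (Cmod (g w) ^ 2 * exp (- k' w)))%R).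
    { intros w N. assert (PM : 0 < Cmod (g w)) by now apply Cmod_gt_0. assert (PM2 : (0 < Cmod (g w) ^ 2)%R) by (apply pow_lt; auto).
      replace (k' w + ((-1) * k w + (-1) * ln (Cmod (g w) ^ 2)))%R with (- k w + (- ln (Cmod (g w) ^ 2) + k' w))%R by ring.
      rewrite !exp_plus, exp_Ropp with (x := ln _), exp_ln by auto. rewrite (exp_Ropp (k' w)). assert (Pk := exp_pos (k' w)). field. split; lra. }
    split; [|split; [|split]].
    - generalize (nearC_and _ _ _ (nearC_and _ _ _ P1 P1') (nearC_and _ _ _ (holo_near_cdv _ _ G1) Ng)). apply nearC_imp. intros w [[Q1 Q2] [Q3 Q4]].
      apply grad_plus; [exact Q2|]. apply grad_plus; apply grad_scal; [exact Q1|]. now apply grad_ln_Cmod2.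
    - apply holo_ext with (fun w => (p' w - RtoC (metric_curv tau / 2) * Cconj w) + (RtoC (-1) * (p w - RtoC (metric_curv tau / 2) * Cconj w) + RtoC (-1) * (2 * (C_derive g w / g w)))).
      + intros w. replace (RtoC (-1)) with (- RtoC 1) by (rewrite <- RtoC_opp; f_equal; ring). ring.
      + apply holo_plus; auto. apply holo_plus; (apply holo_mult; [apply holo_const|]); auto. apply holo_mult; [apply holo_const|]. apply holo_div; auto. now apply holo_derive.
    - generalize (nearC_and _ _ _ Form (Np a)). apply nearC_imp. intros w ((F1 & F2 & F3 & F4) & F5) N. destruct (F5 N) as (L & T & Nm).
      assert (Nz := Csub_nz _ _ N). unfold EE. rewrite Expo by auto. rewrite F1, F2, F4, Cmod_mult.
      assert (Pz : 0 < Cmod (w - a)) by now apply Cmod_gt_0. assert (PM : 0 < Cmod (g w)) by now apply Cmod_gt_0. assert (Pk := exp_pos (- k' w)).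
      assert (PX : 0 < Cmod (Czpow (w - a) (n1 a - dl a))) by now apply Cmod_gt_0, Czpow_nonzero.
      replace (Czpow (w - a) (n1 a)) with (Czpow (w - a) (n1 a - dl a) * Czpow (w - a) (dl a)) by (rewrite <- Czpow_add by auto; f_equal; lia).
      assert (E4 : (Cmod (w - a) ^ (4 * lattice_mult_nat tau a) = Cmod (Czpow (w - a) (dl a)) ^ 2)%R).
      { rewrite dlE. unfold lattice_mult_nat. destruct (excluded_middle_informative (lattice tau a)); simpl; [rewrite !Cmod_mult|]; rewrite Cmod_1; ring. }
      rewrite E4, Cmod_mult. assert (PY : 0 < Cmod (Czpow (w - a) (dl a))) by now apply Cmod_gt_0, Czpow_nonzero.
      field. repeat split; lra.
    - intros L T. destruct (nearC_pt _ _ Form) as (F1 & F2 & F3 & F4). unfold EE. rewrite Expo by auto. rewrite F1, F2, F4, n1E, dlE.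
      destruct (excluded_middle_informative (Th a)) as [F|_]; [tauto|]. unfold lattice_mult_nat. destruct (excluded_middle_informative (lattice tau a)); [tauto|]. simpl.
      rewrite Cmult_1_l, Cmod_1. assert (PM : 0 < Cmod (g a)) by now apply Cmod_gt_0. assert (Pk := exp_pos (- k' a)). field. split; lra. }
  destruct (potential_const EE) as [c Hc].
  { intros w l Hl. unfold EE. now rewrite AJ_lattice, mmp, Rp by auto. }
  { intros a. destruct (EEl a) as (K & p & K1 & K2 & K3 & _). now exists K, p. }
  assert (EEc : forall w, ~ lattice tau w -> ~ Th w -> EE w = c).
  { intros w L T. destruct (EEl w) as (K & p & K1 & _ & K3 & K4). rewrite (K4 L T).
    apply RtoC_inj. apply (cont_agree (fun z => RtoC (exp (K z))) (fun _ => RtoC c)).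
    - apply cont_ext with (fun z => cexp (RtoC (K z))); [intros; apply cexp_R|]. apply (cont_comp cexp (fun z => RtoC (K z))); [eapply cdv_continuous, cdv_cexp|].
      intros eps He. destruct (grad_small K w (p w) (nearC_pt _ _ K1) eps He) as (d & Hd & Q). apply locally_CE. exists d. split; auto. intros z Hz.
      specialize (Q _ Hz). replace (w + (z - w)) with z in Q by ring. rewrite <- RtoC_minus, Cmod_R. apply Q.
    - apply cont_const.
    - generalize (nearP_and _ _ _ K3 (Hc w)). apply nearP_imp. intros z [<- ->]. reflexivity. }
  assert (Rpos : forall w, ~ lattice tau w -> 0 < Rr w).
  { intros w L. destruct (Rl w) as (k & _ & K2). rewrite (nearC_pt _ _ K2). unfold lattice_mult_nat. destruct (excluded_middle_informative (lattice tau w)); [tauto|]. simpl. generalize (exp_pos (- k w)). lra. }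
  assert (R0 : forall w, lattice tau w -> Rr w = 0%R).
  { intros w L. destruct (Rl w) as (k & _ & K2). rewrite (nearC_pt _ _ K2). unfold lattice_mult_nat. destruct (excluded_middle_informative (lattice tau w)); [|tauto].
    replace (w - w) with (RtoC 0) by ring. rewrite Cmod_0. simpl. ring. }
  assert (Nc : RtoC c <> 0).
  { destruct (nearP_ex _ _ (nearP_and _ _ _ (Hc 0) (Np 0)) 1%R Rlt_0_1) as (w & _ & _ & E1 & L & T & Nm).
    intros F. apply RtoC_inj in F. rewrite F in E1. destruct (EEl w) as (K & _ & _ & _ & _ & K4). rewrite (K4 L T) in E1. generalize (exp_pos (K w)). lra. }
  (* On Theta the integrand only carries conventional values. *)
  set (J := fun w => s (AJ tau w) * Cconj (t (AJ tau w)) * RtoC (rho (AJ tau w) * omega0 tau 1 tau)).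
  assert (om : omega0 tau 1 tau = 1%R) by (unfold omega0, Im; simpl; field; unfold Im in Ht; lra).
  assert (Point : forall w, (lattice tau w \/ ~ Th w) -> J w = RtoC c * (P w * RtoC (Rr w))).
  { intros w HLT. unfold J. rewrite om, Rmult_1_r, tE. destruct (Classical_Prop.classic (lattice tau w)) as [L|L].
    - rewrite (R0 w L). destruct (t0loc w) as (g & _ & _ & G2 & G3). rewrite (nearC_pt _ _ G3), (G2 L).
      replace (Cconj (Czpow (w - w) (- n1 w) * 0)) with (RtoC 0) by (rewrite Cmult_0_r; apply C_ext; unfold Re, Im; simpl; ring). ring.
    - assert (T : ~ Th w) by tauto. assert (Nm := Reg w L T). assert (Q := EEc w L T). unfold t0. destruct (excluded_middle_informative (Th w)) as [F|_]; [tauto|].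
      assert (Hs : P w = s (AJ tau w) * mm w). { rewrite <- (Eta w L). now apply Hu. }
      assert (Hr : rho (AJ tau w) = (c * (Cmod (mm w) ^ 2 * Rr w))%R).
      { rewrite <- Q. unfold EE. assert (Pm : 0 < Cmod (mm w)) by now apply Cmod_gt_0. assert (PR := Rpos w L). field. split; lra. }
      rewrite Hr, Hs, RtoC_mult, RtoC_mult, Cmod2_conj. rewrite Cinv_conj by auto. assert (Ncm := Cconj_nz _ Nm). field. exact Ncm. }
  assert (Cc : forall z, cont (fun z => P (cell tau z) * RtoC (Rr (cell tau z))) z).
  { intros z. apply (cont_comp (fun w => P w * RtoC (Rr w)) (cell tau)); [apply HPR|apply cont_cell]. }
  assert (Ec : inner tau rho s t = RtoC c * cell_int (fun z => P (cell tau z) * RtoC (Rr (cell tau z)))).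
  { rewrite <- cell_int_scal by auto. unfold inner, cell_int. apply CI_ext. intros y. apply isCI_CI. apply isCI_isolated; [lra| |].
    - intros x. apply (rcont_row (fun z => RtoC c * (P (cell tau z) * RtoC (Rr (cell tau z))))). intros z. apply cont_mult; [apply cont_const|apply Cc].
    - intros x. generalize (Np (cell tau (x, y))). intros Q. apply locally_CE in Q. destruct Q as (d & Hd & Q). exists d. split; auto.
      intros x' Nx Hx. cbv zeta. change (J (cell tau (x', y)) = RtoC c * (P (cell tau (x', y)) * RtoC (Rr (cell tau (x', y))))). apply Point. right.
      assert (Ed : cell tau (x', y) - cell tau (x, y) = RtoC (x' - x)). { unfold cell. cbn [Re Im fst snd]. rewrite RtoC_minus. ring. }
      apply (Q (cell tau (x', y))).
      + rewrite Ed, Cmod_R. exact Hx.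
      + intros F. apply Nx. apply (f_equal (fun v => v - cell tau (x, y))) in F. rewrite Ed in F. replace (cell tau (x, y) - cell tau (x, y)) with (RtoC 0) in F by ring. apply RtoC_inj in F. lra. }
  rewrite Horth in Ec. apply Classical_Prop.NNPP. intros N. symmetry in Ec. revert Ec. now apply Cmult_neq_0.
Qed.
End Unique.

(** * Transport of the elliptic data along a homothety *)

Lemma cont_mul_l (u a : C) : cont (fun w => u * w) a.
Proof. apply cont_mult; [apply cont_const|apply cont_id]. Qed.

Lemma nearC_mul (u a : C) (P : C -> Prop) : nearC (u * a) P -> nearC a (fun w => P (u * w)).
Proof. apply (cont_near (fun w => u * w)), cont_mul_l. Qed.

Lemma nearP_mul (u a : C) (P : C -> Prop) : u <> 0 -> nearP (u * a) P -> nearP a (fun w => P (u * w)).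
Proof.
  intros Nu H. generalize (nearC_mul u a _ H). apply nearC_imp. intros w Hw N. apply Hw. intros E. apply N.
  apply Ceq_minus. apply Classical_Prop.NNPP. intros N'. apply (Cmult_neq_0 u (w - a) Nu N'). replace (u * (w - a)) with (u * w - u * a) by ring. rewrite E. ring.
Qed.

Lemma holo_mul f (u a : C) : holo_at f (u * a) -> holo_at (fun w => f (u * w)) a.
Proof. intros H. apply (holo_comp f (fun w => u * w)); [exact H|]. apply holo_mult; [apply holo_const|apply holo_id]. Qed.

Section Scale.
Variables tau t u : C.
Hypothesis Ht : 0 < Im t.
Hypothesis Hu : u <> 0.
Hypothesis Hlat : forall z, lattice tau z <-> lattice t (u * z).

(** A homothety between lattices carries the elliptic data of one to those of
    the other, with the factors of the change of variable. *)
Lemma ref_form_scale : ref_form tau (fun w => u * u * eta_fun t (u * w)).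
Proof.
  split; [|split; [|split]].
  - intros w l Hl. rewrite Cmult_plus_distr_l, (eta_fun_periodic t Ht (u * w) (u * l)); [reflexivity|]. now apply Hlat.
  - intros a Ha. apply holo_mult; [apply holo_const|]. apply (holo_mul (eta_fun t)). apply holo_eta_fun; auto. intros L. now apply Ha, Hlat.
  - destruct (eta_fun_local t Ht 0 (lattice_0 t)) as (h & h1 & h2). exists (fun w => u * u * h (u * w)). split.
    + apply holo_mult; [apply holo_const|]. apply (holo_mul h). now rewrite Cmult_0_r.
    + assert (h3 : nearP (u * 0) (fun w => eta_fun t w = / ((w - 0) * (w - 0)) + h w)) by (rewrite Cmult_0_r; exact h2).
      apply (nearP_mul u 0 _ Hu) in h3. revert h3. apply nearC_imp. intros w Hw N. rewrite (Hw N).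
      replace (u * w - 0) with (u * w) by ring. field. now split.
  - exists (fun w => u * eta_prim t (u * w)), (u * (RtoC (PI / Im t) * Cconj u)). split.
    + intros w l Hl. rewrite Cmult_plus_distr_l, (eta_prim_periodic t Ht (u * w) (u * l)); [reflexivity|]. now apply Hlat.
    + intros z Hz. apply rdf_ext with (fun h => u * (eta_fun t (u * z) * (u * h) + RtoC (PI / Im t) * Cconj (u * h))).
      * intros h. rewrite Cmult_conj. ring.
      * apply rdf_scal. apply (rdf_comp_mul (eta_prim t) u z (fun h => eta_fun t (u * z) * h + RtoC (PI / Im t) * Cconj h) Hu). apply eta_prim_rdf; auto.
        intros L. now apply Hz, Hlat.
Qed.

(** The factor |u|^4 that the change of variable produces at the zeros is
    absorbed by the potential; the ratio of the areas of the cells accounts for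
    the change of curvature. *)
Lemma ref_metric_scale : 0 < Im tau -> Im t = (Cmod u ^ 2 * Im tau)%R -> ref_metric tau (fun w => metric t (u * w)).
Proof.
  intros H0 HIm. assert (Pu : 0 < Cmod u) by now apply Cmod_gt_0. split.
  - intros w l Hl. rewrite Cmult_plus_distr_l. apply metric_periodic; auto. now apply Hlat.
  - intros a. destruct (metric_local t Ht (u * a)) as (k & (p & P1 & P2) & K).
    assert (Ei : lattice_mult_nat t (u * a) = lattice_mult_nat tau a).
    { unfold lattice_mult_nat. destruct (excluded_middle_informative (lattice t (u * a))) as [L|L], (excluded_middle_informative (lattice tau a)) as [L'|L']; auto; exfalso.
      - now apply L', Hlat.
      - now apply L, Hlat. }
    set (c := ln (Cmod u ^ (4 * lattice_mult_nat tau a))).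
    assert (Pc : (0 < Cmod u ^ (4 * lattice_mult_nat tau a))%R) by now apply pow_lt.
    exists (fun w => k (u * w)%C + - c)%R. split.
    + exists (fun w => u * p (u * w) + 0). split.
      * generalize (nearC_mul u a _ P1). apply nearC_imp. intros w Hw. apply grad_plus; [now apply grad_comp_mul|apply grad_const].
      * apply holo_ext with (fun w => u * (p (u * w) - RtoC (metric_curv t / 2) * Cconj (u * w))).
        -- intros w. rewrite Cmult_conj. assert (E : RtoC (metric_curv tau / 2) = u * RtoC (metric_curv t / 2) * Cconj u).
           { replace (u * RtoC (metric_curv t / 2) * Cconj u) with (RtoC (metric_curv t / 2) * (u * Cconj u)) by ring. rewrite <- Cmod2_conj, <- RtoC_mult. f_equal.
             unfold metric_curv. rewrite HIm. field. split; lra. }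
           rewrite E. ring.
        -- apply holo_mult; [apply holo_const|]. apply (holo_mul (fun w => p w - RtoC (metric_curv t / 2) * Cconj w)). exact P2.
    + generalize (nearC_mul u a _ K). apply nearC_imp. intros w ->. rewrite Ei. replace (u * w - u * a) with (u * (w - a)) by ring.
      rewrite Cmod_mult, Rpow_mult_distr. replace (- (k (u * w)%C + - c))%R with (c + - k (u * w)%C)%R by ring.
      rewrite exp_plus. unfold c. rewrite exp_ln by auto. ring.
Qed.

Lemma cont_scale a : cont (fun w => (u * u * eta_fun t (u * w)) * RtoC (metric t (u * w))) a.
Proof.
  apply cont_ext with (fun w => (u * u) * (eta_fun t (u * w) * RtoC (metric t (u * w)))); [intros; ring|].
  apply cont_mult; [apply cont_const|]. apply (cont_comp (fun w => eta_fun t w * RtoC (metric t w)) (fun w => u * w)); [now apply cont_eta_metric|apply cont_mul_l].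
Qed.
End Scale.

(** * Asymptotics at the cusp *)

(** 2^32, large enough for the crude constants below. *)
Definition cusp_height : R := 4294967296%R.

Section Cusp.
Variable tau : C.
Hypothesis HT : cusp_height < Im tau.
Let T : R := Im tau.
Let HT' : 4294967296 < T := HT.
Let Ht : 0 < Im tau.
Proof. unfold cusp_height in HT. lra. Qed.

(** The theta function without its two factors of largest variation; high in
    the cusp it is uniformly close to 1. *)
Definition theta_tail (w : C) : C := Phi (nome tau) (nome tau * ew w) * Phi (nome tau) (nome tau * (nome tau * / ew w)).
Definition co_ew (w : C) : C := nome tau * / ew w.

Lemma theta_split w : theta tau w = (1 - ew w) * (1 - co_ew w) * theta_tail w.
Proof.
  assert (Hq := nome_lt_1 tau Ht). unfold theta, theta_tail, co_ew.
  rewrite (Phi_functional _ (ew w) Hq), (Phi_functional _ (nome tau * / ew w) Hq). ring.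
Qed.

(** A bound for the modulus of the argument of either factor of [theta_tail] on
    the cell enlarged by 2 on both sides. *)
Definition tail_bound : R := exp (- (2 * PI * (T - 2))).

Lemma tail_bound_pos : 0 < tail_bound.
Proof. apply exp_pos. Qed.

Lemma tail_bound_small : tail_bound * (T * T) <= 1.
Proof.
  assert (P := PI2_3_2). assert (Q := exp_ge_1p (PI * (T - 2))). assert (Hp : 3 * (T - 2) <= PI * (T - 2)) by (assert (H := HT'); apply Rmult_le_compat_r; lra).
  assert (H := HT').
  assert (B : T <= exp (PI * (T - 2))) by lra.
  unfold tail_bound. rewrite exp_Ropp. replace (2 * PI * (T - 2))%R with (PI * (T - 2) + PI * (T - 2))%R by ring. rewrite exp_plus.
  set (X := exp (PI * (T - 2))) in *. assert (PX : 0 < X) by apply exp_pos.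
  apply Rmult_le_reg_l with (X * X)%R; [nra|]. rewrite <- Rmult_assoc, Rinv_r by nra. nra.
Qed.

Lemma tail_bound_tiny : tail_bound <= / 1000000 /\ 2 ^ 18 * 12 * tail_bound * T <= 1.
Proof.
  assert (K := tail_bound_small). assert (P := tail_bound_pos). assert (H := HT').
  assert (K2 : (tail_bound * T * T <= 1)%R) by lra. assert (PT : 0 < tail_bound * T) by (apply Rmult_lt_0_compat; lra). split; nra.
Qed.

Lemma Cmod_nome : Cmod (nome tau) = exp (- 2 * PI * T).
Proof. apply (Cmod_ew tau). Qed.

Lemma Cmod_co_ew w : Cmod (co_ew w) = exp (- 2 * PI * (T - Im w)).
Proof. unfold co_ew. rewrite Cmod_mult, Cmod_inv by apply ew_nz. rewrite Cmod_nome, Cmod_ew, <- exp_Ropp, <- exp_plus. f_equal. ring. Qed.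

Lemma exp_mono (a b : R) : a <= b -> exp a <= exp b.
Proof. intros [H|H]; [left; now apply exp_increasing|rewrite H; apply Rle_refl]. Qed.

Lemma nome_le_tail : Cmod (nome tau) <= tail_bound.
Proof. rewrite Cmod_nome. apply exp_mono. generalize PI_RGT_0. nra. Qed.

Lemma Phi_tail v : Cmod v <= tail_bound -> Cmod (Phi (nome tau) v - 1) <= 4 * tail_bound.
Proof.
  intros Hv. assert (N := nome_le_tail). destruct tail_bound_tiny as [K _]. assert (Pq := Cmod_ge_0 (nome tau)). assert (Pv := Cmod_ge_0 v).
  assert (I1 : / (1 - Cmod (nome tau)) <= 2). { rewrite <- (Rinv_inv 2). apply Rinv_le_contravar; lra. }
  assert (I0 : 0 < / (1 - Cmod (nome tau))) by (apply Rinv_0_lt_compat; lra).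
  assert (E : Cmod v * / (1 - Cmod (nome tau)) <= tail_bound * 2) by (apply Rmult_le_compat; lra).
  eapply Rle_trans; [apply Phi_close; lra|]. lra.
Qed.

Lemma theta_tail_close w : -2 <= Im w <= T + 2 -> Cmod (theta_tail w - 1) <= 12 * tail_bound.
Proof.
  intros Hw. assert (P := PI_RGT_0). destruct tail_bound_tiny as [K _]. assert (Pk := tail_bound_pos). assert (HT0 := HT').
  assert (A1 : Cmod (nome tau * ew w) <= tail_bound).
  { rewrite Cmod_mult, Cmod_nome, Cmod_ew, <- exp_plus. apply exp_mono. nra. }
  assert (A2 : Cmod (nome tau * (nome tau * / ew w)) <= tail_bound).
  { rewrite Cmod_mult. fold (co_ew w). rewrite Cmod_co_ew, Cmod_nome, <- exp_plus. apply exp_mono. nra. }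
  apply Phi_tail in A1, A2. unfold theta_tail. set (x := Phi _ (nome tau * ew w)) in *. set (y := Phi _ (nome tau * (nome tau * _))) in *.
  replace (x * y - 1) with ((x - 1) * (y - 1) + ((x - 1) + (y - 1))) by ring.
  eapply Rle_trans; [apply Cmod_triangle|]. rewrite Cmod_mult. assert (Q := Cmod_triangle (x - 1) (y - 1)).
  assert (P1 := Cmod_ge_0 (x - 1)). assert (P2 := Cmod_ge_0 (y - 1)).
  assert (Cmod (x - 1) * Cmod (y - 1) <= 4 * tail_bound * 1) by (apply Rmult_le_compat; lra). lra.
Qed.

Lemma theta_tail_bounds w : -2 <= Im w <= T + 2 -> / 2 <= Cmod (theta_tail w) <= 2.
Proof.
  intros Hw. assert (B := theta_tail_close w Hw). destruct tail_bound_tiny as [K _].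
  assert (Q := Cmod_ge_sub 1 (1 - theta_tail w)). replace (1 - (1 - theta_tail w)) with (theta_tail w) in Q by ring. rewrite Cmod_1, Cmod_sub_sym in Q.
  assert (Q' := Cmod_triangle (theta_tail w - 1) 1). replace (theta_tail w - 1 + 1) with (theta_tail w) in Q' by ring. rewrite Cmod_1 in Q'. lra.
Qed.

Lemma theta_tail_nz w : -2 <= Im w <= T + 2 -> theta_tail w <> 0.
Proof. intros H. apply Cmod_gt_0. generalize (theta_tail_bounds w H). lra. Qed.

Lemma holo_co_ew a : holo_at co_ew a.
Proof. apply holo_mult; [apply holo_const|]. apply holo_inv; [apply ew_nz|apply holo_ew]. Qed.

Lemma cdv_co_ew a : cdv co_ew a (- tpi * co_ew a).
Proof.
  eapply cdv_eq; [apply (cdv_scal (nome tau)); apply cdv_inv; [apply ew_nz|apply cdv_ew]|]. cbv beta. unfold co_ew. field. apply ew_nz.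
Qed.

Lemma holo_theta_tail a : holo_at theta_tail a.
Proof.
  assert (Hq := nome_lt_1 tau Ht). apply holo_mult.
  - apply (holo_comp (Phi (nome tau)) (fun w => nome tau * ew w)); [now apply holo_Phi|]. apply holo_mult; [apply holo_const|apply holo_ew].
  - apply (holo_comp (Phi (nome tau)) (fun w => nome tau * co_ew w)); [now apply holo_Phi|]. apply holo_mult; [apply holo_const|apply holo_co_ew].
Qed.

Lemma Im_close z w (r : R) : Cmod (w - z) <= r -> Im z - r <= Im w <= Im z + r.
Proof. intros H. assert (Q := im_le_Cmod (w - z)). rewrite Im_minus in Q. apply Rabs_le_between in Q. lra. Qed.

Definition tail_dlog (w : C) : C := C_derive theta_tail w / theta_tail w.

Lemma holo_tail_dlog w : theta_tail w <> 0 -> holo_at tail_dlog w.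
Proof. intros H. apply holo_div; [exact H|apply holo_derive, holo_theta_tail|apply holo_theta_tail]. Qed.

(** Two Cauchy estimates on discs of radius 1, each of which costs a factor 256
    = 128 * 2, around a division by theta_tail, which costs a factor 2. *)
Lemma tail_dlog_bound w : 0 <= Im w <= T -> Cmod (C_derive tail_dlog w) <= 2 ^ 17 * (12 * tail_bound).
Proof.
  intros Hw. assert (Pk := tail_bound_pos).
  assert (S1 : forall v, -1 <= Im v <= T + 1 -> Cmod (C_derive theta_tail v) <= 256 * (12 * tail_bound)).
  { intros v Hv. replace (256 * (12 * tail_bound))%R with (128 * (12 * tail_bound) / (/ 2))%R by field.
    apply (Cauchy_estimate (fun z => theta_tail z - 1) v (/ 2)); [lra| |].
    - intros z Hz. apply Im_close in Hz. split; [|apply theta_tail_close; lra]. exists (C_derive theta_tail z - 0). apply cdv_minus; [apply holo_cdv, holo_theta_tail|apply cdv_const].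
    - eapply cdv_eq; [apply cdv_minus; [apply holo_cdv, holo_theta_tail|apply cdv_const]|ring]. }
  replace (2 ^ 17 * (12 * tail_bound))%R with (128 * (512 * (12 * tail_bound)) / (/ 2))%R by field.
  apply (Cauchy_estimate tail_dlog w (/ 2)); [lra| |].
  - intros z Hz. apply Im_close in Hz. assert (Nz : theta_tail z <> 0) by (apply theta_tail_nz; lra). split.
    + eexists. now apply holo_cdv, holo_tail_dlog.
    + unfold tail_dlog, Cdiv. rewrite Cmod_mult, Cmod_inv by exact Nz. assert (B := S1 z ltac:(lra)). destruct (theta_tail_bounds z ltac:(lra)) as [B2 _].
      replace (512 * (12 * tail_bound))%R with (256 * (12 * tail_bound) * 2)%R by ring. apply Rmult_le_compat; [apply Cmod_ge_0| |exact B|].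
      * left. apply Rinv_0_lt_compat. lra.
      * rewrite <- (Rinv_inv 2). apply Rinv_le_contravar; lra.
  - apply holo_cdv, holo_tail_dlog, theta_tail_nz. lra.
Qed.

Lemma tpi2 : tpi * tpi = - RtoC (4 * PI * PI).
Proof. unfold tpi. apply C_ext; unfold Re, Im; simpl; ring. Qed.

Lemma factors_nz w : ~ lattice tau w -> 1 - ew w <> 0 /\ 1 - co_ew w <> 0 /\ theta_tail w <> 0.
Proof.
  intros H. assert (N := theta_nz tau Ht w H). rewrite theta_split in N.
  repeat split; intros E; apply N; rewrite E; ring.
Qed.

Lemma theta_dlog_split w : ~ lattice tau w -> theta_dlog tau w = - (tpi * ew w / (1 - ew w)) + (tpi * co_ew w / (1 - co_ew w) + tail_dlog w).
Proof.
  intros H. destruct (factors_nz w H) as (N1 & N2 & N3). unfold theta_dlog.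
  assert (D : C_derive (theta tau) w = ((0 - tpi * ew w) * (1 - co_ew w) + (1 - ew w) * (0 - - tpi * co_ew w)) * theta_tail w + ((1 - ew w) * (1 - co_ew w)) * C_derive theta_tail w).
  { apply cdv_C_derive. apply cdv_ext with (fun w => (1 - ew w) * (1 - co_ew w) * theta_tail w); [intros; symmetry; apply theta_split|].
    apply (cdv_mult (fun w => (1 - ew w) * (1 - co_ew w)) theta_tail); [|apply holo_cdv, holo_theta_tail].
    apply (cdv_mult (fun w => 1 - ew w) (fun w => 1 - co_ew w)); apply cdv_minus; [apply cdv_const|apply cdv_ew|apply cdv_const|apply cdv_co_ew]. }
  rewrite D, theta_split. unfold tail_dlog. field. auto.
Qed.

Lemma eta_fun_split w : ~ lattice tau w ->
  - eta_fun tau w = RtoC (4 * PI * PI) * (ew w / ((1 - ew w) * (1 - ew w)) + co_ew w / ((1 - co_ew w) * (1 - co_ew w))) + (C_derive tail_dlog w + RtoC (PI / T)).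
Proof.
  intros H. destruct (factors_nz w H) as (N1 & N2 & N3). rewrite eta_fun_off by auto. fold T.
  assert (D : C_derive (theta_dlog tau) w = - ((tpi * (tpi * ew w) * (1 - ew w) - tpi * ew w * (0 - tpi * ew w)) / ((1 - ew w) * (1 - ew w))) +
     ((tpi * (- tpi * co_ew w) * (1 - co_ew w) - tpi * co_ew w * (0 - - tpi * co_ew w)) / ((1 - co_ew w) * (1 - co_ew w)) + C_derive tail_dlog w)).
  { apply cdv_C_derive. apply cdv_loc with (fun w => - (tpi * ew w / (1 - ew w)) + (tpi * co_ew w / (1 - co_ew w) + tail_dlog w)).
    - generalize (nonlattice_open tau w Ht H). apply nearC_imp. intros z Hz. symmetry. now apply theta_dlog_split.
    - apply cdv_plus; [apply cdv_opp|apply cdv_plus].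
      + apply (cdv_div (fun w => tpi * ew w) (fun w => 1 - ew w)); [exact N1|apply cdv_scal, cdv_ew|apply cdv_minus; [apply cdv_const|apply cdv_ew]].
      + apply (cdv_div (fun w => tpi * co_ew w) (fun w => 1 - co_ew w)); [exact N2|apply cdv_scal, cdv_co_ew|apply cdv_minus; [apply cdv_const|apply cdv_co_ew]].
      + apply holo_cdv, holo_tail_dlog, N3. }
  rewrite D.
  replace (RtoC (4 * PI * PI)) with (- (tpi * tpi)) by (rewrite tpi2; ring). field. auto.
Qed.

Lemma metric_split w : metric tau w = (Cmod (1 - ew w) ^ 4 * Cmod (1 - co_ew w) ^ 4 * Cmod (theta_tail w) ^ 4 * exp (metric_exponent tau w))%R.
Proof. unfold metric. fold (metric_exponent tau w). rewrite theta_split, !Cmod_mult. ring. Qed.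

Lemma metric_exponent_y w : metric_exponent tau w = (4 * PI * Im w * (1 - Im w / T))%R.
Proof. unfold metric_exponent. fold T. field. generalize Ht. fold T. lra. Qed.

Lemma Cmod_one_minus_le (v : C) : Cmod v <= 1 -> Cmod (1 - v) <= 2.
Proof. intros H. eapply Rle_trans; [apply Cmod_minus_le|]. rewrite Cmod_1. lra. Qed.

(** The fourth power of 1 - e in the metric absorbs the double pole; what
    remains is bounded by 2^2 * 2^4 * 2^4 = 1024. *)
Lemma double_pole_bound (e b p : C) (x : R) : Cmod e <= 1 -> Cmod b <= 1 -> Cmod p <= 2 -> 0 < x -> 1 - e <> 0 ->
  Cmod (e / ((1 - e) * (1 - e))) * (Cmod (1 - e) ^ 4 * Cmod (1 - b) ^ 4 * Cmod p ^ 4 * x) <= 1024 * (Cmod e * x).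
Proof.
  intros He Hb Hp Hx N. assert (N' : 0 < Cmod (1 - e)) by now apply Cmod_gt_0.
  assert (Ne : (1 - e) * (1 - e) <> 0) by now apply Cmult_neq_0.
  unfold Cdiv. rewrite Cmod_mult, Cmod_inv, Cmod_mult by exact Ne.
  assert (He' := Cmod_one_minus_le e He). assert (Hb' := Cmod_one_minus_le b Hb). assert (P1 := Cmod_ge_0 e). assert (P2 := Cmod_ge_0 (1 - b)). assert (P3 := Cmod_ge_0 p).
  set (a := Cmod (1 - e)) in *. set (c := Cmod (1 - b)) in *. set (d := Cmod p) in *. set (y := Cmod e) in *.
  replace (y * / (a * a) * (a ^ 4 * c ^ 4 * d ^ 4 * x))%R with ((a ^ 2 * c ^ 4 * d ^ 4) * (y * x))%R by (field; lra).
  apply Rmult_le_compat_r; [nra|].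
  assert (a ^ 2 <= 2 ^ 2) by (apply pow_incr; lra). assert (c ^ 4 <= 2 ^ 4) by (apply pow_incr; lra). assert (d ^ 4 <= 2 ^ 4) by (apply pow_incr; lra).
  assert (Q1 := pow_le a 2 ltac:(lra)). assert (Q2 := pow_le c 4 P2). assert (Q3 := pow_le d 4 P3).
  replace 1024%R with (2 ^ 2 * 2 ^ 4 * 2 ^ 4)%R by ring. apply Rmult_le_compat; auto; [apply Rmult_le_pos; auto|]. now apply Rmult_le_compat.
Qed.

(** The decay of e(w) against the growth of the Gaussian factor: the exponent 2
    PI T (y - 2 y^2) is largest at y = 1/4. *)
Lemma eG_bound (y : R) : - 2 * PI * (y * T) + 4 * PI * (y * T) * (1 - y) <= PI * T / 4.
Proof.
  replace (- 2 * PI * (y * T) + 4 * PI * (y * T) * (1 - y))%R with (PI * T / 4 - PI * T * (4 * (y - / 4) ^ 2))%R by field.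
  assert (P := PI_RGT_0). assert (0 < PI * T) by (apply Rmult_lt_0_compat; auto). assert (Q := pow2_ge_0 (y - / 4)). nra.
Qed.

Lemma Re_ge_Cmod (c : C) : - Cmod c <= Re c.
Proof. assert (Q := re_le_Cmod c). apply Rabs_le_between in Q. lra. Qed.

(** Twice 4 PI^2 * 1024, for the two pole terms of [eta_fun_split]. *)
Definition pole_constant : R := (8192 * PI * PI)%R.

(** Off the lattice the constant PI / T dominates the variation of
    [theta_tail]; the two pole terms times the metric are bounded by exp (PI T
    / 4), which is small compared with the bulk of the metric by
    [metric_mid_lower]. *)
Lemma integrand_lower w y : Im w = (y * T)%R -> 0 <= y <= 1 ->
  PI / (2 * T) * metric tau w - pole_constant * exp (PI * T / 4) <= Re (- eta_fun tau w * RtoC (metric tau w)).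
Proof.
  intros Ew Hy. assert (P := PI_RGT_0). assert (H0 := HT'). assert (PE := exp_pos (PI * T / 4)).
  assert (PC : 0 < pole_constant) by (unfold pole_constant; nra).
  destruct (Classical_Prop.classic (lattice tau w)) as [L|L].
  { rewrite metric_lattice by auto. replace (- eta_fun tau w * 0) with (RtoC 0) by ring. rewrite re_RtoC. nra. }
  assert (Yw : 0 <= Im w <= T) by (rewrite Ew; nra).
  destruct (factors_nz w L) as (N1 & N2 & N3). assert (RP := metric_pos tau Ht w L).
  rewrite eta_fun_split by auto. set (X := ew w / ((1 - ew w) * (1 - ew w))). set (Y := co_ew w / ((1 - co_ew w) * (1 - co_ew w))). set (L0 := C_derive tail_dlog w).
  set (R0 := metric tau w) in *.
  replace ((RtoC (4 * PI * PI) * (X + Y) + (L0 + RtoC (PI / T))) * RtoC R0) with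
    (RtoC (4 * PI * PI) * (X * RtoC R0) + (RtoC (4 * PI * PI) * (Y * RtoC R0) + (L0 * RtoC R0 + RtoC (PI / T * R0)))) by (rewrite (RtoC_mult (PI / T) R0); ring).
  rewrite !Re_plus, !Re_Rmult, re_RtoC.
  assert (Me : Cmod (ew w) <= 1). { rewrite Cmod_ew, <- exp_0. apply exp_mono. nra. }
  assert (Mb : Cmod (co_ew w) <= 1). { rewrite Cmod_co_ew, <- exp_0. apply exp_mono. nra. }
  destruct (theta_tail_bounds w ltac:(lra)) as [_ Mp].
  assert (EG : metric_exponent tau w = (4 * PI * (y * T) * (1 - y))%R). { rewrite metric_exponent_y, Ew. field. lra. }
  assert (BX : Cmod (X * RtoC R0) <= 1024 * exp (PI * T / 4)).
  { rewrite Cmod_mult, Cmod_R, Rabs_pos_eq by lra. unfold R0. rewrite metric_split.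
    eapply Rle_trans; [apply double_pole_bound; auto; apply exp_pos|]. apply Rmult_le_compat_l; [lra|].
    rewrite Cmod_ew, <- exp_plus, EG, Ew. apply exp_mono, eG_bound. }
  assert (BY : Cmod (Y * RtoC R0) <= 1024 * exp (PI * T / 4)).
  { rewrite Cmod_mult, Cmod_R, Rabs_pos_eq by lra. unfold R0. rewrite metric_split.
    replace (Cmod (1 - ew w) ^ 4 * Cmod (1 - co_ew w) ^ 4 * Cmod (theta_tail w) ^ 4 * exp (metric_exponent tau w))%R with (Cmod (1 - co_ew w) ^ 4 * Cmod (1 - ew w) ^ 4 * Cmod (theta_tail w) ^ 4 * exp (metric_exponent tau w))%R by ring.
    eapply Rle_trans; [apply double_pole_bound; auto; apply exp_pos|]. apply Rmult_le_compat_l; [lra|].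
    rewrite Cmod_co_ew, <- exp_plus, EG, Ew. apply exp_mono. eapply Rle_trans; [|apply (eG_bound (1 - y))]. right. ring. }
  assert (BL : Cmod (L0 * RtoC R0) <= PI / (2 * T) * R0).
  { rewrite Cmod_mult, Cmod_R, Rabs_pos_eq by lra. apply Rmult_le_compat_r; [lra|]. eapply Rle_trans; [apply tail_dlog_bound; exact Yw|].
    destruct tail_bound_tiny as [_ K]. apply Rmult_le_reg_r with (2 * T)%R; [lra|]. replace (PI / (2 * T) * (2 * T))%R with PI by (field; lra).
    assert (Q := PI2_3_2). simpl in *. lra. }
  assert (QX := Re_ge_Cmod (X * RtoC R0)). assert (QY := Re_ge_Cmod (Y * RtoC R0)). assert (QL := Re_ge_Cmod (L0 * RtoC R0)).
  assert (Half : (PI / T * R0 = PI / (2 * T) * R0 + PI / (2 * T) * R0)%R) by (field; lra). rewrite Half.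
  assert (PP : 0 < 4 * PI * PI) by nra.
  assert (QX' : - (4 * PI * PI * (1024 * exp (PI * T / 4))) <= 4 * PI * PI * Re (X * RtoC R0)) by nra.
  assert (QY' : - (4 * PI * PI * (1024 * exp (PI * T / 4))) <= 4 * PI * PI * Re (Y * RtoC R0)) by nra.
  unfold pole_constant. lra.
Qed.

(** On the middle half of the cell the Gaussian exponent 4 PI T y (1 - y) is at
    least 3 PI T / 4, and the three factors of theta have modulus at least 1/2;
    4096 is 2^12. *)
Lemma metric_mid_lower w y : Im w = (y * T)%R -> / 4 <= y <= 3 / 4 -> / 4096 * exp (3 * PI * T / 4) <= metric tau w.
Proof.
  intros Ew Hy. assert (P := PI_RGT_0). assert (H0 := HT').
  assert (Q3 := PI2_3_2).
  assert (X2 : forall x : R, x <= - PI * T / 2 -> exp x <= / 2).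
  { intros x Hx. apply Rle_trans with (exp (Ropp 1)). { apply exp_mono. replace (Ropp 1) with (-1)%R by ring. nra. }
    replace (Ropp 1) with (- (1))%R by ring.
    rewrite exp_Ropp. apply Rinv_le_contravar; [lra|]. generalize (exp_ge_1p 1). lra. }
  assert (PT : 0 < PI * T) by (apply Rmult_lt_0_compat; lra).
  assert (PY : 0 <= PI * T * (y - / 4)) by (apply Rmult_le_pos; lra).
  assert (PY' : 0 <= PI * T * (3 / 4 - y)) by (apply Rmult_le_pos; lra).
  assert (Me : Cmod (ew w) <= / 2). { rewrite Cmod_ew. apply X2. rewrite Ew. nra. }
  assert (Mb : Cmod (co_ew w) <= / 2). { rewrite Cmod_co_ew. apply X2. rewrite Ew. nra. }
  assert (H1 : / 2 <= Cmod (1 - ew w)). { assert (Q := Cmod_ge_sub 1 (ew w)). rewrite Cmod_1 in Q. lra. }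
  assert (H2 : / 2 <= Cmod (1 - co_ew w)). { assert (Q := Cmod_ge_sub 1 (co_ew w)). rewrite Cmod_1 in Q. lra. }
  destruct (theta_tail_bounds w) as [H3 _]. { rewrite Ew. split; nra. }
  rewrite metric_split. replace (/ 4096)%R with ((/ 2) ^ 4 * (/ 2) ^ 4 * (/ 2) ^ 4)%R by field.
  assert (Q4 : 0 <= (/ 2) ^ 4) by (apply pow_le; lra).
  assert (L1 := pow_incr (/ 2) (Cmod (1 - ew w)) 4 ltac:(lra)). assert (L2 := pow_incr (/ 2) (Cmod (1 - co_ew w)) 4 ltac:(lra)). assert (L3 := pow_incr (/ 2) (Cmod (theta_tail w)) 4 ltac:(lra)).
  assert (L4 := Rmult_le_compat _ _ _ _ Q4 Q4 L1 L2). assert (L5 := Rmult_le_compat _ _ _ _ (Rmult_le_pos _ _ Q4 Q4) Q4 L4 L3).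
  apply Rmult_le_compat; [apply Rmult_le_pos; [apply Rmult_le_pos|]; exact Q4|left; apply exp_pos|exact L5|].
  apply exp_mono. rewrite metric_exponent_y, Ew. replace (4 * PI * (y * T) * (1 - y * T / T))%R with (PI * T * (4 * (y * (1 - y))))%R by (field; lra).
    replace (3 * PI * T / 4)%R with (PI * T * (3 / 4))%R by field. apply Rmult_le_compat_l; nra.
Qed.

(** exp (3 PI T / 4) / T outgrows exp (PI T / 4), so the constant term wins and
    the integral of eta against the metric has a nonzero real part. *)
Theorem cusp_nonzero : cell_int (cell_eta tau) <> 0.
Proof.
  assert (P := PI_RGT_0). assert (P3 := PI2_3_2). assert (P4 := PI_4). assert (H0 := HT').
  set (K := fun z => RtoC (-1) * cell_eta tau z).
  assert (CK : forall z, cont K z) by (intros z; apply cont_mult; [apply cont_const|apply cont_cell_eta; exact Ht]).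
  assert (EK : forall x y, K (x, y) = - eta_fun tau (cell tau (x, y)) * RtoC (metric tau (cell tau (x, y)))).
  { intros x y. unfold K, cell_eta. replace (RtoC (-1)) with (- RtoC 1) by (rewrite <- RtoC_opp; f_equal; ring). ring. }
  set (E4 := exp (PI * T / 4)).
  assert (L : (- (pole_constant * E4) / 2 + (PI / (2 * T) * (/ 4096 * exp (3 * PI * T / 4)) - pole_constant * E4) / 2)%R <= Re (cell_int K)).
  { apply cell_int_bound_mid; [exact CK| |].
    - intros x y Hx Hy. rewrite EK. eapply Rle_trans; [|apply (integrand_lower _ y); [apply cell_Im|exact Hy]].
      assert (Q := metric_ge0 tau (cell tau (x, y))). assert (0 < PI / (2 * T)) by (apply Rdiv_lt_0_compat; lra). unfold E4. nra.
    - intros x y Hx Hy. rewrite EK. eapply Rle_trans; [|apply (integrand_lower _ y); [apply cell_Im|lra]].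
      assert (Q := metric_mid_lower (cell tau (x, y)) y (cell_Im tau (x, y)) Hy). assert (0 < PI / (2 * T)) by (apply Rdiv_lt_0_compat; lra). unfold E4. nra. }
  assert (E3 : exp (3 * PI * T / 4) = (E4 * (E4 * E4))%R). { unfold E4. rewrite <- !exp_plus. f_equal. field. }
  assert (B4 : PI * T / 4 <= E4). { unfold E4. generalize (exp_ge_1p (PI * T / 4)). lra. }
  assert (PE : 0 < E4) by apply exp_pos.
  assert (Pos : 0 < Re (cell_int K)).
  { eapply Rlt_le_trans; [|exact L]. rewrite E3.
    assert (M1 : PI * T / 4 * (PI * T / 4) <= E4 * E4) by (apply Rmult_le_compat; nra).
    assert (M2 : PI / (2 * T) * (/ 4096 * (PI * T / 4 * (PI * T / 4))) <= PI / (2 * T) * (/ 4096 * (E4 * E4))).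
    { apply Rmult_le_compat_l; [left; apply Rdiv_lt_0_compat; lra|]. lra. }
    replace (PI / (2 * T) * (/ 4096 * (PI * T / 4 * (PI * T / 4))))%R with (/ 131072 * (PI * PI) * (PI * T))%R in M2 by (field; lra).
    assert (M3 : 2 * pole_constant < / 131072 * (PI * PI) * (PI * T)).
    { unfold pole_constant. replace (2 * (8192 * PI * PI))%R with (/ 131072 * (PI * PI) * 2147483648)%R by field. apply Rmult_lt_compat_l; nra. }
    replace (- (pole_constant * E4) / 2 + (PI / (2 * T) * (/ 4096 * (E4 * (E4 * E4))) - pole_constant * E4) / 2)%R with
      (E4 / 2 * (PI / (2 * T) * (/ 4096 * (E4 * E4)) - 2 * pole_constant))%R by (field; lra).
    apply Rmult_lt_0_compat; lra. }
  intros Z. unfold K in Pos. rewrite cell_int_scal in Pos by (intros; apply cont_cell_eta; exact Ht). rewrite Z, Cmult_0_r, re_RtoC in Pos. lra.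
Qed.
End Cusp.

(** * Isomorphisms of elliptic curves are homotheties of lattices *)

Definition homothety (t t' u : C) : Prop := u <> 0 /\ forall z, lattice t z <-> lattice t' (u * z).

Lemma lattice_coords t z : 0 < Im t -> lattice t z -> exists m n : Z, cx t z = IZR m /\ cy t z = IZR n.
Proof.
  intros Ht (m & n & ->). exists m, n. unfold cx. assert (E : cy t (RtoC (IZR m) + RtoC (IZR n) * t) = IZR n).
  { unfold cy. rewrite Im_plus, Im_Rmult, im_RtoC. field. lra. }
  rewrite E. split; auto. rewrite Re_plus, Re_Rmult, re_RtoC. ring.
Qed.

Lemma cx_plus t z w : cx t (z + w) = (cx t z + cx t w)%R.
Proof. unfold cx, cy. rewrite Im_plus, Re_plus. unfold Rdiv. ring. Qed.
Lemma cy_plus t z w : cy t (z + w) = (cy t z + cy t w)%R.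
Proof. unfold cy. rewrite Im_plus. unfold Rdiv. ring. Qed.

(** The two real characters of the torus separate its points. They turn a map
    that is locally constant modulo the lattice into locally constant
    functions. *)
Lemma characters_separate t z w : 0 < Im t -> ew (RtoC (cx t z)) = ew (RtoC (cx t w)) -> ew (RtoC (cy t z)) = ew (RtoC (cy t w)) -> lattice t (z - w).
Proof.
  intros Ht Hx Hy.
  assert (G : forall x y : R, ew (RtoC x) = ew (RtoC y) -> exists n : Z, (x - y)%R = IZR n).
  { intros x y E. destruct (ew_eq_1 (RtoC x - RtoC y)) as [n Hn].
    - unfold Cminus. rewrite ew_plus, ew_opp, E. field. apply ew_nz.
    - exists n. rewrite <- RtoC_minus in Hn. now apply RtoC_inj. }
  destruct (G _ _ Hx) as [m Hm], (G _ _ Hy) as [n Hn]. exists m, n.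
  rewrite (coords t z Ht) at 1. rewrite (coords t w Ht) at 1. rewrite <- Hm, <- Hn, !RtoC_minus. ring.
Qed.

Lemma characters_periodic t z l : 0 < Im t -> lattice t l -> ew (RtoC (cx t (z + l))) = ew (RtoC (cx t z)) /\ ew (RtoC (cy t (z + l))) = ew (RtoC (cy t z)).
Proof.
  intros Ht Hl. destruct (lattice_coords t l Ht Hl) as (m & n & E1 & E2). rewrite cx_plus, cy_plus, E1, E2, !RtoC_plus, !ew_plus, !ew_Z. split; ring.
Qed.

Lemma lattice_valued_const t (h : C -> C) a : 0 < Im t -> cont h a -> nearC a (fun z => lattice t (h z)) -> nearC a (fun z => h z = h a).
Proof.
  intros Ht Hc HL. assert (La := nearC_pt _ _ HL). generalize (nearC_and _ _ _ HL (Hc (lat_gap t) (lat_gap_pos t Ht))). apply nearC_imp. intros z [L1 L2].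
  apply Ceq_minus. apply (lattice_discrete t); auto. now apply lattice_minus.
Qed.

Lemma locally_const_of_cdv0 (f : C -> C) a : nearC a (fun z => cdv f z 0) -> nearC a (fun z => f z = f a).
Proof.
  intros H. apply locally_CE in H. destruct H as (d & Hd & H). apply locally_CE. exists d. split; auto. intros z Hz.
  replace z with (a + (z - a)) by ring. apply line_const. intros s Hs. apply rdf_ext with (fun h => 0 * h); [intros; ring|]. apply rdf_cdv, H.
  replace (a + RtoC s * (z - a) - a) with (RtoC s * (z - a)) by ring. rewrite Cmod_mult, Cmod_R, Rabs_pos_eq by lra.
  assert (P := Cmod_ge_0 (z - a)). nra.
Qed.

Lemma Cinv_nz (u : C) : u <> 0 -> / u <> 0.
Proof. intros N E. apply C1_nz. transitivity (u * / u); [field; exact N|]. rewrite E. ring. Qed.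

(** The derivatives of the local lifts do not depend on the lift and form an
    elliptic function without poles, hence a constant u. Then f - u z is
    locally constant modulo the lattice, and the characters make it globally
    so. *)
Lemma holo_map_affine (t t' : C) f : 0 < Im t -> 0 < Im t' -> holo_map t t' f -> exists u, forall z, lattice t' (f z - u * z - f (RtoC 0)).
Proof.
  intros Ht Ht' [Hp Hl].
  destruct (fun_choice _ Hl) as [g Hg].
  assert (Eq : forall (h k : C -> C) b, holo_at h b -> holo_at k b -> nearC b (fun z => lattice t' (h z - k z)) -> C_derive h b = C_derive k b).
  { intros h k b Hh Hk HL.
    assert (X := lattice_valued_const t' (fun z => h z - k z) b Ht' (cont_minus _ _ _ (holo_cont _ _ Hh) (holo_cont _ _ Hk)) HL).
    apply (cdv_unique h b); [now apply holo_cdv|]. apply cdv_loc with (fun z => k z + (h b - k b)).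
    - revert X. apply nearC_imp. intros z Hz. cbv beta in Hz. rewrite <- Hz. ring.
    - eapply cdv_eq; [apply cdv_plus; [now apply holo_cdv|apply cdv_const]|ring]. }
  set (D := fun a => C_derive (g a) a).
  assert (Dl : forall a, nearC a (fun b => C_derive (g a) b = D b)).
  { intros a. destruct (Hg a) as [G1 G2]. generalize (nearC_and _ _ _ (holo_open _ _ G1) (nearC_open _ _ G2)). apply nearC_imp. intros b [B1 B2].
    destruct (Hg b) as [G1' G2']. apply Eq; auto. generalize (nearC_and _ _ _ B2 G2'). apply nearC_imp. intros z [L1 L2].
    replace (g a z - g b z) with ((f z - g b z) - (f z - g a z)) by ring. now apply lattice_minus. }
  assert (Dh : forall a, holo_at D a).
  { intros a. apply holo_loc with (C_derive (g a)); [apply Dl|]. apply holo_derive, Hg. }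
  assert (Dp : periodic t D).
  { intros a l La. unfold D. destruct (Hg a) as [G1 G2], (Hg (a + l)) as [G1' G2'].
    rewrite <- (Eq (fun z => g (a + l) (z + l)) (g a) a); auto.
    - symmetry. apply cdv_C_derive. apply cdv_shift. now apply holo_cdv.
    - apply holo_shift. exact G1'.
    - generalize (nearC_and _ _ _ G2 (nearC_shift a l _ G2')). apply nearC_imp. intros z [L1 L2].
      replace (g (a + l) (z + l) - g a z) with ((f z - g a z) - (f (z + l) - g (a + l) (z + l)) + (f (z + l) - f z)) by ring.
      apply lattice_plus; [now apply lattice_minus|now apply Hp]. }
  assert (Dc := periodic_const t D Ht Dp Dh). set (u := D 0). exists u.
  (* the difference with the linear map is locally constant modulo the lattice *)
  assert (Loc : forall a, nearC a (fun z => lattice t' ((f z - u * z) - (f a - u * a)))).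
  { intros a. destruct (Hg a) as [G1 G2].
    assert (X : nearC a (fun z => (f z - u * z) - (f a - u * a) = (f z - g a z) - (f a - g a a) + ((g a z - u * z) - (g a a - u * a)))) by (apply nearC_all; intros; ring).
    assert (Y : nearC a (fun z => g a z - u * z = g a a - u * a)).
    { apply (locally_const_of_cdv0 (fun z => g a z - u * z)). generalize (nearC_and _ _ _ (holo_near_cdv _ _ G1) (Dl a)). apply nearC_imp. intros z [Z1 Z2].
      eapply cdv_eq; [apply cdv_minus; [exact Z1|apply cdv_scal, cdv_id]|]. cbv beta. rewrite Z2, (Dc z 0). fold u. ring. }
    generalize (nearC_and _ _ _ X (nearC_and _ _ _ Y G2)). apply nearC_imp. intros z (E1 & E2 & L). rewrite E1, E2.
    apply lattice_plus; [apply lattice_minus; [exact L|exact (nearC_pt _ _ G2)]|]. replace (g a a - u * a - (g a a - u * a)) with (RtoC 0) by ring. apply lattice_0. }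
  assert (Ch : forall k : C -> R, (forall z l, lattice t' l -> ew (RtoC (k (z + l))) = ew (RtoC (k z))) -> forall z, ew (RtoC (k (f z - u * z))) = ew (RtoC (k (f (RtoC 0) - u * 0)))).
  { intros k Hk z. apply (C_const_of_cdv0 (fun z => ew (RtoC (k (f z - u * z))))). intros a.
    apply cdv_loc with (fun _ => ew (RtoC (k (f a - u * a)))); [|apply cdv_const]. generalize (Loc a). apply nearC_imp. intros w Hw.
    rewrite <- (Hk (f a - u * a) _ Hw). do 3 f_equal. ring. }
  intros z. replace (f z - u * z - f (RtoC 0)) with ((f z - u * z) - (f (RtoC 0) - u * 0)) by ring.
  apply characters_separate; auto.
  - apply (Ch (cx t')). intros; now apply characters_periodic.
  - apply (Ch (cy t')). intros; now apply characters_periodic.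
Qed.

Lemma nonlattice_ex t : 0 < Im t -> exists z, ~ lattice t z.
Proof.
  intros Ht. destruct (nearP_ex _ _ (nonlattice_near t 0 Ht) 1%R Rlt_0_1) as (z & _ & _ & Hz). now exists z.
Qed.

Lemma elliptic_iso_homothety (t t' : UHP) : elliptic_iso t t' <-> exists u, homothety t t' u.
Proof.
  assert (Ht := Im_tau_pos t). assert (Ht' := Im_tau_pos t'). split.
  - intros (f & f' & Hf & Hf' & K1 & K2 & K3). destruct (holo_map_affine t t' f Ht Ht' Hf) as [u Hu].
    assert (Fu : forall z, lattice t' (f z) <-> lattice t' (u * z)).
    { intros z. assert (L := lattice_plus _ _ _ (Hu z) K3). replace (f z - u * z - f (RtoC 0) + f (RtoC 0)) with (f z - u * z) in L by ring. split; intros H.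
      - replace (u * z) with (f z - (f z - u * z)) by ring. now apply lattice_minus.
      - replace (f z) with (u * z + (f z - u * z)) by ring. now apply lattice_plus. }
    assert (Per : forall v l, lattice t' l -> lattice t (f' (v + l) - f' v)) by (intros; now apply Hf').
    assert (F0 : lattice t (f' (RtoC 0))).
    { assert (X := K1 (RtoC 0)). assert (Y := Per (RtoC 0) (f (RtoC 0)) K3). rewrite Cplus_0_l in Y.
      replace (f' (RtoC 0)) with ((f' (f (RtoC 0)) - 0) - (f' (f (RtoC 0)) - f' (RtoC 0))) by ring. now apply lattice_minus. }
    assert (Iff : forall z, lattice t z <-> lattice t' (u * z)).
    { intros z. rewrite <- Fu. split; intros H.
      - assert (X := proj1 Hf (RtoC 0) z H). rewrite Cplus_0_l in X. replace (f z) with (f z - f (RtoC 0) + f (RtoC 0)) by ring. now apply lattice_plus.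
      - assert (X := Per (RtoC 0) (f z) H). rewrite Cplus_0_l in X.
        replace z with ((f' (f z) - f' (RtoC 0)) + f' (RtoC 0) - (f' (f z) - z)) by ring. apply lattice_minus; [now apply lattice_plus|apply K1]. }
    exists u. split; auto. intros E. destruct (nonlattice_ex t Ht) as [z Hz]. apply Hz, Iff. rewrite E, Cmult_0_l. apply lattice_0.
  - intros (u & Nu & Hu). exists (fun z => u * z), (fun z => / u * z). split; [|split; [|split; [|split]]].
    + split.
      * intros z l Hl. replace (u * (z + l) - u * z) with (u * l) by ring. now apply Hu.
      * intros a. exists (fun z => u * z). split; [apply holo_mult; [apply holo_const|apply holo_id]|]. apply nearC_all. intros z.
        replace (u * z - u * z) with (RtoC 0) by ring. apply lattice_0.
    + split.
      * intros z l Hl. replace (/ u * (z + l) - / u * z) with (/ u * l) by ring. apply Hu. replace (u * (/ u * l)) with l by (field; exact Nu). exact Hl.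
      * intros a. exists (fun z => / u * z). split; [apply holo_mult; [apply holo_const|apply holo_id]|]. apply nearC_all. intros z.
        replace (/ u * z - / u * z) with (RtoC 0) by ring. apply lattice_0.
    + intros z. replace (/ u * (u * z) - z) with (RtoC 0) by (field; exact Nu). apply lattice_0.
    + intros z. replace (u * (/ u * z) - z) with (RtoC 0) by (field; exact Nu). apply lattice_0.
    + rewrite Cmult_0_r. apply lattice_0.
Qed.

Lemma homothety_sym t t' u : homothety t t' u -> homothety t' t (/ u).
Proof.
  intros [N H]. split; [now apply Cinv_nz|]. intros z. rewrite (H (/ u * z)). replace (u * (/ u * z)) with z by (field; exact N). reflexivity.
Qed.

Lemma homothety_trans t t' t'' u v : homothety t t' u -> homothety t' t'' v -> homothety t t'' (v * u).
Proof.
  intros [N H] [N' H']. split; [now apply Cmult_neq_0|]. intros z. rewrite H, H', Cmult_assoc. reflexivity.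
Qed.

Lemma M11_class_eq (t t' : UHP) : M11_class t = M11_class t' <-> exists u, homothety t t' u.
Proof.
  split.
  - intros E. apply (f_equal (fun c => proj1_sig c t')) in E. cbn in E. apply elliptic_iso_homothety. rewrite E. apply elliptic_iso_homothety.
    exists 1. split; [apply C1_nz|]. intros z. now rewrite Cmult_1_l.
  - intros [u Hu].
    assert (E : elliptic_iso t = elliptic_iso t').
    { apply functional_extensionality. intros s. apply propositional_extensionality. rewrite !elliptic_iso_homothety. split; intros [v Hv].
      - exists (v * / u). eapply homothety_trans; [apply homothety_sym; exact Hu|exact Hv].
      - exists (v * u). eapply homothety_trans; eauto. }
    unfold M11_class. apply eq_sig_hprop; [intros; apply Classical_Prop.proof_irrelevance|exact E].
Qed.

(** * The integral matrix of a homothety *)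

Lemma basis_unique t (m n m' n' : Z) : 0 < Im t -> RtoC (IZR m) + RtoC (IZR n) * t = RtoC (IZR m') + RtoC (IZR n') * t -> m = m' /\ n = n'.
Proof.
  intros Ht E. assert (N : n = n'). { apply (f_equal Im) in E. rewrite !Im_plus, !Im_Rmult, !im_RtoC in E. apply eq_IZR. apply Rmult_eq_reg_r with (Im t); lra. }
  split; auto. subst n'. apply (f_equal Re) in E. rewrite !Re_plus, !Re_Rmult, !re_RtoC in E. apply eq_IZR. lra.
Qed.

(** The images of 1 and tau form a basis of the other lattice, so the matrix is
    invertible over the integers; its determinant is the ratio of two oriented
    areas, hence positive. *)
Lemma homothety_matrix t t' u : 0 < Im t -> 0 < Im t' -> homothety t t' u -> exists a b c d : Z,
  u = RtoC (IZR a) + RtoC (IZR c) * t' /\ u * t = RtoC (IZR b) + RtoC (IZR d) * t' /\ (a * d - b * c = 1)%Z /\ Im t' = (Cmod u ^ 2 * Im t)%R.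
Proof.
  intros Ht Ht' [Nu Hu].
  destruct (proj1 (Hu 1) (lattice_1 t)) as (a & c & E1). destruct (proj1 (Hu t) (lattice_tau t)) as (b & d & E2). rewrite Cmult_1_r in E1.
  destruct (proj2 (Hu (/ u))) as (al & ga & E3). { replace (u * / u) with (RtoC 1) by (field; exact Nu). apply lattice_1. }
  destruct (proj2 (Hu (/ u * t'))) as (be & de & E4). { replace (u * (/ u * t')) with t' by (field; exact Nu). apply lattice_tau. }
  exists a, b, c, d.
  assert (Q1 : (al * a + ga * b = 1 /\ al * c + ga * d = 0)%Z).
  { apply (basis_unique t'); auto. transitivity (RtoC 1); [|ring]. transitivity (RtoC (IZR al) * u + RtoC (IZR ga) * (u * t)).
    - rewrite E1 at 1. rewrite E2. rewrite !plus_IZR, !mult_IZR, !RtoC_plus, !RtoC_mult. ring.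
    - transitivity (u * (RtoC (IZR al) + RtoC (IZR ga) * t)); [ring|]. rewrite <- E3. field. exact Nu. }
  assert (Q2 : (be * a + de * b = 0 /\ be * c + de * d = 1)%Z).
  { apply (basis_unique t'); auto. transitivity t'; [|ring]. transitivity (RtoC (IZR be) * u + RtoC (IZR de) * (u * t)).
    - rewrite E1 at 1. rewrite E2. rewrite !plus_IZR, !mult_IZR, !RtoC_plus, !RtoC_mult. ring.
    - transitivity (u * (RtoC (IZR be) + RtoC (IZR de) * t)); [ring|]. rewrite <- E4. field. exact Nu. }
  assert (Det : (a * d - b * c = 1 \/ a * d - b * c = -1)%Z).
  { assert (P : ((a * d - b * c) * (al * de - ga * be) = 1)%Z).
    { transitivity ((al * a + ga * b) * (be * c + de * d) - (al * c + ga * d) * (be * a + de * b))%Z; [ring|]. destruct Q1 as [-> ->], Q2 as [-> ->]. ring. }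
    apply Z.mul_eq_1 in P. exact P. }
  assert (Area : (Cmod u ^ 2 * Im t = IZR (a * d - b * c) * Im t')%R).
  { transitivity (Im (Cconj u * (u * t))).
    - replace (Cconj u * (u * t)) with (RtoC (Cmod u ^ 2) * t) by (rewrite Cmod2_conj; ring). now rewrite Im_Rmult.
    - rewrite E2, E1. rewrite minus_IZR, !mult_IZR. destruct t' as [x y]. unfold Im; simpl. ring. }
  assert (Pu : 0 < Cmod u) by now apply Cmod_gt_0.
  destruct Det as [Det|Det]; rewrite Det in Area.
  - repeat split; auto. lra.
  - exfalso. assert (0 < Cmod u ^ 2 * Im t) by (apply Rmult_lt_0_compat; [now apply pow_lt|auto]). lra.
Qed.

Lemma moebius_homothety z (a b c d : Z) : (a * d - b * c = 1)%Z -> RtoC (IZR d) - RtoC (IZR c) * z <> 0 ->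
  homothety z ((RtoC (IZR a) * z - RtoC (IZR b)) / (RtoC (IZR d) - RtoC (IZR c) * z)) (/ (RtoC (IZR d) - RtoC (IZR c) * z)).
Proof.
  intros Det N. set (D := RtoC (IZR d) - RtoC (IZR c) * z) in *. split; [now apply Cinv_nz|].
  assert (DetC : RtoC (IZR a) * RtoC (IZR d) - RtoC (IZR b) * RtoC (IZR c) = 1).
  { rewrite <- !RtoC_mult, <- RtoC_minus, <- !mult_IZR, <- minus_IZR, Det. reflexivity. }
  assert (Key : forall w m n : C, w = m + n * ((RtoC (IZR a) * z - RtoC (IZR b)) / D) -> w * D = (m * RtoC (IZR d) - n * RtoC (IZR b)) + (n * RtoC (IZR a) - m * RtoC (IZR c)) * z).
  { intros w m n ->. transitivity (m * D + n * (RtoC (IZR a) * z - RtoC (IZR b))); [field; exact N|unfold D; ring]. }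
  intros w. split.
  - intros (m & n & ->). exists (a * m + b * n)%Z, (c * m + d * n)%Z. rewrite !plus_IZR, !mult_IZR, !RtoC_plus, !RtoC_mult.
    set (A := RtoC (IZR a)) in *. set (B := RtoC (IZR b)) in *. set (M := RtoC (IZR m)). set (Nn := RtoC (IZR n)). set (E := RtoC (IZR c)) in *. set (F := RtoC (IZR d)) in *.
    replace (M + Nn * z) with ((A * F - B * E) * (M + Nn * z)) by (rewrite DetC; ring). unfold D. field. exact N.
  - intros (m & n & E). exists (m * d - n * b)%Z, (n * a - m * c)%Z. rewrite !minus_IZR, !mult_IZR, !RtoC_minus, !RtoC_mult.
    rewrite <- (Key _ _ _ E). field. exact N.
Qed.

(** * The open set *)

Definition cusp_neighbourhood (x : M11) : Prop := exists t : UHP, cusp_height < Im t /\ x = M11_class t.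

Lemma Im_open_near (f : C -> C) (a : C) (y : R) : cont f a -> y < Im (f a) -> nearC a (fun z => y < Im (f z)).
Proof.
  intros Hc Hy. generalize (Hc (Im (f a) - y)%R ltac:(lra)). apply nearC_imp. intros z Hz.
  assert (Q := im_le_Cmod (f z - f a)). rewrite Im_minus in Q. assert (Q' := Rle_lt_trans _ _ _ Q Hz). apply Rabs_def2 in Q'. lra.
Qed.

(** The Moebius transformation that carries tau to its high representative
    carries the nearby points to nearby, hence still high, points of the same
    class. *)
Lemma cusp_neighbourhood_open : M11_open cusp_neighbourhood.
Proof.
  intros t (t' & Ht' & E). apply M11_class_eq in E. destruct E as [u Hu].
  destruct (homothety_matrix t t' u (Im_tau_pos t) (Im_tau_pos t') Hu) as (a & b & c & d & E1 & E2 & Det & _).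
  set (D := fun z : C => RtoC (IZR d) - RtoC (IZR c) * z). set (mu := fun z : C => (RtoC (IZR a) * z - RtoC (IZR b)) / D z).
  assert (DetC : RtoC (IZR a) * RtoC (IZR d) - RtoC (IZR b) * RtoC (IZR c) = 1).
  { rewrite <- !RtoC_mult, <- RtoC_minus, <- !mult_IZR, <- minus_IZR, Det. reflexivity. }
  assert (Du : u * D t = 1).
  { unfold D. transitivity (RtoC (IZR d) * u - RtoC (IZR c) * (u * t)); [ring|]. rewrite E2, E1. rewrite <- DetC. ring. }
  assert (ND : D t <> 0). { intros F. rewrite F, Cmult_0_r in Du. symmetry in Du. now apply C1_nz. }
  assert (Em : mu t = t').
  { unfold mu. assert (X : RtoC (IZR a) * t - RtoC (IZR b) = t' * D t); [|rewrite X; field; exact ND].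
    assert (Y : u * (RtoC (IZR a) * t - RtoC (IZR b)) = u * (t' * D t)).
    { transitivity (t' * (u * D t)); [|ring]. rewrite Du. transitivity (RtoC (IZR a) * (u * t) - RtoC (IZR b) * u); [ring|]. rewrite E2, E1.
      transitivity ((RtoC (IZR a) * RtoC (IZR d) - RtoC (IZR b) * RtoC (IZR c)) * t'); [ring|]. rewrite DetC. ring. }
    transitivity (/ u * (u * (RtoC (IZR a) * t - RtoC (IZR b)))); [field; apply Hu|]. rewrite Y. field. apply Hu. }
  assert (HD : holo_at D t). { apply holo_minus; [apply holo_const|]. apply holo_mult; [apply holo_const|apply holo_id]. }
  assert (Hmu : holo_at mu t). { apply holo_div; [exact ND| |exact HD]. apply holo_minus; [|apply holo_const]. apply holo_mult; [apply holo_const|apply holo_id]. }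
  assert (NI : nearC (tau_of t) (fun z : C => cusp_height < Im (mu z))). { apply Im_open_near; [now apply holo_cont|]. rewrite Em. exact Ht'. }
  generalize (nearC_and _ _ _ NI (cont_nonzero _ _ (holo_cont _ _ HD) ND)). apply nearC_imp. intros z [Hz Nz] hz.
  assert (Pz : 0 < Im (mu z)) by (unfold cusp_height in Hz; lra).
  exists (mkUHP (mu z) Pz). split; [exact Hz|]. apply M11_class_eq. exists (/ D z). now apply moebius_homothety.
Qed.

Lemma cell_int_matrix (t t' u : C) (a b c d : Z) z : u = RtoC (IZR a) + RtoC (IZR c) * t' -> u * t = RtoC (IZR b) + RtoC (IZR d) * t' ->
  u * cell t z = cell t' (int_matrix a b c d z).
Proof.
  intros E1 E2. unfold cell, int_matrix. cbn [Re Im fst snd]. destruct z as [x y]. cbn [Re Im fst snd].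
  transitivity (RtoC x * u + RtoC y * (u * t)); [ring|]. rewrite E1 at 1. rewrite E2. rewrite !RtoC_plus, !RtoC_mult. ring.
Qed.

Lemma periodic2_cell_eta t : 0 < Im t -> periodic2 (cell_eta t).
Proof.
  intros Ht x y m n. unfold cell_eta.
  assert (E : cell t ((x + IZR m)%R, (y + IZR n)%R) = cell t (x, y) + (RtoC (IZR m) + RtoC (IZR n) * t)).
  { unfold cell. cbn [Re Im fst snd]. rewrite !RtoC_plus. ring. }
  assert (L : lattice t (RtoC (IZR m) + RtoC (IZR n) * t)) by now exists m, n.
  rewrite E, (eta_fun_periodic t Ht _ _ L), metric_periodic by auto. reflexivity.
Qed.

Theorem theorem6p7 :
  exists U : M11 -> Prop,
    M11_open U /\ (exists x : M11, U x) /\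
    forall tau : UHP, U (M11_class tau) -> sigma_X tau <> eta_X tau.
Proof.
  exists cusp_neighbourhood. split; [exact cusp_neighbourhood_open|]. split.
  - assert (Hi : cusp_height < Im (RtoC 0 + RtoC (cusp_height + 1) * Ci)) by (rewrite Im_plus, Im_Rmult; unfold Im; simpl; lra).
    assert (Hp : 0 < Im (RtoC 0 + RtoC (cusp_height + 1) * Ci)) by (unfold cusp_height in *; lra).
    exists (M11_class (mkUHP _ Hp)), (mkUHP _ Hp). now split.
  - intros tau (t & Ht & E) Heq. apply M11_class_eq in E. destruct E as [u Hu].
    assert (H0 := Im_tau_pos tau). assert (H0' := Im_tau_pos t).
    destruct (homothety_matrix tau t u H0 H0' Hu) as (a & b & c & d & E1 & E2 & Det & Area). destruct Hu as [Nu Hu].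
    assert (Hs : is_sigma tau (sigma_X tau)) by (apply (epsilon_spec (inhabits (fun _ : C * C => RtoC 0)) (is_sigma tau)), is_sigma_exists, H0).
    assert (He : is_eta tau (eta_X tau)) by (apply (epsilon_spec (inhabits (fun _ : C * C => RtoC 0)) (is_eta tau)), is_eta_exists, H0).
    rewrite <- Heq in He.
    assert (Orth := sigma_eta_orthogonal tau H0 _ _ _ Hs He (ref_form_scale tau t u H0' Nu Hu) (ref_metric_scale tau t u H0' Nu Hu H0 Area) (cont_scale t u H0')).
    assert (CK : forall z, cont (cell_eta t) z) by (intros; now apply cont_cell_eta).
    assert (CL : forall z, cont (fun z => cell_eta t (int_matrix a b c d z)) z) by (intros z; apply (cont_comp (cell_eta t) (int_matrix a b c d)); [apply CK|apply cont_int_matrix]).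
    apply (cusp_nonzero t Ht). rewrite <- (cell_int_GL2 (cell_eta t) a b c d CK (periodic2_cell_eta t H0') (or_introl Det)).
    assert (X : (u * u) * cell_int (fun z => cell_eta t (int_matrix a b c d z)) = 0).
    { rewrite <- cell_int_scal by exact CL. rewrite <- Orth. f_equal. apply functional_extensionality. intros z. unfold cell_eta.
      rewrite <- (cell_int_matrix tau t u a b c d z E1 E2). ring. }
    apply Classical_Prop.NNPP. intros N. revert X. apply Cmult_neq_0; [now apply Cmult_neq_0|exact N].
Qed.
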